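(* Fix an integer $m\ge1$. For every even $k=12\ell+k'$ with $k'\in\{0,4,6,8,10,14\}$, if $\ell>4.5m+9.5$, then all the zeros of $g_{k,m}$ in the fundamental domain $\mathcal{F}$ lie on the arc $\{e^{i\theta}:\frac{\pi}{2}\le\theta\le\frac{2\pi}{3}\}$.
   Context: $q=e^{2\pi i\tau}$ for $\tau$ in the upper half plane $\mathbb{H}$. For $k=12\ell+k'$ with $\ell\ge0$ an integer and $k'\in\{0,4,6,8,10,14\}$, and $1\le m\le\ell$, $g_{k,m}$ denotes the unique holomorphic modular form of weight $k$ for $\mathrm{PSL}_2(\mathbb{Z})$ with $q$-expansion $q^m+O(q^{\ell+1})$. $\mathcal{F}=\{z\in\mathbb{H}:|z|\ge1,\,-\frac12\le\operatorname{Re}z\le0\}\cup\{z\in\mathbb{H}:|z|>1,\,0<\operatorname{Re}z<\frac12\}$. *)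

(* Defs.v *)
From Stdlib Require Import Reals ZArith List.
From Coquelicot Require Import Coquelicot.
Open Scope R_scope.

Definition Cexp (z : C) : C := (exp (fst z) * cos (snd z), exp (fst z) * sin (snd z)).

Definition qpar (tau : C) : C := Cexp (Cmult (RtoC (2 * PI)) (Cmult Ci tau)).

Definition upper_half (tau : C) : Prop := 0 < Im tau.

Definition ZtoC (n : Z) : C := RtoC (IZR n).

Definition is_modular_form (k : nat) (f : C -> C) (a : nat -> C) : Prop :=
  (forall tau, upper_half tau ->
      @ex_derive C_AbsRing C_NormedModule f tau) /\
  (forall (A B Cc D : Z), (A * D - B * Cc = 1)%Z ->
     forall tau, upper_half tau ->
       f (Cdiv (Cplus (Cmult (ZtoC A) tau) (ZtoC B))
               (Cplus (Cmult (ZtoC Cc) tau) (ZtoC D)))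
       = Cmult (Cpow (Cplus (Cmult (ZtoC Cc) tau) (ZtoC D)) k) (f tau)) /\
  (forall tau, upper_half tau ->
     @is_series C_AbsRing C_NormedModule
        (fun n => Cmult (a n) (Cpow (qpar tau) n)) (f tau)).

Definition is_g (k l m : nat) (f : C -> C) : Prop :=
  exists a : nat -> C,
    is_modular_form k f a /\
    (forall n, (n < m)%nat -> a n = RtoC 0) /\
    a m = RtoC 1 /\
    (forall n, (m < n)%nat -> (n <= l)%nat -> a n = RtoC 0).

Definition in_F (z : C) : Prop :=
  0 < Im z /\
  ((Cmod z >= 1 /\ -1/2 <= Re z <= 0) \/ (Cmod z > 1 /\ 0 < Re z < 1/2)).

Definition on_arc (z : C) : Prop :=
  exists theta, PI / 2 <= theta <= 2 * PI / 3 /\ z = (cos theta, sin theta).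

(* Main.v *)
(* Let L be the sum of q^m|S over all integer translates. On Im z >= 7/10 it is a uniform limit of polynomials in q,
   by partial fractions of the cotangent. After L is truncated beyond q^l, the tail of f, divided by Delta^(l+1),
   satisfies a contractive functional equation under z -> -1/z on the line Im z = 7/10; the maximum principle then
   shows that near the left half of F one has f = q^m + q^m|S + q^m|ST up to a relative error exp(-0.15 l). Only
   |Delta(-1/z)| = |z|^12 |Delta(z)| is needed, and it follows from the transformation of E_2.

   Multiplied by z^(k/2) and an exponential, f becomes E + 1/E + W where |E| = 1 and W is real on the unit circle.
   Away from the corner rho, |Im W| grows more slowly with |z| - 1 than |Im (E + 1/E)| at a point where E + 1/E is
   small, so there is no zero off the arc. In the coordinate w = (z - rho)/(z - conj rho) the form f is, up to a small
   equivariant error, the average of exp X over the rotations of order 3 with X proportional to w, and its first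
   non-vanishing Taylor coefficient dominates for |X| <= 1.2. *)

Require Import Defs.
From Stdlib Require Import Reals ZArith List Lra Lia Psatz.
From Coquelicot Require Import Coquelicot.
Open Scope R_scope.

(** All function theory here is polynomial: Cauchy's estimate for polynomials comes from averaging
    over roots of unity, and uniform limits of polynomials inherit it, so no contour integral
    occurs. The sum q^m + L is what a Poincare series keeps of its terms with |c| <= 1; the
    coefficients of L up to q^l, which f must not have, are measured on Im z = 2, where every
    translate is at most 2^(-k). The quotient by Delta^(l+1) has weight k' - 12, which makes k' = 14
    exceptional: it is the only case of positive weight, and there is no contraction before the
    constant term is removed. The hypothesis l > 4.5 m + 9.5 is consumed almost entirely by the
    relative error on Im z >= 17/20, a height that has to lie below the corner rho, at 0.866. At rho
    the three main terms have the same modulus, and the weight forces f(rho) = 0 for two of the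
    three residues of k/2 mod 3. Near rho no constant lower bound for |f| can hold, so orders of
    vanishing are compared instead. *)

Lemma Cmod_sub_triangle (a b : C) : Cmod (a - b) <= Cmod a + Cmod b.
Proof. unfold Cminus. rewrite <- (Cmod_opp b). apply Cmod_triangle. Qed.

Lemma Cmod_sub_comm (a b : C) : Cmod (a - b) = Cmod (b - a).
Proof. rewrite <- Cmod_opp. f_equal. ring. Qed.

Lemma Cmod_sub_ge (a b : C) : Cmod a - Cmod b <= Cmod (a - b).
Proof.
  assert (H := Cmod_triangle (a - b) b).
  replace (a - b + b)%C with a in H by ring. lra.
Qed.

Lemma Cmod_plus_ge (a b : C) : Cmod a - Cmod b <= Cmod (a + b).
Proof.
  assert (H := Cmod_sub_ge a (- b)). rewrite Cmod_opp in H.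
  replace (a - - b)%C with (a + b)%C in H by ring. lra.
Qed.

Lemma Cmod_sq (z : C) : Cmod z * Cmod z = Re z * Re z + Im z * Im z.
Proof. generalize (Cmod2_alt z). simpl. rewrite !Rmult_1_r. auto. Qed.

Lemma Cmod_Im_le (z : C) : Rabs (Im z) <= Cmod z.
Proof. eapply Rle_trans; [|apply Rmax_Cmod]. apply Rmax_r. Qed.

Lemma Cmod_Re_le (z : C) : Rabs (Re z) <= Cmod z.
Proof. apply re_le_Cmod. Qed.

Lemma Cmod_le_sum (z : C) : Cmod z <= Rabs (Re z) + Rabs (Im z).
Proof.
  replace z with (RtoC (Re z) + Ci * RtoC (Im z))%C at 1
    by (apply injective_projections; simpl; unfold Re, Im; ring).
  eapply Rle_trans; [apply Cmod_triangle|].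
  rewrite Cmod_mult, Cmod_Ci, !Cmod_R. lra.
Qed.

Lemma Cmod_neq_0 (z : C) : 0 < Cmod z -> z <> 0%C.
Proof. intros H E. rewrite E, Cmod_0 in H. lra. Qed.

Lemma Cmod_pos (z : C) : z <> 0%C -> 0 < Cmod z.
Proof. apply Cmod_gt_0. Qed.

Lemma Im_pos_neq_0 (z : C) : 0 < Im z -> z <> 0%C.
Proof. intros H E. rewrite E in H. simpl in H. lra. Qed.

Lemma Re_plus (a b : C) : Re (a + b) = Re a + Re b. Proof. reflexivity. Qed.
Lemma Im_plus (a b : C) : Im (a + b) = Im a + Im b. Proof. reflexivity. Qed.
Lemma Re_minus (a b : C) : Re (a - b) = Re a - Re b. Proof. reflexivity. Qed.
Lemma Im_minus (a b : C) : Im (a - b) = Im a - Im b. Proof. reflexivity. Qed.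
Lemma Re_opp (a : C) : Re (- a) = - Re a. Proof. reflexivity. Qed.
Lemma Im_opp (a : C) : Im (- a) = - Im a. Proof. reflexivity. Qed.
Lemma Re_RtoC (x : R) : Re (RtoC x) = x. Proof. reflexivity. Qed.
Lemma Re_mult (a b : C) : Re (a * b) = Re a * Re b - Im a * Im b. Proof. reflexivity. Qed.
Lemma Im_mult (a b : C) : Im (a * b) = Re a * Im b + Im a * Re b. Proof. reflexivity. Qed.
Lemma Re_scal (x : R) (z : C) : Re (RtoC x * z) = x * Re z.
Proof. rewrite Re_mult. simpl. ring. Qed.
Lemma Im_scal (x : R) (z : C) : Im (RtoC x * z) = x * Im z.
Proof. rewrite Im_mult. simpl. ring. Qed.

Lemma Cinv_alt (z : C) : z <> 0%C ->
  (/ z)%C = (Re z / (Cmod z * Cmod z), - Im z / (Cmod z * Cmod z)).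
Proof.
  intros Hz. unfold Cinv. rewrite Cmod_sq. unfold Re, Im. simpl.
  rewrite !Rmult_1_r. reflexivity.
Qed.

Lemma Im_neg_inv (z : C) : z <> 0%C -> Im (- / z) = Im z / (Cmod z * Cmod z).
Proof. intros Hz. rewrite Im_opp, Cinv_alt by auto. simpl. unfold Rdiv. ring. Qed.

Lemma Re_neg_inv (z : C) : z <> 0%C -> Re (- / z) = - Re z / (Cmod z * Cmod z).
Proof. intros Hz. rewrite Re_opp, Cinv_alt by auto. simpl. unfold Rdiv. ring. Qed.

Lemma Im_neg_inv_pos (z : C) : 0 < Im z -> 0 < Im (- / z).
Proof.
  intros H. assert (Hz := Im_pos_neq_0 _ H). rewrite Im_neg_inv by auto.
  apply Rdiv_lt_0_compat; auto. assert (H0 := Cmod_pos _ Hz). nra.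
Qed.

(** * The exponential *)

Lemma Cexp_0 : Cexp 0 = 1%C.
Proof.
  unfold Cexp; simpl. rewrite exp_0, cos_0, sin_0.
  apply injective_projections; simpl; ring.
Qed.

Lemma Cexp_plus (a b : C) : Cexp (a + b) = (Cexp a * Cexp b)%C.
Proof.
  unfold Cexp. apply injective_projections; simpl;
    rewrite exp_plus, ?cos_plus, ?sin_plus; ring.
Qed.

Lemma Cmod_Cexp (a : C) : Cmod (Cexp a) = exp (Re a).
Proof.
  unfold Cmod, Cexp. simpl.
  replace (_ + _) with (exp (Re a) * exp (Re a) * (Rsqr (cos (snd a)) + Rsqr (sin (snd a))))
    by (unfold Rsqr, Re; ring).
  rewrite Rplus_comm, sin2_cos2, Rmult_1_r. apply sqrt_square. left. apply exp_pos.
Qed.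

Lemma Cexp_neq_0 (a : C) : Cexp a <> 0%C.
Proof. apply Cmod_neq_0. rewrite Cmod_Cexp. apply exp_pos. Qed.

Lemma Cexp_opp (a : C) : Cexp (- a) = (/ Cexp a)%C.
Proof.
  assert (H : (Cexp a * Cexp (- a))%C = 1%C).
  { rewrite <- Cexp_plus. replace (a + - a)%C with (RtoC 0) by ring. apply Cexp_0. }
  assert (H1 := Cexp_neq_0 a).
  replace (Cexp (- a)) with (/ Cexp a * (Cexp a * Cexp (- a)))%C by (field; auto).
  rewrite H. ring.
Qed.

Lemma Cexp_minus (a b : C) : Cexp (a - b) = (Cexp a / Cexp b)%C.
Proof. unfold Cminus, Cdiv. rewrite Cexp_plus, Cexp_opp. reflexivity. Qed.

Lemma Cexp_nat (n : nat) (a : C) : Cexp (RtoC (INR n) * a) = (Cexp a ^ n)%C.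
Proof.
  induction n as [|n IH].
  - simpl. rewrite Cmult_0_l. apply Cexp_0.
  - rewrite S_INR, Cpow_S, <- IH, <- Cexp_plus. f_equal.
    rewrite RtoC_plus. ring.
Qed.

Lemma Cexp_conj (a : C) : Cconj (Cexp a) = Cexp (Cconj a).
Proof.
  unfold Cexp, Cconj. simpl. rewrite cos_neg, sin_neg.
  apply injective_projections; simpl; ring.
Qed.

Lemma Cexp_RtoC (x : R) : Cexp (RtoC x) = RtoC (exp x).
Proof.
  unfold Cexp; simpl. rewrite cos_0, sin_0. apply injective_projections; simpl; ring.
Qed.

(** The upper bound comes from 1 - x <= exp (- x), that is exp x <= 1/(1 - x), without Taylor's
    formula. *)
Lemma exp_quad_bound (x : R) : Rabs x <= 1/2 -> 0 <= exp x - 1 - x <= 2 * (x * x).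
Proof.
  intros Hx. apply Rabs_le_between in Hx.
  assert (H := exp_ineq1_le x).
  assert (H1 := exp_ineq1_le (- x)). rewrite exp_Ropp in H1.
  assert (exp x <= / (1 - x)).
  { rewrite <- (Rinv_inv (exp x)). apply Rinv_le_contravar; lra. }
  assert (/ (1 - x) <= 1 + x + 2 * (x * x)).
  { apply Rmult_le_reg_l with (1 - x); [lra|]. rewrite Rinv_r by lra. nra. }
  lra.
Qed.

Lemma Rabs_sin_le (x : R) : Rabs (sin x) <= Rabs x.
Proof.
  destruct (MVT_abs sin cos 0 x) as [c [Hc _]].
  { intros c _. apply derivable_pt_lim_sin. }
  rewrite sin_0, !Rminus_0_r in Hc. rewrite Hc.
  assert (Rabs (cos c) <= 1) by (apply Rabs_le; apply COS_bound).
  assert (0 <= Rabs x) by apply Rabs_pos. nra.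
Qed.

Lemma cos_quad_bound (x : R) : 0 <= 1 - cos x <= x * x / 2.
Proof.
  split; [generalize (COS_bound x); lra|].
  replace (cos x) with (cos (2 * (x / 2))) by (f_equal; field).
  rewrite cos_2a_sin. assert (H := Rabs_sin_le (x / 2)).
  apply Rsqr_le_abs_1 in H. unfold Rsqr in H. lra.
Qed.

Lemma sin_quad_bound (x : R) : Rabs x <= 1 -> Rabs (sin x - x) <= x * x / 2.
Proof.
  intros Hx.
  destruct (MVT_abs (fun t => sin t - t) (fun t => cos t - 1) 0 x) as [c [Hc [Hc1 Hc2]]].
  { intros c _. apply derivable_pt_lim_minus;
      [apply derivable_pt_lim_sin|apply derivable_pt_lim_id]. }
  rewrite sin_0, !Rminus_0_r in Hc. rewrite Hc.
  assert (H := cos_quad_bound c).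
  rewrite (Rabs_left1 (cos c - 1)) by lra.
  assert (Hcx : Rabs c <= Rabs x).
  { destruct (Rle_dec 0 x).
    - rewrite Rmin_left in Hc1 by lra. rewrite Rmax_right in Hc2 by lra.
      rewrite !Rabs_right; lra.
    - rewrite Rmin_right in Hc1 by lra. rewrite Rmax_left in Hc2 by lra.
      rewrite !Rabs_left1; lra. }
  assert (c * c <= Rabs x * Rabs x).
  { assert (H2 := Rabs_pos c).
    replace (c * c) with (Rabs c * Rabs c) by (rewrite <- Rabs_mult; apply Rabs_right; nra).
    nra. }
  replace (x * x) with (Rabs x * Rabs x) by (rewrite <- Rabs_mult; apply Rabs_right; nra).
  assert (0 <= Rabs x) by apply Rabs_pos. nra.
Qed.

(** The constant 4 is crude and serves qualitative limits only; sharp remainders come from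
    [Cexp_taylor3]. *)
Lemma Cexp_quad_bound (w : C) : Cmod w <= 1/2 ->
  Cmod (Cexp w - 1 - w) <= 4 * (Cmod w * Cmod w).
Proof.
  intros Hw. assert (H1 := Cmod_Re_le w). assert (H2 := Cmod_Im_le w).
  rewrite Cmod_sq. eapply Rle_trans; [apply Cmod_le_sum|].
  destruct w as [x y]. simpl in *.
  assert (Hx := exp_quad_bound x ltac:(lra)).
  assert (Hy := cos_quad_bound y).
  assert (Hs := sin_quad_bound y ltac:(lra)).
  assert (Hs1 := Rabs_sin_le y).
  assert (He : exp x <= 2).
  { apply Rabs_le_between in H1. nra. }
  assert (He1 : Rabs (exp x - 1) <= 2 * Rabs x).
  { replace (exp x - 1) with ((exp x - 1 - x) + x) by ring.
    eapply Rle_trans; [apply Rabs_triang|]. rewrite Rabs_right by lra.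
    replace (x * x) with (Rabs x * Rabs x) in Hx
      by (rewrite <- Rabs_mult; apply Rabs_right; nra).
    assert (0 <= Rabs x) by apply Rabs_pos. nra. }
  assert (A1 : Rabs (exp x * cos y + - (1) + - x) <= y * y + 2 * (x * x)).
  { replace (exp x * cos y + - (1) + - x) with ((exp x - 1 - x) - exp x * (1 - cos y)) by ring.
    assert (0 < exp x) by apply exp_pos. apply Rabs_le; split; nra. }
  assert (A2 : Rabs (exp x * sin y + - 0 + - y) <= x * x + 2 * (y * y)).
  { replace (exp x * sin y + - 0 + - y) with ((exp x - 1) * sin y + (sin y - y)) by ring.
    eapply Rle_trans; [apply Rabs_triang|]. rewrite Rabs_mult.
    assert (Rabs (exp x - 1) * Rabs (sin y) <= 2 * Rabs x * Rabs y).
    { apply Rmult_le_compat; auto using Rabs_pos. }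
    assert (2 * (Rabs x * Rabs y) <= x * x + y * y).
    { assert (E1 : x * x = Rabs x * Rabs x) by (rewrite <- Rabs_mult; symmetry; apply Rabs_right; nra).
      assert (E2 : y * y = Rabs y * Rabs y) by (rewrite <- Rabs_mult; symmetry; apply Rabs_right; nra).
      rewrite E1, E2. assert (0 <= (Rabs x - Rabs y) * (Rabs x - Rabs y)) by apply Rle_0_sqr.
      lra. }
    lra. }
  unfold Re, Im. simpl. lra.
Qed.

(** * Limits and sums of complex sequences *)

Definition clim (u : nat -> C) (l : C) : Prop :=
  forall eps, 0 < eps -> exists N, forall n, (N <= n)%nat -> Cmod (u n - l) < eps.

Fixpoint csum (u : nat -> C) (n : nat) : C :=
  match n with O => RtoC 0 | S n => (csum u n + u n)%C end.

Fixpoint rsum (u : nat -> R) (n : nat) : R :=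
  match n with O => 0 | S n => rsum u n + u n end.

Definition rsummable (M : nat -> R) : Prop := exists B, forall n, rsum M n <= B.

Lemma small_eq_0 (x : R) : (forall eps, 0 < eps -> x <= eps) -> x <= 0.
Proof.
  intros H. destruct (Rle_dec x 0) as [|Hx]; auto.
  assert (H1 := H (x / 2) ltac:(lra)). lra.
Qed.

Lemma le_of_forall_eps (x y K : R) :
  0 <= K -> (forall eps, 0 < eps -> x <= y + K * eps) -> x <= y.
Proof.
  intros HK H. assert (x - y <= 0); [|lra]. apply small_eq_0. intros eps He.
  assert (H1 := H (eps / (K + 1)) ltac:(apply Rdiv_lt_0_compat; lra)).
  assert (K * (eps / (K + 1)) <= eps).
  { replace (K * (eps / (K + 1))) with (eps * (K / (K + 1))) by (field; lra).
    assert (K / (K + 1) <= 1).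
    { apply Rmult_le_reg_r with (K + 1); [lra|]. unfold Rdiv. rewrite Rmult_assoc, Rinv_l; lra. }
    nra. }
  lra.
Qed.

Lemma clim_ext (u v : nat -> C) (l : C) :
  (forall n, u n = v n) -> clim u l -> clim v l.
Proof.
  intros E H eps He. destruct (H eps He) as [N HN]. exists N.
  intros n Hn. rewrite <- E. auto.
Qed.

Lemma clim_unique (u : nat -> C) (l l' : C) : clim u l -> clim u l' -> l = l'.
Proof.
  intros H H'.
  assert (E : Cmod (l - l') <= 0).
  { apply small_eq_0. intros eps He.
    destruct (H (eps / 2) ltac:(lra)) as [N HN]. destruct (H' (eps / 2) ltac:(lra)) as [N' HN'].
    assert (H1 := HN (Nat.max N N') ltac:(lia)). assert (H2 := HN' (Nat.max N N') ltac:(lia)).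
    replace (l - l')%C with ((u (Nat.max N N') - l') - (u (Nat.max N N') - l))%C by ring.
    eapply Rle_trans; [apply Cmod_sub_triangle|]. lra. }
  assert (E0 : (l - l')%C = 0%C).
  { apply Cmod_eq_0. generalize (Cmod_ge_0 (l - l')). lra. }
  replace l with (l - l' + l')%C by ring. rewrite E0. ring.
Qed.

Lemma clim_const (l : C) : clim (fun _ => l) l.
Proof.
  intros eps He. exists 0%nat. intros n _. replace (l - l)%C with (RtoC 0) by ring.
  rewrite Cmod_0. auto.
Qed.

Lemma clim_plus (u v : nat -> C) (l l' : C) :
  clim u l -> clim v l' -> clim (fun n => u n + v n)%C (l + l')%C.
Proof.
  intros H H' eps He.
  destruct (H (eps / 2) ltac:(lra)) as [N HN]. destruct (H' (eps / 2) ltac:(lra)) as [N' HN'].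
  exists (Nat.max N N'). intros n Hn.
  replace (u n + v n - (l + l'))%C with ((u n - l) + (v n - l'))%C by ring.
  eapply Rle_lt_trans; [apply Cmod_triangle|].
  assert (H1 := HN n ltac:(lia)). assert (H2 := HN' n ltac:(lia)). lra.
Qed.

Lemma clim_scal (c : C) (u : nat -> C) (l : C) :
  clim u l -> clim (fun n => c * u n)%C (c * l)%C.
Proof.
  intros H eps He. assert (Hc := Cmod_ge_0 c).
  destruct (H (eps / (Cmod c + 1)) ltac:(apply Rdiv_lt_0_compat; lra)) as [N HN].
  exists N. intros n Hn.
  replace (c * u n - c * l)%C with (c * (u n - l))%C by ring. rewrite Cmod_mult.
  apply Rle_lt_trans with (Cmod c * (eps / (Cmod c + 1))).
  - apply Rmult_le_compat_l; auto. left. auto.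
  - replace (Cmod c * (eps / (Cmod c + 1))) with (eps * (Cmod c / (Cmod c + 1))) by (field; lra).
    assert (Cmod c / (Cmod c + 1) < 1).
    { apply Rmult_lt_reg_r with (Cmod c + 1); [lra|]. unfold Rdiv. rewrite Rmult_assoc, Rinv_l; lra. }
    nra.
Qed.

Lemma clim_minus (u v : nat -> C) (l l' : C) :
  clim u l -> clim v l' -> clim (fun n => u n - v n)%C (l - l')%C.
Proof.
  intros H H'. apply clim_ext with (fun n => u n + (-(1)) * v n)%C.
  { intros n; ring. }
  replace (l - l')%C with (l + (-(1)) * l')%C by ring.
  apply clim_plus; auto. apply clim_scal; auto.
Qed.

Lemma clim_subseq (u : nat -> C) (l : C) (s : nat -> nat) :
  (forall n, (n <= s n)%nat) -> clim u l -> clim (fun n => u (s n)) l.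
Proof.
  intros Hs H eps He. destruct (H eps He) as [N HN]. exists N. intros n Hn.
  apply HN. specialize (Hs n). lia.
Qed.

Lemma clim_null (u : nat -> C) (b : nat -> R) (l : C) :
  (forall n, Cmod (u n - l) <= b n) ->
  (forall eps, 0 < eps -> exists N, forall n, (N <= n)%nat -> b n < eps) -> clim u l.
Proof.
  intros H Hb eps He. destruct (Hb eps He) as [N HN]. exists N. intros n Hn.
  eapply Rle_lt_trans; auto.
Qed.

Lemma clim_Cmod_le (u : nat -> C) (l c : C) (B : R) :
  clim u l -> (exists N, forall n, (N <= n)%nat -> Cmod (u n - c) <= B) -> Cmod (l - c) <= B.
Proof.
  intros H [N0 HB]. apply le_of_forall_eps with (K := 1); [lra|]. intros eps He.
  destruct (H eps He) as [N HN].
  assert (H1 := HN (Nat.max N N0) ltac:(lia)). assert (H2 := HB (Nat.max N N0) ltac:(lia)).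
  replace (l - c)%C with ((u (Nat.max N N0) - c) - (u (Nat.max N N0) - l))%C by ring.
  eapply Rle_trans; [apply Cmod_sub_triangle|]. lra.
Qed.

Lemma clim_norm_le (u : nat -> C) (l : C) (B : R) :
  clim u l -> (forall n, Cmod (u n) <= B) -> Cmod l <= B.
Proof.
  intros H HB. replace l with (l - 0)%C by ring. apply (clim_Cmod_le u); auto.
  exists 0%nat. intros n _. replace (u n - 0)%C with (u n) by ring. auto.
Qed.

Lemma inv_INR_small (c eps : R) : 0 < eps ->
  exists N, forall n, (N <= n)%nat -> c / INR (S n) < eps.
Proof.
  intros He. assert (Hc : 0 <= Rabs c) by apply Rabs_pos.
  destruct (INR_unbounded (Rabs c / eps)) as [N HN]. exists N. intros n Hn.
  assert (H : INR N < INR (S n)) by (apply lt_INR; lia).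
  assert (H0 : 0 < INR (S n)) by (apply lt_0_INR; lia).
  apply Rmult_lt_reg_r with (INR (S n)); auto.
  unfold Rdiv. rewrite Rmult_assoc, Rinv_l by lra.
  assert (Rabs c < eps * INR (S n)).
  { replace (Rabs c) with (eps * (Rabs c / eps)) by (field; lra).
    apply Rmult_lt_compat_l; auto. lra. }
  generalize (Rle_abs c). lra.
Qed.

Lemma ccauchy_cv (u : nat -> C) :
  (forall eps, 0 < eps -> exists N, forall n p, (N <= n)%nat -> (N <= p)%nat ->
     Cmod (u n - u p) < eps) -> exists l, clim u l.
Proof.
  intros H.
  assert (HR : Cauchy_crit (fun n => Re (u n))).
  { intros eps He. destruct (H eps He) as [N HN]. exists N. intros n p Hn Hp.
    unfold Rdist. eapply Rle_lt_trans; [|apply (HN n p); auto].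
    rewrite <- Re_minus. apply Cmod_Re_le. }
  assert (HI : Cauchy_crit (fun n => Im (u n))).
  { intros eps He. destruct (H eps He) as [N HN]. exists N. intros n p Hn Hp.
    unfold Rdist. eapply Rle_lt_trans; [|apply (HN n p); auto].
    rewrite <- Im_minus. apply Cmod_Im_le. }
  destruct (Rcomplete.R_complete _ HR) as [x Hx]. destruct (Rcomplete.R_complete _ HI) as [y Hy].
  exists (x, y). intros eps He.
  destruct (Hx (eps / 2) ltac:(lra)) as [N HN]. destruct (Hy (eps / 2) ltac:(lra)) as [N' HN'].
  exists (Nat.max N N'). intros n Hn.
  eapply Rle_lt_trans; [apply Cmod_le_sum|]. rewrite Re_minus, Im_minus. simpl.
  assert (H1 := HN n ltac:(lia)). assert (H2 := HN' n ltac:(lia)).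
  unfold Rdist in *. lra.
Qed.

Lemma csum_ext (u v : nat -> C) (n : nat) :
  (forall j, (j < n)%nat -> u j = v j) -> csum u n = csum v n.
Proof.
  induction n as [|n IH]; intros H; simpl; auto.
  rewrite IH, H; auto.
Qed.

Lemma csum_plus (u v : nat -> C) (n : nat) :
  csum (fun j => u j + v j)%C n = (csum u n + csum v n)%C.
Proof. induction n as [|n IH]; simpl; [ring|rewrite IH; ring]. Qed.

Lemma csum_scal (c : C) (u : nat -> C) (n : nat) :
  csum (fun j => c * u j)%C n = (c * csum u n)%C.
Proof. induction n as [|n IH]; simpl; [ring|rewrite IH; ring]. Qed.

Lemma csum_minus (u v : nat -> C) (n : nat) :
  csum (fun j => u j - v j)%C n = (csum u n - csum v n)%C.
Proof. induction n as [|n IH]; simpl; [ring|rewrite IH; ring]. Qed.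

Lemma csum_0 (n : nat) : csum (fun _ => RtoC 0) n = RtoC 0.
Proof. induction n as [|n IH]; simpl; auto. rewrite IH. ring. Qed.

Lemma csum_const (c : C) (n : nat) : csum (fun _ => c) n = (RtoC (INR n) * c)%C.
Proof.
  induction n as [|n IH]; [simpl; ring|].
  rewrite S_INR, RtoC_plus. simpl csum. rewrite IH. ring.
Qed.

Lemma csum_S_l (u : nat -> C) (n : nat) :
  csum u (S n) = (u O + csum (fun j => u (S j)) n)%C.
Proof. induction n as [|n IH]; [simpl; ring|]. simpl in *. rewrite IH. ring. Qed.

Lemma csum_add (u : nat -> C) (n p : nat) :
  csum u (n + p) = (csum u n + csum (fun j => u (n + j)%nat) p)%C.
Proof.
  induction p as [|p IH]; [rewrite Nat.add_0_r; simpl; ring|].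
  rewrite Nat.add_succ_r. simpl. rewrite IH. ring.
Qed.

Lemma csum_swap (a : nat -> nat -> C) (n p : nat) :
  csum (fun i => csum (fun j => a i j) p) n = csum (fun j => csum (fun i => a i j) n) p.
Proof.
  induction n as [|n IH]; simpl.
  - symmetry. apply csum_0.
  - rewrite IH, csum_plus. reflexivity.
Qed.

Lemma csum_telescope (u : nat -> C) (n : nat) :
  csum (fun j => u j - u (S j))%C n = (u O - u n)%C.
Proof. induction n as [|n IH]; simpl; [ring|rewrite IH; ring]. Qed.

Lemma rsum_ge_0 (M : nat -> R) (n : nat) : (forall j, 0 <= M j) -> 0 <= rsum M n.
Proof. intros H. induction n as [|n IH]; simpl; [lra|]. specialize (H n). lra. Qed.

Lemma rsum_le (u v : nat -> R) (n : nat) :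
  (forall j, (j < n)%nat -> u j <= v j) -> rsum u n <= rsum v n.
Proof.
  induction n as [|n IH]; intros H; simpl; [lra|].
  assert (H1 := IH (fun j Hj => H j (Nat.lt_trans _ _ _ Hj (Nat.lt_succ_diag_r n)))).
  specialize (H n ltac:(lia)). lra.
Qed.

Lemma rsum_scal (c : R) (u : nat -> R) (n : nat) : rsum (fun j => c * u j) n = c * rsum u n.
Proof. induction n as [|n IH]; simpl; [ring|rewrite IH; ring]. Qed.

Lemma rsum_const (c : R) (n : nat) : rsum (fun _ => c) n = INR n * c.
Proof. induction n as [|n IH]; [simpl; ring|]. rewrite S_INR. simpl rsum. rewrite IH. ring. Qed.

Lemma rsum_mono (M : nat -> R) (n p : nat) :
  (forall j, 0 <= M j) -> (n <= p)%nat -> rsum M n <= rsum M p.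
Proof.
  intros H Hn. induction Hn as [|p Hp IH]; [lra|]. simpl. specialize (H p). lra.
Qed.

Lemma Cmod_csum_le (u : nat -> C) (M : nat -> R) (n : nat) :
  (forall j, (j < n)%nat -> Cmod (u j) <= M j) -> Cmod (csum u n) <= rsum M n.
Proof.
  induction n as [|n IH]; intros H; simpl.
  - rewrite Cmod_0. lra.
  - eapply Rle_trans; [apply Cmod_triangle|].
    apply Rplus_le_compat; auto.
Qed.

Lemma Cmod_csum_tail (u : nat -> C) (M : nat -> R) (n p : nat) :
  (forall j, (n <= j)%nat -> Cmod (u j) <= M j) -> (n <= p)%nat ->
  Cmod (csum u p - csum u n) <= rsum M p - rsum M n.
Proof.
  intros H Hn. induction Hn as [|p Hp IH]; simpl.
  - replace (csum u n - csum u n)%C with (RtoC 0) by ring. rewrite Cmod_0. lra.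
  - replace (csum u p + u p - csum u n)%C with ((csum u p - csum u n) + u p)%C by ring.
    eapply Rle_trans; [apply Cmod_triangle|]. specialize (H p Hp). lra.
Qed.

Lemma rsummable_tail (M : nat -> R) : (forall j, 0 <= M j) -> rsummable M ->
  forall eps, 0 < eps -> exists N, forall n p, (N <= n)%nat -> (n <= p)%nat ->
    rsum M p - rsum M n <= eps.
Proof.
  intros H0 [B HB] eps He.
  destruct (completeness (fun x => exists n, x = rsum M n)) as [s [Hs1 Hs2]].
  { exists B. intros x [n ->]. auto. }
  { exists 0, 0%nat. reflexivity. }
  assert (Hex : exists N, s - eps < rsum M N).
  { destruct (Classical_Prop.classic (exists N, s - eps < rsum M N)) as [|Hn]; auto.
    exfalso. assert (s <= s - eps); [|lra]. apply Hs2. intros x [n ->].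
    destruct (Rle_dec (rsum M n) (s - eps)); auto. exfalso. apply Hn. exists n. lra. }
  destruct Hex as [N HN]. exists N. intros n p Hn Hp.
  assert (rsum M p <= s) by (apply Hs1; exists p; auto).
  assert (rsum M N <= rsum M n) by (apply rsum_mono; auto). lra.
Qed.

Lemma csum_cv (u : nat -> C) (M : nat -> R) :
  (forall j, Cmod (u j) <= M j) -> rsummable M -> exists l, clim (csum u) l.
Proof.
  intros H HM. apply ccauchy_cv. intros eps He.
  assert (H0 : forall j, 0 <= M j) by (intros j; eapply Rle_trans; [apply Cmod_ge_0|apply H]).
  destruct (rsummable_tail M H0 HM (eps / 2) ltac:(lra)) as [N HN]. exists N.
  assert (G : forall n p, (N <= n)%nat -> (n <= p)%nat -> Cmod (csum u p - csum u n) < eps).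
  { intros n p Hn Hp. apply Rle_lt_trans with (rsum M p - rsum M n).
    - apply Cmod_csum_tail; auto.
    - specialize (HN n p Hn Hp). lra. }
  intros n p Hn Hp. destruct (Nat.le_ge_cases n p).
  - rewrite Cmod_sub_comm. auto.
  - auto.
Qed.

(** Dominated convergence for series. The truncation [s r] moves with r and the majorant is required
    only below it, because the terms of an iterated duplication formula are controlled only
    there. *)
Lemma tannery (a : nat -> nat -> C) (b : nat -> C) (M : nat -> R) (s : nat -> nat) (B : C) :
  rsummable M -> (forall r, (r <= s r)%nat) ->
  (forall r j, (j < s r)%nat -> Cmod (a r j) <= M j) -> (forall j, 0 <= M j) ->
  (forall j, clim (fun r => a r j) (b j)) ->
  clim (csum b) B -> clim (fun r => csum (a r) (s r)) B.
Proof.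
  intros HM Hs Ha H0 Hb HB eps He.
  destruct (rsummable_tail M H0 HM (eps / 8) ltac:(lra)) as [N1 HN1].
  destruct (HB (eps / 4) ltac:(lra)) as [N2 HN2].
  set (N := Nat.max N1 N2).
  assert (Hfin : exists R0, forall r, (R0 <= r)%nat -> Cmod (csum (a r) N - csum b N) < eps / 4).
  { assert (Hc : clim (fun r => csum (a r) N) (csum b N)).
    { clearbody N. induction N as [|n IH]; simpl; [apply clim_const|].
      apply clim_plus; auto. }
    destruct (Hc (eps / 4) ltac:(lra)) as [R0 HR0]. exists R0. auto. }
  destruct Hfin as [R0 HR0]. exists (Nat.max R0 N). intros r Hr.
  assert (Hsr := Hs r).
  assert (T1 : Cmod (csum (a r) (s r) - csum (a r) N) <= eps / 4).
  (* Extending row r by zero beyond [s r] makes the majorant valid for all indices. *)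
  { set (v := fun j => if lt_dec j (s r) then a r j else RtoC 0).
    assert (E1 : csum (a r) (s r) = csum v (s r)).
    { apply csum_ext. intros j Hj. unfold v. destruct (lt_dec j (s r)); auto; lia. }
    assert (E2 : csum (a r) N = csum v N).
    { apply csum_ext. intros j Hj. unfold v. destruct (lt_dec j (s r)); auto; lia. }
    rewrite E1, E2. eapply Rle_trans; [apply Cmod_csum_tail with (M := M)|].
    - intros j _. unfold v. destruct (lt_dec j (s r)); auto. rewrite Cmod_0. auto.
    - lia.
    - assert (H1 := HN1 N (s r) ltac:(lia) ltac:(lia)). lra. }
  assert (T2 := HR0 r ltac:(lia)).
  assert (T3 := HN2 N ltac:(lia)).
  replace (csum (a r) (s r) - B)%C
    with ((csum (a r) (s r) - csum (a r) N) + ((csum (a r) N - csum b N) + (csum b N - B)))%C by ring.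
  eapply Rle_lt_trans; [apply Cmod_triangle|].
  assert (H1 := Cmod_triangle (csum (a r) N - csum b N) (csum b N - B)). lra.
Qed.

(** Both iterated sums are limits of the same square partial sums: Tannery's theorem is applied once
    to the rows and once to the columns. *)
Lemma csum_double_swap (a : nat -> nat -> C) (M M' : nat -> R) (u v : nat -> C) (B B' : C) :
  rsummable M -> rsummable M' -> (forall j, 0 <= M j) -> (forall j, 0 <= M' j) ->
  (forall i j, Cmod (a i j) <= M i * M' j) ->
  (forall i, clim (csum (a i)) (u i)) -> (forall j, clim (csum (fun i => a i j)) (v j)) ->
  clim (csum u) B -> clim (csum v) B' -> B = B'.
Proof.
  intros HM HM' H0 H0' Ha Hu Hv HB HB'.
  destruct HM' as [S' HS']. assert (HS'0 : 0 <= S') by (apply (HS' 0%nat)).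
  assert (HT : clim (fun r => csum (fun i => csum (a i) r) r) B).
  { apply tannery with (b := u) (M := fun i => M i * S'); auto.
    - destruct HM as [S HS]. exists (S * S'). intros n.
      assert (E : rsum (fun i => M i * S') n = S' * rsum M n).
      { rewrite <- rsum_scal. apply Rle_antisym; apply rsum_le; intros; lra. }
      rewrite E. specialize (HS n). nra.
    - intros r j _. eapply Rle_trans; [apply Cmod_csum_le with (M := fun i => M j * M' i); auto|].
      rewrite rsum_scal. apply Rmult_le_compat_l; auto.
    - intros j. specialize (H0 j). nra. }
  assert (HT' : clim (fun r => csum (fun j => csum (fun i => a i j) r) r) B').
  { destruct HM as [S HS]. assert (HS0 : 0 <= S) by (apply (HS 0%nat)).
    apply tannery with (b := v) (M := fun j => S * M' j); auto.
    - exists (S * S'). intros n. rewrite rsum_scal. specialize (HS' n). nra.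
    - intros r j _. eapply Rle_trans; [apply Cmod_csum_le with (M := fun i => M' j * M i)|].
      + intros i _. rewrite Rmult_comm. auto.
      + rewrite rsum_scal, Rmult_comm. apply Rmult_le_compat_r; auto.
    - intros j. specialize (H0' j). nra. }
  apply (clim_unique _ _ _ HT). apply clim_ext with (2 := HT').
  intros n. symmetry. apply csum_swap.
Qed.

(** Telescoping with 1/(n+1)^2 <= 1/n - 1/(n+1); the induction carries the sharper bound 2 - 1/n. *)
Lemma rsum_inv_sq_le (n : nat) : rsum (fun j => / (INR (S j) * INR (S j))) n <= 2.
Proof.
  destruct n as [|n]; [simpl; lra|].
  assert (H : rsum (fun j => / (INR (S j) * INR (S j))) (S n) <= 2 - / INR (S n)).
  { induction n as [|n IH]; [simpl; lra|].
    cbn [rsum] in *. eapply Rle_trans; [apply Rplus_le_compat_r; exact IH|].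
    rewrite (S_INR (S n)). set (x := INR (S n)) in *.
    assert (1 <= x) by (unfold x; apply (le_INR 1); lia).
    assert (/ x - / (x+1) = / (x * (x+1))) by (field; lra).
    assert (/ ((x+1)*(x+1)) <= / (x*(x+1))) by (apply Rinv_le_contravar; nra). lra. }
  assert (0 < / INR (S n)) by (apply Rinv_0_lt_compat, lt_0_INR; lia). lra.
Qed.

Lemma rsummable_inv_sq (c : R) : 0 <= c -> rsummable (fun j => c * / (INR (S j) * INR (S j))).
Proof.
  intros Hc. exists (c * 2). intros n. rewrite rsum_scal.
  apply Rmult_le_compat_l; auto. apply rsum_inv_sq_le.
Qed.

Lemma rsum_geom_le (r : R) (n : nat) : 0 <= r < 1 -> rsum (fun j => r ^ j) n <= / (1 - r).
Proof.
  intros Hr.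
  assert (H : (1 - r) * rsum (fun j => r ^ j) n = 1 - r ^ n).
  { induction n as [|n IH]; simpl; [ring|]. rewrite Rmult_plus_distr_l, IH. ring. }
  assert (0 <= r ^ n) by (apply pow_le; lra).
  apply Rmult_le_reg_l with (1 - r); [lra|]. rewrite H, Rinv_r; lra.
Qed.

(** * Polynomials and their uniform limits *)

Fixpoint peval (p : list C) (u : C) : C :=
  match p with nil => RtoC 0 | c :: p => (c + u * peval p u)%C end.

Definition ispoly (f : C -> C) : Prop := exists p, forall u, f u = peval p u.

Lemma ispoly_const (c : C) : ispoly (fun _ => c).
Proof. exists (c :: nil). intros u. simpl. ring. Qed.

Lemma ispoly_id : ispoly (fun u => u).
Proof. exists (RtoC 0 :: RtoC 1 :: nil). intros u. simpl. ring. Qed.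

Lemma ispoly_ext (f g : C -> C) : (forall u, f u = g u) -> ispoly f -> ispoly g.
Proof. intros E [p Hp]. exists p. intros u. rewrite <- E. auto. Qed.

Lemma ispoly_plus (f g : C -> C) : ispoly f -> ispoly g -> ispoly (fun u => f u + g u)%C.
Proof.
  intros [p Hp] [p' Hp'].
  assert (H : exists s, forall u, peval s u = (peval p u + peval p' u)%C).
  { clear. revert p'. induction p as [|c p IH]; intros p'.
    - exists p'. intros u. simpl. ring.
    - destruct p' as [|c' p'].
      + exists (c :: p). intros u. simpl. ring.
      + destruct (IH p') as [s Hs]. exists ((c + c')%C :: s). intros u. simpl. rewrite Hs. ring. }
  destruct H as [s Hs]. exists s. intros u. rewrite Hs, Hp, Hp'. reflexivity.
Qed.

Lemma ispoly_scal (c : C) (f : C -> C) : ispoly f -> ispoly (fun u => c * f u)%C.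
Proof.
  intros [p Hp]. exists (map (fun x => c * x)%C p). intros u. rewrite Hp. clear.
  induction p as [|a p IH]; simpl; [ring|]. rewrite <- IH. ring.
Qed.

Lemma ispoly_shift (f : C -> C) : ispoly f -> ispoly (fun u => u * f u)%C.
Proof. intros [p Hp]. exists (RtoC 0 :: p). intros u. simpl. rewrite Hp. ring. Qed.

Lemma ispoly_mult (f g : C -> C) : ispoly f -> ispoly g -> ispoly (fun u => f u * g u)%C.
Proof.
  intros [p Hp] Hg.
  assert (H : ispoly (fun u => peval p u * g u)%C).
  { clear Hp. induction p as [|c p IH].
    - apply ispoly_ext with (fun _ => RtoC 0); [intros; simpl; ring|apply ispoly_const].
    - apply ispoly_ext with (fun u => c * g u + u * (peval p u * g u))%C.
      { intros u. simpl. ring. }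
      apply ispoly_plus; [apply ispoly_scal; auto|apply ispoly_shift; auto]. }
  apply ispoly_ext with (2 := H). intros u. rewrite Hp. reflexivity.
Qed.

Lemma ispoly_pow (f : C -> C) (n : nat) : ispoly f -> ispoly (fun u => f u ^ n)%C.
Proof.
  intros Hf. induction n as [|n IH]; [apply (ispoly_const (RtoC 1))|].
  apply ispoly_ext with (fun u => f u * f u ^ n)%C; [reflexivity|]. apply ispoly_mult; auto.
Qed.

Lemma ispoly_dilate (c : C) (f : C -> C) : ispoly f -> ispoly (fun u => f (c * u)%C).
Proof.
  intros [p Hp].
  assert (H : ispoly (fun u => peval p (c * u))).
  { clear Hp. induction p as [|a p IH].
    - apply (ispoly_const (RtoC 0)).
    - simpl. apply ispoly_plus; [apply ispoly_const|].
      apply ispoly_ext with (fun u => c * (u * peval p (c * u)))%C; [intros; ring|].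
      apply ispoly_scal, ispoly_shift, IH. }
  apply ispoly_ext with (2 := H). intros u. rewrite Hp. reflexivity.
Qed.

Lemma peval_csum (p : list C) (u : C) :
  peval p u = csum (fun i => nth i p (RtoC 0) * u ^ i)%C (length p).
Proof.
  induction p as [|c p IH]; [reflexivity|].
  change (length (c :: p)) with (S (length p)). rewrite csum_S_l. simpl peval.
  rewrite IH. simpl nth. rewrite <- csum_scal. change (u ^ 0)%C with (RtoC 1).
  replace (c * 1)%C with c by ring. f_equal. apply csum_ext. intros j _.
  rewrite Cpow_S. ring.
Qed.

Lemma Cexp_i_eq_1 (t : R) : Rabs t < 2 * PI -> Cexp (Ci * RtoC t) = 1%C -> t = 0.
Proof.
  intros Ht H. unfold Cexp in H. simpl in H.
  assert (H1 := f_equal fst H). simpl in H1. clear H.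
  replace (0 * t - 1 * 0) with 0 in H1 by ring. rewrite exp_0 in H1.
  replace (0 * 0 + 1 * t) with (2 * (t / 2)) in H1 by field.
  rewrite cos_2a_sin in H1.
  assert (H2 : sin (t / 2) = 0) by nra.
  apply Rabs_def2 in Ht.
  destruct (Rtotal_order t 0) as [H3|[H3|H3]]; auto.
  - assert (H4 := sin_gt_0 (- (t / 2)) ltac:(lra) ltac:(lra)). rewrite sin_neg in H4. lra.
  - assert (H4 := sin_gt_0 (t / 2) ltac:(lra) ltac:(lra)). lra.
Qed.

Lemma Cexp_i_2PI_nat (n : nat) : Cexp (Ci * RtoC (2 * PI * INR n)) = 1%C.
Proof.
  unfold Cexp. simpl.
  replace (0 * 0 + 1 * (2 * PI * INR n)) with (0 + 2 * INR n * PI) by ring.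
  replace (0 * (2 * PI * INR n) - 1 * 0) with 0 by ring.
  rewrite exp_0, cos_period, sin_period, cos_0, sin_0.
  apply injective_projections; simpl; ring.
Qed.

Lemma Cmod_Cexp_i (t : R) : Cmod (Cexp (Ci * RtoC t)) = 1.
Proof.
  rewrite Cmod_Cexp. rewrite <- exp_0. f_equal. simpl. ring.
Qed.

Lemma csum_geom (x : C) (n : nat) : ((1 - x) * csum (fun j => x ^ j)%C n = 1 - x ^ n)%C.
Proof.
  induction n as [|n IH]; [simpl; ring|]. simpl csum.
  rewrite Cmult_plus_distr_l, IH, Cpow_S. ring.
Qed.

(** Orthogonality of characters: the ratio of the geometric sum is an M-th root of unity, different
    from 1 because 0 < |i - n| < M. *)
Lemma root_sum (M i n : nat) : (i < M)%nat -> (n < M)%nat -> i <> n ->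
  csum (fun j => Cexp (Ci * RtoC (2 * PI * (INR i - INR n) / INR M)) ^ j)%C M = RtoC 0.
Proof.
  intros Hi Hn Hin. set (t := 2 * PI * (INR i - INR n) / INR M).
  assert (HM : 0 < INR M) by (apply lt_0_INR; lia).
  assert (HPI := PI_RGT_0).
  set (x := Cexp (Ci * RtoC t)).
  assert (H := csum_geom x M).
  assert (Hx1 : (1 - x)%C <> 0%C).
  { intros E. assert (E1 : x = 1%C).
    { replace x with (1 - (1 - x))%C by ring. rewrite E. ring. }
    apply Cexp_i_eq_1 in E1.
    - apply Hin. apply INR_eq. unfold t in E1.
      assert (E2 : INR i - INR n = t * INR M / (2 * PI)) by (unfold t; field; lra).
      unfold t in E2. rewrite E1 in E2. unfold Rdiv in E2. lra.
    - unfold t, Rdiv. rewrite !Rabs_mult. rewrite (Rabs_right 2), (Rabs_right PI) by lra.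
      rewrite Rabs_inv, (Rabs_right (INR M)) by lra.
      assert (Rabs (INR i - INR n) < INR M).
      { apply lt_INR in Hi. apply lt_INR in Hn. assert (H1 := pos_INR i). assert (H2 := pos_INR n).
        apply Rabs_def1; lra. }
      apply Rmult_lt_reg_r with (INR M); auto. rewrite Rmult_assoc, Rinv_l by lra.
      apply Rmult_lt_compat_l with (r := 2 * PI) in H0; lra. }
  assert (HxM : (x ^ M)%C = 1%C).
  { unfold x. rewrite <- Cexp_nat.
    replace (RtoC (INR M) * (Ci * RtoC t))%C with (Ci * RtoC (2 * PI * INR i) - Ci * RtoC (2 * PI * INR n))%C.
    - rewrite Cexp_minus, !Cexp_i_2PI_nat. field.
    - replace (2 * PI * INR i) with (INR M * t + 2 * PI * INR n) by (unfold t; field; lra).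
      rewrite RtoC_plus, RtoC_mult. ring. }
  rewrite HxM in H.
  replace (csum (fun j : nat => x ^ j) M)%C with (/ (1 - x) * ((1 - x) * csum (fun j => x ^ j) M))%C
    by (field; auto).
  rewrite H. ring.
Qed.

(** Cauchy's estimate: the n-th coefficient times r^n is the average of P(r w) w^(-n) over the M-th
    roots of unity w. Taking for M the length of the list excludes aliasing between exponents. *)
Lemma coef_bound (p : list C) (r B : R) (n : nat) : 0 < r ->
  (forall t, Cmod (peval p (RtoC r * Cexp (Ci * RtoC t))%C) <= B) ->
  Cmod (nth n p (RtoC 0)) * r ^ n <= B.
Proof.
  intros Hr HB.
  destruct (le_lt_dec (length p) n) as [Hn|Hn].
  { rewrite nth_overflow, Cmod_0 by auto.
    eapply Rle_trans; [|apply (HB 0)]. rewrite Rmult_0_l. apply Cmod_ge_0. }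
  set (M := length p).
  assert (HM : 0 < INR M) by (apply lt_0_INR; lia).
  set (w := fun j : nat => Cexp (Ci * RtoC (2 * PI * INR j / INR M))).
  set (v := fun j : nat => Cexp (Ci * RtoC (- (2 * PI * INR n * INR j / INR M)))).
  assert (E : csum (fun j => peval p (RtoC r * w j) * v j)%C M
    = (RtoC (INR M) * (nth n p (RtoC 0) * RtoC (r ^ n)))%C).
  { rewrite (csum_ext _ (fun j => csum (fun i => (nth i p (RtoC 0) * RtoC (r ^ i)) *
       Cexp (Ci * RtoC (2 * PI * (INR i - INR n) / INR M)) ^ j) M)%C).
    2:{ intros j _. rewrite peval_csum. fold M. rewrite Cmult_comm, <- csum_scal.
        apply csum_ext. intros i _. rewrite Cpow_mult_l, <- RtoC_pow.
        unfold w, v. rewrite <- !Cexp_nat.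
        rewrite <- (Cmult_assoc (nth i p (RtoC 0))).
        rewrite (Cmult_comm (Cexp _)). rewrite <- !Cmult_assoc. f_equal. f_equal.
        rewrite <- Cexp_plus. f_equal.
        replace (RtoC (INR j) * (Ci * RtoC (2 * PI * (INR i - INR n) / INR M)))%C
          with (Ci * RtoC (INR j * (2 * PI * (INR i - INR n) / INR M)))%C by (rewrite RtoC_mult; ring).
        replace (RtoC (INR i) * (Ci * RtoC (2 * PI * INR j / INR M)))%C
          with (Ci * RtoC (INR i * (2 * PI * INR j / INR M)))%C by (rewrite RtoC_mult; ring).
        rewrite <- Cmult_plus_distr_l, <- RtoC_plus. f_equal. f_equal. field. lra. }
    rewrite csum_swap.
    assert (Hs : forall K, (K <= M)%nat ->
      csum (fun i => csum (fun j => nth i p (RtoC 0) * RtoC (r ^ i) *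
        Cexp (Ci * RtoC (2 * PI * (INR i - INR n) / INR M)) ^ j) M)%C K
      = if lt_dec n K then (RtoC (INR M) * (nth n p (RtoC 0) * RtoC (r ^ n)))%C else RtoC 0).
    { induction K as [|K IH]; intros HK; simpl csum.
      - destruct (lt_dec n 0); auto; lia.
      - rewrite IH by lia. rewrite csum_scal.
        destruct (Nat.eq_dec K n) as [->|HKn].
        + destruct (lt_dec n n); [lia|]. destruct (lt_dec n (S n)); [|lia].
          rewrite (csum_ext _ (fun _ => RtoC 1)).
          * rewrite csum_const. ring.
          * intros j _. replace (2 * PI * (INR n - INR n) / INR M) with 0 by (field; lra).
            replace (Ci * RtoC 0)%C with (RtoC 0) by ring. rewrite Cexp_0. apply Cpow_1_l.
        + rewrite root_sum by lia.
          destruct (lt_dec n K); destruct (lt_dec n (S K)); try lia; ring. }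
    rewrite Hs by lia. destruct (lt_dec n M); auto; lia. }
  assert (HC : Cmod (csum (fun j => peval p (RtoC r * w j) * v j)%C M) <= INR M * B).
  { rewrite <- rsum_const. apply Cmod_csum_le. intros j _. rewrite Cmod_mult.
    unfold v. rewrite Cmod_Cexp_i, Rmult_1_r. apply HB. }
  rewrite E, !Cmod_mult, !Cmod_R, (Rabs_right (INR M)) in HC by lra.
  rewrite (Rabs_right (r ^ n)) in HC by (apply Rle_ge, pow_le; lra).
  apply Rmult_le_reg_l with (INR M); auto.
Qed.

(** If B < b, Bernoulli's inequality makes (b/B')^n outgrow K. The midpoint B' replaces B because it
    is positive even when B = 0. *)
Lemma le_of_pow_le (b B K : R) : 0 <= b -> 0 <= B ->
  (forall n, b ^ n <= K * B ^ n) -> b <= B.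
Proof.
  intros Hb HB H. destruct (Rle_dec b B) as [|Hn]; auto. exfalso.
  assert (HK : 1 <= K) by (generalize (H 0%nat); simpl; lra).
  set (B' := (b + B) / 2). assert (HB' : 0 < B' < b) by (unfold B'; lra).
  set (h := b / B' - 1).
  assert (Hh : 0 < h).
  { unfold h. assert (1 < b / B'); [|lra]. apply Rmult_lt_reg_r with B'; [lra|].
    unfold Rdiv. rewrite Rmult_assoc, Rinv_l; lra. }
  destruct (INR_unbounded (K / h)) as [n Hn1].
  assert (E : b = B' * (1 + h)) by (unfold h; field; lra).
  assert (H1 := H n). rewrite E, Rpow_mult_distr in H1.
  assert (H2 : 1 + INR n * h <= (1 + h) ^ n) by (apply poly; lra).
  assert (H3 : B ^ n <= B' ^ n) by (apply pow_incr; unfold B'; lra).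
  assert (H4 : 0 < B' ^ n) by (apply pow_lt; lra).
  assert (H5 : K < INR n * h).
  { replace K with (K / h * h) by (field; lra). apply Rmult_lt_compat_r; lra. }
  nra.
Qed.

(* Applying the coefficient bound to all powers of f removes the constant (Landau's trick). *)
Lemma poly_maxmod (f : C -> C) (r B : R) (u : C) : ispoly f -> 0 < r ->
  (forall t, Cmod (f (RtoC r * Cexp (Ci * RtoC t))%C) <= B) -> Cmod u < r -> Cmod (f u) <= B.
Proof.
  intros Hf Hr HB Hu.
  assert (HB0 : 0 <= B) by (eapply Rle_trans; [apply Cmod_ge_0|apply (HB 0)]).
  (* The constant is the sum of the geometric series in |u|/r, the same for every power of f. *)
  apply le_of_pow_le with (K := / (1 - Cmod u / r)); auto using Cmod_ge_0.
  intros n. destruct (ispoly_pow f n Hf) as [p Hp].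
  rewrite <- Cmod_pow, Hp, peval_csum.
  eapply Rle_trans; [apply Cmod_csum_le with (M := fun i => B ^ n * (Cmod u / r) ^ i)|].
  - intros i _. rewrite Cmod_mult, Cmod_pow.
    assert (Hc : Cmod (nth i p (RtoC 0)) * r ^ i <= B ^ n).
    { apply coef_bound; auto. intros t. rewrite <- Hp, Cmod_pow.
      apply pow_incr. split; auto using Cmod_ge_0. }
    assert (Hri : 0 < r ^ i) by (apply pow_lt; auto).
    unfold Rdiv. rewrite Rpow_mult_distr, pow_inv.
    replace (Cmod (nth i p (RtoC 0)) * Cmod u ^ i)
      with (Cmod (nth i p (RtoC 0)) * r ^ i * (Cmod u ^ i * / r ^ i)) by (field; lra).
    apply Rmult_le_compat_r; auto.
    apply Rmult_le_pos; [apply pow_le, Cmod_ge_0|left; apply Rinv_0_lt_compat; auto].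
  - rewrite rsum_scal, Rmult_comm. apply Rmult_le_compat_r; [apply pow_le; auto|].
    apply rsum_geom_le. split.
    + apply Rmult_le_pos; [apply Cmod_ge_0|left; apply Rinv_0_lt_compat; auto].
    + apply Rmult_lt_reg_r with r; auto. unfold Rdiv. rewrite Rmult_assoc, Rinv_l; lra.
Qed.

(** The maximum principle is applied to the cofactor h, which is bounded by B/r^n on the circle. *)
Lemma poly_schwarz (f h : C -> C) (r B : R) (n : nat) (u : C) : ispoly h -> 0 < r ->
  (forall u, f u = u ^ n * h u)%C ->
  (forall t, Cmod (f (RtoC r * Cexp (Ci * RtoC t))%C) <= B) -> Cmod u < r ->
  Cmod (f u) <= B * (Cmod u / r) ^ n.
Proof.
  intros Hh Hr E HB Hu. assert (Hrn : 0 < r ^ n) by (apply pow_lt; auto).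
  rewrite E, Cmod_mult, Cmod_pow. unfold Rdiv. rewrite Rpow_mult_distr, pow_inv.
  assert (H : Cmod (h u) <= B * / r ^ n).
  { apply poly_maxmod with r; auto. intros t. specialize (HB t). rewrite E in HB.
    rewrite Cmod_mult, Cmod_pow, Cmod_mult, Cmod_Cexp_i, Cmod_R, Rabs_right, Rmult_1_r in HB by lra.
    apply Rmult_le_reg_l with (r ^ n); auto.
    replace (r ^ n * (B * / r ^ n)) with B by (field; lra). auto. }
  assert (0 <= Cmod u ^ n) by (apply pow_le, Cmod_ge_0).
  replace (B * (Cmod u ^ n * / r ^ n)) with (Cmod u ^ n * (B * / r ^ n)) by ring.
  apply Rmult_le_compat_l; auto.
Qed.

Lemma poly_bounded (f : C -> C) (R0 : R) : ispoly f ->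
  exists B, 0 <= B /\ forall u, Cmod u <= R0 -> Cmod (f u) <= B.
Proof.
  intros [p Hp].
  assert (H : exists B, 0 <= B /\ forall u, Cmod u <= R0 -> Cmod (peval p u) <= B).
  { clear Hp. induction p as [|c p [B [HB0 HB]]].
    - exists 0. split; [lra|]. intros u _. simpl. rewrite Cmod_0. lra.
    - exists (Cmod c + Rmax R0 0 * B). assert (H1 := Cmod_ge_0 c). assert (H2 := Rmax_r R0 0).
      split; [nra|]. intros u Hu. simpl.
      eapply Rle_trans; [apply Cmod_triangle|]. rewrite Cmod_mult.
      apply Rplus_le_compat_l. apply Rmult_le_compat; auto using Cmod_ge_0.
      eapply Rle_trans; [apply Hu|apply Rmax_l]. }
  destruct H as [B [HB0 HB]]. exists B. split; auto. intros u Hu. rewrite Hp. auto.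
Qed.

(** Stands in for holomorphy in the variable [phi]: such limits inherit the maximum principle of
    polynomials. With [phi] = [qpar] on a half-plane it expresses that g is 1-periodic and extends
    to the closed q-disc, continuously and holomorphically inside. *)
Definition approx (D : C -> Prop) (phi g : C -> C) : Prop :=
  forall eps, 0 < eps -> exists P, ispoly P /\ forall z, D z -> Cmod (g z - P (phi z)) <= eps.

Definition bounded_on (D : C -> Prop) (g : C -> C) : Prop :=
  exists B, 0 <= B /\ forall z, D z -> Cmod (g z) <= B.

Lemma approx_ext (D : C -> Prop) (phi g h : C -> C) :
  (forall z, D z -> g z = h z) -> approx D phi g -> approx D phi h.
Proof.
  intros E H eps He. destruct (H eps He) as [P [HP HP1]]. exists P. split; auto.
  intros z Hz. rewrite <- E; auto.
Qed.

Lemma approx_poly (D : C -> Prop) (phi P : C -> C) : ispoly P -> approx D phi (fun z => P (phi z)).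
Proof.
  intros HP eps He. exists P. split; auto. intros z _.
  replace (P (phi z) - P (phi z))%C with (RtoC 0) by ring. rewrite Cmod_0. lra.
Qed.

Lemma approx_const (D : C -> Prop) (phi : C -> C) (c : C) : approx D phi (fun _ => c).
Proof. apply (approx_poly D phi (fun _ => c)), ispoly_const. Qed.

Lemma approx_gen (D : C -> Prop) (phi : C -> C) : approx D phi phi.
Proof. apply (approx_poly D phi (fun u => u)), ispoly_id. Qed.

Lemma approx_lim (D : C -> Prop) (phi g : C -> C) :
  (forall eps, 0 < eps -> exists h, approx D phi h /\ forall z, D z -> Cmod (g z - h z) <= eps) ->
  approx D phi g.
Proof.
  intros H eps He. destruct (H (eps / 2) ltac:(lra)) as [h [Hh Hgh]].
  destruct (Hh (eps / 2) ltac:(lra)) as [P [HP HhP]]. exists P. split; auto.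
  intros z Hz. replace (g z - P (phi z))%C with ((g z - h z) + (h z - P (phi z)))%C by ring.
  eapply Rle_trans; [apply Cmod_triangle|]. specialize (Hgh z Hz). specialize (HhP z Hz). lra.
Qed.

Lemma approx_sub (D D' : C -> Prop) (phi g : C -> C) :
  (forall z, D' z -> D z) -> approx D phi g -> approx D' phi g.
Proof.
  intros E H eps He. destruct (H eps He) as [P [HP HP1]]. exists P. split; auto.
Qed.

Lemma approx_plus (D : C -> Prop) (phi g h : C -> C) :
  approx D phi g -> approx D phi h -> approx D phi (fun z => g z + h z)%C.
Proof.
  intros Hg Hh eps He. destruct (Hg (eps / 2) ltac:(lra)) as [P [HP HP1]].
  destruct (Hh (eps / 2) ltac:(lra)) as [Q [HQ HQ1]].
  exists (fun u => P u + Q u)%C. split; [apply ispoly_plus; auto|]. intros z Hz.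
  replace (g z + h z - (P (phi z) + Q (phi z)))%C
    with ((g z - P (phi z)) + (h z - Q (phi z)))%C by ring.
  eapply Rle_trans; [apply Cmod_triangle|]. specialize (HP1 z Hz). specialize (HQ1 z Hz). lra.
Qed.

Lemma approx_bounded (D : C -> Prop) (phi g : C -> C) :
  bounded_on D phi -> approx D phi g -> bounded_on D g.
Proof.
  intros [R0 [HR0 HR]] Hg. destruct (Hg 1 ltac:(lra)) as [P [HP HP1]].
  destruct (poly_bounded P R0 HP) as [B [HB0 HB]]. exists (B + 1). split; [lra|].
  intros z Hz. replace (g z) with ((g z - P (phi z)) + P (phi z))%C by ring.
  eapply Rle_trans; [apply Cmod_triangle|].
  specialize (HP1 z Hz). specialize (HB _ (HR z Hz)). lra.
Qed.

Lemma approx_mult (D : C -> Prop) (phi g h : C -> C) : bounded_on D phi ->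
  approx D phi g -> approx D phi h -> approx D phi (fun z => g z * h z)%C.
Proof.
  intros Hphi Hg Hh eps He.
  destruct (approx_bounded _ _ _ Hphi Hg) as [Bg [HBg0 HBg]].
  destruct (approx_bounded _ _ _ Hphi Hh) as [Bh [HBh0 HBh]].
  set (e1 := Rmin 1 (eps / (Bg + Bh + 1))).
  assert (Hq : 0 < eps / (Bg + Bh + 1)) by (apply Rdiv_lt_0_compat; lra).
  assert (He1 : 0 < e1) by (unfold e1; apply Rmin_pos; lra).
  destruct (Hg e1 He1) as [P [HP HP1]]. destruct (Hh e1 He1) as [Q [HQ HQ1]].
  exists (fun u => P u * Q u)%C. split; [apply ispoly_mult; auto|]. intros z Hz.
  specialize (HP1 z Hz). specialize (HQ1 z Hz). specialize (HBg z Hz). specialize (HBh z Hz).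
  set (a := (g z - P (phi z))%C) in *. set (b := (h z - Q (phi z))%C) in *.
  replace (g z * h z - P (phi z) * Q (phi z))%C with (g z * b + h z * a - a * b)%C
    by (unfold a, b; ring).
  eapply Rle_trans; [apply Cmod_sub_triangle|].
  eapply Rle_trans; [apply Rplus_le_compat_r, Cmod_triangle|]. rewrite !Cmod_mult.
  assert (E1 : e1 <= 1) by apply Rmin_l.
  assert (E2 : e1 * (Bg + Bh + 1) <= eps).
  { assert (e1 <= eps / (Bg + Bh + 1)) by apply Rmin_r.
    replace eps with (eps / (Bg + Bh + 1) * (Bg + Bh + 1)) by (field; lra).
    apply Rmult_le_compat_r; lra. }
  assert (Ga := Cmod_ge_0 a). assert (Gb := Cmod_ge_0 b).
  assert (Gg := Cmod_ge_0 (g z)). assert (Gh := Cmod_ge_0 (h z)).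
  assert (Cmod (g z) * Cmod b <= Bg * e1) by (apply Rmult_le_compat; auto).
  assert (Cmod (h z) * Cmod a <= Bh * e1) by (apply Rmult_le_compat; auto).
  assert (Cmod a * Cmod b <= e1 * 1) by (apply Rmult_le_compat; lra). lra.
Qed.

Lemma approx_scal (D : C -> Prop) (phi g : C -> C) (c : C) :
  bounded_on D phi -> approx D phi g -> approx D phi (fun z => c * g z)%C.
Proof. intros Hphi Hg. apply approx_mult; auto. apply approx_const. Qed.

Lemma approx_minus (D : C -> Prop) (phi g h : C -> C) : bounded_on D phi ->
  approx D phi g -> approx D phi h -> approx D phi (fun z => g z - h z)%C.
Proof.
  intros Hphi Hg Hh. apply approx_ext with (fun z => g z + (-(1)) * h z)%C.
  { intros; ring. }
  apply approx_plus; auto. apply approx_scal; auto.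
Qed.

Lemma approx_pow (D : C -> Prop) (phi g : C -> C) (n : nat) : bounded_on D phi ->
  approx D phi g -> approx D phi (fun z => g z ^ n)%C.
Proof.
  intros Hphi Hg. induction n as [|n IH]; [apply (approx_const D phi (RtoC 1))|].
  apply approx_ext with (fun z => g z * g z ^ n)%C; [reflexivity|]. apply approx_mult; auto.
Qed.

Lemma approx_csum (D : C -> Prop) (phi : C -> C) (g : nat -> C -> C) (n : nat) :
  (forall j, approx D phi (g j)) -> approx D phi (fun z => csum (fun j => g j z) n).
Proof.
  intros H. induction n as [|n IH]; simpl; [apply (approx_const D phi (RtoC 0))|].
  apply approx_plus; auto.
Qed.

Lemma approx_comp_poly (D : C -> Prop) (phi g P : C -> C) : bounded_on D phi ->
  ispoly P -> approx D phi g -> approx D phi (fun z => P (g z)).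
Proof.
  intros Hphi [p Hp] Hg. apply approx_ext with (fun z => peval p (g z)).
  { intros z _. rewrite Hp. reflexivity. }
  clear Hp. induction p as [|c p IH]; simpl; [apply (approx_const D phi (RtoC 0))|].
  apply approx_plus; [apply approx_const|]. apply approx_mult; auto.
Qed.

Lemma approx_comp (D D' : C -> Prop) (phi phi' g h : C -> C) : bounded_on D phi ->
  approx D' phi' h -> (forall z, D z -> D' (g z)) -> approx D phi (fun z => phi' (g z)) ->
  approx D phi (fun z => h (g z)).
Proof.
  intros Hphi Hh HD Hg. apply approx_lim. intros eps He.
  destruct (Hh eps He) as [P [HP HP1]]. exists (fun z => P (phi' (g z))). split.
  - apply (approx_comp_poly D phi (fun z => phi' (g z)) P); auto.
  - intros z Hz. auto.
Qed.

Lemma approx_series (D : C -> Prop) (phi g : C -> C) (a : nat -> C -> C) (M : nat -> R) :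
  (forall j, approx D phi (a j)) -> rsummable M -> (forall j, 0 <= M j) ->
  (forall z j, D z -> Cmod (a j z) <= M j) ->
  (forall z, D z -> clim (csum (fun j => a j z)) (g z)) -> approx D phi g.
Proof.
  intros Ha HM HM0 HaM Hg. apply approx_lim. intros eps He.
  destruct (rsummable_tail M HM0 HM eps He) as [N HN].
  exists (fun z => csum (fun j => a j z) N). split; [apply approx_csum; auto|].
  intros z Hz. apply clim_Cmod_le with (csum (fun j => a j z)); auto.
  exists N. intros n Hn. eapply Rle_trans; [apply Cmod_csum_tail with (M := M)|]; auto.
Qed.

Lemma pow_small (r eps : R) : 0 <= r < 1 -> 0 < eps ->
  exists N, forall n, (N <= n)%nat -> r ^ n < eps.
Proof.
  intros Hr He. destruct (pow_lt_1_zero r) with (y := eps) as [N HN]; auto.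
  { rewrite Rabs_right; lra. }
  exists N. intros n Hn. specialize (HN n Hn).
  rewrite Rabs_right in HN; auto. apply Rle_ge, pow_le; lra.
Qed.

Lemma geom_cv (x : C) : Cmod x < 1 -> clim (csum (fun j => x ^ j)%C) (/ (1 - x))%C.
Proof.
  intros Hx.
  assert (H1 : (1 - x)%C <> 0%C).
  { apply Cmod_neq_0. assert (H := Cmod_sub_ge 1 x). rewrite Cmod_1 in H. lra. }
  assert (Hp := Cmod_pos _ H1).
  apply clim_null with (b := fun n => / Cmod (1 - x) * Cmod x ^ n).
  - intros n.
    replace (csum (fun j => x ^ j) n - / (1 - x))%C with (/ (1 - x) * (- x ^ n))%C.
    + rewrite Cmod_mult, Cmod_opp, Cmod_pow, Cmod_inv by auto. lra.
    + replace (csum (fun j => x ^ j) n)%C with (/ (1 - x) * ((1 - x) * csum (fun j => x ^ j) n))%C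
        by (field; auto). rewrite csum_geom. field; auto.
  - intros eps He.
    destruct (pow_small (Cmod x) (eps * Cmod (1 - x))) as [N HN].
    + split; auto using Cmod_ge_0.
    + apply Rmult_lt_0_compat; auto.
    + exists N. intros n Hn. specialize (HN n Hn).
      apply Rmult_lt_reg_l with (Cmod (1 - x)); auto.
      rewrite <- Rmult_assoc, Rinv_r by lra. lra.
Qed.

(** Reciprocals enter the class only through this geometric series, so every denominator has to be
    brought to the form 1 - g with |g| <= r < 1. *)
Lemma approx_geom (D : C -> Prop) (phi g : C -> C) (r : R) : bounded_on D phi ->
  0 <= r < 1 -> approx D phi g -> (forall z, D z -> Cmod (g z) <= r) ->
  approx D phi (fun z => / (1 - g z))%C.
Proof.
  intros Hphi Hr Hg Hgr.
  apply approx_series with (a := fun j z => (g z ^ j)%C) (M := fun j => r ^ j).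
  - intros j. apply approx_pow; auto.
  - exists (/ (1 - r)). intros n. apply rsum_geom_le; auto.
  - intros j. apply pow_le; lra.
  - intros z j Hz. rewrite Cmod_pow. apply pow_incr. split; auto using Cmod_ge_0.
  - intros z Hz. apply geom_cv. specialize (Hgr z Hz). lra.
Qed.

Lemma Cpow_diff_bound (a b : C) (R0 : R) (n : nat) : Cmod a <= R0 -> Cmod b <= R0 ->
  Cmod (a ^ n - b ^ n) <= INR n * R0 ^ pred n * Cmod (a - b).
Proof.
  intros Ha Hb. assert (HR : 0 <= R0) by (eapply Rle_trans; [apply Cmod_ge_0|apply Ha]).
  induction n as [|n IH].
  - simpl. replace (1 - 1)%C with (RtoC 0) by ring. rewrite Cmod_0. lra.
  - rewrite !Cpow_S.
    replace (a * a ^ n - b * b ^ n)%C with (a * (a ^ n - b ^ n) + (a - b) * b ^ n)%C by ring.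
    eapply Rle_trans; [apply Cmod_triangle|]. rewrite !Cmod_mult, Cmod_pow, S_INR. simpl pred.
    assert (H0 := Cmod_ge_0 (a - b)).
    assert (Cmod b ^ n <= R0 ^ n) by (apply pow_incr; split; auto using Cmod_ge_0).
    assert (Cmod a * Cmod (a ^ n - b ^ n) <= R0 * (INR n * R0 ^ pred n * Cmod (a - b))).
    { apply Rmult_le_compat; auto using Cmod_ge_0. }
    assert (R0 * (INR n * R0 ^ pred n * Cmod (a - b)) = INR n * R0 ^ n * Cmod (a - b)).
    { destruct n; simpl; ring. }
    nra.
Qed.

(** The N-th power of exp(w/N) is compared with that of 1 + w/N. The explicit rate, uniform on
    discs, serves twice: it makes exponentials uniform limits of polynomials, and it transports
    binomial estimates to [Cexp]. *)
Lemma exp_limit_bound (w : C) (R0 : R) (N : nat) : Cmod w <= R0 -> 2 * R0 <= INR N ->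
  (0 < N)%nat ->
  Cmod (Cexp w - (1 + w * RtoC (/ INR N)) ^ N) <= exp R0 * (4 * (R0 * R0)) / INR N.
Proof.
  intros Hw HN HN0. assert (HNp : 0 < INR N) by (apply lt_0_INR; auto).
  assert (HR : 0 <= R0) by (eapply Rle_trans; [apply Cmod_ge_0|apply Hw]).
  set (v := (w * RtoC (/ INR N))%C).
  assert (Hv : Cmod v = Cmod w / INR N).
  { unfold v. rewrite Cmod_mult, Cmod_R, Rabs_right; auto. left. apply Rinv_0_lt_compat; auto. }
  assert (Hv1 : Cmod v <= R0 / INR N).
  { rewrite Hv. apply Rmult_le_compat_r; auto. left. apply Rinv_0_lt_compat; auto. }
  assert (Hv2 : R0 / INR N <= 1 / 2).
  { apply Rmult_le_reg_r with (INR N); auto. unfold Rdiv. rewrite Rmult_assoc, Rinv_l; lra. }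
  assert (E : Cexp w = (Cexp v ^ N)%C).
  { rewrite <- Cexp_nat. f_equal. unfold v.
    replace (RtoC (INR N) * (w * RtoC (/ INR N)))%C with (w * (RtoC (INR N) * RtoC (/ INR N)))%C by ring.
    rewrite <- RtoC_mult, Rinv_r by lra. ring. }
  rewrite E.
  assert (Hexp : forall x, 0 <= x -> 1 + x <= exp x) by (intros; apply exp_ineq1_le).
  assert (B1 : Cmod (Cexp v) <= exp (R0 / INR N)).
  { rewrite Cmod_Cexp. assert (Re v <= R0 / INR N).
    { eapply Rle_trans; [apply Rle_abs|]. eapply Rle_trans; [apply Cmod_Re_le|auto]. }
    destruct H as [H|H]; [left; apply exp_increasing; auto|rewrite H; lra]. }
  assert (B2 : Cmod (1 + v) <= exp (R0 / INR N)).
  { eapply Rle_trans; [apply Cmod_triangle|]. rewrite Cmod_1.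
    eapply Rle_trans; [|apply Hexp]; [lra|].
    apply Rmult_le_pos; auto. left. apply Rinv_0_lt_compat; auto. }
  eapply Rle_trans; [apply (Cpow_diff_bound _ _ _ N B1 B2)|].
  assert (B3 : Cmod (Cexp v - (1 + v)) <= 4 * (R0 / INR N * (R0 / INR N))).
  { replace (Cexp v - (1 + v))%C with (Cexp v - 1 - v)%C by ring.
    eapply Rle_trans; [apply Cexp_quad_bound; lra|].
    assert (0 <= Cmod v) by apply Cmod_ge_0. nra. }
  assert (B4 : exp (R0 / INR N) ^ pred N <= exp R0).
  { assert (Hq : 0 <= R0 / INR N) by (assert (0 <= Cmod v) by apply Cmod_ge_0; lra).
    assert (G : forall n, exp (R0 / INR N) ^ n = exp (INR n * (R0 / INR N))).
    { induction n as [|n IH]; [simpl; rewrite Rmult_0_l, exp_0; auto|].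
      rewrite S_INR. simpl. rewrite IH, <- exp_plus. f_equal. ring. }
    rewrite G. assert (INR (pred N) * (R0 / INR N) <= R0).
    { assert (INR (pred N) <= INR N) by (apply le_INR; lia).
      apply Rle_trans with (INR N * (R0 / INR N)).
      - apply Rmult_le_compat_r; auto.
      - right. field. lra. }
    destruct H as [H|H]; [left; apply exp_increasing; auto|rewrite H; lra]. }
  apply Rle_trans with (INR N * exp R0 * (4 * (R0 / INR N * (R0 / INR N)))).
  - apply Rmult_le_compat; auto using Cmod_ge_0.
    + apply Rmult_le_pos; [lra|]. apply pow_le. left. apply exp_pos.
    + apply Rmult_le_compat_l; [lra|auto].
  - right. field. lra.
Qed.

Lemma approx_exp (D : C -> Prop) (phi g : C -> C) : bounded_on D phi ->
  approx D phi g -> approx D phi (fun z => Cexp (g z)).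
Proof.
  intros Hphi Hg. destruct (approx_bounded _ _ _ Hphi Hg) as [B [HB0 HB]].
  apply approx_lim. intros eps He.
  destruct (inv_INR_small (exp B * (4 * (B * B))) eps He) as [N1 HN1].
  destruct (INR_unbounded (2 * B)) as [N2 HN2].
  set (N := S (Nat.max N1 N2)).
  exists (fun z => (1 + g z * RtoC (/ INR N)) ^ N)%C. split.
  - apply approx_pow; auto. apply approx_plus; [apply approx_const|].
    apply approx_mult; auto. apply approx_const.
  - intros z Hz. left. eapply Rle_lt_trans.
    + apply exp_limit_bound with (R0 := B); auto.
      * left. eapply Rlt_le_trans; [apply HN2|]. apply le_INR. lia.
      * unfold N. lia.
    + apply HN1. lia.
Qed.

(** D need not have a boundary: it is enough that [phi] takes every value of the circle |u| = r at
    some point of D where g is bounded by B. *)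
Lemma approx_maxmod (D : C -> Prop) (phi g : C -> C) (r B : R) : 0 < r ->
  approx D phi g ->
  (forall t, exists z, D z /\ phi z = (RtoC r * Cexp (Ci * RtoC t))%C /\ Cmod (g z) <= B) ->
  forall z, D z -> Cmod (phi z) < r -> Cmod (g z) <= B.
Proof.
  intros Hr Hg Hc z Hz Hzr. apply le_of_forall_eps with (K := 2); [lra|]. intros eps He.
  destruct (Hg eps He) as [P [HP HP1]].
  assert (H : Cmod (P (phi z)) <= B + eps).
  { apply poly_maxmod with r; auto. intros t. destruct (Hc t) as [z' [Hz' [E HB]]].
    rewrite <- E. replace (P (phi z')) with (g z' - (g z' - P (phi z')))%C by ring.
    eapply Rle_trans; [apply Cmod_sub_triangle|]. specialize (HP1 z' Hz'). lra. }
  replace (g z) with ((g z - P (phi z)) + P (phi z))%C by ring.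
  eapply Rle_trans; [apply Cmod_triangle|]. specialize (HP1 z Hz). lra.
Qed.

Lemma ispoly_split (P : C -> C) : ispoly P ->
  exists c Q, ispoly Q /\ forall u, (P u = c + u * Q u)%C.
Proof.
  intros [[|c p] Hp].
  - exists (RtoC 0), (fun _ => RtoC 0). split; [apply ispoly_const|].
    intros u. rewrite Hp. simpl. ring.
  - exists c, (peval p). split; [exists p; auto|]. intros u. rewrite Hp. reflexivity.
Qed.

(* Schwarz's lemma with an approximate constant term, so that no point with phi = 0 is needed. *)
Lemma approx_schwarz (D : C -> Prop) (phi g : C -> C) (r eps : R) : 0 < r -> 0 < eps ->
  approx D phi g ->
  exists c, (forall z, D z -> phi z = 0%C -> Cmod (g z - c) <= eps) /\
    forall B, (forall t, exists z, D z /\ phi z = (RtoC r * Cexp (Ci * RtoC t))%C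
                                   /\ Cmod (g z - c) <= B) ->
    forall z, D z -> Cmod (phi z) < r -> Cmod (g z - c) <= B * (Cmod (phi z) / r) + 2 * eps.
Proof.
  intros Hr He Hg. destruct (Hg eps He) as [P [HP HP1]].
  destruct (ispoly_split P HP) as [c [Q [HQ E]]]. exists c. split.
  { intros z Hz Hz0. specialize (HP1 z Hz). rewrite E, Hz0 in HP1.
    replace (c + 0 * Q 0)%C with c in HP1 by ring. auto. }
  intros B HB z Hz Hzr.
  assert (H : Cmod (P (phi z) - c) <= (B + eps) * (Cmod (phi z) / r) ^ 1).
  { apply (poly_schwarz (fun u => P u - c)%C Q); auto.
    - intros u. rewrite E. simpl. ring.
    - intros t. destruct (HB t) as [z' [Hz' [E' HB']]]. rewrite <- E'.
      replace (P (phi z') - c)%C with ((g z' - c) - (g z' - P (phi z')))%C by ring.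
      eapply Rle_trans; [apply Cmod_sub_triangle|]. specialize (HP1 z' Hz'). lra. }
  rewrite pow_1 in H.
  replace (g z - c)%C with ((g z - P (phi z)) + (P (phi z) - c))%C by ring.
  eapply Rle_trans; [apply Cmod_triangle|]. specialize (HP1 z Hz).
  assert (0 <= Cmod (phi z) / r <= 1).
  { split.
    - apply Rmult_le_pos; [apply Cmod_ge_0|left; apply Rinv_0_lt_compat; auto].
    - apply Rmult_le_reg_r with r; auto. unfold Rdiv. rewrite Rmult_assoc, Rinv_l; lra. }
  nra.
Qed.

Lemma disc_bounded (r : R) : 0 <= r -> bounded_on (fun w => Cmod w <= r) (fun w => w).
Proof. intros Hr. exists r. split; auto. Qed.

(** 2 B bounds g - g(0). As 0 belongs to the disc, the approximate constant term of [approx_schwarz]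
    is within eps of g(0). *)
Lemma disc_schwarz (g : C -> C) (r B : R) (w : C) : 0 < r ->
  approx (fun w => Cmod w <= r) (fun w => w) g ->
  (forall w, Cmod w <= r -> Cmod (g w) <= B) -> Cmod w < r ->
  Cmod (g w - g 0%C) <= 2 * B * (Cmod w / r).
Proof.
  intros Hr Hg HB Hw.
  assert (Hw0 : 0 <= Cmod w / r <= 1).
  { split.
    - apply Rmult_le_pos; [apply Cmod_ge_0|left; apply Rinv_0_lt_compat; auto].
    - apply Rmult_le_reg_r with r; auto. unfold Rdiv. rewrite Rmult_assoc, Rinv_l; lra. }
  apply le_of_forall_eps with (K := 4); [lra|]. intros eps He.
  destruct (approx_schwarz _ _ g r eps Hr He Hg) as [c [Hc0 Hc]].
  assert (H00 : Cmod 0 <= r) by (rewrite Cmod_0; lra).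
  specialize (Hc0 0%C H00 eq_refl).
  assert (H := Hc (2 * B + eps)).
  assert (H1 : Cmod (g w - c) <= (2 * B + eps) * (Cmod w / r) + 2 * eps).
  { apply H; auto; [|lra]. intros t. exists (RtoC r * Cexp (Ci * RtoC t))%C.
    assert (Hm : Cmod (RtoC r * Cexp (Ci * RtoC t)) <= r).
    { rewrite Cmod_mult, Cmod_Cexp_i, Cmod_R, Rabs_right; lra. }
    repeat split; auto.
    replace (g (RtoC r * Cexp (Ci * RtoC t)) - c)%C
      with (g (RtoC r * Cexp (Ci * RtoC t)) - g 0 + (g 0 - c))%C by ring.
    eapply Rle_trans; [apply Cmod_triangle|].
    assert (H2 := Cmod_sub_triangle (g (RtoC r * Cexp (Ci * RtoC t))%C) (g 0%C)).
    assert (H3 := HB _ Hm). assert (H4 := HB 0%C H00). lra. }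
  replace (g w - g 0)%C with ((g w - c) - (g 0 - c))%C by ring.
  eapply Rle_trans; [apply Cmod_sub_triangle|]. nra.
Qed.

(** * Partial fractions of the cotangent and of its derivative *)

(** [sn] and [cn] are 2i sin(pi w) and 2 cos(pi w); that w is not an integer is expressed below as
    [sn w <> 0]. *)
Definition sn (w : C) : C := (Cexp (RtoC PI * Ci * w) - Cexp (- (RtoC PI * Ci * w)))%C.
Definition cn (w : C) : C := (Cexp (RtoC PI * Ci * w) + Cexp (- (RtoC PI * Ci * w)))%C.

Lemma Cexp_PIi2 : Cexp (RtoC PI * Ci * RtoC (/2)) = Ci.
Proof.
  unfold Cexp. simpl.
  replace ((PI * 0 - 0 * 1) * / 2 - (PI * 1 + 0 * 0) * 0) with 0 by ring.
  replace ((PI * 0 - 0 * 1) * 0 + (PI * 1 + 0 * 0) * / 2) with (PI / 2) by field.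
  rewrite exp_0, cos_PI2, sin_PI2. apply injective_projections; simpl; ring.
Qed.

Lemma Ci2 : (Ci * Ci = -(1))%C.
Proof. apply injective_projections; simpl; ring. Qed.

Lemma Ci_neq_0 : Ci <> 0%C.
Proof. intros E. apply (f_equal snd) in E. simpl in E. lra. Qed.

Lemma C2_neq_0 : RtoC 2 <> 0%C.
Proof. intros H; apply (f_equal fst) in H; simpl in H; lra. Qed.

(** Everything becomes a rational function of A = exp(pi i w/2), which reduces the duplication
    formulas to field identities. *)
Lemma half_shift_exp (w : C) :
  let A := Cexp (RtoC PI * Ci * (w / 2))%C in
  sn w = (A * A - / (A * A))%C /\ cn w = (A * A + / (A * A))%C /\
  sn (w / 2) = (A - / A)%C /\ cn (w / 2) = (A + / A)%C /\
  sn ((w - 1) / 2) = (- Ci * (A + / A))%C /\ cn ((w - 1) / 2) = (- Ci * (A - / A))%C.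
Proof.
  intros A. assert (HA : A <> 0%C) by apply Cexp_neq_0.
  assert (E1 : Cexp (RtoC PI * Ci * w) = (A * A)%C).
  { unfold A. rewrite <- Cexp_plus. f_equal. field. }
  assert (E3 : Cexp (RtoC PI * Ci * ((w - 1) / 2)) = (A * / Ci)%C).
  { unfold A. rewrite <- Cexp_PIi2 at 3. rewrite <- Cexp_opp, <- Cexp_plus. f_equal.
    rewrite RtoC_inv by lra. field. }
  assert (HCi := Ci_neq_0).
  assert (ECi : (/ Ci = - Ci)%C).
  { replace (/ Ci)%C with (/ Ci * (- (Ci * Ci)))%C by (rewrite Ci2; ring). field. auto. }
  unfold sn, cn. rewrite !Cexp_opp, E1, E3. fold A.
  repeat split.
  - replace (/ (A * / Ci))%C with (Ci * / A)%C by (field; auto). rewrite ECi. ring.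
  - replace (/ (A * / Ci))%C with (Ci * / A)%C by (field; auto). rewrite ECi. ring.
Qed.

Lemma sn_shift1 (w : C) : sn (w + 1) = (- sn w)%C /\ cn (w + 1) = (- cn w)%C.
Proof.
  assert (E : Cexp (RtoC PI * Ci * (w + 1)) = (- Cexp (RtoC PI * Ci * w))%C).
  { replace (RtoC PI * Ci * (w + 1))%C
      with (RtoC PI * Ci * w + (RtoC PI * Ci * RtoC (/2) + RtoC PI * Ci * RtoC (/2)))%C.
    - rewrite !Cexp_plus, Cexp_PIi2, Ci2. ring.
    - rewrite RtoC_inv by lra. field. }
  assert (H := Cexp_neq_0 (RtoC PI * Ci * w)).
  unfold sn, cn. rewrite !Cexp_opp, E. split; field; auto.
Qed.

(* The two functions expanded below, with the normalisations 1/w^2 and 1/w at the origin. *)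
Definition csc2 (w : C) : C := (RtoC (-4 * (PI * PI)) / (sn w * sn w))%C.
Definition ct (w : C) : C := (RtoC PI * Ci * cn w / sn w)%C.

Lemma nonint_half (w : C) : sn w <> 0%C ->
  sn (w / 2) <> 0%C /\ sn ((w - 1) / 2) <> 0%C /\ sn ((w + 1) / 2) <> 0%C.
Proof.
  intros H. destruct (half_shift_exp w) as [E1 [E2 [E3 [E4 [E5 E6]]]]].
  set (A := Cexp (RtoC PI * Ci * (w / 2))%C) in *.
  assert (HA : A <> 0%C) by apply Cexp_neq_0.
  assert (Ef : sn w = ((A - / A) * (A + / A))%C) by (rewrite E1; field; auto).
  assert (H1 : (A - / A)%C <> 0%C) by (intros E; apply H; rewrite Ef, E; ring).
  assert (H2 : (A + / A)%C <> 0%C) by (intros E; apply H; rewrite Ef, E; ring).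
  assert (H3 : sn ((w - 1) / 2) <> 0%C).
  { rewrite E5. apply Cmult_neq_0; auto. intros E. apply Ci_neq_0.
    replace Ci with (- - Ci)%C by ring. rewrite E. ring. }
  repeat split; auto.
  - rewrite E3; auto.
  - replace ((w + 1) / 2)%C with ((w - 1) / 2 + 1)%C by (field; apply C2_neq_0).
    rewrite (proj1 (sn_shift1 _)). intros E. apply H3.
    replace (sn ((w - 1) / 2)) with (- - sn ((w - 1) / 2))%C by ring. rewrite E. ring.
Qed.

Lemma nonint_shift (w : C) : sn w <> 0%C -> forall n, sn (w + RtoC (INR n)) <> 0%C /\ sn (w - RtoC (INR n)) <> 0%C.
Proof.
  intros H n. induction n as [|n [IH1 IH2]].
  - simpl. replace (w + 0)%C with w by ring. replace (w - 0)%C with w by ring. auto.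
  - rewrite S_INR, RtoC_plus. split.
    + replace (w + (RtoC (INR n) + 1))%C with (w + RtoC (INR n) + 1)%C by ring.
      rewrite (proj1 (sn_shift1 _)). intros E. apply IH1.
      replace (sn (w + RtoC (INR n))) with (- - sn (w + RtoC (INR n)))%C by ring. rewrite E. ring.
    + intros E. apply IH2.
      replace (w - RtoC (INR n))%C with (w - (RtoC (INR n) + 1) + 1)%C by ring.
      rewrite (proj1 (sn_shift1 _)), E. ring.
Qed.

(** The functional equation of the Herglotz trick: duplication together with period 1. The factor
    [kappa] is 1/4 for a double pole and 1/2 for a simple one, so that the principal part at 0 is
    preserved. *)
Definition doubling (kappa : R) (F : C -> C) : Prop :=
  forall w, sn w <> 0%C ->
    F w = (RtoC kappa * (F (w / 2) + F ((w - 1) / 2)))%C /\ F (w + 1)%C = F w.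

Lemma csc2_doubling : doubling (/ 4) csc2.
Proof.
  intros w H. split.
  - destruct (half_shift_exp w) as [E1 [E2 [E3 [E4 [E5 E6]]]]].
    assert (Hh := nonint_half w H). destruct Hh as [H1 [H2 _]].
    unfold csc2. rewrite E1, E3, E5 in *.
    set (A := Cexp (RtoC PI * Ci * (w / 2))%C) in *.
    assert (HA : A <> 0%C) by apply Cexp_neq_0.
    replace (- Ci * (A + / A) * (- Ci * (A + / A)))%C with ((Ci * Ci) * ((A + / A) * (A + / A)))%C by ring.
    rewrite Ci2.
    assert (G1 : (A * A - 1)%C <> 0%C).
    { intros E. apply H1. replace (A - / A)%C with ((A * A - 1) / A)%C by (field; auto).
      rewrite E. unfold Cdiv. ring. }
    assert (G2 : (A * A + 1)%C <> 0%C).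
    { intros E. apply H2. replace (A + / A)%C with ((A * A + 1) / A)%C by (field; auto).
      rewrite E. unfold Cdiv. ring. }
    assert (G3 : (A * A * (A * A) - 1)%C <> 0%C).
    { replace (A * A * (A * A) - 1)%C with ((A * A - 1) * (A * A + 1))%C by ring.
      apply Cmult_neq_0; auto. }
    rewrite RtoC_inv by lra.
    field. repeat split; auto.
  - unfold csc2. rewrite (proj1 (sn_shift1 w)).
    replace (- sn w * - sn w)%C with (sn w * sn w)%C by ring. reflexivity.
Qed.

Lemma ct_doubling : doubling (/ 2) ct.
Proof.
  intros w H. split.
  - destruct (half_shift_exp w) as [E1 [E2 [E3 [E4 [E5 E6]]]]].
    assert (Hh := nonint_half w H). destruct Hh as [H1 [H2 _]].
    unfold ct. rewrite E1, E2, E3, E4, E5, E6 in *.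
    set (A := Cexp (RtoC PI * Ci * (w / 2))%C) in *.
    assert (HA : A <> 0%C) by apply Cexp_neq_0.
    assert (G1 : (A * A - 1)%C <> 0%C).
    { intros E. apply H1. replace (A - / A)%C with ((A * A - 1) / A)%C by (field; auto).
      rewrite E. unfold Cdiv. ring. }
    assert (G2 : (A * A + 1)%C <> 0%C).
    { intros E. apply H2. replace (A + / A)%C with ((A * A + 1) / A)%C by (field; auto).
      rewrite E. unfold Cdiv. ring. }
    assert (G3 : (A * A * (A * A) - 1)%C <> 0%C).
    { replace (A * A * (A * A) - 1)%C with ((A * A - 1) * (A * A + 1))%C by ring.
      apply Cmult_neq_0; auto. }
    assert (HCi := Ci_neq_0).
    rewrite RtoC_inv by lra. field. repeat split; auto.

  - unfold ct. destruct (sn_shift1 w) as [-> ->]. field. auto.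
Qed.

Lemma csum_rev (u : nat -> C) (n : nat) : csum (fun j => u (n - 1 - j)%nat) n = csum u n.
Proof.
  induction n as [|n IH]; [reflexivity|].
  rewrite csum_S_l. simpl csum. replace (S n - 1 - 0)%nat with n by lia.
  rewrite Cplus_comm. f_equal. rewrite <- IH. apply csum_ext. intros j Hj. f_equal. lia.
Qed.

(** After r + 1 halvings the arguments are (w + n)/2^(r+1) with -2^r <= n < 2^r, where n = j is
    paired with n = -1 - j. As r grows, the term of a fixed n tends to the polar part at -n, so the
    partial fraction expansion is the limit of these finite sums. *)
Lemma doubling_iter (kappa : R) (F : C -> C) (w : C) : doubling kappa F -> sn w <> 0%C ->
  forall r, F w = csum (fun j =>
      RtoC (kappa ^ S r) * (F ((w + RtoC (INR j)) / RtoC (2 ^ S r))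
        + F ((w - 1 - RtoC (INR j)) / RtoC (2 ^ S r))))%C (2 ^ r).
Proof.
  intros HF Hw r.
  assert (H2 := C2_neq_0).
  assert (HP : forall r, RtoC (2 ^ r) <> 0%C).
  { intros n E. apply (f_equal fst) in E. simpl in E. assert (0 < 2 ^ n) by (apply pow_lt; lra). lra. }
  assert (HN : forall r j, (j < 2 ^ r)%nat -> sn ((w + RtoC (INR j)) / RtoC (2 ^ r)) <> 0%C /\
     sn ((w - 1 - RtoC (INR j)) / RtoC (2 ^ r)) <> 0%C).
  { assert (G : forall r v, sn v <> 0%C ->
       forall j, sn ((v + RtoC (INR j)) / RtoC (2 ^ r)) <> 0%C /\ sn ((v - RtoC (INR j)) / RtoC (2 ^ r)) <> 0%C).
    { intros n. induction n as [|n IH]; intros v Hv j.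
      - simpl. replace ((v + RtoC (INR j)) / 1)%C with (v + RtoC (INR j))%C by field.
        replace ((v - RtoC (INR j)) / 1)%C with (v - RtoC (INR j))%C by field.
        apply nonint_shift; auto.
      - destruct (nonint_shift v Hv j) as [A1 A2].
        destruct (nonint_half _ A1) as [B1 _]. destruct (nonint_half _ A2) as [B2 _].
        destruct (IH _ B1 0%nat) as [C1 _]. destruct (IH _ B2 0%nat) as [C2 _].
        simpl INR in C1, C2.
        replace ((v + RtoC (INR j)) / RtoC (2 ^ S n))%C with (((v + RtoC (INR j)) / 2 + 0) / RtoC (2 ^ n))%C.
        2:{ simpl pow. rewrite RtoC_mult. specialize (HP n). field. auto. }
        replace ((v - RtoC (INR j)) / RtoC (2 ^ S n))%C with (((v - RtoC (INR j)) / 2 + 0) / RtoC (2 ^ n))%C.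
        2:{ simpl pow. rewrite RtoC_mult. specialize (HP n). field. auto. }
        auto. }
    intros n j _. split; [exact (proj1 (G n w Hw j))|].
    replace (w - 1 - RtoC (INR j))%C with (w - RtoC (INR (S j)))%C by (rewrite S_INR, RtoC_plus; ring).
    apply G; auto. }
  induction r as [|r IH].
  - simpl. replace ((w + 0) / (2 * 1))%C with (w / 2)%C by (field; auto).
    rewrite !Rmult_1_r, Cplus_0_l. destruct (HF w Hw) as [E _]. rewrite E. f_equal. f_equal; f_equal;
    field; auto.
  - rewrite IH.
    replace (2 ^ S r)%nat with (2 ^ r + 2 ^ r)%nat by (simpl; lia).
    (* The new indices j and 2^(r+1) - 1 - j both arise from the old index j, so the upper half of
       the new range is summed backwards. *)
    match goal with |- _ = csum ?u _ =>
      rewrite (csum_add u), <- (csum_rev (fun j => u (2 ^ r + j)%nat)), <- csum_plus end.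
    apply csum_ext. intros j Hj.
    assert (Hpr : (2 ^ r + (2 ^ r - 1 - j))%nat = (2 ^ S r - 1 - j)%nat) by (simpl; lia).
    rewrite Hpr.
    assert (EI : RtoC (INR (2 ^ S r - 1 - j)) = (RtoC (2 ^ S r) - 1 - RtoC (INR j))%C).
    { rewrite !minus_INR, pow_INR by (simpl; lia).
      replace (INR 2) with 2 by (simpl; lra). replace (INR 1) with 1 by reflexivity.
      rewrite !RtoC_minus. reflexivity. }
    rewrite EI.
    destruct (HN (S r) j) as [N1 N2]; [simpl; lia|].
    destruct (HF _ N1) as [E1 _]. destruct (HF _ N2) as [E2 _].
    rewrite E1, E2.
    assert (Hp1 := HP (S r)).
    assert (EP : RtoC (2 ^ S (S r)) = (2 * RtoC (2 ^ S r))%C) by (rewrite <- RtoC_mult; reflexivity).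
    assert (EK : RtoC (kappa ^ S (S r)) = (RtoC kappa * RtoC (kappa ^ S r))%C) by (rewrite <- RtoC_mult; reflexivity).
    rewrite EP, EK.
    set (Q := RtoC (2 ^ S r)) in *. set (J := RtoC (INR j)).
    (* Period 1 is used here: the second half of (w - 1 - j)/Q leaves the range on the left and is
       moved back by 1. *)
    assert (EF : F (((w - 1 - J) / Q - 1) / 2)%C = F ((w + (Q - 1 - J)) / (2 * Q))%C).
    { destruct (nonint_half _ N2) as [_ [M2 _]].
      destruct (HF _ M2) as [_ E3]. fold J in E3. rewrite <- E3. f_equal. field; auto. }
    rewrite EF.
    replace ((w + J) / Q / 2)%C with ((w + J) / (2 * Q))%C by (field; auto).
    replace (((w + J) / Q - 1) / 2)%C with ((w - 1 - (Q - 1 - J)) / (2 * Q))%C by (field; auto).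
    replace ((w - 1 - J) / Q / 2)%C with ((w - 1 - J) / (2 * Q))%C by (field; auto).
    ring.
Qed.

Lemma clim_mult (u v : nat -> C) (l l' : C) :
  clim u l -> clim v l' -> clim (fun n => u n * v n)%C (l * l')%C.
Proof.
  intros H H'.
  assert (H0 : clim (fun n => (u n - l) * (v n - l'))%C (RtoC 0)).
  { intros eps He. destruct (H (Rmin 1 eps)) as [N HN]; [apply Rmin_pos; lra|].
    destruct (H' 1) as [N' HN']; [lra|].
    exists (Nat.max N N'). intros n Hn.
    replace ((u n - l) * (v n - l') - 0)%C with ((u n - l) * (v n - l'))%C by ring.
    rewrite Cmod_mult. specialize (HN n ltac:(lia)). specialize (HN' n ltac:(lia)).
    assert (Rmin 1 eps <= eps) by apply Rmin_r.
    assert (A := Cmod_ge_0 (u n - l)). assert (A' := Cmod_ge_0 (v n - l')).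
    apply Rle_lt_trans with (Cmod (u n - l) * 1); [apply Rmult_le_compat_l; lra|lra]. }
  assert (H1 := clim_plus _ _ _ _ H0 (clim_plus _ _ _ _ (clim_scal l _ _ H') (clim_scal l' _ _ H))).
  assert (H2 := clim_minus _ _ _ _ H1 (clim_const (l * l')%C)).
  replace (l * l')%C with (0 + (l * l' + l' * l) - l * l')%C by ring.
  apply clim_ext with (2 := H2). intros n. simpl. ring.
Qed.

Lemma clim_inv (u : nat -> C) (l : C) : l <> 0%C -> clim u l -> clim (fun n => / u n)%C (/ l)%C.
Proof.
  intros Hl H eps He. assert (Hp := Cmod_pos _ Hl).
  destruct (H (Rmin (Cmod l / 2) (eps * (Cmod l * Cmod l) / 2))) as [N HN].
  { apply Rmin_pos; [lra|]. assert (0 < Cmod l * Cmod l) by nra.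
    assert (0 < eps * (Cmod l * Cmod l)) by nra. lra. }
  exists N. intros n Hn. specialize (HN n Hn).
  assert (A1 := Rmin_l (Cmod l / 2) (eps * (Cmod l * Cmod l) / 2)).
  assert (A2 := Rmin_r (Cmod l / 2) (eps * (Cmod l * Cmod l) / 2)).
  assert (Hu : Cmod l / 2 < Cmod (u n)).
  { assert (T := Cmod_sub_ge l (l - u n)). replace (l - (l - u n))%C with (u n) in T by ring.
    rewrite Cmod_sub_comm in HN. lra. }
  assert (Hu0 : u n <> 0%C) by (apply Cmod_neq_0; lra).
  replace (/ u n - / l)%C with (- (u n - l) * / (u n * l))%C by (field; auto).
  rewrite Cmod_mult, Cmod_opp, Cmod_inv, Cmod_mult by (apply Cmult_neq_0; auto).
  assert (Hul : Cmod l * Cmod l / 2 < Cmod (u n) * Cmod l) by nra.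
  apply Rmult_lt_reg_r with (Cmod (u n) * Cmod l); [nra|].
  rewrite Rmult_assoc, Rinv_l by nra. nra.
Qed.

(** From t cos t <= sin t at t = x/2 follows sin x >= x cos^2(x/2) = x (1 + cos x)/2, and cos x >=
    -3/4 on the range. *)
Lemma sin_lower (x : R) : Rabs x <= 3 * PI / 4 -> Rabs x / 8 <= Rabs (sin x).
Proof.
  assert (Hpos : forall x, 0 <= x <= 3 * PI / 4 -> x / 8 <= sin x).
  { clear x. intros x Hx. assert (HPI := PI_RGT_0).
    assert (Htan : forall t, 0 <= t < PI / 2 -> t * cos t <= sin t).
    { intros t Ht. destruct (MVT_abs sin cos 0 t) as [c [Hc [H1 H2]]].
      { intros c _. apply derivable_pt_lim_sin. }
      rewrite Rmin_left in H1 by lra. rewrite Rmax_right in H2 by lra.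
      rewrite sin_0, !Rminus_0_r in Hc.
      rewrite (Rabs_right t), (Rabs_right (sin t)), (Rabs_right (cos c)) in Hc.
      - rewrite Hc, Rmult_comm. apply Rmult_le_compat_r; [lra|].
        apply cos_decr_1; lra.
      - apply Rle_ge, cos_ge_0; lra.
      - apply Rle_ge, sin_ge_0; lra.
      - lra. }
    assert (H := Htan (x / 2) ltac:(lra)).
    assert (E : sin x = 2 * sin (x / 2) * cos (x / 2)) by (rewrite <- sin_2a; f_equal; field).
    assert (Hc0 : 0 <= cos (x / 2)) by (apply cos_ge_0; lra).
    assert (E2 : 2 * (cos (x / 2) * cos (x / 2)) = 1 + cos x).
    { replace (cos x) with (cos (2 * (x / 2))) by (f_equal; field). rewrite cos_2a_cos. ring. }
    assert (Hc : - (3 / 4) <= cos x).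
    { apply Rle_trans with (cos (3 * PI / 4)).
      - replace (3 * PI / 4) with (3 * (PI / 4)) by field. rewrite cos_3PI4.
        assert (Hs := sqrt_sqrt 2 ltac:(lra)). assert (Hs0 : 0 < sqrt 2) by (apply sqrt_lt_R0; lra).
        assert (Hs1 : 4 / 3 <= sqrt 2) by nra.
        assert (/ sqrt 2 <= / (4 / 3)) by (apply Rinv_le_contravar; lra).
        replace (-1 / sqrt 2) with (- / sqrt 2) by (field; lra). lra.
      - apply cos_decr_1; lra. }
    rewrite E. nra. }
  intros Hx. destruct (Rle_dec 0 x) as [H|H].
  - rewrite Rabs_right in * by lra. eapply Rle_trans; [apply Hpos; lra|apply Rle_abs].
  - rewrite (Rabs_left1 x) in * by lra.
    eapply Rle_trans; [apply (Hpos (- x)); lra|]. rewrite sin_neg, <- Rabs_Ropp. apply Rle_abs.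
Qed.

Lemma sn_normsq (a b : R) :
  Cmod (sn (a, b)) * Cmod (sn (a, b)) =
  (exp (PI * b) - exp (- (PI * b))) * (exp (PI * b) - exp (- (PI * b)))
  + 4 * (sin (PI * a) * sin (PI * a)).
Proof.
  rewrite Cmod_sq. unfold sn, Cexp, Re, Im. simpl.
  replace ((PI * 0 - 0 * 1) * a - (PI * 1 + 0 * 0) * b) with (- (PI * b)) by ring.
  replace ((PI * 0 - 0 * 1) * b + (PI * 1 + 0 * 0) * a) with (PI * a) by ring.
  rewrite Ropp_involutive, cos_neg, sin_neg.
  assert (E : exp (- (PI * b)) * exp (PI * b) = 1).
  { rewrite <- exp_plus. rewrite <- exp_0. f_equal. ring. }
  assert (E2 : cos (PI * a) * cos (PI * a) = 1 - sin (PI * a) * sin (PI * a)).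
  { assert (H := sin2_cos2 (PI * a)). unfold Rsqr in H. lra. }
  set (s := sin (PI * a)) in *. set (c := cos (PI * a)) in *.
  set (e1 := exp (PI * b)) in *. set (e2 := exp (- (PI * b))) in *.
  replace ((e2 * c + - (e1 * c)) * (e2 * c + - (e1 * c)) + (e2 * s + - (e1 * - s)) * (e2 * s + - (e1 * - s)))
    with ((c * c) * ((e1 - e2) * (e1 - e2)) + (s * s) * ((e1 - e2) * (e1 - e2) + 4 * (e2 * e1))) by ring.
  rewrite E, E2. ring.
Qed.

Lemma sinh_lower (x : R) : (2 * x) * (2 * x) <= (exp x - exp (- x)) * (exp x - exp (- x)).
Proof.
  assert (H : forall x, 0 <= x -> 2 * x <= exp x - exp (- x)).
  { clear x. intros x Hx.
    destruct (Rle_lt_or_eq_dec 0 x Hx) as [Hx'|<-].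
    2:{ rewrite Ropp_0, exp_0. lra. }
    destruct (MVT_cor2 (fun t => exp t - exp (- t) - 2 * t)
      (fun t => exp t + exp (- t) - 2) 0 x Hx') as [d [Hd _]].
    { intros d _. apply is_derive_Reals. auto_derive; auto. ring. }
    rewrite Ropp_0, exp_0 in Hd.
    assert (2 <= exp d + exp (- d)).
    { generalize (exp_ineq1_le d) (exp_ineq1_le (- d)). lra. }
    nra. }
  destruct (Rle_dec 0 x) as [Hx|Hx].
  - assert (H1 := H x Hx). apply Rmult_le_compat; lra.
  - assert (H1 := H (- x) ltac:(lra)). rewrite Ropp_involutive in H1.
    replace (2 * x * (2 * x)) with (2 * - x * (2 * - x)) by ring.
    replace ((exp x - exp (- x)) * (exp x - exp (- x)))
      with ((exp (- x) - exp x) * (exp (- x) - exp x)) by ring.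
    apply Rmult_le_compat; lra.
Qed.

(** The strip is the one met by the iterated duplication formula: n/2^(r+1) contributes at most 1/2
    to the real part, and w at most 1/4 once 2^(r+1) >= 4 |Re w|. *)
Lemma sn_lower (w : C) : Rabs (Re w) <= 3 / 4 -> Cmod w / 2 <= Cmod (sn w).
Proof.
  intros Hw. destruct w as [a b]. simpl in Hw.
  assert (H := sn_normsq a b). assert (H1 := sinh_lower (PI * b)).
  assert (HPI := PI_RGT_0). assert (HPI3 : 2 < PI) by (generalize PI2_3_2; lra).
  assert (H2 : Rabs (PI * a) / 8 <= Rabs (sin (PI * a))).
  { apply sin_lower. rewrite Rabs_mult, (Rabs_right PI) by lra.
    replace (3 * PI / 4) with (PI * (3 / 4)) by field. apply Rmult_le_compat_l; lra. }
  assert (H3 : Rabs (PI * a) / 8 * (Rabs (PI * a) / 8) <= sin (PI * a) * sin (PI * a)).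
  { replace (sin (PI * a) * sin (PI * a)) with (Rabs (sin (PI * a)) * Rabs (sin (PI * a)))
      by (rewrite <- Rabs_mult; apply Rabs_right; nra).
    assert (0 <= Rabs (PI * a)) by apply Rabs_pos. apply Rmult_le_compat; lra. }
  replace (Rabs (PI * a) / 8 * (Rabs (PI * a) / 8)) with (PI * a * (PI * a) / 64) in H3.
  2:{ replace (Rabs (PI * a) / 8 * (Rabs (PI * a) / 8)) with (Rabs (PI * a) * Rabs (PI * a) / 64) by field.
      f_equal. rewrite <- Rabs_mult. symmetry. apply Rabs_right. nra. }
  assert (Hm : Cmod (a, b) * Cmod (a, b) = a * a + b * b) by apply Cmod_sq.
  assert (G := Cmod_ge_0 (a, b)). assert (G' := Cmod_ge_0 (sn (a, b))).
  assert (HPI4 : 4 < PI * PI) by nra.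
  apply Rsqr_incr_0_var; auto. unfold Rsqr.
  assert (P1 : PI * a * (PI * a) = PI * PI * (a * a)) by ring.
  assert (P2 : 2 * (PI * b) * (2 * (PI * b)) = 4 * (PI * PI) * (b * b)) by ring.
  rewrite P1 in H3. rewrite P2 in H1. assert (0 <= a * a) by nra. assert (0 <= b * b) by nra.
  assert (4 * (a * a) <= PI * PI * (a * a)) by (apply Rmult_le_compat_r; lra).
  assert (4 * (b * b) <= PI * PI * (b * b)) by (apply Rmult_le_compat_r; lra).
  lra.
Qed.

Lemma Cmod_PIi (w : C) : Cmod (RtoC PI * Ci * w) = PI * Cmod w.
Proof.
  assert (HPI := PI_RGT_0). rewrite !Cmod_mult, Cmod_Ci, Cmod_R, Rabs_right by lra. ring.
Qed.

Lemma sn_near_0 (w : C) : PI * Cmod w <= 1 / 2 ->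
  Cmod (sn w - 2 * (RtoC PI * Ci) * w) <= 8 * (PI * Cmod w * (PI * Cmod w)) /\
  Cmod (cn w - 2) <= 8 * (PI * Cmod w * (PI * Cmod w)).
Proof.
  intros Hw. set (v := (RtoC PI * Ci * w)%C).
  assert (Hv : Cmod v = PI * Cmod w) by apply Cmod_PIi.
  assert (H1 := Cexp_quad_bound v ltac:(lra)).
  assert (H2 := Cexp_quad_bound (- v) ltac:(rewrite Cmod_opp; lra)).
  rewrite Cmod_opp in H2. rewrite Hv in H1, H2. unfold sn, cn. fold v. split.
  - replace (Cexp v - Cexp (- v) - 2 * (RtoC PI * Ci) * w)%C
      with ((Cexp v - 1 - v) - (Cexp (- v) - 1 - - v))%C by (unfold v; ring).
    eapply Rle_trans; [apply Cmod_sub_triangle|]. lra.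
  - replace (Cexp v + Cexp (- v) - 2)%C
      with ((Cexp v - 1 - v) + (Cexp (- v) - 1 - - v))%C by (unfold v; ring).
    eapply Rle_trans; [apply Cmod_triangle|]. lra.
Qed.

Lemma inv_pow2_le (r : nat) : / 2 ^ S r <= 1 / INR (S r).
Proof.
  assert (H : INR (S r) <= 2 ^ S r).
  { generalize (S r). intros n. induction n as [|n IH]; [simpl; lra|].
    rewrite S_INR. simpl. assert (1 <= 2 ^ n) by (apply pow_R1_Rle; lra). lra. }
  assert (0 < INR (S r)) by (apply lt_0_INR; lia).
  unfold Rdiv. rewrite Rmult_1_l. apply Rinv_le_contravar; auto.
Qed.

(** The offset [r0] is there because the majorant of the iterated sums requires 2^(r + r0 + 1) >= 4
    |Re w| already at r = 0. *)
Lemma scaled_lim (x : C) (r0 : nat) :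
  clim (fun r => RtoC (2 ^ S (r + r0)) * sn (x / RtoC (2 ^ S (r + r0))))%C (2 * (RtoC PI * Ci) * x)%C /\
  clim (fun r => cn (x / RtoC (2 ^ S (r + r0))))%C (RtoC 2).
Proof.
  assert (HPI := PI_RGT_0). assert (Hx0 := Cmod_ge_0 x).
  set (K := 8 * (PI * Cmod x * (PI * Cmod x))).
  assert (HK : 0 <= K) by (unfold K; assert (0 <= PI * Cmod x) by nra; nra).
  assert (Hpt : forall r, let N := 2 ^ S (r + r0) in PI * Cmod x / N <= 1 / 2 ->
     Cmod (RtoC N * sn (x / RtoC N) - 2 * (RtoC PI * Ci) * x) <= K / N /\
     Cmod (cn (x / RtoC N) - 2) <= K / N).
  { intros r N HN. assert (HNp : 0 < N) by (apply pow_lt; lra).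
    assert (HN1 : 1 <= N) by (apply pow_R1_Rle; lra).
    assert (HNc : RtoC N <> 0%C) by (intros E; apply (f_equal fst) in E; simpl in E; lra).
    assert (Hm : Cmod (x / RtoC N) = Cmod x / N).
    { rewrite Cmod_div, Cmod_R, Rabs_right; auto; lra. }
    destruct (sn_near_0 (x / RtoC N)) as [A1 A2].
    { rewrite Hm. unfold Rdiv in *. rewrite <- Rmult_assoc. auto. }
    rewrite Hm in A1, A2.
    assert (EK : 8 * (PI * (Cmod x / N) * (PI * (Cmod x / N))) = K / N / N) by (unfold K; field; lra).
    rewrite EK in A1, A2. split.
    - replace (RtoC N * sn (x / RtoC N) - 2 * (RtoC PI * Ci) * x)%C
        with (RtoC N * (sn (x / RtoC N) - 2 * (RtoC PI * Ci) * (x / RtoC N)))%C by (field; auto).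
      rewrite Cmod_mult, Cmod_R, Rabs_right by lra.
      replace (K / N) with (N * (K / N / N)) by (field; lra). apply Rmult_le_compat_l; lra.
    - eapply Rle_trans; [apply A2|]. unfold Rdiv.
      assert (0 <= K * / N) by (apply Rmult_le_pos; auto; left; apply Rinv_0_lt_compat; auto).
      assert (/ N <= 1) by (rewrite <- Rinv_1; apply Rinv_le_contravar; lra). nra. }
  assert (HE : forall eps, 0 < eps -> exists N, forall r, (N <= r)%nat ->
     PI * Cmod x / 2 ^ S (r + r0) <= 1/2 /\ K / 2 ^ S (r + r0) < eps).
  { intros eps He. destruct (inv_INR_small (PI * Cmod x) (1/2) ltac:(lra)) as [N1 HN1].
    destruct (inv_INR_small K eps He) as [N2 HN2].
    exists (Nat.max N1 N2). intros r Hr. assert (B := inv_pow2_le (r + r0)).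
    specialize (HN1 (r + r0)%nat ltac:(lia)). specialize (HN2 (r + r0)%nat ltac:(lia)).
    unfold Rdiv in *. rewrite Rmult_1_l in B. split.
    - eapply Rle_trans; [|left; apply HN1]. apply Rmult_le_compat_l; auto. nra.
    - eapply Rle_lt_trans; [|apply HN2]. apply Rmult_le_compat_l; auto. }
  split; intros eps He; destruct (HE eps He) as [N HN]; exists N; intros r Hr;
    destruct (HN r Hr) as [B1 B2]; destruct (Hpt r B1) as [C1 C2]; lra.
Qed.

Lemma pow2_ge (x : R) : exists r0, forall r, x <= 2 ^ S (r + r0).
Proof.
  destruct (INR_unbounded x) as [n Hn]. exists n. intros r.
  assert (H : INR (S (r + n)) <= 2 ^ S (r + n)).
  { generalize (S (r + n)). intros p. induction p as [|p IH]; [simpl; lra|].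
    rewrite S_INR. simpl. assert (1 <= 2 ^ p) by (apply pow_R1_Rle; lra). lra. }
  assert (INR n <= INR (S (r + n))) by (apply le_INR; lia). lra.
Qed.

Lemma pow_nat_ge (r : nat) : (r <= 2 ^ r)%nat.
Proof. generalize (Nat.pow_gt_lin_r 2 r). lia. Qed.

(** A distance from the integers that grows linearly with them, which yields majorants 1/(d^2
    (j+1)^2). The integers are listed as -j and 1 + j. *)
Definition away (d : R) (w : C) : Prop := 0 < d /\
  forall j, d * INR (S j) <= Cmod (w + RtoC (INR j)) /\ d * INR (S j) <= Cmod (w - 1 - RtoC (INR j)).

Lemma away_terms (d : R) (w : C) (j r r0 : nat) : away d w ->
  (forall r, 4 * Rabs (Re w) <= 2 ^ S (r + r0)) -> (j < 2 ^ (r + r0))%nat ->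
  let N := 2 ^ S (r + r0) in
  forall x, x = (w + RtoC (INR j))%C \/ x = (w - 1 - RtoC (INR j))%C ->
  0 < N /\ 0 < Cmod x /\ d * INR (S j) <= Cmod x /\ Cmod x / 2 <= Cmod (RtoC N * sn (x / RtoC N)).
Proof.
  intros [Hd Ha] HN Hj N x Hx. specialize (HN r). fold N in HN.
  assert (HNp : 0 < N) by (apply pow_lt; lra).
  assert (HNc : RtoC N <> 0%C) by (intros E; apply (f_equal fst) in E; simpl in E; lra).
  assert (Hx1 : d * INR (S j) <= Cmod x) by (destruct (Ha j); destruct Hx as [->| ->]; auto).
  assert (HS : 0 < INR (S j)) by (apply lt_0_INR; lia).
  assert (Hxp : 0 < Cmod x) by nra.
  repeat split; auto.
  assert (Hre : Rabs (Re (x / RtoC N)) <= 3 / 4).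
  { assert (E : Re (x / RtoC N) = Re x / N).
    { unfold Cdiv. rewrite <- RtoC_inv by lra. rewrite Cmult_comm, Re_scal. unfold Rdiv. ring. }
    rewrite E. unfold Rdiv at 1. rewrite Rabs_mult, (Rabs_right (/ N))
      by (left; apply Rinv_0_lt_compat; auto).
    assert (HjN : INR j + 1 <= N / 2).
    { rewrite <- S_INR. replace (N / 2) with (INR (2 ^ (r + r0))).
      - apply le_INR. lia.
      - rewrite pow_INR. unfold N. simpl. replace (1 + 1) with 2 by ring. field. }
    assert (Hj0 := pos_INR j).
    assert (Rabs (Re x) <= 3 / 4 * N).
    { assert (Rabs (Re x) <= Rabs (Re w) + (INR j + 1)); [|lra].
      destruct Hx as [->| ->]; [rewrite Re_plus|rewrite !Re_minus]; simpl.
      - eapply Rle_trans; [apply Rabs_triang|]. rewrite (Rabs_right (INR j)) by lra. lra.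
      - replace (Re w - 1 - INR j) with (Re w + - (INR j + 1)) by ring.
        eapply Rle_trans; [apply Rabs_triang|].
        rewrite (Rabs_left1 (- (INR j + 1))) by lra. lra. }
    apply Rmult_le_reg_r with N; auto. rewrite Rmult_assoc, Rinv_l; lra. }
  assert (H := sn_lower _ Hre). rewrite Cmod_div, Cmod_R, Rabs_right in H by (auto; lra).
  rewrite Cmod_mult, Cmod_R, Rabs_right by lra.
  apply Rle_trans with (N * (Cmod x / N / 2)); [right; field; lra|]. apply Rmult_le_compat_l; lra.
Qed.

Lemma Rinv_sq_le (d n y : R) : 0 < d -> 0 < n -> d * n <= y -> / (y * y) <= / (d * d) * / (n * n).
Proof.
  intros Hd Hn Hy. rewrite <- Rinv_mult. apply Rinv_le_contravar.
  - assert (0 < d * d) by nra. assert (0 < n * n) by nra. nra.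
  - assert (0 < d * n) by nra. replace (d * d * (n * n)) with (d * n * (d * n)) by ring.
    apply Rmult_le_compat; lra.
Qed.

Definition psq (w : C) (j : nat) : C :=
  (/ ((w + RtoC (INR j)) * (w + RtoC (INR j))) +
   / ((w - 1 - RtoC (INR j)) * (w - 1 - RtoC (INR j))))%C.

(** By Tannery's theorem the iterated duplication formula tends to the partial fraction sum, while
    all its members are equal to [csc2 w]. *)
Lemma csc2_series (d : R) (w : C) : away d w -> sn w <> 0%C -> clim (csum (psq w)) (csc2 w).
Proof.
  intros Ha Hw. assert (HPI := PI_RGT_0). assert (Hd := proj1 Ha).
  assert (HdI : 0 < / (d * d)) by (apply Rinv_0_lt_compat; nra).
  destruct (pow2_ge (4 * Rabs (Re w))) as [r0 Hr0].
  assert (Hb : forall x j, d * INR (S j) <= Cmod x -> Cmod (/ (x * x)) <= / (d * d) * / (INR (S j) * INR (S j))).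
  { intros x j Hx. assert (0 < INR (S j)) by (apply lt_0_INR; lia).
    assert (x <> 0%C) by (apply Cmod_neq_0; nra).
    rewrite Cmod_inv, Cmod_mult by (apply Cmult_neq_0; auto). apply Rinv_sq_le; auto. }
  destruct (csum_cv (psq w) (fun j => 2 * / (d * d) * / (INR (S j) * INR (S j)))) as [B HB].
  { intros j. destruct (proj2 Ha j) as [A1 A2]. unfold psq.
    eapply Rle_trans; [apply Cmod_triangle|]. assert (G1 := Hb _ _ A1). assert (G2 := Hb _ _ A2). lra. }
  { apply rsummable_inv_sq. lra. }
  assert (HT : clim (fun r => csum ((fun r j =>
      RtoC ((/ 4) ^ S (r + r0)) * (csc2 ((w + RtoC (INR j)) / RtoC (2 ^ S (r + r0)))
        + csc2 ((w - 1 - RtoC (INR j)) / RtoC (2 ^ S (r + r0)))))%C r) (2 ^ (r + r0))) B).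
  { set (K := 16 * (PI * PI)). assert (HK : 0 < K) by (unfold K; nra).
    assert (Et : forall r x, sn (x / RtoC (2 ^ S (r + r0))) <> 0%C ->
      (RtoC ((/ 4) ^ S (r + r0)) * csc2 (x / RtoC (2 ^ S (r + r0))))%C
      = (RtoC (-4 * (PI * PI)) * / ((RtoC (2 ^ S (r + r0)) * sn (x / RtoC (2 ^ S (r + r0))))
         * (RtoC (2 ^ S (r + r0)) * sn (x / RtoC (2 ^ S (r + r0))))))%C).
    { intros r x Hs. unfold csc2.
      assert (HN0 : 2 ^ S (r + r0) <> 0) by (apply pow_nonzero; lra).
      assert (HN : RtoC (2 ^ S (r + r0)) <> 0%C).
      { intros E; apply (f_equal fst) in E; simpl fst in E; auto. }
      replace ((/ 4) ^ S (r + r0)) with (/ (2 ^ S (r + r0) * 2 ^ S (r + r0))).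
      - rewrite RtoC_inv, RtoC_mult by (apply Rmult_integral_contrapositive; auto).
        unfold Cdiv. field; auto.
      - rewrite <- Rpow_mult_distr, pow_inv. replace (2 * 2) with 4 by ring. reflexivity. }
    apply tannery with (b := psq w) (M := fun j => 2 * (K * / (d * d)) * / (INR (S j) * INR (S j))).
    - apply rsummable_inv_sq. assert (0 < K * / (d * d)) by (apply Rmult_lt_0_compat; lra). lra.
    - intros r. generalize (pow_nat_ge (r + r0)). lia.
    - intros r j Hj.
      assert (G : forall x, x = (w + RtoC (INR j))%C \/ x = (w - 1 - RtoC (INR j))%C ->
        Cmod (RtoC ((/ 4) ^ S (r + r0)) * csc2 (x / RtoC (2 ^ S (r + r0))))
          <= K * / (d * d) * / (INR (S j) * INR (S j))).
      { intros x Hx. destruct (away_terms d w j r r0 Ha Hr0 Hj x Hx) as [HN [Hxp [Hx1 Hx2]]].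
        set (t := (RtoC (2 ^ S (r + r0)) * sn (x / RtoC (2 ^ S (r + r0))))%C) in *.
        assert (Hs : sn (x / RtoC (2 ^ S (r + r0))) <> 0%C).
        { intros E. unfold t in Hx2. rewrite E, Cmult_0_r, Cmod_0 in Hx2. lra. }
        rewrite Et by auto. fold t.
        assert (Ht : t <> 0%C) by (apply Cmod_neq_0; lra).
        rewrite Cmod_mult, Cmod_inv, Cmod_mult, Cmod_R by (apply Cmult_neq_0; auto).
        rewrite Rabs_left1 by nra.
        assert (0 < INR (S j)) by (apply lt_0_INR; lia).
        assert (Q := Rinv_sq_le (d / 2) (INR (S j)) (Cmod t) ltac:(lra) ltac:(lra) ltac:(lra)).
        replace (/ (d / 2 * (d / 2))) with (4 * / (d * d)) in Q by (field; lra).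
        apply Rle_trans with (4 * (PI * PI) * (4 * / (d * d) * / (INR (S j) * INR (S j))));
          [|right; unfold K; ring].
        replace (- (-4 * (PI * PI))) with (4 * (PI * PI)) by ring.
        apply Rmult_le_compat_l; [nra|exact Q]. }
      assert (G1 := G _ (or_introl eq_refl)). assert (G2 := G _ (or_intror eq_refl)).
      rewrite Cmult_plus_distr_l. eapply Rle_trans; [apply Cmod_triangle|]. lra.
    - intros j. assert (0 < INR (S j)) by (apply lt_0_INR; lia).
      assert (0 < / (INR (S j) * INR (S j))) by (apply Rinv_0_lt_compat; nra).
      assert (0 < K * / (d * d)) by (apply Rmult_lt_0_compat; lra).
      apply Rmult_le_pos; lra.
    - intros j. unfold psq.
      assert (G : forall x, d * INR (S j) <= Cmod x ->
        clim (fun r => RtoC (-4 * (PI * PI)) * / ((RtoC (2 ^ S (r + r0)) * sn (x / RtoC (2 ^ S (r + r0))))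
         * (RtoC (2 ^ S (r + r0)) * sn (x / RtoC (2 ^ S (r + r0))))))%C (/ (x * x))%C).
      { intros x Hx. assert (0 < INR (S j)) by (apply lt_0_INR; lia).
        assert (Hx0 : x <> 0%C) by (apply Cmod_neq_0; nra).
        assert (HPIc : RtoC PI <> 0%C) by (intros E; apply (f_equal fst) in E; simpl in E; lra).
        assert (Hne : (2 * (RtoC PI * Ci) * x)%C <> 0%C).
        { repeat apply Cmult_neq_0; auto. apply C2_neq_0. apply Ci_neq_0. }
        destruct (scaled_lim x r0) as [L1 _].
        assert (L2 := clim_scal (RtoC (-4 * (PI * PI))) _ _ (clim_inv _ _ (Cmult_neq_0 _ _ Hne Hne) (clim_mult _ _ _ _ L1 L1))).
        replace (/ (x * x))%C with (RtoC (-4 * (PI * PI)) * / (2 * (RtoC PI * Ci) * x * (2 * (RtoC PI * Ci) * x)))%C; [exact L2|].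
        replace (2 * (RtoC PI * Ci) * x * (2 * (RtoC PI * Ci) * x))%C
          with (4 * (Ci * Ci) * (RtoC PI * RtoC PI) * (x * x))%C by ring.
        rewrite Ci2, !RtoC_mult. field. split; auto. }
      destruct (proj2 Ha j) as [A1 A2].
      assert (HH := clim_plus _ _ _ _ (G _ A1) (G _ A2)).
      (* the identity [Et] only holds once the sine does not vanish, i.e. eventually *)
      intros eps He. destruct (HH eps He) as [N HN]. exists (Nat.max N j).
      intros r Hr. specialize (HN r ltac:(lia)).
      assert (Hj : (j < 2 ^ (r + r0))%nat).
      { generalize (Nat.pow_gt_lin_r 2 (r + r0)). lia. }
      assert (Hsn : forall x, x = (w + RtoC (INR j))%C \/ x = (w - 1 - RtoC (INR j))%C ->
        sn (x / RtoC (2 ^ S (r + r0))) <> 0%C).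
      { intros x Hx. destruct (away_terms d w j r r0 Ha Hr0 Hj x Hx) as [_ [Hxp [_ Hx2]]].
        intros E. rewrite E, Cmult_0_r, Cmod_0 in Hx2. lra. }
      rewrite Cmult_plus_distr_l, !Et by auto. exact HN.
    - exact HB. }
  assert (E : B = csc2 w); [|rewrite <- E; exact HB].
  apply (clim_unique _ _ _ HT). apply clim_ext with (2 := clim_const (csc2 w)).
  intros r. apply (doubling_iter (/ 4) csc2 w csc2_doubling Hw (r + r0)).
Qed.

Lemma clim_bounded (u : nat -> C) (l : C) : clim u l -> exists B, 0 <= B /\ forall n, Cmod (u n) <= B.
Proof.
  intros H. destruct (H 1 ltac:(lra)) as [N HN].
  exists (rsum (fun j => Cmod (u j)) N + (Cmod l + 1)).
  assert (H0 : forall n, 0 <= rsum (fun j => Cmod (u j)) n)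
    by (intros; apply rsum_ge_0; intros; apply Cmod_ge_0).
  assert (Hl := Cmod_ge_0 l). split; [specialize (H0 N); lra|].
  intros n. destruct (le_lt_dec N n) as [Hn|Hn].
  - specialize (HN n Hn). replace (u n) with ((u n - l) + l)%C by ring.
    eapply Rle_trans; [apply Cmod_triangle|]. specialize (H0 N). lra.
  - assert (Cmod (u n) <= rsum (fun j => Cmod (u j)) N); [|lra].
    apply Rle_trans with (rsum (fun j => Cmod (u j)) (S n)).
    + simpl. specialize (H0 n). lra.
    + apply rsum_mono; [intros; apply Cmod_ge_0|lia].
Qed.

(** Turns a sum of two cotangents into sin(u + v)/(sin u sin v), whose decay is quadratic. *)
Lemma cn_sn_add (u v : C) : (cn u * sn v + cn v * sn u = 2 * sn (u + v))%C.
Proof.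
  unfold cn, sn. rewrite Cmult_plus_distr_l, !Cexp_opp, Cexp_plus.
  assert (A := Cexp_neq_0 (RtoC PI * Ci * u)). assert (B := Cexp_neq_0 (RtoC PI * Ci * v)).
  field; auto.
Qed.

Definition psum (w : C) (j : nat) : C :=
  (/ (w + RtoC (INR j)) + / (w - 1 - RtoC (INR j)))%C.

Lemma psum_alt (d : R) (w : C) (j : nat) : away d w ->
  psum w j = ((2 * w - 1) * (/ (w + RtoC (INR j)) * / (w - 1 - RtoC (INR j))))%C /\
  Cmod (/ (w + RtoC (INR j)) * / (w - 1 - RtoC (INR j))) <= / (d * d) * / (INR (S j) * INR (S j)).
Proof.
  intros [Hd Ha]. destruct (Ha j) as [A1 A2].
  assert (0 < INR (S j)) by (apply lt_0_INR; lia).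
  assert (X1 : (w + RtoC (INR j))%C <> 0%C) by (apply Cmod_neq_0; nra).
  assert (X2 : (w - 1 - RtoC (INR j))%C <> 0%C) by (apply Cmod_neq_0; nra).
  split; [unfold psum; field; auto|].
  rewrite Cmod_mult, !Cmod_inv by auto. rewrite <- !Rinv_mult. apply Rinv_le_contravar.
  - assert (0 < d * d) by nra. assert (0 < INR (S j) * INR (S j)) by nra. nra.
  - assert (0 < d * INR (S j)) by nra.
    replace (d * d * (INR (S j) * INR (S j))) with (d * INR (S j) * (d * INR (S j))) by ring.
    apply Rmult_le_compat; lra.
Qed.

(** Single terms 1/(w + n) are not summable. Pairing n = j with n = -1 - j gives (2w - 1)/((w + j)(w
    - 1 - j)), and the addition formula gives the same shape before the limit, so Tannery's theorem
    is applied to pairs. *)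
Lemma ct_series (d : R) (w : C) : away d w -> sn w <> 0%C -> clim (csum (psum w)) (ct w).
Proof.
  intros Ha Hw. assert (HPI := PI_RGT_0). assert (Hd := proj1 Ha).
  assert (HdI : 0 < / (d * d)) by (apply Rinv_0_lt_compat; nra).
  assert (HPIc : RtoC PI <> 0%C) by (intros E; apply (f_equal fst) in E; simpl in E; lra).
  assert (HCi := Ci_neq_0). assert (HC2 := C2_neq_0).
  destruct (pow2_ge (4 * Rabs (Re w))) as [r0 Hr0].
  assert (HS0 : forall j, 0 < / (INR (S j) * INR (S j))).
  { intros j. assert (0 < INR (S j)) by (apply lt_0_INR; lia). apply Rinv_0_lt_compat; nra. }
  destruct (csum_cv (psum w) (fun j => Cmod (2 * w - 1) * / (d * d) * / (INR (S j) * INR (S j)))) as [B HB].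
  { intros j. destruct (psum_alt d w j Ha) as [E1 E2]. rewrite E1, Cmod_mult, Rmult_assoc.
    apply Rmult_le_compat_l; auto using Cmod_ge_0. }
  { apply rsummable_inv_sq. apply Rmult_le_pos; [apply Cmod_ge_0|lra]. }
  destruct (scaled_lim (2 * w - 1) r0) as [Ls _].
  destruct (clim_bounded _ _ Ls) as [Bs [HBs0 HBs]].
  assert (Et : forall r j, (j < 2 ^ (r + r0))%nat ->
    (RtoC ((/ 2) ^ S (r + r0)) * (ct ((w + RtoC (INR j)) / RtoC (2 ^ S (r + r0)))
        + ct ((w - 1 - RtoC (INR j)) / RtoC (2 ^ S (r + r0)))))%C
    = (2 * (RtoC PI * Ci) * (RtoC (2 ^ S (r + r0)) * sn ((2 * w - 1) / RtoC (2 ^ S (r + r0)))) *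
       (/ (RtoC (2 ^ S (r + r0)) * sn ((w + RtoC (INR j)) / RtoC (2 ^ S (r + r0)))) *
       / (RtoC (2 ^ S (r + r0)) * sn ((w - 1 - RtoC (INR j)) / RtoC (2 ^ S (r + r0))))))%C).
  { intros r j Hj.
    assert (Hsn : forall x, x = (w + RtoC (INR j))%C \/ x = (w - 1 - RtoC (INR j))%C ->
        sn (x / RtoC (2 ^ S (r + r0))) <> 0%C).
    { intros x Hx. destruct (away_terms d w j r r0 Ha Hr0 Hj x Hx) as [_ [Hxp [_ Hx2]]].
      intros E. rewrite E, Cmult_0_r, Cmod_0 in Hx2. lra. }
    assert (S1 := Hsn _ (or_introl eq_refl)). assert (S2 := Hsn _ (or_intror eq_refl)).
    assert (HN0 : 2 ^ S (r + r0) <> 0) by (apply pow_nonzero; lra).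
    rewrite pow_inv, RtoC_inv by auto.
    assert (HN : RtoC (2 ^ S (r + r0)) <> 0%C).
    { intros E; apply (f_equal fst) in E; simpl fst in E; auto. }
    set (N := RtoC (2 ^ S (r + r0))) in *.
    replace ((2 * w - 1) / N)%C with ((w + RtoC (INR j)) / N + (w - 1 - RtoC (INR j)) / N)%C by (field; auto).
    set (u := ((w + RtoC (INR j)) / N)%C) in *. set (v := ((w - 1 - RtoC (INR j)) / N)%C) in *.
    unfold ct.
    replace (2 * (RtoC PI * Ci) * (N * sn (u + v)))%C
      with (RtoC PI * Ci * N * (2 * sn (u + v)))%C by ring.
    rewrite <- cn_sn_add. field. auto. }
  assert (HT : clim (fun r => csum ((fun r j =>
      RtoC ((/ 2) ^ S (r + r0)) * (ct ((w + RtoC (INR j)) / RtoC (2 ^ S (r + r0)))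
        + ct ((w - 1 - RtoC (INR j)) / RtoC (2 ^ S (r + r0)))))%C r) (2 ^ (r + r0))) B).
  { set (K := 2 * PI * Bs * 4). assert (HK : 0 <= K) by (unfold K; nra).
    apply tannery with (b := psum w) (M := fun j => (K * / (d * d)) * / (INR (S j) * INR (S j))).
    - apply rsummable_inv_sq. nra.
    - intros r. generalize (pow_nat_ge (r + r0)). lia.
    - intros r j Hj. rewrite Et by auto.
      destruct (away_terms d w j r r0 Ha Hr0 Hj _ (or_introl eq_refl)) as [_ [X0 [X1 X2]]].
      destruct (away_terms d w j r r0 Ha Hr0 Hj _ (or_intror eq_refl)) as [_ [Y0 [Y1 Y2]]].
      set (t := (RtoC (2 ^ S (r + r0)) * sn ((w + RtoC (INR j)) / RtoC (2 ^ S (r + r0))))%C) in *.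
      set (t' := (RtoC (2 ^ S (r + r0)) * sn ((w - 1 - RtoC (INR j)) / RtoC (2 ^ S (r + r0))))%C) in *.
      specialize (HBs r). cbv beta in HBs.
      rewrite Cmod_mult, (Cmod_mult (2 * (RtoC PI * Ci))), !Cmod_mult, Cmod_Ci, !Cmod_R, (Rabs_right 2), (Rabs_right PI) by lra.
      rewrite !Cmod_mult, !Cmod_R in HBs.
      assert (T0 : t <> 0%C) by (apply Cmod_neq_0; lra). assert (T0' : t' <> 0%C) by (apply Cmod_neq_0; lra).
      rewrite !Cmod_inv by auto.
      assert (HSj : 0 < INR (S j)) by (apply lt_0_INR; lia).
      assert (Q : / Cmod t * / Cmod t' <= 4 * / (d * d) * / (INR (S j) * INR (S j))).
      { rewrite <- Rinv_mult.
        replace (4 * / (d * d) * / (INR (S j) * INR (S j)))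
          with (/ ((d * INR (S j) / 2) * (d * INR (S j) / 2))) by (field; lra).
        assert (0 < d * INR (S j)) by nra.
        apply Rinv_le_contravar; [nra|]. apply Rmult_le_compat; lra. }
      apply Rle_trans with (2 * (PI * 1) * Bs * (4 * / (d * d) * / (INR (S j) * INR (S j)))).
      + apply Rmult_le_compat; auto.
        * apply Rmult_le_pos; [lra|]. apply Rmult_le_pos; [apply Rabs_pos|apply Cmod_ge_0].
        * apply Rmult_le_pos; left; apply Rinv_0_lt_compat; lra.
        * apply Rmult_le_compat_l; lra.
      + right. unfold K. ring.
    - intros j. specialize (HS0 j). apply Rmult_le_pos; [apply Rmult_le_pos; lra|lra].
    - intros j. destruct (proj2 Ha j) as [A1 A2].
      assert (0 < INR (S j)) by (apply lt_0_INR; lia).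
      set (x := (w + RtoC (INR j))%C) in *. set (y := (w - 1 - RtoC (INR j))%C) in *.
      assert (X : x <> 0%C) by (apply Cmod_neq_0; nra).
      assert (Y : y <> 0%C) by (apply Cmod_neq_0; nra).
      assert (Nx : (2 * (RtoC PI * Ci) * x)%C <> 0%C) by (repeat apply Cmult_neq_0; auto).
      assert (Ny : (2 * (RtoC PI * Ci) * y)%C <> 0%C) by (repeat apply Cmult_neq_0; auto).
      destruct (scaled_lim x r0) as [Lx _]. destruct (scaled_lim y r0) as [Ly _].
      assert (HH := clim_mult _ _ _ _ (clim_scal (2 * (RtoC PI * Ci)) _ _ Ls)
        (clim_mult _ _ _ _ (clim_inv _ _ Nx Lx) (clim_inv _ _ Ny Ly))).
      assert (EL : psum w j = (2 * (RtoC PI * Ci) * (2 * (RtoC PI * Ci) * (2 * w - 1)) *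
        (/ (2 * (RtoC PI * Ci) * x) * / (2 * (RtoC PI * Ci) * y)))%C).
      { unfold psum. fold x y. replace (2 * w - 1)%C with (x + y)%C by (unfold x, y; ring).
        field. auto. }
      rewrite EL.
      intros eps He. destruct (HH eps He) as [N HN]. exists (Nat.max N j).
      intros r Hr. specialize (HN r ltac:(lia)).
      assert (Hj : (j < 2 ^ (r + r0))%nat) by (generalize (Nat.pow_gt_lin_r 2 (r + r0)); lia).
      cbv beta. unfold x, y. rewrite Et by auto. exact HN.
    - exact HB. }
  assert (E : B = ct w); [|rewrite <- E; exact HB].
  apply (clim_unique _ _ _ HT). apply clim_ext with (2 := clim_const (ct w)).
  intros r. apply (doubling_iter (/ 2) ct w ct_doubling Hw (r + r0)).
Qed.

(** Small indices are bounded below by the imaginary part and large ones by the real part; beyond 2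
    |Re w| + 1 the latter is at least (j + 1)/2. *)
Lemma away_Im (w : C) : Im w <> 0 -> exists d, away d w.
Proof.
  intros Hb. set (a := Re w) in *. set (b := Rabs (Im w)).
  assert (Hb0 : 0 < b) by (apply Rabs_pos_lt; auto).
  assert (Ha0 : 0 <= Rabs a) by apply Rabs_pos.
  exists (Rmin (/ 2) (b / (2 * Rabs a + 4))).
  assert (Hd : 0 < Rmin (/ 2) (b / (2 * Rabs a + 4))).
  { apply Rmin_pos; [lra|]. apply Rdiv_lt_0_compat; lra. }
  split; auto. intros j. rewrite S_INR. assert (Hj := pos_INR j).
  assert (G : forall x, Rabs (Im x) = b -> INR j - Rabs a <= Rabs (Re x) ->
    Rmin (/ 2) (b / (2 * Rabs a + 4)) * (INR j + 1) <= Cmod x).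
  { intros x Hx1 Hx2. assert (I1 := Cmod_Im_le x). assert (I2 := Cmod_Re_le x). rewrite Hx1 in I1.
    destruct (Rle_dec (INR j) (2 * Rabs a + 1)) as [H|H].
    - eapply Rle_trans; [|apply I1].
      apply Rle_trans with (b / (2 * Rabs a + 4) * (2 * Rabs a + 4)); [|right; field; lra].
      apply Rmult_le_compat; try lra. apply Rmin_r.
    - eapply Rle_trans; [|apply I2]. apply Rle_trans with (/ 2 * (INR j + 1)); [|lra].
      apply Rmult_le_compat_r; [lra|apply Rmin_l]. }
  split; apply G.
  - rewrite Im_plus. simpl. rewrite Rplus_0_r. reflexivity.
  - rewrite Re_plus. simpl. fold a.
    assert (H := Rabs_triang (a + INR j) (- a)). rewrite Rabs_Ropp in H.
    replace (a + INR j + - a) with (INR j) in H by ring. rewrite (Rabs_right (INR j)) in H by lra. lra.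
  - rewrite !Im_minus. simpl. rewrite !Rminus_0_r. reflexivity.
  - rewrite !Re_minus. simpl. fold a.
    assert (H := Rabs_triang (a - 1 - INR j) (- a)). rewrite Rabs_Ropp in H.
    replace (a - 1 - INR j + - a) with (- (INR j + 1)) in H by ring.
    rewrite (Rabs_left1 (- (INR j + 1))) in H by lra. lra.
Qed.

Lemma sn_Im_neq_0 (w : C) : Im w <> 0 -> sn w <> 0%C.
Proof.
  intros Hb E. destruct w as [a b]. simpl in Hb.
  assert (H := sn_normsq a b). rewrite E, Cmod_0 in H.
  assert (H1 := sinh_lower (PI * b)). assert (HPI := PI_RGT_0).
  assert (0 < PI * b * (PI * b)).
  { assert (PI * b <> 0) by (apply Rmult_integral_contrapositive; lra). nra. }
  assert (0 <= sin (PI * a) * sin (PI * a)) by nra. nra.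
Qed.

Lemma away_half : away (/ 2) (RtoC (/ 2)).
Proof.
  split; [lra|]. intros j. rewrite S_INR. assert (Hj := pos_INR j).
  rewrite <- RtoC_plus, <- !RtoC_minus, !Cmod_R. split.
  - rewrite Rabs_right; lra.
  - rewrite Rabs_left1; lra.
Qed.

Lemma csc2_half : csc2 (RtoC (/ 2)) = RtoC (PI * PI).
Proof.
  unfold csc2, sn. rewrite Cexp_opp, Cexp_PIi2. assert (H := Ci_neq_0).
  replace ((Ci - / Ci) * (Ci - / Ci))%C with (Ci * Ci - 2 + / (Ci * Ci))%C by (field; auto).
  rewrite Ci2, !RtoC_mult. field.
Qed.

Definition isq (j : nat) : C := (/ (RtoC (INR (S j)) * RtoC (INR (S j))))%C.

Lemma Cmod_isq (j : nat) : Cmod (isq j) = / (INR (S j) * INR (S j)).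
Proof.
  assert (0 < INR (S j)) by (apply lt_0_INR; lia).
  unfold isq. rewrite <- RtoC_mult, <- RtoC_inv by nra. rewrite Cmod_R, Rabs_right; auto.
  left. apply Rinv_0_lt_compat. nra.
Qed.

(** The expansion of pi^2/sin^2 at w = 1/2 is a sum over the odd integers, and the even ones
    contribute a quarter of the whole. *)
Lemma zeta2 : clim (csum isq) (RtoC (PI * PI / 6)).
Proof.
  destruct (csum_cv isq (fun j => 1 * / (INR (S j) * INR (S j)))) as [z Hz].
  { intros j. rewrite Cmod_isq. lra. }
  { apply rsummable_inv_sq. lra. }
  assert (Hs : sn (RtoC (/ 2)) <> 0%C).
  { intros E. assert (E2 := csc2_half). unfold csc2 in E2. rewrite E in E2.
    apply (f_equal Cmod) in E2. unfold sn in E. rewrite Cexp_opp, Cexp_PIi2 in E.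
    assert (HCi := Ci_neq_0).
    assert (E3 : (Ci - / Ci)%C = (2 * Ci)%C).
    { replace (/ Ci)%C with (/ Ci * (- (Ci * Ci)))%C by (rewrite Ci2; ring). field. auto. }
    rewrite E3 in E. apply (f_equal snd) in E. simpl in E. lra. }
  assert (H := csc2_series _ _ away_half Hs). rewrite csc2_half in H.
  (* sum of 8/(2j+1)^2 = 2 (4 zeta - zeta) *)
  assert (H1 : forall n, csum (psq (RtoC (/ 2))) n = (8 * csum isq (2 * n) - 2 * csum isq n)%C).
  { induction n as [|n IH]; [simpl; ring|].
    replace (2 * S n)%nat with (S (S (2 * n))) by lia. simpl csum. rewrite IH.
    replace (n + (n + 0))%nat with (2 * n)%nat by lia.
    assert (E : psq (RtoC (/ 2)) n = (8 * (isq (2 * n) + isq (S (2 * n))) - 2 * isq n)%C).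
    { unfold psq, isq. rewrite !S_INR, !mult_INR. simpl (INR 2).
      replace (1 + 1) with 2 by ring. assert (Hn := pos_INR n).
      rewrite <- RtoC_plus, <- !RtoC_minus. rewrite <- !RtoC_mult.
      rewrite <- !RtoC_inv by nra. rewrite <- !RtoC_plus, <- !RtoC_mult, <- RtoC_minus.
      f_equal. field. repeat split; nra. }
    rewrite E. ring. }
  assert (H2 : clim (csum (psq (RtoC (/ 2)))) (8 * z - 2 * z)%C).
  { apply clim_ext with (fun n => 8 * csum isq (2 * n) - 2 * csum isq n)%C.
    { intros; symmetry; auto. }
    apply clim_minus; apply clim_scal; auto.
    apply (clim_subseq (csum isq) z (fun n => (2 * n)%nat)); auto. intros; lia. }
  assert (E := clim_unique _ _ _ H H2).
  replace (RtoC (PI * PI / 6)) with z; auto.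
  unfold Rdiv. rewrite RtoC_mult, E, RtoC_inv by lra. field.
Qed.

(** * The quasi-modularity of E_2 *)

Definition nS (j : nat) : C := RtoC (INR (S j)).

Lemma nS_pos (j : nat) : 1 <= INR (S j).
Proof. apply (le_INR 1). lia. Qed.

(** Regroups the pairs (j, -1 - j) into a centre and the pairs (n, -n), leaving one boundary
    term. *)
Lemma pair_sum_shift (phi : C -> C) (w : C) (n : nat) :
  csum (fun j => phi (w + RtoC (INR j)) + phi (w - 1 - RtoC (INR j)))%C (S n)
  = (phi w + csum (fun j => phi (w + nS j) + phi (w - nS j)) n + phi (w - nS n))%C.
Proof.
  induction n as [|n IH].
  - simpl. unfold nS. simpl. replace (w + 0)%C with w by ring.
    replace (w - 1 - 0)%C with (w - 1)%C by ring. ring.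
  - set (F := (fun j => phi (w + RtoC (INR j)) + phi (w - 1 - RtoC (INR j)))%C) in *.
    change (csum F (S (S n))) with (csum F (S n) + F (S n))%C. rewrite IH. unfold F. cbn [csum].
    unfold nS. rewrite (S_INR (S n)), RtoC_plus.
    replace (w - (RtoC (INR (S n)) + 1))%C with (w - 1 - RtoC (INR (S n)))%C by ring. ring.
Qed.

Lemma Cmod_far (w : C) : exists N, forall n, (N <= n)%nat -> INR (S n) / 2 <= Cmod (w - nS n) /\ INR (S n) / 2 <= Cmod (w + nS n).
Proof.
  destruct (INR_unbounded (2 * Cmod w)) as [N HN]. exists N. intros n Hn.
  assert (INR N <= INR (S n)) by (apply le_INR; lia).
  assert (Hm : Cmod (nS n) = INR (S n)).
  { unfold nS. rewrite Cmod_R, Rabs_right; auto. generalize (nS_pos n). lra. }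
  split.
  - rewrite Cmod_sub_comm. assert (H1 := Cmod_sub_ge (nS n) w). lra.
  - rewrite Cplus_comm. assert (H1 := Cmod_plus_ge (nS n) w). lra.
Qed.

Lemma clim_inv_far (w : C) (s : C) : (s = 1 \/ s = -(1))%C ->
  clim (fun n => / (w + s * nS n))%C (RtoC 0).
Proof.
  intros Hs. destruct (Cmod_far w) as [N HN]. intros eps He.
  destruct (inv_INR_small 2 eps He) as [N1 HN1]. exists (Nat.max N N1). intros n Hn.
  specialize (HN n ltac:(lia)). specialize (HN1 n ltac:(lia)). assert (Hp := nS_pos n).
  replace (/ (w + s * nS n) - 0)%C with (/ (w + s * nS n))%C by ring.
  assert (Hb : INR (S n) / 2 <= Cmod (w + s * nS n)).
  { destruct Hs as [->| ->].
    - replace (w + 1 * nS n)%C with (w + nS n)%C by ring. tauto.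
    - replace (w + - (1) * nS n)%C with (w - nS n)%C by ring. tauto. }
  rewrite Cmod_inv by (apply Cmod_neq_0; lra).
  apply Rle_lt_trans with (2 / INR (S n)); auto.
  replace (2 / INR (S n)) with (/ (INR (S n) / 2)) by (field; lra).
  apply Rinv_le_contravar; lra.
Qed.

Lemma csc2_pairs (w : C) : Im w <> 0 ->
  clim (csum (fun j => / ((w + nS j) * (w + nS j)) + / ((w - nS j) * (w - nS j)))%C)
       (csc2 w - / (w * w))%C.
Proof.
  intros Hw. destruct (away_Im w Hw) as [d Hd].
  assert (H := csc2_series d w Hd (sn_Im_neq_0 w Hw)).
  assert (H1 := clim_subseq _ _ S ltac:(intros; lia) H).
  assert (H2 := clim_inv_far w (-(1)) (or_intror eq_refl)).
  assert (H3 := clim_minus _ _ _ _ (clim_minus _ _ _ _ H1 (clim_const (/ (w * w))%C)) (clim_mult _ _ _ _ H2 H2)).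
  replace (csc2 w - / (w * w))%C with (csc2 w - / (w * w) - 0 * 0)%C by ring.
  apply clim_ext with (2 := H3). intros n. cbv beta.
  assert (E := pair_sum_shift (fun x => / (x * x))%C w n). cbv beta in E.
  change (csum (psq w) (S n) - / (w * w) - / (w + - (1) * nS n) * / (w + - (1) * nS n) =
    csum (fun j => / ((w + nS j) * (w + nS j)) + / ((w - nS j) * (w - nS j))) n)%C.
  change (csum (psq w) (S n)) with (csum (fun j => / ((w + RtoC (INR j)) * (w + RtoC (INR j)))
    + / ((w - 1 - RtoC (INR j)) * (w - 1 - RtoC (INR j)))) (S n))%C.
  rewrite E.
  assert (Hne : (w - nS n)%C <> 0%C).
  { intros E0. apply Hw. apply (f_equal Im) in E0. unfold nS in E0. rewrite Im_minus in E0. simpl in E0. unfold Im. lra. }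
  replace (w + - (1) * nS n)%C with (w - nS n)%C by ring.
  replace (/ ((w - nS n) * (w - nS n)))%C with (/ (w - nS n) * / (w - nS n))%C by (field; auto). ring.
Qed.

Lemma ct_pairs (w : C) : Im w <> 0 ->
  clim (csum (fun j => / (w + nS j) + / (w - nS j))%C) (ct w - / w)%C.
Proof.
  intros Hw. destruct (away_Im w Hw) as [d Hd].
  assert (H := ct_series d w Hd (sn_Im_neq_0 w Hw)).
  assert (H1 := clim_subseq _ _ S ltac:(intros; lia) H).
  assert (H2 := clim_inv_far w (-(1)) (or_intror eq_refl)).
  assert (H3 := clim_minus _ _ _ _ (clim_minus _ _ _ _ H1 (clim_const (/ w)%C)) H2).
  replace (ct w - / w)%C with (ct w - / w - 0)%C by ring.
  apply clim_ext with (2 := H3). intros n. cbv beta.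
  assert (E := pair_sum_shift Cinv w n).
  change (csum (psum w) (S n)) with (csum (fun j => / (w + RtoC (INR j))
    + / (w - 1 - RtoC (INR j))) (S n))%C.
  rewrite E. replace (w + - (1) * nS n)%C with (w - nS n)%C by ring. ring.
Qed.

Lemma sn_Im_lower (w : C) : 0 < Im w -> 2 * (PI * Im w) <= Cmod (sn w) /\ PI * Im w <= Cmod (sn w).
Proof.
  intros Hw. destruct w as [a b]. simpl in *. assert (HPI := PI_RGT_0).
  assert (H := sn_normsq a b). assert (H1 := sinh_lower (PI * b)).
  assert (0 <= sin (PI * a) * sin (PI * a)) by nra.
  assert (G : 2 * (PI * b) <= Cmod (sn (a, b))).
  { apply Rsqr_incr_0_var; [unfold Rsqr; lra|apply Cmod_ge_0]. }
  split; auto. assert (0 < PI * b) by nra. lra.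
Qed.

Lemma csc2_bound (w : C) : 0 < Im w -> Cmod (csc2 w) <= / (Im w * Im w).
Proof.
  intros Hw. assert (HPI := PI_RGT_0). destruct (sn_Im_lower w Hw) as [H _].
  assert (Hp : 0 < PI * Im w) by nra.
  assert (Hs : sn w <> 0%C) by (apply Cmod_neq_0; lra).
  unfold csc2, Cdiv. rewrite Cmod_mult, Cmod_inv, Cmod_mult, Cmod_R by (apply Cmult_neq_0; auto).
  rewrite Rabs_left1 by nra.
  apply Rle_trans with (4 * (PI * PI) * / (2 * (PI * Im w) * (2 * (PI * Im w)))).
  - replace (- (-4 * (PI * PI))) with (4 * (PI * PI)) by ring.
    apply Rmult_le_compat_l; [nra|]. apply Rinv_le_contravar; [nra|].
    apply Rmult_le_compat; lra.
  - right. field. lra.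
Qed.

Lemma ct_at_infinity (w : C) : 0 < Im w -> Cmod (ct w - - (RtoC PI * Ci)) <= 2 / Im w.
Proof.
  intros Hw. assert (HPI := PI_RGT_0). destruct (sn_Im_lower w Hw) as [_ H].
  assert (Hp : 0 < PI * Im w) by nra.
  assert (Hs : sn w <> 0%C) by (apply Cmod_neq_0; lra).
  unfold ct.
  replace (RtoC PI * Ci * cn w / sn w - - (RtoC PI * Ci))%C
    with (RtoC PI * Ci * (2 * Cexp (RtoC PI * Ci * w)) / sn w)%C.
  2:{ replace (2 * Cexp (RtoC PI * Ci * w))%C with (cn w + sn w)%C by (unfold cn, sn; ring). field. auto. }
  unfold Cdiv. rewrite Cmod_mult, Cmod_PIi, Cmod_mult, Cmod_Cexp, Cmod_inv, Cmod_R, (Rabs_right 2) by (auto; lra).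
  assert (E : exp (Re (RtoC PI * Ci * w)) <= 1).
  { rewrite <- exp_0. left. apply exp_increasing. simpl. unfold Im in *. nra. }
  apply Rle_trans with (PI * (2 * 1) * / (PI * Im w)).
  - apply Rmult_le_compat.
    + assert (0 < exp (Re (RtoC PI * Ci * w))) by apply exp_pos. nra.
    + left. apply Rinv_0_lt_compat. lra.
    + nra.
    + apply Rinv_le_contravar; lra.
  - right. field. lra.
Qed.

(** Positivity of the quadratic form |Dz + x|^2. D and x are real so that the half-integral shifts
    of the telescoping series are covered too. *)
Lemma lattice_lower (z : C) : 0 < Im z -> exists k, 0 < k /\
  forall D x : R, k * (D * D + x * x) <= Cmod (RtoC D * z + RtoC x) * Cmod (RtoC D * z + RtoC x).
Proof.
  intros Hz. set (y := Im z) in *. set (m := Cmod z).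
  assert (Hm : 0 <= m) by apply Cmod_ge_0.
  set (L := / y * / y + (1 + m / y) * (1 + m / y)).
  assert (Hy : 0 < / y) by (apply Rinv_0_lt_compat; auto).
  assert (Hq : 0 <= m / y) by (apply Rmult_le_pos; lra).
  assert (HL : 0 < L).
  { unfold L. assert (0 < / y * / y) by (apply Rmult_lt_0_compat; auto).
    assert (0 <= (1 + m / y) * (1 + m / y)) by (apply Rmult_le_pos; lra). lra. }
  exists (/ L). split; [apply Rinv_0_lt_compat; auto|]. intros D x.
  set (s := Cmod (RtoC D * z + RtoC x)). assert (Hs : 0 <= s) by apply Cmod_ge_0.
  assert (H1 : Rabs D * y <= s).
  { assert (H := Cmod_Im_le (RtoC D * z + RtoC x)). fold s in H.
    rewrite Im_plus, Im_scal in H. simpl in H. rewrite Rplus_0_r, Rabs_mult in H.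
    fold (Im z) in H. fold y in H. rewrite (Rabs_right y) in H by lra. auto. }
  assert (H2 : Rabs x <= s + Rabs D * m).
  { rewrite <- Cmod_R. replace (RtoC x) with ((RtoC D * z + RtoC x) - RtoC D * z)%C by ring.
    eapply Rle_trans; [apply Cmod_sub_triangle|]. rewrite Cmod_mult, Cmod_R. unfold s, m. lra. }
  assert (HD0 : 0 <= Rabs D) by apply Rabs_pos. assert (Hx0 : 0 <= Rabs x) by apply Rabs_pos.
  assert (H3 : Rabs D <= s * / y).
  { apply Rmult_le_reg_r with y; auto. rewrite Rmult_assoc, Rinv_l; lra. }
  assert (H4 : Rabs x <= s * (1 + m / y)).
  { eapply Rle_trans; [apply H2|]. unfold Rdiv. nra. }
  assert (ED : D * D = Rabs D * Rabs D) by (rewrite <- Rabs_mult; symmetry; apply Rabs_right; nra).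
  assert (Ex : x * x = Rabs x * Rabs x) by (rewrite <- Rabs_mult; symmetry; apply Rabs_right; nra).
  apply Rmult_le_reg_l with L; auto. rewrite <- Rmult_assoc, Rinv_r, Rmult_1_l by lra.
  rewrite ED, Ex.
  assert (Rabs D * Rabs D <= s * / y * (s * / y)) by (apply Rmult_le_compat; auto).
  assert (Rabs x * Rabs x <= s * (1 + m / y) * (s * (1 + m / y))) by (apply Rmult_le_compat; auto).
  unfold L. lra.
Qed.

Lemma lattice_neq_0 (z : C) (D x : R) : 0 < Im z -> D <> 0 -> (RtoC D * z + RtoC x)%C <> 0%C.
Proof.
  intros Hz HD E. apply (f_equal Im) in E. rewrite Im_plus, Im_scal in E. simpl in E.
  assert (D * Im z = 0) by (unfold Im in *; lra). apply Rmult_integral in H. lra.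
Qed.

(** This is E_2(-1/z)/z^2 = E_2(z) + 6/(pi i z), with E_2 written as 1 + (6/pi^2) T. The double
    series of (dz + c)^(-2) converges only conditionally, so a telescoping series with the same
    leading behaviour is subtracted. The difference converges absolutely and may be summed in either
    order; the two orders of the telescoping series differ by the defect pi i/z. *)
Theorem E2_transform (z T T' : C) : 0 < Im z ->
  clim (csum (fun d => csc2 (nS d * z)%C)) T ->
  clim (csum (fun d => csc2 (nS d * - / z)%C)) T' ->
  (/ (z * z) * T' = T + RtoC (PI * PI / 6) - RtoC (PI * PI / 6) * / (z * z) - RtoC PI * Ci / z)%C.
Proof.
  intros Hz HT HT'.
  assert (Hz0 := Im_pos_neq_0 z Hz). assert (Hz2 : (z * z)%C <> 0%C) by (apply Cmult_neq_0; auto).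
  destruct (lattice_lower z Hz) as [k [Hk HL]].
  assert (HnS : forall j, nS j <> 0%C).
  { intros j E. apply (f_equal Re) in E. unfold nS in E. rewrite !Re_RtoC in E.
    generalize (nS_pos j). lra. }
  set (Wp := fun d c => (nS d * z + nS c)%C). set (Wm := fun d c => (nS d * z - nS c)%C).
  (* With half shifts on both sides, 1/W^2 - (1/(W - 1/2) - 1/(W + 1/2)) decays like W^(-4), and |dz
     + c|^2 >= 2 k d c turns this into the summable product 1/(d^2 c^2). *)
  set (hf := RtoC (/ 2)).
  assert (Hhf : (hf * hf = RtoC (/ 4))%C) by (unfold hf; rewrite <- RtoC_mult; f_equal; field).
  assert (NE : forall d x, (nS d * z + RtoC x)%C <> 0%C).
  { intros d x. apply lattice_neq_0; auto. generalize (nS_pos d). lra. }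
  assert (NEp : forall d c, (Wp d c <> 0 /\ Wp d c - hf <> 0 /\ Wp d c + hf <> 0)%C).
  { intros d c. unfold Wp, hf, nS at 2 4 6. rewrite <- !Cplus_assoc, <- RtoC_plus.
    unfold Cminus. rewrite <- Cplus_assoc, <- RtoC_opp, <- RtoC_plus. repeat split; apply NE. }
  assert (NEm : forall d c, (Wm d c <> 0 /\ Wm d c - hf <> 0 /\ Wm d c + hf <> 0)%C).
  { intros d c. unfold Wm, hf, nS at 2 4 6. unfold Cminus. rewrite <- !Cplus_assoc.
    rewrite <- !RtoC_opp, <- !RtoC_plus. repeat split; apply NE. }
  set (B := fun d c => (/ (Wp d c * Wp d c) + / (Wm d c * Wm d c))%C).
  set (b := fun d c => ((/ (Wp d c - hf) - / (Wp d c + hf)) + (/ (Wm d c - hf) - / (Wm d c + hf)))%C).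
  (* Row d of [b] telescopes to [H d (1/2)]. The sum of [H d x] over d is [h x], by the expansion of
     the cotangent, so the columns of [b] sum to differences of [h]. *)
  set (H := fun d x => (/ (nS d * z + RtoC x) - / (nS d * z - RtoC x))%C).
  set (h := fun x : R => (- / z * (ct (- RtoC x / z) - / (- RtoC x / z)))%C).
  assert (RB : forall d, clim (csum (B d)) (csc2 (nS d * z) - / (nS d * z * (nS d * z)))%C).
  { intros d. apply (csc2_pairs (nS d * z)%C). unfold nS. rewrite Im_scal.
    generalize (nS_pos d). intros. assert (0 < INR (S d) * Im z) by nra. lra. }
  assert (Rb : forall d, clim (csum (b d)) (H d (/ 2)%R)).
  { intros d. set (w := (nS d * z)%C).
    assert (L1 := clim_inv_far (w + hf)%C 1%C (or_introl eq_refl)).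
    assert (L2 := clim_inv_far (w - hf)%C (-(1))%C (or_intror eq_refl)).
    assert (L1' : clim (fun n => / (w + RtoC (INR n) + hf))%C (RtoC 0)).
    { intros eps He. destruct (L1 eps He) as [N HN]. exists (S N). intros [|n] Hn; [lia|].
      specialize (HN n ltac:(lia)). unfold nS in HN.
      replace (w + RtoC (INR (S n)) + hf)%C with (w + hf + 1 * RtoC (INR (S n)))%C by ring. auto. }
    assert (L2' : clim (fun n => / (w - RtoC (INR n) - hf))%C (RtoC 0)).
    { intros eps He. destruct (L2 eps He) as [N HN]. exists (S N). intros [|n] Hn; [lia|].
      specialize (HN n ltac:(lia)). unfold nS in HN.
      replace (w - RtoC (INR (S n)) - hf)%C with (w - hf + - (1) * RtoC (INR (S n)))%C by ring. auto. }
    assert (LL := clim_plus _ _ _ _ (clim_minus _ _ _ _ (clim_const (/ (w + hf))%C) L1')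
                (clim_minus _ _ _ _ L2' (clim_const (/ (w - hf))%C))).
    assert (E : H d (/ 2)%R = (/ (w + hf) - 0 + (0 - / (w - hf)))%C) by (unfold H; fold w; fold hf; ring).
    rewrite E. apply clim_ext with (2 := LL). intros n. cbv beta.
    induction n as [|n IH].
    - simpl. replace (w + 0 + hf)%C with (w + hf)%C by ring. replace (w - 0 - hf)%C with (w - hf)%C by ring. ring.
    - cbn [csum]. rewrite <- IH. unfold b, Wp, Wm. fold w. unfold nS. rewrite S_INR, RtoC_plus.
      replace (w + (RtoC (INR n) + 1) - hf)%C with (w + RtoC (INR n) + hf)%C by (unfold hf; rewrite RtoC_inv by lra; field).
      replace (w - (RtoC (INR n) + 1) + hf)%C with (w - RtoC (INR n) - hf)%C by (unfold hf; rewrite RtoC_inv by lra; field).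
      ring. }
  assert (CB : forall c, clim (csum (fun d => B d c)) (/ (z * z) * csc2 (nS c * - / z) - / (nS c * nS c))%C).
  { intros c. set (w := (nS c * - / z)%C).
    assert (Hw : Im w <> 0).
    { unfold w, nS. rewrite Im_scal. generalize (nS_pos c) (Im_neg_inv_pos z Hz). intros.
      assert (0 < INR (S c) * Im (- / z)) by nra. lra. }
    assert (L := clim_scal (/ (z * z))%C _ _ (csc2_pairs w Hw)).
    replace (/ (z * z) * csc2 w - / (nS c * nS c))%C with (/ (z * z) * (csc2 w - / (w * w)))%C.
    2:{ unfold w. field. auto. }
    apply clim_ext with (2 := L). intros n. rewrite <- csum_scal. apply csum_ext. intros d _.
    unfold B. destruct (NEp d c) as [A1 _]. destruct (NEm d c) as [A2 _].
    assert (E1 : Wm d c = (z * (w + nS d))%C) by (unfold Wm, w; field; auto).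
    assert (E2 : Wp d c = (- z * (w - nS d))%C) by (unfold Wp, w; field; auto).
    assert (G1 : (w + nS d)%C <> 0%C) by (intros E; apply A2; rewrite E1, E; ring).
    assert (G2 : (w - nS d)%C <> 0%C) by (intros E; apply A1; rewrite E2, E; ring).
    rewrite E1, E2. field. auto. }
  assert (Ch : forall x, 0 < x -> clim (csum (fun d => H d x)) (h x)).
  { intros x Hx. set (w := (- RtoC x / z)%C).
    assert (Ew : w = (RtoC x * - / z)%C) by (unfold w; field; auto).
    assert (Hw : Im w <> 0).
    { rewrite Ew, Im_scal. generalize (Im_neg_inv_pos z Hz). intros.
      assert (0 < x * Im (- / z)) by nra. lra. }
    assert (L := clim_scal (- / z)%C _ _ (ct_pairs w Hw)).
    apply clim_ext with (2 := L). intros n. rewrite <- csum_scal. apply csum_ext. intros d _.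
    unfold H. assert (A1 := NE d x). assert (A2 := NE d (- x)). rewrite RtoC_opp in A2.
    assert (E1 : (nS d * z + - RtoC x)%C = (z * (w + nS d))%C) by (unfold w; field; auto).
    assert (E2 : (nS d * z + RtoC x)%C = (- z * (w - nS d))%C) by (unfold w; field; auto).
    assert (G1 : (w + nS d)%C <> 0%C) by (intros E; apply A2; rewrite E1, E; ring).
    assert (G2 : (w - nS d)%C <> 0%C) by (intros E; apply A1; rewrite E2, E; ring).
    replace (nS d * z - RtoC x)%C with (z * (w + nS d))%C by (rewrite <- E1; reflexivity).
    rewrite E2. field. auto. }
  assert (Cb : forall c, clim (csum (fun d => b d c)) (h (INR (S c) - / 2)%R - h (INR (S c) + / 2)%R)%C).
  { intros c. assert (Hc := nS_pos c).
    assert (L := clim_minus _ _ _ _ (Ch (INR (S c) - / 2)%R ltac:(lra)) (Ch (INR (S c) + / 2)%R ltac:(lra))).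
    apply clim_ext with (2 := L). intros n. rewrite <- csum_minus. apply csum_ext. intros d _.
    unfold H, b, Wp, Wm, hf, nS. rewrite RtoC_minus, RtoC_plus.
    set (X := RtoC (INR (S c))). set (Y := (RtoC (INR (S d)) * z)%C). set (e := RtoC (/ 2)).
    replace (Y + (X - e))%C with (Y + X - e)%C by ring. replace (Y + (X + e))%C with (Y + X + e)%C by ring.
    replace (Y - (X - e))%C with (Y - X + e)%C by ring. replace (Y - (X + e))%C with (Y - X - e)%C by ring.
    ring. }
  assert (Dom : forall d c, Cmod (B d c - b d c) <= (/ (k * k) * / (INR (S d) * INR (S d))) * / (INR (S c) * INR (S c))).
  { intros d c. assert (Hd := nS_pos d). assert (Hc := nS_pos c).
    set (D := INR (S d)) in *. set (X := INR (S c)) in *.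
    assert (Sq1 : 2 * (D * X) <= D * D + X * X) by (generalize (Rle_0_sqr (D - X)); unfold Rsqr; lra).
    assert (Sq2 : D * X <= D * D + (X - / 2) * (X - / 2)).
    { generalize (Rle_0_sqr (D - (X - / 2))); unfold Rsqr. assert (D * 1 <= D * X) by (apply Rmult_le_compat_l; lra). lra. }
    assert (Sq3 : (X - / 2) * (X - / 2) <= (X + / 2) * (X + / 2)) by lra.
    assert (G : forall W x, (x = X \/ x = - X) -> W = (nS d * z + RtoC x)%C -> (W <> 0)%C -> (W - hf <> 0)%C -> (W + hf <> 0)%C ->
      Cmod (/ (W * W) - (/ (W - hf) - / (W + hf))) <= / 2 * (/ (k * k) * / (D * D) * / (X * X))).
    { intros W x Hx EW N1 N2 N3.
      assert (Hp : (W * W * ((W - hf) * (W + hf)))%C <> 0%C) by (repeat apply Cmult_neq_0; auto).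
      replace (/ (W * W) - (/ (W - hf) - / (W + hf)))%C
        with (- RtoC (/ 4) * / (W * W * ((W - hf) * (W + hf))))%C.
      2:{ rewrite <- Hhf.
          assert (E2 : (2 * hf = 1)%C) by (unfold hf; rewrite <- RtoC_mult; f_equal; field).
          replace (/ (W - hf) - / (W + hf))%C with ((2 * hf) * / ((W - hf) * (W + hf)))%C by (field; auto).
          rewrite E2. field. auto. }
      rewrite Cmod_mult, Cmod_opp, Cmod_R, (Rabs_right (/4)), Cmod_inv by (auto; lra).
      assert (M1 : k * (2 * (D * X)) <= Cmod (W * W)).
      { rewrite Cmod_mult, EW. eapply Rle_trans; [|apply HL]. apply Rmult_le_compat_l; [lra|].
        fold D. destruct Hx as [->| ->]; lra. }
      assert (M2 : k * (D * X) <= Cmod ((W - hf) * (W + hf))).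
      { assert (Q : forall e, (e = / 2 \/ e = - / 2) -> k * (D * X) <= Cmod (W + RtoC e) * Cmod (W + RtoC e)).
        { intros e Hee. rewrite EW, <- Cplus_assoc, <- RtoC_plus.
          eapply Rle_trans; [|apply HL]. apply Rmult_le_compat_l; [lra|]. fold D.
          destruct Hx as [->| ->]; destruct Hee as [->| ->]; lra. }
        assert (Q1 := Q _ (or_introl eq_refl)). assert (Q2 := Q _ (or_intror eq_refl)).
        rewrite RtoC_opp in Q2. rewrite Cmod_mult. fold hf in Q1, Q2.
        change (W - hf)%C with (W + - hf)%C.
        assert (P1 := Cmod_ge_0 (W + hf)). assert (P2 := Cmod_ge_0 (W + - hf)).
        assert (0 < k * (D * X)) by (apply Rmult_lt_0_compat; nra).
        apply Rsqr_incr_0_var; [|nra]. unfold Rsqr.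
        replace (Cmod (W + - hf) * Cmod (W + hf) * (Cmod (W + - hf) * Cmod (W + hf)))
          with (Cmod (W + hf) * Cmod (W + hf) * (Cmod (W + - hf) * Cmod (W + - hf))) by ring.
        apply Rmult_le_compat; lra. }
      assert (P0 : 0 < k * (D * X)) by (apply Rmult_lt_0_compat; nra).
      rewrite Cmod_mult.
      apply Rle_trans with (/ 4 * / (k * (2 * (D * X)) * (k * (D * X)))).
      - apply Rmult_le_compat_l; [lra|]. apply Rinv_le_contravar.
        + replace (k * (2 * (D * X)) * (k * (D * X))) with (2 * ((k * (D * X)) * (k * (D * X)))) by ring. nra.
        + apply Rmult_le_compat; lra.
      - apply Rle_trans with (/ 8 * (/ (k * k) * / (D * D) * / (X * X))); [right; field; lra|].
        apply Rmult_le_compat_r; [|lra].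
        assert (0 < k * k) by nra. assert (0 < D * D) by nra. assert (0 < X * X) by nra.
        repeat apply Rmult_le_pos; left; apply Rinv_0_lt_compat; auto. }
    unfold B, b. destruct (NEp d c) as [A1 [A2 A3]]. destruct (NEm d c) as [A4 [A5 A6]].
    replace (/ (Wp d c * Wp d c) + / (Wm d c * Wm d c) - (/ (Wp d c - hf) - / (Wp d c + hf) + (/ (Wm d c - hf) - / (Wm d c + hf))))%C
      with ((/ (Wp d c * Wp d c) - (/ (Wp d c - hf) - / (Wp d c + hf))) + (/ (Wm d c * Wm d c) - (/ (Wm d c - hf) - / (Wm d c + hf))))%C by ring.
    eapply Rle_trans; [apply Cmod_triangle|].
    assert (G1 := G (Wp d c) X (or_introl eq_refl) eq_refl A1 A2 A3).
    assert (G2 := G (Wm d c) (- X) (or_intror eq_refl) ltac:(rewrite RtoC_opp; reflexivity) A4 A5 A6).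
    lra. }
  assert (Z2 := zeta2).
  assert (SR : clim (csum (fun d => csc2 (nS d * z) - / (nS d * z * (nS d * z)) - H d (/ 2)%R)%C)
                    (T - / (z * z) * RtoC (PI * PI / 6) - h (/ 2)%R)%C).
  { assert (L := clim_minus _ _ _ _ (clim_minus _ _ _ _ HT (clim_scal (/ (z * z))%C _ _ Z2)) (Ch (/ 2)%R ltac:(lra))).
    apply clim_ext with (2 := L). intros n. rewrite <- csum_scal, <- !csum_minus.
    apply csum_ext. intros d _. f_equal. f_equal. unfold isq. fold (nS d).
    specialize (HnS d). field. auto. }
  (* The cotangent term tends to -pi i high in the upper half-plane; this limit of [h] is the term
     that breaks modularity. *)
  assert (Hinf : clim (fun n => h (INR n + / 2)%R) (RtoC PI * Ci / z)%C).
  { set (y := Im (- / z)). assert (Hy : 0 < y) by (apply Im_neg_inv_pos; auto).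
    assert (L1 : clim (fun n => ct (- RtoC (INR n + / 2)%R / z)%C) (- (RtoC PI * Ci))%C).
    { intros eps He. destruct (inv_INR_small (4 / y) eps He) as [N HN]. exists (S N). intros n Hn.
      destruct n as [|n]; [lia|]. specialize (HN n ltac:(lia)). assert (Hp := nS_pos n).
      assert (Ew : (- RtoC (INR (S n) + / 2)%R / z)%C = (RtoC (INR (S n) + / 2)%R * - / z)%C) by (field; auto).
      assert (Him : Im (- RtoC (INR (S n) + / 2)%R / z)%C = (INR (S n) + / 2) * y) by (rewrite Ew, Im_scal; reflexivity).
      eapply Rle_lt_trans; [apply ct_at_infinity|].
      - rewrite Him. nra.
      - rewrite Him. eapply Rle_lt_trans; [|apply HN].
        replace (4 / y / INR (S n)) with (2 * / (INR (S n) * y / 2)) by (field; lra).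
        unfold Rdiv at 1. apply Rmult_le_compat_l; [lra|]. apply Rinv_le_contravar; nra. }
    assert (L2 : clim (fun n => / (- RtoC (INR n + / 2)%R / z))%C (RtoC 0)).
    { assert (L := clim_scal (- z)%C _ _ (clim_inv_far (- hf)%C 1%C (or_introl eq_refl))).
      intros eps He. destruct (inv_INR_small (Cmod z) eps He) as [N HN]. exists (S N). intros n Hn.
      destruct n as [|n]; [lia|]. specialize (HN n ltac:(lia)). assert (Hp := nS_pos n).
      assert (Hx : RtoC (INR (S n) + / 2)%R <> 0%C).
      { intros E. apply (f_equal Re) in E. rewrite !Re_RtoC in E. lra. }
      replace (/ (- RtoC (INR (S n) + / 2)%R / z) - 0)%C with (- z * / RtoC (INR (S n) + / 2)%R)%C by (field; auto).
      rewrite Cmod_mult, Cmod_opp, Cmod_inv, Cmod_R, Rabs_right by (auto; lra).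
      eapply Rle_lt_trans; [|apply HN]. apply Rmult_le_compat_l; [apply Cmod_ge_0|].
      apply Rinv_le_contravar; lra. }
    assert (L := clim_scal (- / z)%C _ _ (clim_minus _ _ _ _ L1 L2)).
    replace (RtoC PI * Ci / z)%C with (- / z * (- (RtoC PI * Ci) - 0))%C by (field; auto).
    exact L. }
  assert (SC : clim (csum (fun c => / (z * z) * csc2 (nS c * - / z) - / (nS c * nS c)
                      - (h (INR (S c) - / 2)%R - h (INR (S c) + / 2)%R))%C)
                    (/ (z * z) * T' - RtoC (PI * PI / 6) - (h (/ 2)%R - RtoC PI * Ci / z))%C).
  { assert (L := clim_minus _ _ _ _ (clim_minus _ _ _ _ (clim_scal (/ (z * z))%C _ _ HT') Z2)
       (clim_minus _ _ _ _ (clim_const (h (/ 2)%R)) Hinf)).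
    apply clim_ext with (2 := L). intros n. cbv beta.
    assert (Et : (h (/ 2)%R - h (INR n + / 2)%R)%C = csum (fun c => h (INR (S c) - / 2)%R - h (INR (S c) + / 2)%R)%C n).
    { rewrite (csum_ext _ (fun c => h (INR c + / 2)%R - h (INR (S c) + / 2)%R)%C).
      - rewrite csum_telescope. simpl INR. rewrite Rplus_0_l. reflexivity.
      - intros c _. rewrite S_INR. replace (INR c + 1 - / 2) with (INR c + / 2)%R by field. reflexivity. }
    rewrite Et, <- csum_scal, <- !csum_minus. reflexivity. }
  assert (Fin := csum_double_swap (fun d c => B d c - b d c)%C
    (fun d => / (k * k) * / (INR (S d) * INR (S d))) (fun c => / (INR (S c) * INR (S c))) _ _ _ _
    (rsummable_inv_sq (/ (k * k)) ltac:(left; apply Rinv_0_lt_compat; nra))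
    ltac:(exists 2; apply rsum_inv_sq_le)
    ltac:(intros j; apply Rmult_le_pos; left; apply Rinv_0_lt_compat; [nra|generalize (nS_pos j); nra])
    ltac:(intros j; left; apply Rinv_0_lt_compat; generalize (nS_pos j); nra)
    Dom
    ltac:(intros d; apply clim_ext with (2 := clim_minus _ _ _ _ (RB d) (Rb d)); intros n; cbv beta; rewrite csum_minus; reflexivity)
    ltac:(intros c; apply clim_ext with (2 := clim_minus _ _ _ _ (CB c) (Cb c)); intros n; cbv beta; rewrite csum_minus; reflexivity)
    SR SC).
  assert (Fin2 : (/ (z * z) * T')%C = ((/ (z * z) * T' - RtoC (PI * PI / 6) - (h (/ 2)%R - RtoC PI * Ci / z))
     + RtoC (PI * PI / 6) + (h (/ 2)%R - RtoC PI * Ci / z))%C) by ring.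
  rewrite Fin2, <- Fin. ring.
Qed.

(** * The discriminant *)

(** A total choice of limit, so that [lams] is a function; its value carries meaning for convergent
    sequences, through [clim_val_eq]. *)
Definition clim_val (u : nat -> C) : C :=
  (real (Lim_seq (fun n => Re (u n))), real (Lim_seq (fun n => Im (u n)))).

Lemma clim_val_eq (u : nat -> C) (l : C) : clim u l -> clim_val u = l.
Proof.
  intros H. unfold clim_val. destruct l as [x y].
  assert (HR : is_lim_seq (fun n => Re (u n)) x).
  { apply is_lim_seq_Reals. intros eps He. destruct (H eps He) as [N HN]. exists N. intros n Hn.
    unfold Rdist. eapply Rle_lt_trans; [|apply (HN n Hn)].
    assert (Q := Cmod_Re_le (u n - (x, y))). rewrite Re_minus in Q. exact Q. }
  assert (HI : is_lim_seq (fun n => Im (u n)) y).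
  { apply is_lim_seq_Reals. intros eps He. destruct (H eps He) as [N HN]. exists N. intros n Hn.
    unfold Rdist. eapply Rle_lt_trans; [|apply (HN n Hn)].
    assert (Q := Cmod_Im_le (u n - (x, y))). rewrite Im_minus in Q. exact Q. }
  rewrite (is_lim_seq_unique _ _ HR), (is_lim_seq_unique _ _ HI). reflexivity.
Qed.

Lemma qpar_plus (a b : C) : qpar (a + b) = (qpar a * qpar b)%C.
Proof. unfold qpar. rewrite <- Cexp_plus. f_equal. ring. Qed.

Lemma qpar_neq_0 (z : C) : qpar z <> 0%C.
Proof. apply Cexp_neq_0. Qed.

Lemma qpar_nat (n : nat) (z : C) : qpar (RtoC (INR n) * z) = (qpar z ^ n)%C.
Proof. unfold qpar. rewrite <- Cexp_nat. f_equal. ring. Qed.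

Lemma Cmod_qpar (z : C) : Cmod (qpar z) = exp (- (2 * PI * Im z)).
Proof. unfold qpar. rewrite Cmod_Cexp. f_equal. simpl. unfold Im. ring. Qed.

Lemma exp_le (x y : R) : x <= y -> exp x <= exp y.
Proof. intros [H|H]; [left; apply exp_increasing; auto|rewrite H; lra]. Qed.

Lemma exp_lt_1 (x : R) : x < 0 -> exp x < 1.
Proof. intros H. rewrite <- exp_0. apply exp_increasing. auto. Qed.

Lemma exp_pow (x : R) (n : nat) : exp x ^ n = exp (INR n * x).
Proof.
  induction n as [|n IH]; [simpl; rewrite Rmult_0_l, exp_0; auto|].
  rewrite S_INR. simpl. rewrite IH, <- exp_plus. f_equal. ring.
Qed.

Lemma Cmod_qpar_le (A : R) (z : C) : A <= Im z -> Cmod (qpar z) <= exp (- (2 * PI * A)).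
Proof. intros H. rewrite Cmod_qpar. apply exp_le. assert (HPI := PI_RGT_0). nra. Qed.

Lemma Cmod_qpar_lt_1 (z : C) : 0 < Im z -> Cmod (qpar z) < 1.
Proof. intros H. rewrite Cmod_qpar. apply exp_lt_1. assert (HPI := PI_RGT_0). nra. Qed.

Lemma one_minus_neq_0 (u : C) : Cmod u < 1 -> (1 - u)%C <> 0%C.
Proof.
  intros H. apply Cmod_neq_0. assert (H1 := Cmod_sub_ge 1 u). rewrite Cmod_1 in H1. lra.
Qed.

Lemma Cmod_inv_one_minus (u : C) (r : R) : Cmod u <= r -> r < 1 -> Cmod (/ (1 - u)) <= / (1 - r).
Proof.
  intros H Hr. assert (H1 := Cmod_sub_ge 1 u). rewrite Cmod_1 in H1.
  rewrite Cmod_inv by (apply one_minus_neq_0; lra). apply Rinv_le_contravar; lra.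
Qed.

Lemma csc2_qpar (w : C) : 0 < Im w ->
  csc2 w = (RtoC (-4 * (PI * PI)) * (qpar w / ((1 - qpar w) * (1 - qpar w))))%C.
Proof.
  intros Hw. unfold csc2, sn. rewrite Cexp_opp.
  assert (E : qpar w = (Cexp (RtoC PI * Ci * w) * Cexp (RtoC PI * Ci * w))%C).
  { unfold qpar. rewrite <- Cexp_plus. f_equal. rewrite RtoC_mult. ring. }
  assert (N1 := one_minus_neq_0 _ (Cmod_qpar_lt_1 w Hw)).
  rewrite E in *. set (e := Cexp (RtoC PI * Ci * w)) in *.
  assert (He : e <> 0%C) by apply Cexp_neq_0.
  assert (N2 : (e * e - 1)%C <> 0%C).
  { intros H. apply N1. replace (1 - e * e)%C with (- (e * e - 1))%C by ring. rewrite H. ring. }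
  field. repeat split; auto.
Qed.

(** With n = d + 1, the terms q^n/(n (1 - q^n)) add up to -log prod (1 - q^n): expand each logarithm
    and exchange the sums. Hence [Lam] is a logarithm of the discriminant for which no branch has to
    be chosen. *)
Definition lamt (d : nat) (z : C) : C :=
  (/ nS d * (qpar z ^ S d / (1 - qpar z ^ S d)))%C.

Definition lams (z : C) : C := clim_val (csum (fun d => lamt d z)).

Definition Lam (z : C) : C := (RtoC (2 * PI) * Ci * z - 24 * lams z)%C.

(* [Dmod z] is the absolute value of the discriminant q prod (1-q^n)^24 at z. *)
Definition Dmod (z : C) : R := exp (Re (Lam z)).

Lemma Cmod_nS_inv (d : nat) : Cmod (/ nS d) = / INR (S d).
Proof.
  assert (H := nS_pos d). unfold nS. rewrite <- RtoC_inv, Cmod_R by lra.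
  apply Rabs_right. left. apply Rinv_0_lt_compat. lra.
Qed.

Lemma lamt_bound (d : nat) (z : C) (r : R) : Cmod (qpar z) <= r -> r < 1 ->
  Cmod (lamt d z) <= r / (1 - r) * r ^ d.
Proof.
  intros H Hr. assert (H0 : 0 <= r) by (eapply Rle_trans; [apply Cmod_ge_0|apply H]).
  assert (Hp : Cmod (qpar z ^ S d) <= r ^ S d).
  { rewrite Cmod_pow. apply pow_incr. split; auto using Cmod_ge_0. }
  assert (Hrd : 0 <= r ^ d <= 1).
  { split; [apply pow_le; auto|]. rewrite <- (pow1 d). apply pow_incr. lra. }
  assert (Hr1 : r ^ S d <= r) by (simpl; nra).
  unfold lamt, Cdiv. rewrite !Cmod_mult, Cmod_nS_inv.
  assert (H1 := Cmod_inv_one_minus (qpar z ^ S d) r ltac:(lra) Hr).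
  assert (H2 : / INR (S d) <= 1).
  { rewrite <- Rinv_1. apply Rinv_le_contravar; [lra|apply nS_pos]. }
  assert (H3 : 0 < / INR (S d)) by (apply Rinv_0_lt_compat; generalize (nS_pos d); lra).
  apply Rle_trans with (1 * (r ^ S d * / (1 - r))).
  - apply Rmult_le_compat; auto; [lra| |].
    + apply Rmult_le_pos; apply Cmod_ge_0.
    + apply Rmult_le_compat; auto using Cmod_ge_0.
  - simpl. right. unfold Rdiv. ring.
Qed.

Lemma rsummable_geom (c r : R) : 0 <= c -> 0 <= r < 1 -> rsummable (fun d => c * r ^ d).
Proof.
  intros Hc Hr. exists (c * / (1 - r)). intros n. rewrite rsum_scal.
  apply Rmult_le_compat_l; auto. apply rsum_geom_le; auto.
Qed.

Lemma lams_cv (z : C) : 0 < Im z -> clim (csum (fun d => lamt d z)) (lams z).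
Proof.
  intros Hz. assert (Hr := Cmod_qpar_lt_1 z Hz). assert (H0 := Cmod_ge_0 (qpar z)).
  destruct (csum_cv (fun d => lamt d z) (fun d => Cmod (qpar z) / (1 - Cmod (qpar z)) * Cmod (qpar z) ^ d)) as [l Hl].
  - intros d. apply lamt_bound; auto. lra.
  - apply rsummable_geom; auto. apply Rmult_le_pos; auto. left. apply Rinv_0_lt_compat. lra.
  - unfold lams. rewrite (clim_val_eq _ _ Hl). auto.
Qed.

Lemma lams_bound (z : C) (r : R) : 0 < Im z -> Cmod (qpar z) <= r -> r < 1 ->
  Cmod (lams z) <= r / ((1 - r) * (1 - r)).
Proof.
  intros Hz H Hr. assert (H0 : 0 <= r) by (eapply Rle_trans; [apply Cmod_ge_0|apply H]).
  apply (clim_norm_le _ _ _ (lams_cv z Hz)). intros n.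
  eapply Rle_trans; [apply Cmod_csum_le; intros j _; apply (lamt_bound j z r); auto|].
  rewrite rsum_scal. unfold Rdiv. rewrite Rinv_mult, <- Rmult_assoc.
  apply Rmult_le_compat_l; [apply Rmult_le_pos; auto; left; apply Rinv_0_lt_compat; lra|].
  apply rsum_geom_le. lra.
Qed.

Lemma Dmod_pos (z : C) : 0 < Dmod z.
Proof. apply exp_pos. Qed.

Lemma Dmod_alt (z : C) : Dmod z = Cmod (qpar z) * Cmod (Cexp (- (24 * lams z))).
Proof.
  rewrite Cmod_qpar, Cmod_Cexp. unfold Dmod, Lam. rewrite <- exp_plus. f_equal.
  rewrite Re_minus, Re_opp. simpl. unfold Re, Im. ring.
Qed.

Lemma Dmod_bounds (z : C) (r : R) : 0 < Im z -> Cmod (qpar z) <= r -> r < 1 ->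
  exp (- (24 * (r / ((1 - r) * (1 - r))))) * Cmod (qpar z) <= Dmod z <=
  exp (24 * (r / ((1 - r) * (1 - r)))) * Cmod (qpar z).
Proof.
  intros Hz H Hr. assert (HB := lams_bound z r Hz H Hr).
  assert (HR := Cmod_Re_le (lams z)). apply Rabs_le_between in HR.
  rewrite Dmod_alt, Cmod_Cexp, (Rmult_comm (Cmod (qpar z)) (exp (Re _))).
  assert (E : Re (- (24 * lams z)) = - (24 * Re (lams z))).
  { rewrite Re_opp. rewrite Re_scal. ring. }
  rewrite E. split.
  - apply Rmult_le_compat_r; [apply Cmod_ge_0|]. apply exp_le. lra.
  - apply Rmult_le_compat_r; [apply Cmod_ge_0|]. apply exp_le. lra.
Qed.

(** The factor exp |X| makes both bounds global; in the use below it is absorbed by the decay of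
    q^n. *)
Lemma Cexp_minus_1_bound (X : C) : Cmod (Cexp X - 1) <= 4 * Cmod X * exp (Cmod X) /\
  Cmod (Cexp X - 1 - X) <= 8 * (Cmod X * Cmod X) * exp (Cmod X).
Proof.
  assert (H0 := Cmod_ge_0 X). assert (H1 := exp_ineq1_le (Cmod X)).
  destruct (Rle_dec (Cmod X) (1 / 2)) as [H|H].
  - assert (HQ := Cexp_quad_bound X H). split.
    + replace (Cexp X - 1)%C with ((Cexp X - 1 - X) + X)%C by ring.
      eapply Rle_trans; [apply Cmod_triangle|].
      assert (4 * Cmod X * 1 <= 4 * Cmod X * exp (Cmod X)) by (apply Rmult_le_compat_l; lra). nra.
    + assert (0 <= Cmod X * Cmod X) by nra.
      assert (8 * (Cmod X * Cmod X) * 1 <= 8 * (Cmod X * Cmod X) * exp (Cmod X)) by (apply Rmult_le_compat_l; lra).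
      lra.
  - assert (HE : Cmod (Cexp X) <= exp (Cmod X)).
    { rewrite Cmod_Cexp. apply exp_le. eapply Rle_trans; [apply Rle_abs|apply Cmod_Re_le]. }
    assert (H2 : Cmod (Cexp X - 1) <= 2 * exp (Cmod X)).
    { eapply Rle_trans; [apply Cmod_sub_triangle|]. rewrite Cmod_1. lra. }
    assert (Hp := exp_pos (Cmod X)). split.
    + eapply Rle_trans; [apply H2|]. apply Rmult_le_compat_r; lra.
    + eapply Rle_trans; [apply Cmod_sub_triangle|].
      assert (2 * exp (Cmod X) <= 8 * (Cmod X * Cmod X) * exp (Cmod X)) by (apply Rmult_le_compat_r; nra).
      assert (Cmod (Cexp X - 1) + Cmod X <= 2 * exp (Cmod X)).
      { assert (Cmod (Cexp X - 1) <= exp (Cmod X) + 1)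
          by (eapply Rle_trans; [apply Cmod_sub_triangle|]; rewrite Cmod_1; lra). lra. }
      lra.
Qed.

(** Each t^j with j < n is at least t^n, so n t^n is below the geometric series. *)
Lemma n_pow_le (t : R) (n : nat) : 0 <= t < 1 -> INR n * t ^ n <= / (1 - t).
Proof.
  intros Ht. eapply Rle_trans; [|apply (rsum_geom_le t n Ht)].
  rewrite <- rsum_const. apply rsum_le. intros j Hj.
  replace n with (j + (n - j))%nat by lia. rewrite pow_add.
  assert (0 <= t ^ j) by (apply pow_le; lra).
  assert (t ^ (n - j) <= 1) by (rewrite <- (pow1 (n - j)); apply pow_incr; lra). nra.
Qed.

Definition lamt' (d : nat) (z : C) : C :=
  (RtoC (2 * PI) * Ci * (qpar z ^ S d / ((1 - qpar z ^ S d) * (1 - qpar z ^ S d))))%C.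

(** A shift |h| <= A/2 costs at most half of the decay of q^n, which is why s is exp(-pi A) and not
    exp(-2 pi A). *)
Lemma lamt_quad (A : R) (d : nat) (z h : C) : 0 < A -> A <= Im z -> Cmod h <= A / 2 ->
  let s := exp (- (PI * A)) in
  Cmod (lamt d (z + h) - lamt d z - lamt' d z * h) <=
    20 * (4 * (PI * PI)) * (/ (1 - s) * / (1 - s) * / (1 - s)) * (INR (S d) * s ^ S d) * (Cmod h * Cmod h).
Proof.
  intros HA Hz Hh s. assert (HPI := PI_RGT_0).
  assert (Hs : 0 < s < 1) by (split; [apply exp_pos|apply exp_lt_1; nra]).
  assert (Hn := nS_pos d). set (n := INR (S d)) in *.
  set (U := (qpar z ^ S d)%C). set (X := (RtoC (2 * PI) * Ci * (nS d * h))%C).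
  assert (EU' : (qpar (z + h) ^ S d = U * Cexp X)%C).
  { rewrite qpar_plus, Cpow_mult_l. fold U. f_equal.
    rewrite <- qpar_nat. unfold qpar, X, nS. f_equal. ring. }
  assert (HX : Cmod X = 2 * PI * n * Cmod h).
  { unfold X, nS. rewrite !Cmod_mult, Cmod_Ci, !Cmod_R, (Rabs_right (2 * PI)), (Rabs_right (INR (S d))).
    - fold n. ring. - fold n. lra. - lra. }
  assert (Hh0 := Cmod_ge_0 h). assert (HX0 := Cmod_ge_0 X).
  assert (HU : Cmod U * exp (Cmod X) <= s ^ S d).
  { unfold U. rewrite Cmod_pow, Cmod_qpar, exp_pow, <- exp_plus, HX. unfold s. rewrite exp_pow. fold n.
    apply exp_le. assert (n * (2 * PI * A) <= n * (2 * PI * Im z)).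
    { apply Rmult_le_compat_l; [lra|]. apply Rmult_le_compat_l; lra. }
    assert (2 * PI * n * Cmod h <= 2 * PI * n * (A / 2)).
    { apply Rmult_le_compat_l; [nra|lra]. } nra. }
  assert (HE1 : 1 <= exp (Cmod X)) by (generalize (exp_ineq1_le (Cmod X)); lra).
  assert (HU0 := Cmod_ge_0 U).
  assert (Hsd : s ^ S d <= s).
  { simpl. assert (s ^ d <= 1) by (rewrite <- (pow1 d); apply pow_incr; lra). nra. }
  assert (HU1 : Cmod U <= s) by nra.
  assert (HU2 : Cmod (U * Cexp X) <= s).
  { rewrite Cmod_mult, Cmod_Cexp. assert (exp (Re X) <= exp (Cmod X)).
    { apply exp_le. eapply Rle_trans; [apply Rle_abs|apply Cmod_Re_le]. }
    assert (0 < exp (Re X)) by apply exp_pos. nra. }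
  assert (I1 := Cmod_inv_one_minus U s HU1 (proj2 Hs)).
  assert (I2 := Cmod_inv_one_minus _ s HU2 (proj2 Hs)).
  assert (N1 := one_minus_neq_0 U ltac:(lra)). assert (N2 := one_minus_neq_0 (U * Cexp X) ltac:(lra)).
  assert (Nn : nS d <> 0%C).
  { intros E. apply (f_equal Re) in E. unfold nS in E. rewrite !Re_RtoC in E. fold n in E. lra. }
  destruct (Cexp_minus_1_bound X) as [B1 B2].
  unfold lamt, lamt'. fold U. rewrite EU'.
  replace (/ nS d * (U * Cexp X / (1 - U * Cexp X)) - / nS d * (U / (1 - U)) -
    RtoC (2 * PI) * Ci * (U / ((1 - U) * (1 - U))) * h)%C
    with (/ nS d * ((U * (Cexp X - 1 - X) * (1 - U) + U * X * (U * (Cexp X - 1)))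
      * (/ (1 - U) * / (1 - U) * / (1 - U * Cexp X))))%C.
  2:{ assert (EX : (RtoC (2 * PI) * Ci * (U / ((1 - U) * (1 - U))) * h)%C
        = (/ nS d * (X * (U / ((1 - U) * (1 - U)))))%C) by (unfold X; field; auto).
      rewrite EX. field. repeat split; auto. }
  rewrite !Cmod_mult, Cmod_nS_inv. fold n.
  assert (Hin : 0 < / n) by (apply Rinv_0_lt_compat; lra).
  assert (Hmain : Cmod (U * (Cexp X - 1 - X) * (1 - U) + U * X * (U * (Cexp X - 1))) <= 20 * (s ^ S d * (Cmod X * Cmod X))).
  { eapply Rle_trans; [apply Cmod_triangle|]. rewrite !Cmod_mult.
    assert (M1 : Cmod (1 - U) <= 2).
    { eapply Rle_trans; [apply Cmod_sub_triangle|]. rewrite Cmod_1. lra. }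
    assert (T1 : Cmod U * Cmod (Cexp X - 1 - X) <= 8 * (s ^ S d * (Cmod X * Cmod X))).
    { apply Rle_trans with (Cmod U * (8 * (Cmod X * Cmod X) * exp (Cmod X))).
      - apply Rmult_le_compat_l; auto.
      - replace (Cmod U * (8 * (Cmod X * Cmod X) * exp (Cmod X)))
          with (Cmod U * exp (Cmod X) * (8 * (Cmod X * Cmod X))) by ring.
        apply Rle_trans with (s ^ S d * (8 * (Cmod X * Cmod X))); [|right; ring].
        apply Rmult_le_compat_r; auto. nra. }
    assert (T2 : Cmod U * Cmod (Cexp X - 1) <= 4 * (s ^ S d * Cmod X)).
    { apply Rle_trans with (Cmod U * (4 * Cmod X * exp (Cmod X))).
      - apply Rmult_le_compat_l; auto.
      - replace (Cmod U * (4 * Cmod X * exp (Cmod X))) with (Cmod U * exp (Cmod X) * (4 * Cmod X)) by ring.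
        apply Rle_trans with (s ^ S d * (4 * Cmod X)); [|right; ring].
        apply Rmult_le_compat_r; auto. nra. }
    assert (T3 : Cmod U * Cmod (Cexp X - 1 - X) * Cmod (1 - U) <= 8 * (s ^ S d * (Cmod X * Cmod X)) * 2).
    { apply Rmult_le_compat; auto using Cmod_ge_0. apply Rmult_le_pos; auto using Cmod_ge_0. }
    assert (T4 : Cmod U * Cmod X * (Cmod U * Cmod (Cexp X - 1)) <= 1 * Cmod X * (4 * (s ^ S d * Cmod X))).
    { apply Rmult_le_compat; auto.
      - apply Rmult_le_pos; auto.
      - apply Rmult_le_pos; auto using Cmod_ge_0.
      - apply Rmult_le_compat_r; lra. }
    lra. }
  apply Rle_trans with (/ n * (20 * (s ^ S d * (Cmod X * Cmod X)) * (/ (1 - s) * / (1 - s) * / (1 - s)))).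
  - apply Rmult_le_compat_l; [lra|]. apply Rmult_le_compat; auto using Cmod_ge_0.
    + repeat apply Rmult_le_pos; apply Cmod_ge_0.
    + apply Rmult_le_compat; auto using Cmod_ge_0.
      * apply Rmult_le_pos; apply Cmod_ge_0.
      * apply Rmult_le_compat; auto using Cmod_ge_0.
  - right. rewrite HX. field. split; lra.
Qed.

(** The derivative of [lams] is -i/(2 pi) times the sum of the [csc2 (n z)]. It is recorded as a
    first-order expansion with a uniform quadratic remainder, the only form of differentiability
    used. *)
Lemma lams_quad (A : R) : 0 < A -> exists K, 0 <= K /\ forall z h T, A <= Im z -> Cmod h <= A / 2 ->
  clim (csum (fun d => csc2 (nS d * z)%C)) T ->
  Cmod (lams (z + h) - lams z + Ci / RtoC (2 * PI) * T * h) <= K * (Cmod h * Cmod h).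
Proof.
  intros HA. assert (HPI := PI_RGT_0). set (s := exp (- (PI * A))).
  assert (Hs : 0 < s < 1) by (split; [apply exp_pos|apply exp_lt_1; nra]).
  set (c := 20 * (4 * (PI * PI)) * (/ (1 - s) * / (1 - s) * / (1 - s))).
  assert (Hi : 0 < / (1 - s)) by (apply Rinv_0_lt_compat; lra).
  assert (Hc : 0 <= c).
  { unfold c. assert (0 < / (1 - s) * / (1 - s)) by nra. assert (0 < PI * PI) by nra.
    assert (0 < / (1 - s) * / (1 - s) * / (1 - s)) by nra. nra. }
  set (t := exp (- (PI * A / 2))).
  assert (Ht : 0 < t < 1) by (split; [apply exp_pos|apply exp_lt_1; nra]).
  assert (Est : s = t * t) by (unfold s, t; rewrite <- exp_plus; f_equal; field).
  assert (Hnt : forall n, INR n * s ^ n <= / (1 - t) * t ^ n).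
  { intros n. rewrite Est, Rpow_mult_distr, <- Rmult_assoc.
    apply Rmult_le_compat_r; [apply pow_le; lra|]. apply n_pow_le; lra. }
  exists (c * (/ (1 - t) * / (1 - t))).
  assert (Hti : 0 < / (1 - t)) by (apply Rinv_0_lt_compat; lra).
  split; [apply Rmult_le_pos; auto; nra|].
  intros z h T Hz Hh HT. assert (Hh0 := Cmod_ge_0 h).
  assert (Hzh : 0 < Im (z + h)).
  { rewrite Im_plus. assert (Q := Cmod_Im_le h). apply Rabs_le_between in Q. lra. }
  assert (Hz0 : 0 < Im z) by lra.
  assert (HPIc : RtoC PI <> 0%C) by (intros E; apply (f_equal Re) in E; rewrite !Re_RtoC in E; lra).
  assert (L := clim_plus _ _ _ _ (clim_minus _ _ _ _ (lams_cv _ Hzh) (lams_cv _ Hz0))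
     (clim_scal (Ci / RtoC (2 * PI) * h)%C _ _ HT)).
  replace (lams (z + h) - lams z + Ci / RtoC (2 * PI) * T * h)%C
    with (lams (z + h) - lams z + Ci / RtoC (2 * PI) * h * T)%C by ring.
  apply (clim_norm_le _ _ _ L). intros n. cbv beta.
  rewrite <- csum_scal, <- csum_minus, <- csum_plus.
  eapply Rle_trans; [apply Cmod_csum_le with (M := fun d => c * (/ (1 - t) * t ^ d) * (Cmod h * Cmod h))|].
  - intros d _.
    assert (HI : 0 < Im (nS d * z)).
    { unfold nS. rewrite Im_scal. generalize (nS_pos d). nra. }
    replace (lamt d (z + h) - lamt d z + Ci / RtoC (2 * PI) * h * csc2 (nS d * z))%C
      with (lamt d (z + h) - lamt d z - lamt' d z * h)%C.
    + eapply Rle_trans; [apply (lamt_quad A); auto|]. fold s. fold c.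
      apply Rmult_le_compat_r; [nra|]. apply Rmult_le_compat_l; auto.
      eapply Rle_trans; [apply Hnt|]. apply Rmult_le_compat_l; [lra|].
      simpl. assert (0 <= t ^ d) by (apply pow_le; lra). nra.
    + rewrite csc2_qpar by auto. unfold nS. rewrite qpar_nat. unfold lamt'.
      assert (N1 : (1 - qpar z ^ S d)%C <> 0%C).
      { apply one_minus_neq_0. rewrite <- qpar_nat. apply Cmod_qpar_lt_1. exact HI. }
      rewrite !RtoC_mult.
      replace (Ci / (RtoC 2 * RtoC PI) * h * (RtoC (-4) * (RtoC PI * RtoC PI) * (qpar z ^ S d / ((1 - qpar z ^ S d) * (1 - qpar z ^ S d)))))%C
        with (- (RtoC 2 * RtoC PI * Ci * (qpar z ^ S d / ((1 - qpar z ^ S d) * (1 - qpar z ^ S d))) * h))%C; [ring|].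
      field. split; auto.
  - assert (E : rsum (fun d => c * (/ (1 - t) * t ^ d) * (Cmod h * Cmod h)) n
       = (c * / (1 - t) * (Cmod h * Cmod h)) * rsum (fun d => t ^ d) n).
    { rewrite <- rsum_scal. apply Rle_antisym; apply rsum_le; intros; lra. }
    rewrite E. apply Rle_trans with ((c * / (1 - t) * (Cmod h * Cmod h)) * / (1 - t)); [|right; ring].
    apply Rmult_le_compat_l; [|apply rsum_geom_le; lra].
    apply Rmult_le_pos; [apply Rmult_le_pos; lra|nra].
Qed.

Lemma E2_sum_cv (z : C) : 0 < Im z ->
  exists T, clim (csum (fun d => csc2 (nS d * z)%C)) T /\ Cmod T <= 2 * / (Im z * Im z).
Proof.
  intros Hz.
  assert (HB : forall d, Cmod (csc2 (nS d * z)) <= / (Im z * Im z) * / (INR (S d) * INR (S d))).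
  { intros d. assert (H := nS_pos d).
    assert (E : Im (nS d * z) = INR (S d) * Im z) by (unfold nS; apply Im_scal).
    eapply Rle_trans; [apply csc2_bound; rewrite E; nra|]. rewrite E. right. field. split; nra. }
  destruct (csum_cv (fun d => csc2 (nS d * z)%C) _ HB) as [T HT].
  { apply rsummable_inv_sq. left. apply Rinv_0_lt_compat. nra. }
  exists T. split; auto. apply (clim_norm_le _ _ _ HT). intros n.
  eapply Rle_trans; [apply Cmod_csum_le; intros j _; apply HB|].
  rewrite rsum_scal, Rmult_comm. apply Rmult_le_compat_r; [left; apply Rinv_0_lt_compat; nra|].
  apply rsum_inv_sq_le.
Qed.

(** Squaring the modulus reduces the claim to the real logarithm of 1 + x with x = 2 Re s +
    |s|^2. *)
Lemma ln_quad (s : C) : Cmod s <= / 5 -> Rabs (ln (Cmod (1 + s)) - Re s) <= 10 * (Cmod s * Cmod s).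
Proof.
  intros Hs. assert (H0 := Cmod_ge_0 s). assert (HR := Cmod_Re_le s). apply Rabs_le_between in HR.
  assert (Hp : 0 < Cmod (1 + s)).
  { assert (H := Cmod_plus_ge 1 s). rewrite Cmod_1 in H. lra. }
  set (x := 2 * Re s + Cmod s * Cmod s).
  assert (Ex : Cmod (1 + s) * Cmod (1 + s) = 1 + x).
  { unfold x. rewrite !Cmod_sq, Re_plus, Im_plus. simpl. ring. }
  assert (Hx1 : - (/ 2) <= x <= 1) by (unfold x; nra).
  assert (El : 2 * ln (Cmod (1 + s)) = ln (1 + x)).
  { rewrite <- Ex, ln_mult by auto. ring. }
  assert (Hup : ln (1 + x) <= x).
  { rewrite <- (ln_exp x) at 2. apply ln_le; [lra|apply exp_ineq1_le]. }
  assert (Hlo : x - 2 * (x * x) <= ln (1 + x)).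
  { assert (H1 : 1 + (/ (1 + x) - 1) <= exp (/ (1 + x) - 1)) by apply exp_ineq1_le.
    assert (H2 : ln (/ (1 + x)) <= / (1 + x) - 1).
    { rewrite <- (ln_exp (/ (1 + x) - 1)). apply ln_le; [apply Rinv_0_lt_compat; lra|lra]. }
    rewrite ln_Rinv in H2 by lra.
    assert (/ (1 + x) - 1 <= - x + 2 * (x * x)).
    { apply Rmult_le_reg_l with (1 + x); [lra|]. rewrite Rmult_minus_distr_l, Rinv_r by lra. nra. }
    lra. }
  assert (Hxx : x * x <= 9 * (Cmod s * Cmod s)).
  { assert (Rabs x <= 3 * Cmod s) by (unfold x; apply Rabs_le; nra).
    assert (0 <= Rabs x) by apply Rabs_pos.
    replace (x * x) with (Rabs x * Rabs x) by (rewrite <- Rabs_mult; apply Rabs_right; nra). nra. }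
  assert (0 <= x * x) by nra. unfold x in Hup, Hlo. fold x in Hlo. fold x in Hup.
  assert (Ex2 : x = 2 * Re s + Cmod s * Cmod s) by reflexivity.
  apply Rabs_le. split; lra.
Qed.

(** Replaces integration of a zero derivative: n steps of length 1/n change g by at most K/n in
    total. *)
Lemma quad_const (g : R -> R) (K r : R) : 0 < r ->
  (forall s t, 0 <= s <= 1 -> 0 <= t <= 1 -> Rabs (t - s) <= r -> Rabs (g t - g s) <= K * ((t - s) * (t - s))) ->
  g 1 = g 0.
Proof.
  intros Hr H.
  assert (HK : forall n, (0 < n)%nat -> / INR n <= r -> Rabs (g 1 - g 0) <= K / INR n).
  { intros n Hn Hnr. assert (Hp : 0 < INR n) by (apply lt_0_INR; auto).
    assert (G : forall j, (j <= n)%nat -> Rabs (g (INR j / INR n) - g 0) <= INR j * (K * (/ INR n * / INR n))).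
    { induction j as [|j IH]; intros Hj.
      - simpl. unfold Rdiv. rewrite Rmult_0_l, Rminus_diag_eq, Rabs_R0 by reflexivity. lra.
      - specialize (IH ltac:(lia)). rewrite S_INR.
        replace (g ((INR j + 1) / INR n) - g 0)
          with ((g ((INR j + 1) / INR n) - g (INR j / INR n)) + (g (INR j / INR n) - g 0)) by ring.
        eapply Rle_trans; [apply Rabs_triang|].
        assert (Hd : (INR j + 1) / INR n - INR j / INR n = / INR n) by (field; lra).
        assert (H1 := H (INR j / INR n) ((INR j + 1) / INR n)). rewrite Hd in H1.
        assert (Hi : 0 < / INR n) by (apply Rinv_0_lt_compat; auto).
        assert (Hle : forall x, 0 <= x <= INR n -> 0 <= x / INR n <= 1).
        { intros x Hx. split; [apply Rmult_le_pos; lra|]. apply Rmult_le_reg_r with (INR n); auto.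
          unfold Rdiv. rewrite Rmult_assoc, Rinv_l; lra. }
        assert (Hj1 : INR j + 1 <= INR n) by (rewrite <- S_INR; apply le_INR; auto).
        assert (Hj0 := pos_INR j).
        specialize (H1 (Hle (INR j) ltac:(lra)) (Hle (INR j + 1) ltac:(lra))).
        rewrite (Rabs_right (/ INR n)) in H1 by lra. specialize (H1 Hnr). lra. }
    specialize (G n (Nat.le_refl n)). replace (INR n / INR n) with 1 in G by (field; lra).
    replace (INR n * (K * (/ INR n * / INR n))) with (K / INR n) in G by (field; lra). auto. }
  assert (Rabs (g 1 - g 0) <= 0).
  { apply small_eq_0. intros eps He.
    destruct (inv_INR_small K eps He) as [N1 HN1]. destruct (inv_INR_small 1 r Hr) as [N2 HN2].
    set (N := Nat.max N1 N2).
    assert (H1 := HK (S N) ltac:(lia)). specialize (HN1 N ltac:(lia)). specialize (HN2 N ltac:(lia)).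
    unfold Rdiv in HN2. rewrite Rmult_1_l in HN2. specialize (H1 ltac:(lra)). lra. }
  assert (Hnn := Rabs_pos (g 1 - g 0)).
  assert (H1 : Rabs (g 1 - g 0) = 0) by lra.
  destruct (Req_dec (g 1 - g 0) 0) as [E|E]; [lra|]. apply Rabs_no_R0 in E. lra.
Qed.

(** The logarithm of |Delta(-1/z)| / (|z|^12 |Delta(z)|). *)
Definition Gfun (z : C) : R := Re (Lam (- / z)) - Re (Lam z) - 12 * ln (Cmod z).

(** The linear terms cancel by the transformation of E_2: its defect contributes 24 (i/(2 pi)) (-pi
    i/z) = 12/z, the derivative of 12 log z. *)
Lemma Gfun_quad (A M : R) : 0 < A -> 0 < M -> exists K r, 0 < r /\
  forall z h, A <= Im z -> Cmod z <= M -> Cmod h <= r ->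
    Rabs (Gfun (z + h) - Gfun z) <= K * (Cmod h * Cmod h).
Proof.
  intros HA HM. assert (HPI := PI_RGT_0).
  set (A' := A / (M * M)). assert (HMM : 0 < M * M) by nra.
  assert (HA' : 0 < A') by (apply Rdiv_lt_0_compat; auto).
  destruct (lams_quad A HA) as [K1 [HK1 HL1]].
  destruct (lams_quad A' HA') as [K2 [HK2 HL2]].
  set (c := 2 / (A * A)). assert (Hc : 0 < c) by (apply Rdiv_lt_0_compat; nra).
  (* The first bound keeps h/z small; the second keeps the induced displacement h' of -1/z below
     A'/2. *)
  set (r := Rmin (A / 10) (A' / (2 * c))).
  assert (Hr : 0 < r) by (apply Rmin_pos; apply Rdiv_lt_0_compat; lra).
  set (DB := 2 * PI + 24 * (/ (2 * PI)) * (2 * / (A' * A'))).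
  set (K := 24 * K1 + 24 * (K2 * (c * c)) + DB * (c * / A) + 120 * (/ A * / A)).
  exists K, r. split; auto. intros z h Hz HzM Hh.
  assert (Hr1 : r <= A / 10) by apply Rmin_l. assert (Hr2 : r <= A' / (2 * c)) by apply Rmin_r.
  assert (Hz0 : 0 < Im z) by lra. assert (Hzne := Im_pos_neq_0 z Hz0).
  assert (Hh0 := Cmod_ge_0 h).
  assert (HzA : A <= Cmod z) by (generalize (Cmod_Im_le z); rewrite Rabs_right by lra; lra).
  assert (HzhA : A / 2 <= Cmod (z + h)) by (generalize (Cmod_plus_ge z h); lra).
  assert (Hzhne : (z + h)%C <> 0%C) by (apply Cmod_neq_0; lra).
  set (h' := (h / (z * (z + h)))%C).
  assert (Ezh : (- / (z + h) = - / z + h')%C) by (unfold h'; field; auto).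
  assert (Hh' : Cmod h' <= c * Cmod h).
  { unfold h', Cdiv. rewrite Cmod_mult, Cmod_inv, Cmod_mult by (apply Cmult_neq_0; auto).
    rewrite Rmult_comm. apply Rmult_le_compat_r; auto. unfold c.
    replace (2 / (A * A)) with (/ (A * (A / 2))) by (field; lra).
    apply Rinv_le_contravar; [nra|]. apply Rmult_le_compat; lra. }
  assert (Hh'2 : Cmod h' <= A' / 2).
  { eapply Rle_trans; [apply Hh'|]. apply Rle_trans with (c * (A' / (2 * c))).
    - apply Rmult_le_compat_l; lra. - right. field. lra. }
  assert (HIm' : A' <= Im (- / z)).
  { rewrite Im_neg_inv by auto. unfold A', Rdiv.
    assert (0 < Cmod z * Cmod z) by nra. assert (Cmod z * Cmod z <= M * M) by nra.
    apply Rmult_le_compat; try lra. left; apply Rinv_0_lt_compat; auto.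
    apply Rinv_le_contravar; auto. }
  destruct (E2_sum_cv z Hz0) as [T [HT HTb]].
  destruct (E2_sum_cv (- / z) ltac:(lra)) as [T' [HT' HTb']].
  assert (E2 := E2_transform z T T' Hz0 HT HT').
  assert (Q1 := HL1 z h T Hz ltac:(lra) HT).
  assert (Q2 := HL2 (- / z)%C h' T' HIm' Hh'2 HT').
  rewrite <- Ezh in Q2.
  set (R1 := (lams (z + h) - lams z + Ci / RtoC (2 * PI) * T * h)%C) in *.
  set (R2 := (lams (- / (z + h)) - lams (- / z) + Ci / RtoC (2 * PI) * T' * h')%C) in *.
  assert (HPIc : RtoC PI <> 0%C) by (intros E; apply (f_equal Re) in E; rewrite !Re_RtoC in E; lra).
  set (D' := (RtoC (2 * PI) * Ci + 24 * (Ci / RtoC (2 * PI)) * T')%C).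
  assert (Hmain : (Lam (- / (z + h)) - Lam (- / z) - (Lam (z + h) - Lam z)
    = RtoC (-24) * R2 + 24 * R1 - D' * (h * h' / z) + 12 * (h / z))%C).
  { unfold Lam. rewrite Ezh at 1. unfold R1, R2.
    assert (ED : (D' / (z * z) = RtoC (2 * PI) * Ci + 24 * (Ci / RtoC (2 * PI)) * T + 12 / z)%C).
    { unfold D'.
      replace ((RtoC (2 * PI) * Ci + 24 * (Ci / RtoC (2 * PI)) * T') / (z * z))%C
        with (RtoC (2 * PI) * Ci / (z * z) + 24 * (Ci / RtoC (2 * PI)) * (/ (z * z) * T'))%C.
      2:{ rewrite RtoC_mult. field. auto. }
      rewrite E2. unfold Rdiv. rewrite !RtoC_mult, RtoC_inv by lra.
      replace (RtoC 2 * RtoC PI * Ci / (z * z) + 24 * (Ci / (RtoC 2 * RtoC PI)) *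
        (T + RtoC PI * RtoC PI * / 6 - RtoC PI * RtoC PI * / 6 * / (z * z) - RtoC PI * Ci / z))%C
        with (RtoC 2 * RtoC PI * Ci + 24 * (Ci / (RtoC 2 * RtoC PI)) * T - (Ci * Ci) * 12 / z)%C by (field; auto).
      rewrite Ci2. unfold Cdiv. ring. }
    assert (Eh : (h' = h / (z * z) - h * h' / z)%C) by (unfold h'; field; auto).
    assert (EDh : (D' * h' = (RtoC (2 * PI) * Ci + 24 * (Ci / RtoC (2 * PI)) * T + 12 / z) * h - D' * (h * h' / z))%C).
    { rewrite <- ED. rewrite Eh at 1. field. auto. }
    replace (RtoC (2 * PI) * Ci * (- / z + h') - 24 * lams (- / (z + h)) - (RtoC (2 * PI) * Ci * - / z - 24 * lams (- / z))
      - (RtoC (2 * PI) * Ci * (z + h) - 24 * lams (z + h) - (RtoC (2 * PI) * Ci * z - 24 * lams z)))%C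
      with (D' * h' - 24 * (lams (- / (z + h)) - lams (- / z) + Ci / RtoC (2 * PI) * T' * h')
        + 24 * (lams (z + h) - lams z + Ci / RtoC (2 * PI) * T * h)
        - (RtoC (2 * PI) * Ci * h + 24 * (Ci / RtoC (2 * PI)) * T * h))%C by (unfold D'; ring).
    rewrite EDh. unfold Cdiv. ring. }
  assert (HD' : Cmod D' <= DB).
  { unfold D', DB. eapply Rle_trans; [apply Cmod_triangle|]. unfold Cdiv.
    rewrite !Cmod_mult, Cmod_Ci, Cmod_inv, !Cmod_R, (Rabs_right (2 * PI)), (Rabs_right 24).
    - apply Rplus_le_compat; [lra|]. rewrite Rmult_1_l.
      apply Rmult_le_compat_l.
      + assert (0 < / (2 * PI)) by (apply Rinv_0_lt_compat; lra). apply Rmult_le_pos; lra.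
      + eapply Rle_trans; [apply HTb'|]. apply Rmult_le_compat_l; [lra|].
        apply Rinv_le_contravar; [nra|]. apply Rmult_le_compat; lra.
    - lra. - lra.
    - intros E; apply (f_equal Re) in E; rewrite !Re_RtoC in E; lra. }
  assert (Hs : Cmod (h / z) <= Cmod h * / A).
  { unfold Cdiv. rewrite Cmod_mult, Cmod_inv by auto. apply Rmult_le_compat_l; auto.
    apply Rinv_le_contravar; auto. }
  assert (HAi : 0 < / A) by (apply Rinv_0_lt_compat; auto).
  assert (Hs5 : Cmod (h / z) <= / 5).
  { eapply Rle_trans; [apply Hs|]. apply Rle_trans with (A / 10 * / A).
    - apply Rmult_le_compat_r; lra. - replace (A / 10 * / A) with (/ 10) by (field; lra). lra. }
  assert (HLn := ln_quad (h / z)%C Hs5).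
  assert (Eln : ln (Cmod (z + h)) = ln (Cmod z) + ln (Cmod (1 + h / z))).
  { replace (z + h)%C with (z * (1 + h / z))%C by (field; auto). rewrite Cmod_mult.
    apply ln_mult; [lra|]. assert (H := Cmod_plus_ge 1 (h / z)). rewrite Cmod_1 in H. lra. }
  assert (EG : Gfun (z + h) - Gfun z = Re (RtoC (-24) * R2 + 24 * R1 - D' * (h * h' / z))%C
     - 12 * (ln (Cmod (1 + h / z)) - Re (h / z))).
  { unfold Gfun. rewrite Eln.
    assert (ER := f_equal Re Hmain). rewrite (Re_plus _ (12 * (h / z))%C), !Re_minus in ER.
    rewrite (Re_scal 12) in ER. rewrite Re_minus. lra. }
  rewrite EG.
  assert (B1 : Rabs (Re (RtoC (-24) * R2 + 24 * R1 - D' * (h * h' / z))%C) <=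
    24 * (K2 * (c * c * (Cmod h * Cmod h))) + 24 * (K1 * (Cmod h * Cmod h)) + DB * (c * / A * (Cmod h * Cmod h))).
  { eapply Rle_trans; [apply Cmod_Re_le|]. eapply Rle_trans; [apply Cmod_sub_triangle|].
    apply Rplus_le_compat; [eapply Rle_trans; [apply Cmod_triangle|]; apply Rplus_le_compat|].
    - rewrite Cmod_mult. rewrite Cmod_R, Rabs_left by lra. replace (- -24) with 24 by ring.
      apply Rmult_le_compat_l; [lra|]. eapply Rle_trans; [apply Q2|].
      apply Rmult_le_compat_l; auto. assert (0 <= Cmod h') by apply Cmod_ge_0.
      replace (c * c * (Cmod h * Cmod h)) with (c * Cmod h * (c * Cmod h)) by ring.
      apply Rmult_le_compat; auto.
    - rewrite Cmod_mult, Cmod_R, Rabs_right by lra. lra.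
    - rewrite Cmod_mult. apply Rmult_le_compat; auto using Cmod_ge_0.
      replace (h * h' / z)%C with (h' * (h / z))%C by (field; auto). rewrite Cmod_mult.
      replace (c * / A * (Cmod h * Cmod h)) with (c * Cmod h * (Cmod h * / A)) by ring.
      apply Rmult_le_compat; auto using Cmod_ge_0. }
  assert (B2 : Cmod (h / z) * Cmod (h / z) <= / A * / A * (Cmod h * Cmod h)).
  { replace (/ A * / A * (Cmod h * Cmod h)) with (Cmod h * / A * (Cmod h * / A)) by ring.
    apply Rmult_le_compat; auto using Cmod_ge_0. }
  unfold Rminus at 1. eapply Rle_trans; [apply Rabs_triang|]. rewrite Rabs_Ropp, Rabs_mult, (Rabs_right 12) by lra.
  unfold K. lra.
Qed.

(** [Gfun] is constant along the segment from i to z, which stays in a half-plane Im >= A, and it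
    vanishes at i, the fixed point of z -> -1/z. *)
Theorem Dmod_S (z : C) : 0 < Im z -> Dmod (- / z) = Cmod z ^ 12 * Dmod z.
Proof.
  intros Hz. assert (Hz0 := Im_pos_neq_0 z Hz). assert (Hp := Cmod_pos z Hz0).
  set (A := Rmin 1 (Im z)). assert (HA : 0 < A) by (apply Rmin_pos; lra).
  set (M := 1 + Cmod z).
  destruct (Gfun_quad A M HA ltac:(unfold M; lra)) as [K [r [Hr HG]]].
  set (path := fun t : R => (Ci + RtoC t * (z - Ci))%C).
  assert (Hconst : Gfun (path 1) = Gfun (path 0)).
  { set (L := Cmod (z - Ci)). assert (HL : 0 <= L) by apply Cmod_ge_0.
    apply (quad_const (fun t => Gfun (path t)) (Rabs K * (L * L)) (r / (L + 1))).
    - apply Rdiv_lt_0_compat; lra.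
    - intros s t Hs Ht Hst.
      replace (path t) with (path s + RtoC (t - s) * (z - Ci))%C by (unfold path; rewrite RtoC_minus; ring).
      assert (Em : Cmod (RtoC (t - s) * (z - Ci)) = Rabs (t - s) * L) by (rewrite Cmod_mult, Cmod_R; reflexivity).
      assert (H0 := Rabs_pos (t - s)).
      eapply Rle_trans; [apply HG|].
      + unfold path. rewrite Im_plus, Im_scal, Im_minus. simpl (Im Ci).
        assert (A <= 1) by apply Rmin_l. assert (A <= Im z) by apply Rmin_r.
        assert (0 <= (1 - s) * (1 - A)) by (apply Rmult_le_pos; lra).
        assert (0 <= s * (Im z - A)) by (apply Rmult_le_pos; lra). lra.
      + unfold path, M. replace (Ci + RtoC s * (z - Ci))%C with (RtoC (1 - s) * Ci + RtoC s * z)%C by (rewrite RtoC_minus; ring).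
        eapply Rle_trans; [apply Cmod_triangle|]. rewrite !Cmod_mult, Cmod_Ci, !Cmod_R, !Rabs_right by lra.
        assert (s * Cmod z <= 1 * Cmod z) by (apply Rmult_le_compat_r; lra). lra.
      + rewrite Em. apply Rle_trans with (r / (L + 1) * (L + 1)); [|right; field; lra].
        apply Rmult_le_compat; lra.
      + rewrite Em. assert (E : (t - s) * (t - s) = Rabs (t - s) * Rabs (t - s)).
        { rewrite <- Rabs_mult. symmetry. apply Rabs_right, Rle_ge, Rle_0_sqr. }
        rewrite E.
        replace (Rabs K * (L * L) * (Rabs (t - s) * Rabs (t - s)))
          with (Rabs K * (Rabs (t - s) * L * (Rabs (t - s) * L))) by ring.
        apply Rmult_le_compat_r; [|apply Rle_abs].
        assert (0 <= Rabs (t - s) * L) by nra. nra. }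
  replace (path 1) with z in Hconst by (unfold path; ring).
  replace (path 0) with Ci in Hconst by (unfold path; ring).
  assert (HCi := Ci_neq_0).
  assert (E0 : Gfun Ci = 0).
  { unfold Gfun. replace (- / Ci)%C with Ci.
    - rewrite Cmod_Ci, ln_1. ring.
    - replace Ci with (- (Ci * Ci) * Ci)%C at 1 by (rewrite Ci2; ring).
      replace (- / Ci)%C with ((Ci * Ci) * / Ci)%C by (rewrite Ci2; ring).
      replace (- (Ci * Ci) * Ci)%C with Ci by (rewrite Ci2; ring). field. auto. }
  unfold Gfun in Hconst at 1. rewrite E0 in Hconst.
  unfold Dmod. replace (Re (Lam (- / z))) with (12 * ln (Cmod z) + Re (Lam z)) by lra.
  rewrite exp_plus. f_equal.
  replace 12 with (INR 12) by (simpl; ring). rewrite <- exp_pow, exp_ln by auto. reflexivity.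
Qed.

(** * Translation sums as functions of q *)

Definition hp (A : R) : C -> Prop := fun z => A <= Im z.

Lemma hp_bounded (A : R) : bounded_on (hp A) qpar.
Proof.
  exists (exp (- (2 * PI * A))). split; [left; apply exp_pos|]. intros z Hz. apply Cmod_qpar_le. exact Hz.
Qed.

Lemma away_unif (A : R) : 0 < A -> exists d, 0 < d /\ forall z, A <= Im z -> Rabs (Re z) <= 2 -> away d z.
Proof.
  intros HA. exists (Rmin (/ 4) (A / 7)).
  assert (Hd : 0 < Rmin (/ 4) (A / 7)) by (apply Rmin_pos; lra).
  split; auto. intros z Hz Hx. split; auto. intros j.
  assert (M1 := Rmin_l (/ 4) (A / 7)). assert (M2 := Rmin_r (/ 4) (A / 7)).
  assert (Hj := pos_INR j). rewrite S_INR.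
  assert (G : forall x, A <= Im x -> INR j - 2 <= Rabs (Re x) -> Rmin (/ 4) (A / 7) * (INR j + 1) <= Cmod x).
  { intros x H1 H2. assert (I1 := Cmod_Im_le x). rewrite Rabs_right in I1 by lra. assert (I2 := Cmod_Re_le x).
    destruct (Rle_dec (INR j) 5).
    - apply Rle_trans with (A / 7 * (INR j + 1)); [apply Rmult_le_compat_r; lra|]. nra.
    - apply Rle_trans with (/ 4 * (INR j + 1)); [apply Rmult_le_compat_r; lra|]. lra. }
  apply Rabs_le_between in Hx. split; apply G.
  - rewrite Im_plus. simpl. lra.
  - rewrite Re_plus. simpl. fold (Re z). eapply Rle_trans; [|apply Rle_abs]. lra.
  - rewrite !Im_minus. simpl. fold (Im z). lra.
  - rewrite !Re_minus. simpl. fold (Re z). rewrite <- Rabs_Ropp. eapply Rle_trans; [|apply Rle_abs]. lra.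
Qed.

(* The sum over n in [-N, N-1] of zeta^2 g(zeta), zeta = 1/(z+n). *)
Definition psg (g : C -> C) (z : C) (j : nat) : C :=
  (/ (z + RtoC (INR j)) * / (z + RtoC (INR j)) * g (/ (z + RtoC (INR j))) +
   / (z - 1 - RtoC (INR j)) * / (z - 1 - RtoC (INR j)) * g (/ (z - 1 - RtoC (INR j))))%C.

(** One polynomial in q serves all large N at once, so the infinite sum never has to be named. The
    class of such g is linear and closed under uniform limits on |zeta| <= 1/A, which is how it is
    enlarged step by step. *)
Definition Kap (A : R) (g : C -> C) : Prop :=
  forall eps, 0 < eps -> exists P N0, ispoly P /\
    forall N z, (N0 <= N)%nat -> A <= Im z -> Rabs (Re z) <= 1 ->
      Cmod (csum (psg g z) N - P (qpar z)) <= eps.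

Lemma hp_inv_bound (A : R) (z : C) : 0 < A -> A <= Im z -> Cmod (/ z) <= / A.
Proof.
  intros HA Hz. assert (H := Cmod_Im_le z). rewrite Rabs_right in H by lra.
  rewrite Cmod_inv by (apply Im_pos_neq_0; lra). apply Rinv_le_contravar; lra.
Qed.

Lemma Im_shift (z : C) (x : R) : Im (z + RtoC x) = Im z /\ Im (z - RtoC x) = Im z /\ Im (z - 1 - RtoC x) = Im z.
Proof. unfold Im. simpl. repeat split; ring. Qed.

Lemma psg_ext (A : R) (g g' : C -> C) (z : C) (j : nat) : 0 < A -> A <= Im z ->
  (forall x, Cmod x <= / A -> g x = g' x) -> psg g z j = psg g' z j.
Proof.
  intros HA Hz E. destruct (Im_shift z (INR j)) as [E1 [_ E2]].
  unfold psg. rewrite !E; auto; apply hp_inv_bound; auto; [rewrite E2|rewrite E1]; auto.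
Qed.

Lemma Kap_ext (A : R) (g g' : C -> C) : 0 < A -> (forall x, Cmod x <= / A -> g x = g' x) ->
  Kap A g -> Kap A g'.
Proof.
  intros HA E H eps He. destruct (H eps He) as [P [N0 [HP H1]]]. exists P, N0. split; auto.
  intros N z HN Hz Hx. rewrite <- (csum_ext (psg g z)); auto.
  intros j _. apply (psg_ext A); auto.
Qed.

Lemma psg_bound (A d : R) (g : C -> C) (B : R) (z : C) (j : nat) : 0 < A -> A <= Im z -> away d z ->
  (forall x, Cmod x <= / A -> Cmod (g x) <= B) -> 0 <= B ->
  Cmod (psg g z j) <= 2 * B * / (d * d) * / (INR (S j) * INR (S j)).
Proof.
  intros HA Hz [Hd Ha] HB HB0. destruct (Im_shift z (INR j)) as [E1 [_ E2]]. destruct (Ha j) as [A1 A2].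
  assert (Hj := nS_pos j).
  assert (G : forall x : C, A <= Im x -> d * INR (S j) <= Cmod x ->
    Cmod (/ x * / x * g (/ x)%C) <= / (d * d) * / (INR (S j) * INR (S j)) * B).
  { intros x H1 H2. assert (Hx : x <> 0%C) by (apply Im_pos_neq_0; lra).
    rewrite !Cmod_mult. apply Rmult_le_compat; auto using Cmod_ge_0.
    - apply Rmult_le_pos; apply Cmod_ge_0.
    - rewrite Cmod_inv, <- Rinv_mult by auto. apply Rinv_sq_le; lra.
    - apply HB. apply hp_inv_bound; auto. }
  unfold psg. eapply Rle_trans; [apply Cmod_triangle|].
  assert (G1 := G _ ltac:(rewrite E1; exact Hz) A1). assert (G2 := G _ ltac:(rewrite E2; exact Hz) A2). lra.
Qed.

Lemma psg_csum_bound (A d : R) (g : C -> C) (B : R) (z : C) (N : nat) : 0 < A -> A <= Im z -> away d z ->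
  (forall x, Cmod x <= / A -> Cmod (g x) <= B) -> 0 <= B ->
  Cmod (csum (psg g z) N) <= 4 * / (d * d) * B.
Proof.
  intros HA Hz Ha HB HB0. assert (Hd := proj1 Ha).
  eapply Rle_trans; [apply Cmod_csum_le; intros j _; apply (psg_bound A d g B); auto|].
  rewrite rsum_scal. assert (H := rsum_inv_sq_le N).
  assert (0 < / (d * d)) by (apply Rinv_0_lt_compat; nra).
  apply Rle_trans with (2 * B * / (d * d) * 2); [|lra].
  apply Rmult_le_compat_l; auto. repeat apply Rmult_le_pos; lra.
Qed.

Lemma psg_plus (g g' : C -> C) (z : C) (j : nat) :
  psg (fun x => g x + g' x)%C z j = (psg g z j + psg g' z j)%C.
Proof. unfold psg. ring. Qed.

Lemma psg_minus (g g' : C -> C) (z : C) (j : nat) :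
  psg (fun x => g x - g' x)%C z j = (psg g z j - psg g' z j)%C.
Proof. unfold psg. ring. Qed.

Lemma psg_scal (c : C) (g : C -> C) (z : C) (j : nat) :
  psg (fun x => c * g x)%C z j = (c * psg g z j)%C.
Proof. unfold psg. ring. Qed.

Lemma Kap_plus (A : R) (g g' : C -> C) : Kap A g -> Kap A g' -> Kap A (fun x => g x + g' x)%C.
Proof.
  intros H H' eps He. destruct (H (eps / 2) ltac:(lra)) as [P [N0 [HP H1]]].
  destruct (H' (eps / 2) ltac:(lra)) as [Q [N0' [HQ H1']]].
  exists (fun u => P u + Q u)%C, (Nat.max N0 N0'). split; [apply ispoly_plus; auto|].
  intros N z HN Hz Hx. rewrite (csum_ext _ (fun j => psg g z j + psg g' z j)%C)
    by (intros; apply psg_plus).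
  rewrite csum_plus. specialize (H1 N z ltac:(lia) Hz Hx). specialize (H1' N z ltac:(lia) Hz Hx).
  replace (csum (psg g z) N + csum (psg g' z) N - (P (qpar z) + Q (qpar z)))%C
    with ((csum (psg g z) N - P (qpar z)) + (csum (psg g' z) N - Q (qpar z)))%C by ring.
  eapply Rle_trans; [apply Cmod_triangle|]. lra.
Qed.

Lemma Kap_scal (A : R) (c : C) (g : C -> C) : Kap A g -> Kap A (fun x => c * g x)%C.
Proof.
  intros H eps He. assert (Hc := Cmod_ge_0 c).
  destruct (H (eps / (Cmod c + 1)) ltac:(apply Rdiv_lt_0_compat; lra)) as [P [N0 [HP H1]]].
  exists (fun u => c * P u)%C, N0. split; [apply ispoly_scal; auto|].
  intros N z HN Hz Hx. rewrite (csum_ext _ (fun j => c * psg g z j)%C) by (intros; apply psg_scal).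
  rewrite csum_scal.
  replace (c * csum (psg g z) N - c * P (qpar z))%C with (c * (csum (psg g z) N - P (qpar z)))%C by ring.
  rewrite Cmod_mult. specialize (H1 N z HN Hz Hx).
  apply Rle_trans with ((Cmod c + 1) * (eps / (Cmod c + 1))); [|right; field; lra].
  apply Rmult_le_compat; auto using Cmod_ge_0; lra.
Qed.

Lemma Kap_zero (A : R) : Kap A (fun _ => RtoC 0).
Proof.
  intros eps He. exists (fun _ => RtoC 0), 0%nat. split; [apply ispoly_const|].
  intros N z _ _ _. rewrite (csum_ext _ (fun _ => RtoC 0)) by (intros; unfold psg; ring).
  rewrite csum_0. replace (0 - 0)%C with (RtoC 0) by ring. rewrite Cmod_0. lra.
Qed.

Lemma Kap_csum (A : R) (g : nat -> C -> C) (n : nat) :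
  (forall i, (i < n)%nat -> Kap A (g i)) -> Kap A (fun x => csum (fun i => g i x) n).
Proof.
  induction n as [|n IH]; intros H; simpl; [apply Kap_zero|]. apply Kap_plus; auto.
Qed.

(** The factor zeta^2 makes the translation sums bounded by 4/d^2 times the sup norm of g on the
    disc, uniformly in N. *)
Lemma Kap_lim (A : R) (g : C -> C) : 0 < A ->
  (forall eps, 0 < eps -> exists g', Kap A g' /\ forall x, Cmod x <= / A -> Cmod (g x - g' x) <= eps) ->
  Kap A g.
Proof.
  intros HA H eps He. destruct (away_unif A HA) as [d [Hd Haw]].
  assert (Hdd : 0 < d * d) by nra.
  set (e := eps / 2 * (d * d) / 4).
  assert (He1 : 0 < e) by (unfold e; assert (0 < eps / 2 * (d * d)) by (apply Rmult_lt_0_compat; lra); lra).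
  destruct (H e He1) as [g' [Hg' Hgg]].
  destruct (Hg' (eps / 2) ltac:(lra)) as [P [N0 [HP H1]]]. exists P, N0. split; auto.
  intros N z HN Hz Hx. specialize (H1 N z HN Hz Hx).
  assert (B := psg_csum_bound A d (fun x => g x - g' x)%C e z N HA Hz (Haw z Hz ltac:(lra)) Hgg ltac:(lra)).
  rewrite (csum_ext _ (fun j => psg g z j - psg g' z j)%C) in B by (intros; apply psg_minus).
  rewrite csum_minus in B.
  replace (4 * / (d * d) * e) with (eps / 2) in B by (unfold e; field; lra).
  replace (csum (psg g z) N - P (qpar z))%C
    with ((csum (psg g z) N - csum (psg g' z) N) + (csum (psg g' z) N - P (qpar z)))%C by ring.
  eapply Rle_trans; [apply Cmod_triangle|]. lra.
Qed.

Lemma csc2_approx (A : R) : 0 < A -> approx (hp A) qpar csc2.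
Proof.
  intros HA. assert (HPI := PI_RGT_0).
  assert (Hr : 0 <= exp (- (2 * PI * A)) < 1).
  { split; [left; apply exp_pos|apply exp_lt_1; nra]. }
  apply approx_ext with (fun w => RtoC (-4 * (PI * PI)) * (qpar w * (/ (1 - qpar w) * / (1 - qpar w))))%C.
  - intros z Hz. unfold hp in Hz. rewrite csc2_qpar by lra.
    assert (N := one_minus_neq_0 _ (Cmod_qpar_lt_1 z ltac:(lra))). field. auto.
  - assert (HB := hp_bounded A).
    apply approx_scal; auto. apply approx_mult; auto; [apply approx_gen|].
    apply approx_mult; auto; apply (approx_geom _ _ _ (exp (- (2 * PI * A)))); auto;
      try apply approx_gen; intros z Hz; apply Cmod_qpar_le; auto.
Qed.

(** For zeta = 1/(z + n) one has zeta^2/(1 - a zeta)^2 = 1/(z + n - a)^2. The sum is therefore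
    pi^2/sin^2 at z - a, a function of q after the dilation by exp(-2 pi i a). *)
Lemma Kap_base (A a : R) : 0 < A -> Rabs a <= 1 -> Rabs a <= A / 2 ->
  Kap A (fun x => / ((1 - RtoC a * x) * (1 - RtoC a * x)))%C.
Proof.
  intros HA Ha1 Ha2 eps He.
  destruct (csc2_approx A HA (eps / 2) ltac:(lra)) as [P [HP HP1]].
  destruct (away_unif A HA) as [d [Hd Haw]].
  assert (Hdi : 0 < / (d * d)) by (apply Rinv_0_lt_compat; nra).
  set (M := fun j => 2 * / (d * d) * / (INR (S j) * INR (S j))).
  assert (HM0 : forall j, 0 <= M j).
  { intros j. unfold M. apply Rmult_le_pos; [lra|]. left. apply Rinv_0_lt_compat. generalize (nS_pos j). nra. }
  destruct (rsummable_tail M HM0 (rsummable_inv_sq (2 * / (d * d)) ltac:(lra)) (eps / 2) ltac:(lra)) as [N0 HN0].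
  exists (fun u => P (qpar (- RtoC a) * u)%C), N0. split; [apply ispoly_dilate; auto|].
  intros N z HN Hz Hx. set (w := (z - RtoC a)%C).
  assert (Hw : A <= Im w) by (unfold w; rewrite (proj1 (proj2 (Im_shift z a))); auto).
  assert (Hwx : Rabs (Re w) <= 2).
  { unfold w. rewrite Re_minus, Re_RtoC. unfold Rminus. eapply Rle_trans; [apply Rabs_triang|].
    rewrite Rabs_Ropp. lra. }
  assert (Haww := Haw w Hw Hwx).
  assert (HL := csc2_series d w Haww (sn_Im_neq_0 w ltac:(lra))).
  assert (Eq : qpar w = (qpar (- RtoC a) * qpar z)%C).
  { rewrite <- qpar_plus. f_equal. unfold w. ring. }
  rewrite <- Eq.
  assert (Es : csum (psg (fun x => / ((1 - RtoC a * x) * (1 - RtoC a * x)))%C z) N = csum (psq w) N).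
  { apply csum_ext. intros j _. unfold psg, psq.
    destruct (Im_shift z (INR j)) as [E1 [_ E2]].
    destruct (Im_shift w (INR j)) as [E3 [_ E4]].
    assert (N1 : (z + RtoC (INR j))%C <> 0%C) by (apply Im_pos_neq_0; lra).
    assert (N2 : (z - 1 - RtoC (INR j))%C <> 0%C) by (apply Im_pos_neq_0; lra).
    assert (N3 : (w + RtoC (INR j))%C <> 0%C) by (apply Im_pos_neq_0; lra).
    assert (N4 : (w - 1 - RtoC (INR j))%C <> 0%C) by (apply Im_pos_neq_0; lra).
    replace (w + RtoC (INR j))%C with (z + RtoC (INR j) - RtoC a)%C in * by (unfold w; ring).
    replace (w - 1 - RtoC (INR j))%C with (z - 1 - RtoC (INR j) - RtoC a)%C in * by (unfold w; ring).
    set (x := (z + RtoC (INR j))%C) in *. set (y := (z - 1 - RtoC (INR j))%C) in *.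
    replace (1 - RtoC a * / x)%C with ((x - RtoC a) / x)%C by (field; auto).
    replace (1 - RtoC a * / y)%C with ((y - RtoC a) / y)%C by (field; auto).
    field. auto. }
  rewrite Es.
  assert (T1 : Cmod (csc2 w - csum (psq w) N) <= eps / 2).
  { apply (clim_Cmod_le _ _ _ _ HL). exists N. intros n Hn.
    eapply Rle_trans; [apply Cmod_csum_tail with (M := M); auto|apply HN0; auto].
    intros j _. destruct (proj2 Haww j) as [A1 A2]. unfold psq, M.
    eapply Rle_trans; [apply Cmod_triangle|].
    assert (G : forall x, d * INR (S j) <= Cmod x -> Cmod (/ (x * x)) <= / (d * d) * / (INR (S j) * INR (S j))).
    { intros x Hxx. assert (Hj := nS_pos j). assert (x <> 0%C) by (apply Cmod_neq_0; nra).
      rewrite Cmod_inv, Cmod_mult by (apply Cmult_neq_0; auto). apply Rinv_sq_le; lra. }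
    assert (G1 := G _ A1). assert (G2 := G _ A2). lra. }
  rewrite Cmod_sub_comm in T1. specialize (HP1 w Hw).
  replace (csum (psq w) N - P (qpar w))%C with ((csum (psq w) N - csc2 w) + (csc2 w - P (qpar w)))%C by ring.
  eapply Rle_trans; [apply Cmod_triangle|]. lra.
Qed.

(* closed form of the remainder of the expansion of (1-x)^(-2) *)
Definition Rem2 (p : nat) (x : C) : C :=
  ((RtoC (INR p) + 1 - RtoC (INR p) * x) / ((1 - x) * (1 - x)))%C.

Lemma Rem2_expand (p : nat) (x : C) : (1 - x)%C <> 0%C ->
  (/ ((1 - x) * (1 - x)) - csum (fun i => (RtoC (INR i) + 1) * x ^ i) p = x ^ p * Rem2 p x)%C.
Proof.
  intros Hx. induction p as [|p IH].
  - unfold Rem2. simpl. field. auto.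
  - cbn [csum].
    replace (/ ((1 - x) * (1 - x)) - (csum (fun i => (RtoC (INR i) + 1) * x ^ i) p + (RtoC (INR p) + 1) * x ^ p))%C
      with (/ ((1 - x) * (1 - x)) - csum (fun i => (RtoC (INR i) + 1) * x ^ i) p - (RtoC (INR p) + 1) * x ^ p)%C by ring.
    rewrite IH. unfold Rem2. rewrite S_INR, RtoC_plus, Cpow_S. field. auto.
Qed.

Lemma Rem2_bound (p : nat) (x : C) : Cmod x <= / 2 ->
  Cmod (Rem2 p x - (RtoC (INR p) + 1)) <= Cmod x * (8 * (INR p + 2)).
Proof.
  intros Hx. assert (Hx0 := Cmod_ge_0 x). assert (Hp := pos_INR p).
  assert (Hne := one_minus_neq_0 x ltac:(lra)).
  replace (Rem2 p x - (RtoC (INR p) + 1))%C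
    with (x * ((RtoC (INR p) + 2 - (RtoC (INR p) + 1) * x) * (/ (1 - x) * / (1 - x))))%C.
  2:{ unfold Rem2. field. auto. }
  rewrite Cmod_mult. apply Rmult_le_compat_l; auto. rewrite !Cmod_mult.
  assert (I := Cmod_inv_one_minus x (/ 2) Hx ltac:(lra)). replace (/ (1 - / 2)) with 2 in I by field.
  assert (I0 := Cmod_ge_0 (/ (1 - x))).
  assert (B : Cmod (RtoC (INR p) + 2 - (RtoC (INR p) + 1) * x) <= 2 * (INR p + 2)).
  { eapply Rle_trans; [apply Cmod_sub_triangle|]. rewrite Cmod_mult, <- !RtoC_plus, !Cmod_R, !Rabs_right by lra.
    nra. }
  apply Rle_trans with (2 * (INR p + 2) * (2 * 2)); [|lra].
  apply Rmult_le_compat; auto using Cmod_ge_0; [apply Rmult_le_pos; auto|].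
  apply Rmult_le_compat; auto.
Qed.

(** Expanding 1/(1 - a zeta)^2 in powers of a isolates zeta^p: subtract the lower monomials, already
    in the class, divide by (p + 1) a^p, and let a tend to 0. This takes the place of
    differentiating the cotangent expansion p times. *)
Lemma Kap_monomial (A : R) (p : nat) : 0 < A -> Kap A (fun x => x ^ p)%C.
Proof.
  intros HA. induction p as [p IH] using lt_wf_ind. apply Kap_lim; auto. intros eps He.
  assert (HAi : 0 < / A) by (apply Rinv_0_lt_compat; auto).
  assert (Hp := pos_INR p).
  set (c := (/ A) ^ p * (/ A * (8 * (INR p + 2)))).
  assert (Hc : 0 < c).
  { unfold c. assert (0 < (/ A) ^ p) by (apply pow_lt; auto). apply Rmult_lt_0_compat; auto.
    apply Rmult_lt_0_compat; lra. }
  (* The first two bounds are those of [Kap_base]; the third makes the remainder a c at most eps. *)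
  set (a := Rmin (Rmin 1 (A / 2)) (eps / c)).
  assert (Ha : 0 < a).
  { apply Rmin_pos; [apply Rmin_pos; lra|apply Rdiv_lt_0_compat; auto]. }
  assert (M1 : a <= 1) by (eapply Rle_trans; [apply Rmin_l|apply Rmin_l]).
  assert (M2 : a <= A / 2) by (eapply Rle_trans; [apply Rmin_l|apply Rmin_r]).
  assert (M3 : a <= eps / c) by apply Rmin_r.
  assert (Hac : RtoC a <> 0%C) by (intros E; apply (f_equal Re) in E; rewrite !Re_RtoC in E; lra).
  assert (Hap : (RtoC a ^ p)%C <> 0%C) by (apply Cpow_nz; auto).
  assert (Hp1 : (RtoC (INR p) + 1)%C <> 0%C).
  { intros E; apply (f_equal Re) in E. rewrite Re_plus, !Re_RtoC in E. lra. }
  exists (fun x => / (RtoC a ^ p * (RtoC (INR p) + 1)) *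
    (/ ((1 - RtoC a * x) * (1 - RtoC a * x)) + -(1) * csum (fun i => (RtoC (INR i) + 1) * RtoC a ^ i * x ^ i) p))%C.
  split.
  - apply Kap_scal, Kap_plus; [apply Kap_base; auto; rewrite Rabs_right; lra|].
    apply Kap_scal, Kap_csum. intros i Hi. apply Kap_scal. auto.
  - intros x Hx. assert (Hx0 := Cmod_ge_0 x).
    assert (Hax : Cmod (RtoC a * x) <= / 2).
    { rewrite Cmod_mult, Cmod_R, Rabs_right by lra. apply Rle_trans with (A / 2 * / A).
      - apply Rmult_le_compat; lra. - right. field. lra. }
    assert (Hne := one_minus_neq_0 _ (Rle_lt_trans _ _ 1 Hax ltac:(lra))).
    assert (E := Rem2_expand p (RtoC a * x)%C Hne).
    rewrite (csum_ext _ (fun i => (RtoC (INR i) + 1) * RtoC a ^ i * x ^ i)%C) in E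
      by (intros; rewrite Cpow_mult_l; ring).
    replace (/ ((1 - RtoC a * x) * (1 - RtoC a * x)) + -(1) * csum (fun i => (RtoC (INR i) + 1) * RtoC a ^ i * x ^ i) p)%C
      with ((RtoC a * x) ^ p * Rem2 p (RtoC a * x))%C by (rewrite <- E; ring).
    rewrite Cpow_mult_l.
    replace (x ^ p - / (RtoC a ^ p * (RtoC (INR p) + 1)) * (RtoC a ^ p * x ^ p * Rem2 p (RtoC a * x)))%C
      with (- (/ (RtoC (INR p) + 1) * (x ^ p * (Rem2 p (RtoC a * x) - (RtoC (INR p) + 1)))))%C by (field; auto).
    rewrite Cmod_opp, !Cmod_mult, Cmod_pow.
    assert (B := Rem2_bound p (RtoC a * x)%C Hax).
    rewrite (Cmod_mult (RtoC a)), Cmod_R, (Rabs_right a) in B by lra.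
    assert (I1 : Cmod (/ (RtoC (INR p) + 1)) <= 1).
    { rewrite Cmod_inv by auto. rewrite <- RtoC_plus, Cmod_R, Rabs_right by lra.
      rewrite <- Rinv_1. apply Rinv_le_contravar; lra. }
    apply Rle_trans with (1 * ((/ A) ^ p * (a * / A * (8 * (INR p + 2))))).
    + apply Rmult_le_compat; auto using Cmod_ge_0.
      { apply Rmult_le_pos; [apply pow_le|]; auto using Cmod_ge_0. }
      apply Rmult_le_compat; auto using Cmod_ge_0; [apply pow_le; auto|apply pow_incr; auto|].
      eapply Rle_trans; [apply B|]. apply Rmult_le_compat_r; [lra|]. apply Rmult_le_compat_l; lra.
    + replace (1 * ((/ A) ^ p * (a * / A * (8 * (INR p + 2))))) with (a * c) by (unfold c; ring).
      apply Rle_trans with (eps / c * c); [apply Rmult_le_compat_r; lra|right; field; lra].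
Qed.

Lemma Kap_approx (A : R) (g : C -> C) : 0 < A ->
  approx (fun x => Cmod x <= / A) (fun x => x) g -> Kap A g.
Proof.
  intros HA Hg. apply Kap_lim; auto. intros eps He. destruct (Hg eps He) as [P [[p Hp] HP]].
  exists P. split; auto.
  assert (G : forall s i, Kap A (fun x => x ^ i * peval s x)%C).
  { clear - HA. induction s as [|c s IH]; intros i.
    - apply Kap_ext with (fun _ => RtoC 0); auto; [intros; simpl; ring|apply Kap_zero].
    - apply Kap_ext with (fun x => c * x ^ i + x ^ S i * peval s x)%C; auto.
      { intros x _. cbn [peval]. rewrite Cpow_S. ring. }
      apply Kap_plus; auto. apply Kap_scal, Kap_monomial; auto. }
  apply Kap_ext with (fun x => x ^ 0 * peval p x)%C; auto.
  intros x _. rewrite Hp. simpl. ring.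
Qed.

(* q^m slashed by S, in weight k *)
Definition Sl (k m : nat) (w : C) : C := ((/ w) ^ k * qpar (- / w) ^ m)%C.

Definition LN (k m N : nat) (z : C) : C :=
  csum (fun j => Sl k m (z + RtoC (INR j)) + Sl k m (z - 1 - RtoC (INR j)))%C N.

(** zeta^k exp(-2 pi i m zeta) is zeta^2 times an entire function of zeta because k >= 2. *)
Lemma LN_approx (A : R) (k m : nat) (eps : R) : 0 < A -> (2 <= k)%nat -> 0 < eps ->
  exists P N0, ispoly P /\ forall N z, (N0 <= N)%nat -> A <= Im z -> Rabs (Re z) <= 1 ->
      Cmod (LN k m N z - P (qpar z)) <= eps.
Proof.
  intros HA Hk He.
  assert (HAi : 0 < / A) by (apply Rinv_0_lt_compat; auto).
  assert (HK : Kap A (fun x => x ^ (k - 2) * Cexp (- (RtoC (2 * PI) * Ci * RtoC (INR m)) * x))%C).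
  { apply Kap_approx; auto. assert (HB := disc_bounded (/ A) ltac:(lra)).
    apply approx_mult; auto; [apply approx_pow; auto; apply approx_gen|].
    apply approx_exp; auto. apply approx_scal; auto. apply approx_gen. }
  destruct (HK eps He) as [P [N0 [HP H]]]. exists P, N0. split; auto.
  intros N z HN Hz Hx. specialize (H N z HN Hz Hx).
  replace (LN k m N z) with
    (csum (psg (fun x => x ^ (k - 2) * Cexp (- (RtoC (2 * PI) * Ci * RtoC (INR m)) * x))%C z) N); auto.
  apply csum_ext. intros j _. unfold psg, Sl.
  assert (E : forall x : C, (/ x * / x * ((/ x) ^ (k - 2) * Cexp (- (RtoC (2 * PI) * Ci * RtoC (INR m)) * / x))
     = (/ x) ^ k * qpar (- / x) ^ m)%C).
  { intros x. replace k with (S (S (k - 2))) at 2 by lia. rewrite !Cpow_S.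
    rewrite <- qpar_nat. unfold qpar.
    replace (RtoC (2 * PI) * (Ci * (RtoC (INR m) * - / x)))%C
      with (- (RtoC (2 * PI) * Ci * RtoC (INR m)) * / x)%C by ring. ring. }
  rewrite !E. reflexivity.
Qed.

(** * The contraction principle for forms vanishing to order l+1 *)

Lemma PI_bounds : 3.141 < PI < 3.142.
Proof.
  destruct (PI_2_3_7_ineq 2) as [H1 H2].
  unfold tg_alt, PI_2_3_7_tg, Ratan_seq in H1, H2. simpl in H1, H2. lra.
Qed.

Lemma Cexp_i_2PI_Z (n : Z) : Cexp (Ci * RtoC (2 * PI * IZR n)) = 1%C.
Proof.
  destruct (Z.le_ge_cases 0 n) as [H|H].
  - rewrite <- (Z2Nat.id n H), <- INR_IZR_INZ. apply Cexp_i_2PI_nat.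
  - assert (E : n = (- Z.of_nat (Z.to_nat (- n)))%Z) by (rewrite Z2Nat.id; lia).
    rewrite E, opp_IZR, <- INR_IZR_INZ.
    replace (Ci * RtoC (2 * PI * - INR (Z.to_nat (- n))))%C
      with (- (Ci * RtoC (2 * PI * INR (Z.to_nat (- n)))))%C by (rewrite !RtoC_mult, RtoC_opp; ring).
    rewrite Cexp_opp, Cexp_i_2PI_nat. field.
Qed.

(** Reducing Re z modulo 1 means that bounds on a horizontal line have to be proved only for |Re z|
    <= 1/2. *)
Lemma circle_point (A t : R) : exists z, Im z = A /\ Rabs (Re z) <= 1 / 2 /\
  qpar z = (RtoC (exp (- (2 * PI * A))) * Cexp (Ci * RtoC t))%C.
Proof.
  assert (HPI := PI_RGT_0). set (x := t / (2 * PI)). set (n := up (x - 1 / 2)).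
  destruct (archimed (x - 1 / 2)) as [H1 H2]. fold n in H1, H2.
  exists (x - IZR n, A). split; [reflexivity|]. split; [simpl; apply Rabs_le; lra|].
  unfold qpar.
  replace (RtoC (2 * PI) * (Ci * ((x - IZR n)%R, A)))%C
    with (RtoC (- (2 * PI * A)) + (Ci * RtoC t - Ci * RtoC (2 * PI * IZR n)))%C.
  - rewrite Cexp_plus, Cexp_minus, Cexp_RtoC, Cexp_i_2PI_Z. field.
  - apply injective_projections; simpl; unfold x; field; lra.
Qed.

Lemma hp_maxmod (A B : R) (g : C -> C) : approx (hp A) qpar g ->
  (forall z, Im z = A -> Rabs (Re z) <= 1 / 2 -> Cmod (g z) <= B) ->
  forall z, A < Im z -> Cmod (g z) <= B.
Proof.
  intros Hg HB z Hz. assert (HPI := PI_RGT_0).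
  apply (approx_maxmod (hp A) qpar g (exp (- (2 * PI * A)))); auto.
  - apply exp_pos.
  - intros t. destruct (circle_point A t) as [w [H1 [H2 H3]]]. exists w.
    repeat split; auto. unfold hp. lra.
  - unfold hp. lra.
  - rewrite Cmod_qpar. apply exp_increasing. nra.
Qed.

(** Schwarz's lemma in q: the deviation from the constant term decays like |q| above the line. The
    constant c is fixed before B, so that the bound can be iterated. *)
Lemma hp_schwarz (A eps : R) (g : C -> C) : 0 < eps -> approx (hp A) qpar g ->
  exists c, forall B,
  (forall z, Im z = A -> Rabs (Re z) <= 1 / 2 -> Cmod (g z - c) <= B) ->
  forall z, A < Im z -> Cmod (g z - c) <= B * exp (- (2 * PI * (Im z - A))) + 2 * eps.
Proof.
  intros He Hg. assert (HPI := PI_RGT_0).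
  destruct (approx_schwarz (hp A) qpar g (exp (- (2 * PI * A))) eps (exp_pos _) He Hg) as [c [_ Hc]].
  exists c. intros B HB z Hz.
  replace (exp (- (2 * PI * (Im z - A)))) with (Cmod (qpar z) / exp (- (2 * PI * A))).
  - apply Hc.
    + intros t. destruct (circle_point A t) as [w [H1 [H2 H3]]]. exists w.
      repeat split; auto. unfold hp. lra.
    + unfold hp. lra.
    + rewrite Cmod_qpar. apply exp_increasing. nra.
  - rewrite Cmod_qpar. unfold Rdiv. rewrite <- exp_Ropp, <- exp_plus. f_equal. ring.
Qed.

(** Starting from any finite bound B0, the improvements B -> k B + s converge to the fixed point
    s/(1 - k); no supremum has to be attained. *)
Lemma contraction_sup {X : Type} (phi : X -> R) (k s B0 : R) : 0 <= k < 1 ->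
  (forall B, (forall x, phi x <= B) -> forall x, phi x <= k * B + s) ->
  (forall x, phi x <= B0) -> forall x, phi x <= s / (1 - k).
Proof.
  intros Hk H H0 x. set (L := s / (1 - k)).
  assert (EL : k * L + s = L) by (unfold L; field; lra).
  assert (G : forall j x, phi x <= L + k ^ j * Rabs (B0 - L)).
  { induction j as [|j IH]; intros y.
    - simpl. assert (Q := Rle_abs (B0 - L)). specialize (H0 y). lra.
    - eapply Rle_trans; [apply (H _ IH)|]. simpl. right. rewrite Rmult_plus_distr_l. rewrite <- EL at 3. ring. }
  apply le_of_forall_eps with (K := 1); [lra|]. intros eps He.
  set (D := Rabs (B0 - L)). assert (HD : 0 <= D) by apply Rabs_pos.
  destruct (pow_small k (eps / (D + 1)) Hk ltac:(apply Rdiv_lt_0_compat; lra)) as [N HN].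
  specialize (HN N (Nat.le_refl N)). specialize (G N x). fold D in G.
  assert (k ^ N * D <= eps); [|lra].
  assert (0 <= k ^ N) by (apply pow_le; lra).
  apply Rle_trans with (eps / (D + 1) * (D + 1)); [|right; field; lra].
  apply Rmult_le_compat; lra.
Qed.

Lemma lams_approx (A : R) : 0 < A -> approx (hp A) qpar lams.
Proof.
  intros HA. assert (HPI := PI_RGT_0). set (r := exp (- (2 * PI * A))).
  assert (Hr : 0 < r < 1) by (split; [apply exp_pos|apply exp_lt_1; nra]).
  assert (HB := hp_bounded A).
  apply approx_series with (a := lamt) (M := fun d => r / (1 - r) * r ^ d).
  - intros d.
    apply approx_ext with (fun z => / nS d * (qpar z ^ S d * / (1 - qpar z ^ S d)))%C; [reflexivity|].
    assert (Hq : approx (hp A) qpar (fun z => qpar z ^ S d)%C) by (apply approx_pow; auto; apply approx_gen).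
    apply approx_scal; auto. apply approx_mult; auto.
    apply (approx_geom _ _ _ r); auto; [lra|]. intros z Hz. rewrite Cmod_pow.
    apply Rle_trans with (r ^ S d).
    + apply pow_incr. split; [apply Cmod_ge_0|apply Cmod_qpar_le; auto].
    + simpl. assert (r ^ d <= 1) by (rewrite <- (pow1 d); apply pow_incr; lra). nra.
  - apply rsummable_geom; [|lra]. apply Rmult_le_pos; [lra|]. left. apply Rinv_0_lt_compat. lra.
  - intros d. apply Rmult_le_pos; [|apply pow_le; lra].
    apply Rmult_le_pos; [lra|]. left. apply Rinv_0_lt_compat. lra.
  - intros z d Hz. apply lamt_bound; [apply Cmod_qpar_le; auto|lra].
  - intros z Hz. unfold hp in Hz. apply lams_cv. lra.
Qed.

(* Delta^(l+1) *)
Definition Wl (l : nat) (z : C) : C := (qpar z ^ S l * Cexp (- (24 * lams z)) ^ S l)%C.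

Lemma Wl_neq_0 (l : nat) (z : C) : Wl l z <> 0%C.
Proof. apply Cmult_neq_0; apply Cpow_nz; [apply qpar_neq_0|apply Cexp_neq_0]. Qed.

Lemma Cmod_Wl (l : nat) (z : C) : Cmod (Wl l z) = Dmod z ^ S l.
Proof.
  unfold Wl. rewrite Cmod_mult, !Cmod_pow, <- Rpow_mult_distr, <- Dmod_alt. reflexivity.
Qed.

Lemma Wl_ratio (l : nat) (z : C) : 0 < Im z ->
  Cmod (Wl l (- / z)) = (Cmod z ^ 12) ^ S l * Cmod (Wl l z).
Proof. intros Hz. rewrite !Cmod_Wl, Dmod_S by auto. apply Rpow_mult_distr. Qed.

(** On this segment |z|^2 <= 0.49 + 0.25 < 1, so -1/z lies strictly above the line and the maximum
    principle bounds a function there by its values on the line. *)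
Lemma line_facts (z : C) : Im z = 7 / 10 -> Rabs (Re z) <= 1 / 2 ->
  49 / 100 <= Cmod z * Cmod z <= 74 / 100 /\ Im (- / z) = 7 / 10 / (Cmod z * Cmod z) /\
  7 / 10 < Im (- / z) /\ Rabs (Re (- / z)) <= 1.
Proof.
  intros H1 H2. assert (Hz : z <> 0%C) by (apply Im_pos_neq_0; lra).
  assert (E := Cmod_sq z). rewrite H1 in E.
  assert (E2 : Re z * Re z = Rabs (Re z) * Rabs (Re z)).
  { rewrite <- Rabs_mult. symmetry. apply Rabs_right, Rle_ge, Rle_0_sqr. }
  assert (H0 := Rabs_pos (Re z)).
  assert (Hb : 49 / 100 <= Cmod z * Cmod z <= 74 / 100) by (rewrite E, E2; split; nra).
  set (t := Cmod z * Cmod z) in *.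
  assert (Hi : 0 < / t) by (apply Rinv_0_lt_compat; lra).
  split; auto. rewrite Im_neg_inv, Re_neg_inv, H1 by auto. fold t. split; [reflexivity|]. split.
  - apply Rmult_lt_reg_r with t; [lra|]. replace (7 / 10 / t * t) with (7 / 10) by (field; lra). lra.
  - unfold Rdiv. rewrite Rabs_mult, Rabs_Ropp, (Rabs_right (/ t)) by lra.
    apply Rmult_le_reg_r with t; [lra|]. rewrite Rmult_assoc, Rinv_l by lra. rewrite E, E2. nra.
Qed.

Lemma pow_le_1 (x : R) (n : nat) : 0 <= x <= 1 -> x ^ n <= 1.
Proof. intros H. rewrite <- (pow1 n). apply pow_incr. lra. Qed.

Lemma exp_neg_le (x : R) : 0 <= x -> exp (- x) <= / (1 + x + x * x / 2 + x * x * x / 6).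
Proof.
  intros Hx. rewrite exp_Ropp. apply Rinv_le_contravar; [nra|].
  eapply Rle_trans; [|apply (exp_ge_taylor x 3 Hx)]. simpl. right. field.
Qed.

(* Upper bounds for 1/(1 - c), where c bounds |z|^(12-k') on the line Im z = 7/10, |Re z| <= 1/2; for k' = 14 the
   multiplier exceeds 1, and the gain comes from first removing the constant term, which the value at i controls. *)
Definition Kc (k' : nat) : R :=
  match k' with O => 5 / 4 | S _ => if Nat.leb k' 10 then 4 else 36 end.

(** The quotient n = e/Delta^(l+1) satisfies n(z) = kap n(-1/z) + rho with |kap| = |z|^(12 - k') and
    |rho| <= s. As -1/z lies above the line, a bound for n on the line yields a better one when k'
    <= 10. The final bound is carried upwards by the maximum principle. *)
Theorem contraction (k k' l : nat) (e g : C -> C) (s : R) :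
  k = (12 * l + k')%nat -> (k' <= 10 \/ k' = 14)%nat -> 0 <= s ->
  (forall z, 7 / 10 <= Im z -> e z = (qpar z ^ S l * g z)%C) ->
  approx (hp (7 / 10)) qpar g ->
  (forall z, Im z = 7 / 10 -> Rabs (Re z) <= 1 / 2 ->
     Cmod (e z - (/ z) ^ k * e (- / z)%C) <= s * Dmod z ^ S l) ->
  (k' = 14%nat -> 2 * Cmod (e Ci) <= s * Dmod Ci ^ S l) ->
  forall z, 7 / 10 < Im z -> Cmod (e z) <= Kc k' * s * Dmod z ^ S l.
Proof.
  intros Hk Hk' Hs He Hg Hline Hi. assert (HPIb := PI_bounds).
  assert (HB := hp_bounded (7 / 10)).
  set (n := fun z => (g z * Cexp (24 * lams z) ^ S l)%C).
  assert (Hn : approx (hp (7 / 10)) qpar n).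
  { unfold n. apply approx_mult; auto. apply approx_pow; auto. apply approx_exp; auto.
    apply approx_scal; auto. apply lams_approx. lra. }
  assert (En : forall z, 7 / 10 <= Im z -> e z = (n z * Wl l z)%C).
  { intros z Hz. rewrite He by auto. unfold n, Wl. rewrite Cexp_opp, Cpow_inv by apply Cexp_neq_0.
    field. apply Cpow_nz, Cexp_neq_0. }
  set (X := {z : C | Im z = 7 / 10 /\ Rabs (Re z) <= 1 / 2}).
  destruct (approx_bounded _ _ _ HB Hn) as [B0 [HB00 HB0]].
  assert (Hmul : forall z, Im z = 7 / 10 -> Rabs (Re z) <= 1 / 2 -> exists kap rho,
    n z = (kap * n (- / z) + rho)%C /\ Cmod rho <= s /\ Cmod kap * Cmod z ^ k = Cmod z ^ (12 * S l)).
  { intros z H1 H2. destruct (line_facts z H1 H2) as [F1 [F2 [F3 F4]]].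
    assert (Hz : z <> 0%C) by (apply Im_pos_neq_0; lra). assert (HW := Wl_neq_0 l z).
    exists ((/ z) ^ k * (Wl l (- / z) / Wl l z))%C, ((e z - (/ z) ^ k * e (- / z)) / Wl l z)%C.
    split; [|split].
    - rewrite (En z), (En (- / z)%C) by lra. field. auto.
    - unfold Cdiv. rewrite Cmod_mult, Cmod_inv, Cmod_Wl by auto.
      assert (HD : 0 < Dmod z ^ S l) by (apply pow_lt, Dmod_pos).
      apply Rmult_le_reg_r with (Dmod z ^ S l); auto.
      rewrite Rmult_assoc, Rinv_l, Rmult_1_r by lra. auto.
    - unfold Cdiv. rewrite !Cmod_mult, Cmod_pow, !Cmod_inv, Wl_ratio by (auto; lra).
      assert (HWp := Cmod_pos _ HW). assert (Hzp := Cmod_pos _ Hz). rewrite pow_inv, <- pow_mult.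
      field. split; [lra|]. apply pow_nonzero. lra. }
  assert (Hfin : forall K, (forall z, Im z = 7 / 10 -> Rabs (Re z) <= 1 / 2 -> Cmod (n z) <= K) ->
    forall z, 7 / 10 < Im z -> Cmod (e z) <= K * Dmod z ^ S l).
  { intros K HK z Hz. rewrite En by lra. rewrite Cmod_mult, Cmod_Wl.
    apply Rmult_le_compat_r; [left; apply pow_lt, Dmod_pos|]. apply (hp_maxmod (7 / 10)); auto. }
  destruct Hk' as [Hk'|Hk'].
  (* |z|^2 <= 0.74 gives 0.74^6 <= 1/5 for k' = 0 and at most 0.74 for the others, since then 12 -
     k' >= 2. *)
  - set (kc := match k' with O => 1 / 5 | S _ => 74 / 100 end).
    assert (Hkc : 0 <= kc < 1) by (unfold kc; destruct k'; lra).
    apply Hfin. intros z0 H01 H02.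
    assert (G : forall x : X, Cmod (n (proj1_sig x)) <= s / (1 - kc)).
    { apply contraction_sup with (B0 := B0); [lra| |].
      - intros B HBx [z [H1 H2]]. simpl.
        assert (HB' : forall w, Im w = 7 / 10 -> Rabs (Re w) <= 1 / 2 -> Cmod (n w) <= B).
        { intros w Hw1 Hw2. apply (HBx (exist _ w (conj Hw1 Hw2))). }
        destruct (line_facts z H1 H2) as [F1 [F2 [F3 F4]]].
        destruct (Hmul z H1 H2) as [kap [rho [E1 [E2 E3]]]].
        assert (Hzp : 0 < Cmod z) by (apply Cmod_pos, Im_pos_neq_0; lra).
        assert (HB2 := hp_maxmod _ B n Hn HB' (- / z)%C F3).
        assert (Hkap : Cmod kap <= kc).
        { replace (12 * S l)%nat with ((12 - k') + k)%nat in E3 by lia.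
          rewrite pow_add in E3. apply Rmult_eq_reg_r in E3; [|apply pow_nonzero; lra].
          rewrite E3. unfold kc. destruct k' as [|k'].
          - replace (Cmod z ^ (12 - 0)) with ((Cmod z * Cmod z) ^ 6) by (simpl; ring).
            eapply Rle_trans; [apply pow_incr; split; [nra|apply (proj2 F1)]|]. simpl. lra.
          - replace (12 - S k')%nat with (2 + (10 - S k'))%nat by lia. rewrite pow_add.
            assert (Cmod z ^ (10 - S k') <= 1) by (apply pow_le_1; nra).
            assert (0 <= Cmod z ^ (10 - S k')) by (apply pow_le; lra).
            apply Rle_trans with (74 / 100 * 1); [|lra].
            apply Rmult_le_compat; auto; [apply pow_le; lra|]. simpl. lra. }
        rewrite E1. eapply Rle_trans; [apply Cmod_triangle|]. rewrite Cmod_mult.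
        assert (Cmod kap * Cmod (n (- / z)%C) <= kc * B).
        { apply Rmult_le_compat; auto using Cmod_ge_0. }
        lra.
      - intros [z [H1 H2]]. simpl. apply HB0. unfold hp. lra. }
    specialize (G (exist _ z0 (conj H01 H02))). simpl in G. eapply Rle_trans; [apply G|].
    unfold Kc, kc. destruct k' as [|k']; [lra|]. rewrite (proj2 (Nat.leb_le _ _) Hk'). lra.
  - assert (Hleb : Nat.leb k' 10 = false) by (apply Nat.leb_gt; lia).
    assert (HK : Kc k' = 36) by (unfold Kc; destruct k'; [lia|]; rewrite Hleb; reflexivity).
    rewrite HK. apply Hfin. intros z0 H01 H02.
    apply le_of_forall_eps with (K := 200); [lra|]. intros eps Heps.
    destruct (hp_schwarz (7 / 10) eps n Heps Hn) as [c Hc].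
    assert (Hni : Cmod (n Ci) <= s / 2).
    { specialize (Hi Hk'). rewrite (En Ci), Cmod_mult, Cmod_Wl in Hi by (simpl; lra).
      assert (HD : 0 < Dmod Ci ^ S l) by (apply pow_lt, Dmod_pos).
      apply Rmult_le_reg_r with (Dmod Ci ^ S l); auto. lra. }
    assert (Ex1 : exp (- (2 * PI * (3 / 10))) <= 174 / 1000).
    { eapply Rle_trans; [apply exp_le; instantiate (1 := - (1884 / 1000)); lra|].
      eapply Rle_trans; [apply exp_neg_le; lra|]. lra. }
    (* The value at i controls the constant term: between the line and i the deviation from c
       shrinks by exp(-0.6 pi). *)
    assert (Hcb : forall B, (forall z, Im z = 7 / 10 -> Rabs (Re z) <= 1 / 2 -> Cmod (n z - c) <= B) ->
       Cmod c <= s / 2 + B * (174 / 1000) + 2 * eps).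
    { intros B HBc. assert (H0 : 0 <= B).
      { eapply Rle_trans; [apply Cmod_ge_0|]. apply (HBc z0 H01 H02). }
      assert (H1 := Hc B HBc Ci ltac:(simpl; lra)). simpl (Im Ci) in H1.
      replace (1 - 7 / 10) with (3 / 10) in H1 by field.
      replace c with (n Ci - (n Ci - c))%C by ring.
      eapply Rle_trans; [apply Cmod_sub_triangle|].
      assert (B * exp (- (2 * PI * (3 / 10))) <= B * (174 / 1000)) by (apply Rmult_le_compat_l; auto). lra. }
    (* With t = 1/|z|^2, the deviation contributes t exp(-1.4 pi (t - 1)) <= 0.363 and the constant
       term (1 + 100/49) 0.174; together they stay below 9/10. *)
    assert (G : forall x : X, Cmod (n (proj1_sig x) - c) <= (3 * s + 12 * eps) / (1 - 9 / 10)).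
    { apply contraction_sup with (B0 := B0 + Cmod c); [lra| |].
      - intros B HBx [z [H1 H2]]. simpl.
        assert (HB' : forall w, Im w = 7 / 10 -> Rabs (Re w) <= 1 / 2 -> Cmod (n w - c) <= B).
        { intros w Hw1 Hw2. apply (HBx (exist _ w (conj Hw1 Hw2))). }
        assert (HBpos : 0 <= B).
        { eapply Rle_trans; [apply Cmod_ge_0|]. apply (HB' z0 H01 H02). }
        destruct (line_facts z H1 H2) as [F1 [F2 [F3 F4]]].
        destruct (Hmul z H1 H2) as [kap [rho [E1 [E2 E3]]]].
        assert (Hzp : 0 < Cmod z) by (apply Cmod_pos, Im_pos_neq_0; lra).
        assert (HB2 := Hc B HB' (- / z)%C F3). specialize (Hcb B HB').
        set (t := / (Cmod z * Cmod z)).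
        assert (Ht : 100 / 74 <= t <= 100 / 49).
        { unfold t. split.
          - replace (100 / 74) with (/ (74 / 100)) by field. apply Rinv_le_contravar; lra.
          - replace (100 / 49) with (/ (49 / 100)) by field. apply Rinv_le_contravar; lra. }
        assert (Hkap : Cmod kap = t).
        { replace k with (2 + 12 * S l)%nat in E3 by lia.
          rewrite pow_add, <- Rmult_assoc in E3.
          assert (Hp : 0 < Cmod z ^ (12 * S l)) by (apply pow_lt; auto).
          assert (E4 : Cmod kap * Cmod z ^ 2 = 1).
          { apply Rmult_eq_reg_r with (Cmod z ^ (12 * S l)); lra. }
          unfold t. apply Rmult_eq_reg_r with (Cmod z * Cmod z); [|nra]. rewrite Rinv_l by nra.
          simpl in E4. lra. }
        assert (Him : Im (- / z) - 7 / 10 = 7 / 10 * (t - 1)) by (rewrite F2; unfold t; field; lra).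
        rewrite Him in HB2.
        assert (Hex : t * exp (- (2 * PI * (7 / 10 * (t - 1)))) <= 363 / 1000).
        { set (x := 439 / 100 * (t - 1)). assert (Hx : 154 / 100 <= x) by (unfold x; lra).
          apply Rle_trans with (t * / (1 + x + x * x / 2 + x * x * x / 6)).
          - apply Rmult_le_compat_l; [lra|]. eapply Rle_trans; [|apply exp_neg_le; lra].
            apply exp_le. unfold x. nra.
          - replace t with (1 + x * (100 / 439)) by (unfold x; field).
            apply Rmult_le_reg_r with (1 + x + x * x / 2 + x * x * x / 6); [nra|].
            rewrite Rmult_assoc, Rinv_l by nra.
            assert (0 <= (x - 154 / 100) * (x - 154 / 100)) by apply Rle_0_sqr.
            assert (0 <= x * x) by nra. assert (154 / 100 * (x * x) <= x * x * x) by nra. nra. }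
        rewrite E1. replace (kap * n (- / z) + rho - c)%C
          with (kap * (n (- / z) - c) + (kap * c + (rho - c)))%C by ring.
        eapply Rle_trans; [apply Cmod_triangle|]. rewrite Cmod_mult.
        assert (Q := Cmod_triangle (kap * c)%C (rho - c)%C). rewrite Cmod_mult in Q.
        assert (Q2 := Cmod_sub_triangle rho c). rewrite Hkap in *.
        assert (T1 : t * Cmod (n (- / z)%C - c) <= B * (363 / 1000) + 2 * t * eps).
        { apply Rle_trans with (t * (B * exp (- (2 * PI * (7 / 10 * (t - 1)))) + 2 * eps)).
          - apply Rmult_le_compat_l; lra.
          - assert (B * (t * exp (- (2 * PI * (7 / 10 * (t - 1))))) <= B * (363 / 1000)) by (apply Rmult_le_compat_l; auto).
            lra. }
        assert (T2 : t * Cmod c <= 100 / 49 * Cmod c) by (apply Rmult_le_compat_r; [apply Cmod_ge_0|lra]).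
        assert (T3 : 2 * t * eps <= 2 * (100 / 49) * eps) by (apply Rmult_le_compat_r; lra).
        lra.
      - intros [z [H1 H2]]. simpl. eapply Rle_trans; [apply Cmod_sub_triangle|].
        apply Rplus_le_compat_r. apply HB0. unfold hp. lra. }
    assert (HcF := Hcb ((3 * s + 12 * eps) / (1 - 9 / 10))
      ltac:(intros w Hw1 Hw2; exact (G (exist _ w (conj Hw1 Hw2))))).
    specialize (G (exist _ z0 (conj H01 H02))). simpl in G.
    replace (n z0) with ((n z0 - c) + c)%C by ring. eapply Rle_trans; [apply Cmod_triangle|].
    lra.
Qed.

(** * The form g_{k,m} *)

Lemma is_series_clim (u : nat -> C) (s : C) :
  @is_series C_AbsRing C_NormedModule u s -> clim (csum u) s.
Proof.
  intros H eps He.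
  assert (HF := proj1 (filterlim_locally_ball_norm (K := C_AbsRing) (U := C_NormedModule) _ _) H (mkposreal eps He)).
  destruct HF as [N HN]. exists (S N). intros n Hn. destruct n as [|n]; [lia|].
  specialize (HN n ltac:(lia)). unfold ball_norm in HN. simpl in HN.
  (* [sum_n] includes its last index and [csum] does not, hence the shift by one. *)
  assert (E : @sum_n (NormedModule.AbelianMonoid C_AbsRing C_NormedModule) u n = csum u (S n)).
  { clear. induction n as [|n IH].
    - rewrite sum_O. simpl. symmetry. apply Cplus_0_l.
    - rewrite sum_Sn, IH. reflexivity. }
  rewrite E in HN. exact HN.
Qed.

(** What the proof retains of [is_g]: the inversion, the q-expansion, which carries periodicity and
    regularity, and the prescribed coefficients. *)
Definition vanish_form (k l m : nat) (f : C -> C) (a : nat -> C) : Prop :=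
  (forall z, 0 < Im z -> f (- / z)%C = (z ^ k * f z)%C) /\
  (forall z, 0 < Im z -> clim (csum (fun n => a n * qpar z ^ n)%C) (f z)) /\
  (forall n, (n < m)%nat -> a n = 0%C) /\ a m = 1%C /\
  (forall n, (m < n)%nat -> (n <= l)%nat -> a n = 0%C).

Lemma is_g_vanish_form (k l m : nat) (f : C -> C) : is_g k l m f -> exists a, vanish_form k l m f a.
Proof.
  intros [a [[_ [Hmod Hser]] [H1 [H2 H3]]]]. exists a. split; [|split; auto].
  - intros z Hz. assert (H := Hmod 0%Z (-1)%Z 1%Z 0%Z eq_refl z Hz). unfold ZtoC in H.
    assert (Hz0 := Im_pos_neq_0 z Hz).
    replace (RtoC 1 * z + RtoC 0)%C with z in H by ring.
    replace ((RtoC 0 * z + RtoC (-1)) / z)%C with (- / z)%C in H by (field; auto). exact H.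
  - intros z Hz. apply is_series_clim, Hser, Hz.
Qed.

Lemma csum_vanish_head (k l m : nat) (f : C -> C) (a : nat -> C) (u : C) : vanish_form k l m f a -> (m <= l)%nat ->
  csum (fun n => a n * u ^ n)%C (S l) = (u ^ m)%C.
Proof.
  intros [_ [_ [H1 [H2 H3]]]] Hml.
  assert (G : forall n, (n <= S l)%nat -> csum (fun n => a n * u ^ n)%C n = if lt_dec m n then (u ^ m)%C else 0%C).
  { induction n as [|n IH]; intros Hn; simpl.
    - destruct (lt_dec m 0); auto; lia.
    - rewrite IH by lia. destruct (lt_eq_lt_dec m n) as [[H|H]|H].
      + destruct (lt_dec m n); [|lia]. destruct (lt_dec m (S n)); [|lia]. rewrite H3 by lia. ring.
      + subst n. destruct (lt_dec m m); [lia|]. destruct (lt_dec m (S m)); [|lia]. rewrite H2. ring.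
      + destruct (lt_dec m n); [lia|]. destruct (lt_dec m (S n)); [lia|]. rewrite H1 by lia. ring. }
  rewrite G by lia. destruct (lt_dec m (S l)); auto; lia.
Qed.

Definition qvanish (l : nat) (h : C -> C) : Prop :=
  exists g, (forall z, 7 / 10 <= Im z -> h z = (qpar z ^ S l * g z)%C) /\ approx (hp (7 / 10)) qpar g.

Lemma clim_term_bounded (u : nat -> C) (s : C) : clim (csum u) s -> exists B, 0 <= B /\ forall n, Cmod (u n) <= B.
Proof.
  intros H. destruct (clim_bounded _ _ H) as [B [HB0 HB]]. exists (2 * B). split; [lra|].
  intros n. replace (u n) with (csum u (S n) - csum u n)%C by (simpl; ring).
  eapply Rle_trans; [apply Cmod_sub_triangle|].
  assert (H1 := HB (S n)). assert (H2 := HB n). lra.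
Qed.

(** Convergence at z = i/2 bounds the coefficients, and exp(-1.4 pi) < exp(-pi) then gives a
    geometric majorant on Im z >= 7/10. *)
Lemma vanish_form_qvanish (k l m : nat) (f : C -> C) (a : nat -> C) :
  vanish_form k l m f a -> (m <= l)%nat -> qvanish l (fun z => f z - qpar z ^ m)%C.
Proof.
  intros Hf Hml. assert (HPI := PI_RGT_0).
  exists (fun z => (f z - qpar z ^ m) / qpar z ^ S l)%C. split.
  { intros z _. field. apply Cpow_nz, qpar_neq_0. }
  set (r := exp (- (2 * PI * (7 / 10)))). set (r1 := exp (- (2 * PI * (1 / 2)))).
  assert (Hr : 0 < r < 1) by (split; [apply exp_pos|apply exp_lt_1; nra]).
  assert (Hr1 : 0 < r1) by apply exp_pos.
  assert (Hrr : 0 <= r / r1 < 1).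
  { unfold r, r1, Rdiv. rewrite <- exp_Ropp, <- exp_plus. split; [left; apply exp_pos|apply exp_lt_1; nra]. }
  set (z1 := (0, 1 / 2) : C). assert (Hz1 : 0 < Im z1) by (simpl; lra).
  destruct (clim_term_bounded _ _ (proj1 (proj2 Hf) z1 Hz1)) as [B [HB0 HB]].
  assert (Hrl : 0 < r1 ^ S l) by (apply pow_lt; auto).
  apply approx_series with (a := fun j z => (a (S l + j)%nat * qpar z ^ j)%C)
    (M := fun j => B / r1 ^ S l * (r / r1) ^ j).
  - intros j. assert (HBo := hp_bounded (7 / 10)). apply approx_scal; auto. apply approx_pow; auto. apply approx_gen.
  - apply rsummable_geom; auto. apply Rmult_le_pos; auto. left. apply Rinv_0_lt_compat. auto.
  - intros j. apply Rmult_le_pos; [|apply pow_le; lra].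
    apply Rmult_le_pos; auto. left. apply Rinv_0_lt_compat. auto.
  - intros z j Hz. specialize (HB (S l + j)%nat). rewrite Cmod_mult, Cmod_pow, Cmod_qpar in HB.
    simpl (Im z1) in HB. fold r1 in HB. rewrite pow_add in HB.
    rewrite Cmod_mult, Cmod_pow.
    assert (Hq : Cmod (qpar z) ^ j <= r ^ j).
    { apply pow_incr. split; [apply Cmod_ge_0|apply Cmod_qpar_le; exact Hz]. }
    assert (H1j : 0 < r1 ^ j) by (apply pow_lt; auto).
    apply Rle_trans with (Cmod (a (S l + j)%nat) * r ^ j).
    { apply Rmult_le_compat_l; [apply Cmod_ge_0|auto]. }
    unfold Rdiv. rewrite Rpow_mult_distr, pow_inv.
    replace (Cmod (a (S l + j)%nat) * r ^ j)
      with (Cmod (a (S l + j)%nat) * (r1 ^ S l * r1 ^ j) * (/ r1 ^ S l * (r ^ j * / r1 ^ j))) by (field; lra).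
    rewrite Rmult_assoc with (r1 := B). apply Rmult_le_compat_r; auto.
    assert (0 < / r1 ^ S l) by (apply Rinv_0_lt_compat; auto).
    assert (0 < / r1 ^ j) by (apply Rinv_0_lt_compat; auto).
    assert (0 < r ^ j) by (apply pow_lt; lra).
    apply Rmult_le_pos; [left; auto|]. apply Rmult_le_pos; left; auto.
  - intros z Hz. unfold hp in Hz.
    assert (Hq := Cpow_nz _ (S l) (qpar_neq_0 z)).
    assert (L := proj1 (proj2 Hf) z ltac:(lra)).
    assert (L1 := clim_subseq _ _ (fun n => (S l + n)%nat) (fun n => Nat.le_add_l n (S l)) L).
    assert (L2 := clim_scal (/ qpar z ^ S l)%C _ _ (clim_minus _ _ _ _ L1 (clim_const (qpar z ^ m)%C))).
    replace ((f z - qpar z ^ m) / qpar z ^ S l)%C with (/ qpar z ^ S l * (f z - qpar z ^ m))%C by (field; auto).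
    apply clim_ext with (2 := L2). intros n. cbv beta.
    rewrite csum_add, (csum_vanish_head k l m f a (qpar z) Hf Hml).
    rewrite (csum_ext _ (fun j => qpar z ^ S l * (a (S l + j)%nat * qpar z ^ j))%C (n)).
    + rewrite csum_scal. field. auto.
    + intros j _. rewrite Cpow_add_r. ring.
Qed.

Lemma qvanish_minus (l : nat) (h h' : C -> C) : qvanish l h -> qvanish l h' -> qvanish l (fun z => h z - h' z)%C.
Proof.
  intros [g [Hg Ag]] [g' [Hg' Ag']]. exists (fun z => g z - g' z)%C. split.
  - intros z Hz. rewrite Hg, Hg' by auto. ring.
  - apply approx_minus; auto. apply hp_bounded.
Qed.

Lemma Ci_pow_14 (l : nat) : ((/ Ci) ^ (12 * l + 14) = -(1))%C.
Proof.
  assert (E : (/ Ci = - Ci)%C).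
  { assert (H := Ci_neq_0). replace (/ Ci)%C with (/ Ci * (- (Ci * Ci)))%C by (rewrite Ci2; ring). field. auto. }
  rewrite E. replace (12 * l + 14)%nat with (4 * (3 * l + 3) + 2)%nat by lia.
  rewrite Cpow_add_r, Cpow_mult_r.
  replace ((- Ci) ^ 4)%C with ((Ci * Ci) * (Ci * Ci))%C by (simpl; ring).
  replace ((- Ci) ^ 2)%C with (Ci * Ci)%C by (simpl; ring). rewrite Ci2.
  replace (- (1) * - (1))%C with (RtoC 1) by ring. rewrite Cpow_1_l. ring.
Qed.

Lemma neg_inv_Ci : (- / Ci = Ci)%C.
Proof.
  assert (H := Ci_neq_0). replace (- / Ci)%C with (Ci * Ci * / Ci)%C by (rewrite Ci2; ring). field. auto.
Qed.

(** The contraction with s = 0, applied to the difference of the two forms. For k' = 14 the value at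
    i vanishes because i^(-k) = -1. *)
Lemma form_unique (k k' l m : nat) (f f' : C -> C) (a a' : nat -> C) :
  k = (12 * l + k')%nat -> (k' <= 10 \/ k' = 14)%nat -> (m <= l)%nat ->
  vanish_form k l m f a -> vanish_form k l m f' a' ->
  forall z, 7 / 10 < Im z -> f z = f' z.
Proof.
  intros Hk Hk' Hml Hf Hf' z Hz.
  assert (Hq := qvanish_minus _ _ _ (vanish_form_qvanish _ _ _ _ _ Hf Hml) (vanish_form_qvanish _ _ _ _ _ Hf' Hml)).
  destruct Hq as [g [Hg Ag]].
  set (e := fun z => (f z - f' z)%C).
  assert (Hinv : forall w, 0 < Im w -> e w = ((/ w) ^ k * e (- / w))%C).
  { intros w Hw. unfold e. rewrite (proj1 Hf), (proj1 Hf') by auto.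
    assert (Hw0 := Im_pos_neq_0 w Hw). rewrite Cpow_inv by auto. field. apply Cpow_nz; auto. }
  assert (H := contraction k k' l e g 0 Hk Hk' ltac:(lra)
     ltac:(intros w Hw; unfold e; rewrite <- Hg by auto; ring) Ag).
  assert (H0 : Cmod (e z) <= Kc k' * 0 * Dmod z ^ S l).
  { apply H; auto.
    - intros w Hw1 _. rewrite <- Hinv by lra. replace (e w - e w)%C with (RtoC 0) by ring. rewrite Cmod_0. lra.
    - intros E. assert (HC := Hinv Ci ltac:(simpl; lra)). rewrite neg_inv_Ci, Hk, E, Ci_pow_14 in HC.
      assert (E0 : e Ci = 0%C).
      { replace (e Ci) with (/ 2 * (e Ci - - (1) * e Ci))%C by field. rewrite <- HC. ring. }
      rewrite E0, Cmod_0. lra. }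
  assert (E : e z = 0%C).
  { apply Cmod_eq_0. assert (Q := Cmod_ge_0 (e z)). nra. }
  unfold e in E. replace (f z) with (f z - f' z + f' z)%C by ring. rewrite E. ring.
Qed.

Lemma qpar_reflect (z : C) : qpar (- Cconj z) = Cconj (qpar z).
Proof.
  unfold qpar. rewrite Cexp_conj. f_equal. apply injective_projections; simpl; ring.
Qed.

Lemma clim_conj (u : nat -> C) (s : C) : clim u s -> clim (fun n => Cconj (u n)) (Cconj s).
Proof.
  intros H eps He. destruct (H eps He) as [N HN]. exists N. intros n Hn.
  rewrite <- Cminus_conj, Cmod_conj. auto.
Qed.

Lemma csum_conj (u : nat -> C) (n : nat) : csum (fun j => Cconj (u j)) n = Cconj (csum u n).
Proof.
  induction n as [|n IH]; simpl.
  - apply injective_projections; simpl; ring.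
  - rewrite IH, Cplus_conj. reflexivity.
Qed.

(** z -> conj f(-conj z) has the conjugate coefficients, hence the same prescribed ones, and
    uniqueness identifies it with f. Evenness of k removes the sign (-1)^k under inversion. *)
Lemma form_reflect (k k' l m : nat) (f : C -> C) (a : nat -> C) :
  k = (12 * l + k')%nat -> (k' <= 10 \/ k' = 14)%nat -> (m <= l)%nat -> Nat.Even k ->
  vanish_form k l m f a -> forall z, 7 / 10 < Im z -> f (- Cconj z)%C = Cconj (f z).
Proof.
  intros Hk Hk' Hml [K HK] Hf z Hz.
  assert (Hf' : vanish_form k l m (fun w => Cconj (f (- Cconj w)%C)) (fun n => Cconj (a n))).
  { destruct Hf as [H1 [H2 [H3 [H4 H5]]]]. repeat split.
    - intros w Hw. assert (Hw0 := Im_pos_neq_0 w Hw).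
      assert (E : (- Cconj (- / w) = - / (- Cconj w))%C).
      { rewrite Copp_conj, Cinv_conj by auto.
        assert (Cconj w <> 0)%C by (intros E; apply Hw0; rewrite <- (Cconj_conj w), E; apply injective_projections; simpl; ring).
        field. auto. }
      rewrite E, H1 by (simpl; unfold Im in Hw; lra).
      rewrite Cmult_conj, Cpow_conj, Copp_conj, Cconj_conj. f_equal.
      rewrite HK, Cpow_mult_r, Cpow_mult_r. f_equal. simpl. ring.
    - intros w Hw. assert (L := clim_conj _ _ (H2 (- Cconj w)%C ltac:(simpl; unfold Im in Hw; lra))).
      apply clim_ext with (2 := L). intros n. rewrite <- csum_conj. apply csum_ext. intros j _.
      rewrite Cmult_conj, Cpow_conj, qpar_reflect, Cconj_conj. reflexivity.
    - intros n Hn. rewrite H3 by auto. apply injective_projections; simpl; ring.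
    - rewrite H4. apply injective_projections; simpl; ring.
    - intros n Hn1 Hn2. rewrite H5 by auto. apply injective_projections; simpl; ring. }
  assert (H := form_unique k k' l m f _ a _ Hk Hk' Hml Hf Hf' z Hz).
  cbv beta in H. rewrite H, Cconj_conj. reflexivity.
Qed.

(** * Size of the translates of q^m|S *)

Lemma Cmod_Sl (k m : nat) (w : C) : 0 < Im w ->
  Cmod (Sl k m w) = (/ Cmod w) ^ k * exp (- (2 * PI * (Im w / (Cmod w * Cmod w)))) ^ m.
Proof.
  intros Hw. assert (H0 := Im_pos_neq_0 w Hw). unfold Sl.
  rewrite Cmod_mult, !Cmod_pow, Cmod_inv, Cmod_qpar, Im_neg_inv by auto. reflexivity.
Qed.

Lemma Cmod_Sl_le (k m : nat) (w : C) (a : R) : 0 < Im w -> 0 < a <= Cmod w -> Cmod (Sl k m w) <= (/ a) ^ k.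
Proof.
  intros Hw Ha. rewrite Cmod_Sl by auto.
  assert (H1 : 0 < exp (- (2 * PI * (Im w / (Cmod w * Cmod w)))) <= 1).
  { split; [apply exp_pos|]. rewrite <- exp_0. apply exp_le. assert (HPI := PI_RGT_0).
    assert (H : 0 < Im w / (Cmod w * Cmod w)) by (apply Rdiv_lt_0_compat; nra). nra. }
  assert (H2 : 0 <= (/ Cmod w) ^ k) by (apply pow_le; left; apply Rinv_0_lt_compat; lra).
  apply Rle_trans with ((/ Cmod w) ^ k * 1).
  - apply Rmult_le_compat_l; auto. apply pow_le_1. lra.
  - rewrite Rmult_1_r. apply pow_incr. split; [left; apply Rinv_0_lt_compat; lra|].
    apply Rinv_le_contravar; lra.
Qed.

(** The device by which exponentials are traded for powers and back; both sides agree to first order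
    at u = 1. *)
Lemma exp_1_minus_inv (u : R) : 0 < u -> exp (1 - / u) <= u.
Proof.
  intros Hu. assert (Hi := Rinv_0_lt_compat u Hu).
  assert (H := exp_ineq1_le (/ u - 1)).
  replace (1 - / u) with (- (/ u - 1)) by ring. rewrite exp_Ropp.
  rewrite <- (Rinv_inv u) at 2. apply Rinv_le_contravar; lra.
Qed.

(** Put u = |w|^2/N0. Leaving the circle |w|^2 = N0, each factor q grows by at most exp(d (1 - 1/u))
    <= u^d, which costs d m of the K powers of 1/u supplied by the weight. *)
Lemma Sl_bound (K m d : nat) (w : C) (N0 : R) : 0 < N0 <= Cmod w * Cmod w -> 0 < Im w ->
  2 * PI * Im w / N0 <= INR d -> (d * m <= K)%nat ->
  Cmod (Sl (2 * K) m w) <=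
    (/ N0) ^ K * exp (- (2 * PI * Im w / N0)) ^ m * (N0 / (Cmod w * Cmod w)) ^ (K - d * m).
Proof.
  intros [HN0 HN] Hw Hd HK. rewrite Cmod_Sl by auto. assert (HPI := PI_RGT_0).
  set (N := Cmod w * Cmod w) in *. set (u := N / N0).
  assert (HNp : 0 < N) by lra.
  assert (Hu : 1 <= u).
  { unfold u. apply Rmult_le_reg_r with N0; auto. unfold Rdiv. rewrite Rmult_assoc, Rinv_l; lra. }
  assert (Hw0 : 0 < Cmod w) by (apply Cmod_pos, Im_pos_neq_0; auto).
  assert (E1 : (/ Cmod w) ^ (2 * K) = (/ N0) ^ K * (/ u) ^ K).
  { rewrite pow_mult, <- Rpow_mult_distr. f_equal. unfold u, N. field. split; lra. }
  assert (E2 : exp (- (2 * PI * (Im w / N))) =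
    exp (- (2 * PI * Im w / N0)) * exp (2 * PI * Im w / N0 * (1 - / u))).
  { rewrite <- exp_plus. f_equal. unfold u. field. split; lra. }
  assert (E3 : N0 / N = / u) by (unfold u; field; split; lra).
  rewrite E1, E2, E3, Rpow_mult_distr.
  assert (Hiu : 0 < / u <= 1).
  { split; [apply Rinv_0_lt_compat; lra|]. rewrite <- Rinv_1. apply Rinv_le_contravar; lra. }
  assert (H3 : exp (2 * PI * Im w / N0 * (1 - / u)) <= u ^ d).
  { apply Rle_trans with (exp (INR d * (1 - / u))).
    - apply exp_le. apply Rmult_le_compat_r; lra.
    - rewrite <- exp_pow. apply pow_incr. split; [left; apply exp_pos|].
      apply exp_1_minus_inv. lra. }
  assert (H4 : exp (2 * PI * Im w / N0 * (1 - / u)) ^ m <= u ^ (d * m)).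
  { rewrite pow_mult. apply pow_incr. split; [left; apply exp_pos|auto]. }
  assert (H5 : (/ u) ^ K * u ^ (d * m) = (/ u) ^ (K - d * m)).
  { replace K with ((K - d * m) + d * m)%nat at 1 by lia. rewrite pow_add, Rmult_assoc, <- Rpow_mult_distr.
    rewrite Rinv_l, pow1 by lra. ring. }
  rewrite <- H5.
  assert (A1 : 0 <= (/ N0) ^ K) by (apply pow_le; left; apply Rinv_0_lt_compat; auto).
  assert (A2 : 0 <= exp (- (2 * PI * Im w / N0)) ^ m) by (apply pow_le; left; apply exp_pos).
  assert (A3 : 0 <= (/ u) ^ K) by (apply pow_le; lra).
  set (e := exp (- (2 * PI * Im w / N0)) ^ m) in *.
  set (x := exp (2 * PI * Im w / N0 * (1 - / u)) ^ m) in *.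
  apply Rle_trans with ((/ N0) ^ K * e * (/ u) ^ K * x); [right; ring|].
  apply Rle_trans with ((/ N0) ^ K * e * (/ u) ^ K * u ^ (d * m)); [|right; ring].
  apply Rmult_le_compat_l; auto. apply Rmult_le_pos; auto. apply Rmult_le_pos; auto.
Qed.

Lemma Cmod_sq_translate (z : C) (x : R) :
  Cmod (z + RtoC x) * Cmod (z + RtoC x) = (Re z + x) * (Re z + x) + Im z * Im z.
Proof. rewrite Cmod_sq. simpl. unfold Re, Im. ring. Qed.

(** Every translate has |w|^2 >= 4, and 2 pi Im w/4 = pi permits d = 4. The condition on K leaves
    one power of 4/|w|^2, enough to sum over the translates. *)
Lemma LN_line2 (K m N : nat) (z : C) : Im z = 2 -> Rabs (Re z) <= 1 / 2 -> (4 * m + 1 <= K)%nat ->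
  Cmod (LN (2 * K) m N z) <= 25 * ((/ 2) ^ (2 * K) * exp (- PI) ^ m).
Proof.
  intros Hz Hx HK. assert (HPI := PI_bounds). apply Rabs_le_between in Hx.
  set (Th := (/ 2) ^ (2 * K) * exp (- PI) ^ m).
  assert (HTh : 0 < Th).
  { unfold Th. apply Rmult_lt_0_compat; apply pow_lt; [lra|apply exp_pos]. }
  assert (G : forall (w : C) (j : nat), Im w = 2 ->
    j = O \/ (INR (S j) - 1 - 1 / 2) * (INR (S j) - 1 - 1 / 2) <= Re w * Re w ->
    Cmod (Sl (2 * K) m w) <= 25 / 4 * Th * / (INR (S j) * INR (S j))).
  { intros w j Hw Hre. assert (Hj := nS_pos j). set (s := INR (S j)) in *.
    assert (HN : Cmod w * Cmod w = Re w * Re w + 4) by (rewrite Cmod_sq, Hw; ring).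
    assert (HN0 := Rle_0_sqr (Re w)). unfold Rsqr in HN0.
    assert (Hs2 : 0 < s * s) by nra.
    assert (Hd : 2 * PI * Im w / 4 <= INR 4) by (rewrite Hw; simpl; lra).
    eapply Rle_trans; [apply (Sl_bound K m 4 w 4); auto; try lra; lia|].
    replace (2 * PI * Im w / 4) with PI by (rewrite Hw; field).
    replace ((/ 4) ^ K) with ((/ 2) ^ (2 * K)) by (rewrite pow_mult; f_equal; simpl; field).
    fold Th. replace (K - 4 * m)%nat with (S (K - 4 * m - 1)) by lia.
    assert (Hv : 0 < 4 / (Cmod w * Cmod w) <= 1).
    { split; [apply Rdiv_lt_0_compat; lra|]. apply Rmult_le_reg_r with (Cmod w * Cmod w); [lra|].
      unfold Rdiv. rewrite Rmult_assoc, Rinv_l; lra. }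
    assert (Hp := pow_le_1 (4 / (Cmod w * Cmod w)) (K - 4 * m - 1) ltac:(lra)). simpl pow.
    apply Rle_trans with (Th * (4 / (Cmod w * Cmod w) * 1)).
    { apply Rmult_le_compat_l; [lra|]. apply Rmult_le_compat_l; [lra|exact Hp]. }
    apply Rle_trans with (Th * (25 / 4 * / (s * s))); [|right; ring].
    apply Rmult_le_compat_l; [lra|]. rewrite Rmult_1_r.
    (* 25/4 is the maximum of 4 s^2/((s - 3/2)^2 + 4), and this square is the defect. *)
    assert (HQ := Rle_0_sqr (5 / 2 - 6 / 10 * s)). unfold Rsqr in HQ.
    assert (Hmain : 4 * (s * s) <= 25 / 4 * (Cmod w * Cmod w)).
    { destruct Hre as [->|Hre]; [change s with 1; lra|nra]. }
    apply Rmult_le_reg_r with (Cmod w * Cmod w); [lra|].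
    unfold Rdiv at 1. rewrite Rmult_assoc, Rinv_l by lra.
    apply Rmult_le_reg_r with (s * s); auto.
    replace (25 / 4 * / (s * s) * (Cmod w * Cmod w) * (s * s)) with (25 / 4 * (Cmod w * Cmod w)) by (field; lra).
    lra. }
  unfold LN. eapply Rle_trans.
  - apply Cmod_csum_le with (M := fun j => 25 / 2 * Th * / (INR (S j) * INR (S j))). intros j _.
    destruct (Im_shift z (INR j)) as [E1 [_ E2]]. assert (Hj := pos_INR j).
    eapply Rle_trans; [apply Cmod_triangle|].
    assert (B1 := G (z + RtoC (INR j))%C j ltac:(rewrite E1; auto)).
    assert (B2 := G (z - 1 - RtoC (INR j))%C j ltac:(rewrite E2; auto)).
    assert (Er : Re (z + RtoC (INR j)) = Re z + INR j) by reflexivity.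
    assert (Er' : Re (z - 1 - RtoC (INR j)) = - (1 + INR j - Re z)) by (simpl; unfold Re; ring).
    rewrite Er in B1. rewrite Er' in B2. rewrite S_INR in *.
    assert (C1 : j = O \/ (INR j + 1 - 1 - 1 / 2) * (INR j + 1 - 1 - 1 / 2) <= (Re z + INR j) * (Re z + INR j)).
    { destruct j as [|j]; [left; auto|right]. rewrite S_INR in *. assert (Hj' := pos_INR j).
      apply Rmult_le_compat; lra. }
    assert (C2 : j = O \/ (INR j + 1 - 1 - 1 / 2) * (INR j + 1 - 1 - 1 / 2) <=
       - (1 + INR j - Re z) * - (1 + INR j - Re z)).
    { destruct j as [|j]; [left; auto|right]. rewrite S_INR in *. assert (Hj' := pos_INR j).
      replace (- (1 + (INR j + 1) - Re z) * - (1 + (INR j + 1) - Re z)) with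
        ((1 + (INR j + 1) - Re z) * (1 + (INR j + 1) - Re z)) by ring.
      apply Rmult_le_compat; lra. }
    specialize (B1 C1). specialize (B2 C2). lra.
  - rewrite rsum_scal. assert (H := rsum_inv_sq_le N). nra.
Qed.

(** Cauchy's estimate on radius r bounds the coefficients of the head H, of degree at most l; for
    |u| >= 21 r the geometric sum is within 21/20 of its last term. *)
Lemma poly_truncate (P : C -> C) (l : nat) (r B : R) : ispoly P -> 0 < r ->
  (forall t, Cmod (P (RtoC r * Cexp (Ci * RtoC t))%C) <= B) ->
  exists H Q, ispoly Q /\ (forall u, P u = H u + u ^ S l * Q u)%C /\
    forall u, 21 * r <= Cmod u -> Cmod (H u) <= 21 / 20 * B * (Cmod u / r) ^ l.
Proof.
  intros [p Hp] Hr HB.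
  set (c := fun i => nth i p (RtoC 0)).
  assert (E : forall n u, (P u = csum (fun i => c i * u ^ i) n + u ^ n * peval (skipn n p) u)%C).
  { intros n u. rewrite Hp. unfold c. clear. revert p. induction n as [|n IH]; intros p; [simpl; ring|].
    rewrite csum_S_l. destruct p as [|a p]; simpl.
    - rewrite (csum_ext _ (fun _ => RtoC 0)); [rewrite csum_0; ring|]. intros j _. ring.
    - rewrite (csum_ext _ (fun j => u * (nth j p (RtoC 0) * u ^ j))%C) by (intros; ring).
      rewrite csum_scal, (IH p). ring. }
  exists (fun u => csum (fun i => c i * u ^ i)%C (S l)), (peval (skipn (S l) p)).
  split; [exists (skipn (S l) p); auto|split; [auto|]].
  intros u Hu. set (x := Cmod u / r).
  assert (Hx : 21 <= x). { unfold x. apply Rmult_le_reg_r with r; auto. unfold Rdiv. rewrite Rmult_assoc, Rinv_l; lra. }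
  assert (HB0 : 0 <= B) by (eapply Rle_trans; [apply Cmod_ge_0|apply (HB 0)]).
  eapply Rle_trans; [apply Cmod_csum_le with (M := fun i => B * x ^ i)|].
  - intros i _. rewrite Cmod_mult, Cmod_pow.
    assert (Hc := coef_bound p r B i Hr ltac:(intros t; rewrite <- Hp; apply HB)). fold (c i) in Hc.
    unfold x, Rdiv. rewrite Rpow_mult_distr, pow_inv.
    assert (Hri : 0 < r ^ i) by (apply pow_lt; auto).
    replace (Cmod (c i) * Cmod u ^ i) with (Cmod (c i) * r ^ i * (Cmod u ^ i * / r ^ i)) by (field; lra).
    apply Rmult_le_compat_r; auto. apply Rmult_le_pos; [apply pow_le, Cmod_ge_0|].
    left. apply Rinv_0_lt_compat. auto.
  - rewrite rsum_scal. rewrite (Rmult_comm (21 / 20)), !Rmult_assoc. apply Rmult_le_compat_l; auto.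
    clear -Hx. induction l as [|l IH]; [simpl; lra|].
    assert (0 < x ^ l) by (apply pow_lt; lra). change (rsum (pow x) (S (S l))) with (rsum (pow x) (S l) + x ^ S l).
    simpl pow at 2. simpl pow at 3.
    assert (21 * x ^ l <= x * x ^ l) by (apply Rmult_le_compat_r; lra). simpl pow. simpl pow in *. lra.
Qed.

(* The translates of q^m|S by the integers n with |n| >= 2. *)
Definition far_translates (k m N : nat) (z : C) : C :=
  (csum (fun j => Sl k m (z + RtoC (INR (S (S j)))) + Sl k m (z - RtoC (INR (S (S j))))) N +
   Sl k m (z - RtoC (INR (S (S N)))))%C.

(** The sum runs over -N - 2 <= n <= N + 1; the asymmetry accounts for the unpaired term of
    [far_translates]. *)
Lemma LN_split (k m N : nat) (z : C) :
  LN k m (S (S N)) z = (Sl k m z + Sl k m (z + 1) + Sl k m (z - 1) + far_translates k m N z)%C.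
Proof.
  assert (G : forall n, LN k m (S n) z =
    (Sl k m z + csum (fun j => Sl k m (z + RtoC (INR (S j))) + Sl k m (z - RtoC (INR (S j)))) n +
     Sl k m (z - RtoC (INR (S n))))%C).
  { unfold LN. induction n as [|n IH].
    - cbn [csum]. assert (E1 : (z + RtoC (INR 0) = z)%C) by (simpl; ring).
      assert (E2 : (z - 1 - RtoC (INR 0) = z - RtoC (INR 1))%C) by (simpl; ring). rewrite E1, E2, Cplus_0_l, Cplus_0_r. reflexivity.
    - change (csum (fun j => Sl k m (z + RtoC (INR j)) + Sl k m (z - 1 - RtoC (INR j)))%C (S (S n))) with
        (csum (fun j => Sl k m (z + RtoC (INR j)) + Sl k m (z - 1 - RtoC (INR j))) (S n) +
         (Sl k m (z + RtoC (INR (S n))) + Sl k m (z - 1 - RtoC (INR (S n)))))%C.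
      rewrite IH.
      replace (z - 1 - RtoC (INR (S n)))%C with (z - RtoC (INR (S (S n))))%C
        by (rewrite (S_INR (S n)), RtoC_plus; ring).
      cbn [csum]. ring. }
  rewrite G, csum_S_l. unfold far_translates. simpl INR at 1 2. ring.
Qed.

(** The pairs give 16 M, because the sum of 1/(j + 1)^2 is at most 2, and the unpaired term gives
    M. *)
Lemma far_translates_bound (k m N : nat) (z : C) (M : R) :
  (forall n, (2 <= n)%nat -> Cmod (Sl k m (z + RtoC (INR n))) <= M * (4 / (INR n * INR n)) /\
                             Cmod (Sl k m (z - RtoC (INR n))) <= M * (4 / (INR n * INR n))) ->
  0 <= M -> Cmod (far_translates k m N z) <= 17 * M.
Proof.
  intros H HM. unfold far_translates. eapply Rle_trans; [apply Cmod_triangle|].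
  assert (B1 : Cmod (csum (fun j => Sl k m (z + RtoC (INR (S (S j)))) + Sl k m (z - RtoC (INR (S (S j)))))%C N) <= 16 * M).
  { eapply Rle_trans; [apply Cmod_csum_le with (M := fun j => 8 * M * / (INR (S j) * INR (S j)))|].
    - intros j _. eapply Rle_trans; [apply Cmod_triangle|]. destruct (H (S (S j)) ltac:(lia)) as [H1 H2].
      assert (Hj := nS_pos j).
      assert (H3 : / (INR (S (S j)) * INR (S (S j))) <= / (INR (S j) * INR (S j))).
      { rewrite (S_INR (S j)). apply Rinv_le_contravar; nra. }
      unfold Rdiv in *. assert (M * / (INR (S (S j)) * INR (S (S j))) <= M * / (INR (S j) * INR (S j))) by (apply Rmult_le_compat_l; auto). lra.
    - rewrite rsum_scal. assert (H0 := rsum_inv_sq_le N). nra. }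
  destruct (H (S (S N)) ltac:(lia)) as [_ H2].
  assert (H3 : 4 / (INR (S (S N)) * INR (S (S N))) <= 1).
  { rewrite !S_INR. assert (HN := pos_INR N).
    apply Rmult_le_reg_r with ((INR N + 1 + 1) * (INR N + 1 + 1)); [nra|].
    unfold Rdiv. rewrite Rmult_assoc, Rinv_l; nra. }
  assert (M * (4 / (INR (S (S N)) * INR (S (S N)))) <= M * 1) by (apply Rmult_le_compat_l; auto). lra.
Qed.

Lemma far_translates_bound_pow (k m N : nat) (z : C) (a : R) : 0 < Im z -> 0 < a -> (2 <= k)%nat ->
  (forall n, (2 <= n)%nat -> a * INR n <= Cmod (z + RtoC (INR n)) /\ a * INR n <= Cmod (z - RtoC (INR n))) ->
  Cmod (far_translates k m N z) <= 17 * (/ (2 * a)) ^ k.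
Proof.
  intros Hz Ha Hk H. apply far_translates_bound.
  - intros n Hn. destruct (H n Hn) as [H1 H2]. destruct (Im_shift z (INR n)) as [E1 [E2 _]].
    assert (Hn' : 2 <= INR n) by (apply (le_INR 2); auto).
    assert (G : (/ (a * INR n)) ^ k <= (/ (2 * a)) ^ k * (4 / (INR n * INR n))).
    { replace (/ (a * INR n)) with (/ (2 * a) * (2 / INR n)) by (field; lra).
      rewrite Rpow_mult_distr. apply Rmult_le_compat_l; [apply pow_le; left; apply Rinv_0_lt_compat; lra|].
      replace k with (2 + (k - 2))%nat by lia. rewrite pow_add.
      assert (H2n : 0 <= 2 / INR n <= 1).
      { split; [apply Rmult_le_pos; [lra|left; apply Rinv_0_lt_compat; lra]|].
        apply Rmult_le_reg_r with (INR n); [lra|]. unfold Rdiv. rewrite Rmult_assoc, Rinv_l; lra. }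
      assert (H3 := pow_le_1 (2 / INR n) (k - 2) H2n).
      replace (4 / (INR n * INR n)) with ((2 / INR n) ^ 2 * 1) by (simpl; field; lra).
      apply Rmult_le_compat_l; auto. apply pow_le; lra. }
    split; (eapply Rle_trans; [apply Cmod_Sl_le with (a := (a * INR n)%R)|exact G]).
    + rewrite E1; auto.
    + split; [apply Rmult_lt_0_compat; lra|auto].
    + rewrite E2; auto.
    + split; [apply Rmult_lt_0_compat; lra|auto].
  - apply pow_le. left. apply Rinv_0_lt_compat. lra.
Qed.

Lemma qpar_shift (z : C) : qpar (z + 1) = qpar z /\ qpar (z - 1) = qpar z.
Proof.
  assert (H1 : qpar 1 = 1%C).
  { rewrite <- (Cexp_i_2PI_nat 1) at 2. unfold qpar. f_equal. simpl INR. rewrite Rmult_1_r. ring. }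
  split.
  - rewrite qpar_plus, H1. ring.
  - assert (E : (qpar (z - 1) * qpar 1 = qpar z)%C) by (rewrite <- qpar_plus; f_equal; ring).
    rewrite <- E, H1. ring.
Qed.

Lemma Cpow_even_opp (z : C) (K : nat) : ((- z) ^ (2 * K) = z ^ (2 * K))%C.
Proof. rewrite !Cpow_mult_r. f_equal. simpl. ring. Qed.

Lemma Im_neq_0_shift (z : C) (x : R) : 0 < Im z -> (z + RtoC x <> 0)%C /\ (z - RtoC x <> 0)%C.
Proof.
  intros H. destruct (Im_shift z x) as [E1 [E2 _]].
  split; apply Im_pos_neq_0; [rewrite E1|rewrite E2]; auto.
Qed.

(** S exchanges q^m with q^m|S. It exchanges q^m|ST with q^m|ST^(-1) because STS = T^(-1) S T^(-1)
    and q^m is invariant under T. *)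
Lemma Sl_S (K m : nat) (z : C) : 0 < Im z ->
  ((/ z) ^ (2 * K) * Sl (2 * K) m (- / z) = qpar z ^ m)%C /\
  ((/ z) ^ (2 * K) * Sl (2 * K) m (- / z + 1) = Sl (2 * K) m (z - 1))%C /\
  ((/ z) ^ (2 * K) * Sl (2 * K) m (- / z - 1) = Sl (2 * K) m (z + 1))%C.
Proof.
  intros Hz. assert (H0 := Im_pos_neq_0 z Hz). destruct (Im_neq_0_shift z 1 Hz) as [Hp Hm].
  assert (Hp' : (RtoC (-1) - z <> 0)%C).
  { intros E. apply Hp. replace (z + RtoC 1)%C with (- (RtoC (-1) - z))%C by ring. rewrite E. ring. }
  unfold Sl. repeat split.
  - assert (E : (/ - / z = - z)%C) by (field; auto). rewrite E, Cmult_assoc, <- Cpow_mult_l.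
    replace (/ z * - z)%C with (- (1))%C by (field; auto).
    rewrite Cpow_even_opp, Cpow_1_l, Cmult_1_l. do 2 f_equal.
    ring.
  - assert (E : (/ (- / z + 1) = z * / (z - 1))%C) by (field; auto).
    rewrite E, Cmult_assoc, <- Cpow_mult_l.
    replace (/ z * (z * / (z - 1)))%C with (/ (z - 1))%C by (field; auto). do 2 f_equal.
    transitivity (qpar (- / (z - 1) - 1)); [f_equal; field; auto|apply qpar_shift].
  - assert (E : (/ (- / z - 1) = - (z * / (z + 1)))%C) by (field; auto).
    rewrite E, Cpow_even_opp, Cmult_assoc, <- Cpow_mult_l.
    replace (/ z * (z * / (z + 1)))%C with (/ (z + 1))%C by (field; auto). do 2 f_equal.
    transitivity (qpar (- / (z + 1) + 1)); [f_equal; field; auto|apply qpar_shift].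
Qed.

(* The terms n = -1, 0, 1 of the sum over translates are permuted by S together with q^m itself, so only the far
   translates and the truncated head contribute to the failure of modularity of the tail. *)
Lemma form_source (K l m : nat) (f : C -> C) (a : nat -> C) (P H Q : C -> C) (eps y : R) (N0 : nat) (z : C) :
  (1 <= K)%nat -> vanish_form (2 * K) l m f a ->
  (forall u, P u = H u + u ^ S l * Q u)%C ->
  (forall N z, (N0 <= N)%nat -> 7 / 10 <= Im z -> Rabs (Re z) <= 1 -> Cmod (LN (2 * K) m N z - P (qpar z)) <= eps) ->
  7 / 10 <= Im z -> 7 / 10 <= Im (- / z) -> Rabs (Re z) <= 1 -> Rabs (Re (- / z)) <= 1 ->
  0 < y -> (forall n, (2 <= n)%nat -> y * INR n <= Cmod (z + RtoC (INR n)) /\ y * INR n <= Cmod (z - RtoC (INR n)) /\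
     y * INR n <= Cmod (1 + RtoC (INR n) * z) /\ y * INR n <= Cmod (1 - RtoC (INR n) * z)) ->
  let e := fun z => (f z - qpar z ^ m - qpar z ^ S l * Q (qpar z))%C in
  Cmod (e z - (/ z) ^ (2 * K) * e (- / z)%C) <=
    Cmod (H (qpar z)) + (/ Cmod z) ^ (2 * K) * Cmod (H (qpar (- / z))) +
    34 * (/ (2 * y)) ^ (2 * K) + eps * (1 + (/ Cmod z) ^ (2 * K)).
Proof.
  intros HK Hf HP HL Hz Hz' Hx Hx' Hy Hn e.
  assert (Hz0 : 0 < Im z) by lra. assert (H0 := Im_pos_neq_0 z Hz0). assert (HC := Cmod_pos z H0).
  set (w := (- / z)%C) in *. set (J := ((/ z) ^ (2 * K))%C).
  assert (HJ : Cmod J = (/ Cmod z) ^ (2 * K)) by (unfold J; rewrite Cmod_pow, Cmod_inv; auto).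
  assert (Ef : f z = (J * f w)%C).
  { unfold w. rewrite (proj1 Hf z Hz0). unfold J. rewrite Cmult_assoc, <- Cpow_mult_l.
    replace (/ z * z)%C with (RtoC 1) by (field; auto). rewrite Cpow_1_l. ring. }
  destruct (Sl_S K m z Hz0) as [S0 [S1 S2]]. fold w J in S0, S1, S2.
  set (N := N0). assert (L1 := HL (S (S N)) z ltac:(unfold N; lia) Hz Hx).
  assert (L2 := HL (S (S N)) w ltac:(unfold N; lia) Hz' Hx').
  rewrite LN_split in L1, L2.
  set (T1 := far_translates (2 * K) m N z) in *. set (T2 := far_translates (2 * K) m N w) in *.
  assert (B1 : Cmod T1 <= 17 * (/ (2 * y)) ^ (2 * K)).
  { apply far_translates_bound_pow; auto; [lia|]. intros n Hn2. destruct (Hn n Hn2) as [A1 [A2 _]]. auto. }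
  assert (B2 : Cmod J * Cmod T2 <= 17 * (/ (2 * y)) ^ (2 * K)).
  { apply Rle_trans with (Cmod J * (17 * (/ (2 * (y * / Cmod z))) ^ (2 * K))).
    - apply Rmult_le_compat_l; [apply Cmod_ge_0|]. apply far_translates_bound_pow; [lra| |lia|].
      + apply Rmult_lt_0_compat; auto. apply Rinv_0_lt_compat; auto.
      + intros n Hn2. destruct (Hn n Hn2) as [_ [_ [A1 A2]]].
        assert (E1 : (w + RtoC (INR n) = - (/ z * (1 - RtoC (INR n) * z)))%C) by (unfold w; field; auto).
        assert (E2 : (w - RtoC (INR n) = - (/ z * (1 + RtoC (INR n) * z)))%C) by (unfold w; field; auto).
        rewrite E1, E2, !Cmod_opp, !Cmod_mult, Cmod_inv by auto.
        assert (Hi := Rinv_0_lt_compat _ HC).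
        split; replace (y * / Cmod z * INR n) with (/ Cmod z * (y * INR n)) by ring;
          apply Rmult_le_compat_l; lra.
    - right. rewrite HJ. replace (/ (2 * (y * / Cmod z))) with (Cmod z * / (2 * y)) by (field; lra).
      rewrite Rpow_mult_distr.
      replace (17 * (/ (2 * y)) ^ (2 * K)) with
        ((/ Cmod z * Cmod z) ^ (2 * K) * (17 * (/ (2 * y)) ^ (2 * K))) by (rewrite Rinv_l, pow1 by lra; ring).
      rewrite Rpow_mult_distr. ring. }
  set (D1 := (Sl (2 * K) m z + Sl (2 * K) m (z + 1) + Sl (2 * K) m (z - 1) + T1 - P (qpar z))%C) in *.
  set (D2 := (Sl (2 * K) m w + Sl (2 * K) m (w + 1) + Sl (2 * K) m (w - 1) + T2 - P (qpar w))%C) in *.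
  assert (Sz : (J * qpar w ^ m = Sl (2 * K) m z)%C) by reflexivity.
  assert (E : (e z - J * e w = D1 - J * D2 - T1 + J * T2 + H (qpar z) - J * H (qpar w))%C).
  { unfold e, D1, D2.
    replace (qpar z ^ S l * Q (qpar z))%C with (P (qpar z) - H (qpar z))%C by (rewrite HP; ring).
    replace (qpar w ^ S l * Q (qpar w))%C with (P (qpar w) - H (qpar w))%C by (rewrite HP; ring).
    rewrite Ef, <- S0, <- S1, <- S2, <- Sz. ring. }
  rewrite E.
  assert (M : Cmod (D1 - J * D2 - T1 + J * T2 + H (qpar z) - J * H (qpar w)) <=
    Cmod D1 + Cmod J * Cmod D2 + Cmod T1 + Cmod J * Cmod T2 + Cmod (H (qpar z)) + Cmod J * Cmod (H (qpar w))).
  { rewrite <- !Cmod_mult.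
    eapply Rle_trans; [apply Cmod_sub_triangle|]. apply Rplus_le_compat_r.
    eapply Rle_trans; [apply Cmod_triangle|]. apply Rplus_le_compat_r.
    eapply Rle_trans; [apply Cmod_triangle|]. apply Rplus_le_compat_r.
    eapply Rle_trans; [apply Cmod_sub_triangle|]. apply Rplus_le_compat_r.
    apply Cmod_sub_triangle. }
  rewrite HJ in *.
  assert (HJ0 : 0 <= (/ Cmod z) ^ (2 * K)) by (rewrite <- HJ; apply Cmod_ge_0).
  assert ((/ Cmod z) ^ (2 * K) * Cmod D2 <= (/ Cmod z) ^ (2 * K) * eps) by (apply Rmult_le_compat_l; auto).
  lra.
Qed.

(** * Numerical bounds for the exponential, the discriminant and the source term *)

(** exp(-t) times the polynomial is nondecreasing on [0, 2], its derivative being exp(-t) t^3 (1/6 -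
    t/12). *)
Lemma exp_upper (x : R) : 0 <= x <= 2 ->
  exp x <= 1 + x + x * x / 2 + x * x * x / 6 + x * x * x * x / 12.
Proof.
  intros Hx. set (h := fun t => exp (- t) * (1 + t + t * t / 2 + t * t * t / 6 + t * t * t * t / 12)).
  destruct (Req_dec x 0) as [->|Hx0]; [rewrite exp_0; lra|].
  assert (Hh : 1 <= h x).
  { destruct (MVT_gen h 0 x (fun t => exp (- t) * (t * t * t * (/ 6 - t / 12)))) as [c [Hc E]].
    - intros t _. unfold h. auto_derive; auto. field.
    - intros t _. apply continuity_pt_filterlim. apply (ex_derive_continuous (V := R_NormedModule)).
      unfold h. auto_derive. auto.
    - rewrite Rmin_left, Rmax_right in Hc by lra.
      assert (H0 : h 0 = 1) by (unfold h; rewrite Ropp_0, exp_0; field). rewrite H0 in E.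
      assert (0 <= exp (- c) * (c * c * c * (/ 6 - c / 12)) * (x - 0)); [|lra].
      assert (He := exp_pos (- c)).
      apply Rmult_le_pos; [|lra]. apply Rmult_le_pos; [lra|]. apply Rmult_le_pos; [|lra].
      apply Rmult_le_pos; [|lra]. apply Rmult_le_pos; lra. }
  unfold h in Hh. rewrite exp_Ropp in Hh. assert (He := exp_pos x).
  apply Rmult_le_reg_l with (/ exp x); [apply Rinv_0_lt_compat; auto|]. rewrite Rinv_l; lra.
Qed.

(** All numerical values follow this scheme: x is small enough for a Taylor polynomial to be sharp,
    and a decimal bound for exp x is raised to the power n. *)
Lemma exp_upper_pow (x b c : R) (n : nat) : 0 <= x <= 2 ->
  1 + x + x * x / 2 + x * x * x / 6 + x * x * x * x / 12 <= b -> b ^ n <= c -> exp (INR n * x) <= c.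
Proof.
  intros Hx Hb Hc. assert (H := exp_upper x Hx). rewrite <- exp_pow.
  eapply Rle_trans; [|exact Hc]. apply pow_incr. split; [left; apply exp_pos|lra].
Qed.

Lemma exp_lower (x : R) : 0 <= x ->
  1 + x + x * x / 2 + x * x * x / 6 + x * x * x * x / 24 + x * x * x * x * x / 120 +
  x * x * x * x * x * x / 720 + x * x * x * x * x * x * x / 5040 <= exp x.
Proof.
  intros Hx. eapply Rle_trans; [|apply (exp_ge_taylor x 7 Hx)]. cbn. lra.
Qed.

Lemma exp_lower_pow (x b c : R) (n : nat) : 0 <= x -> 0 <= b ->
  b <= 1 + x + x * x / 2 + x * x * x / 6 + x * x * x * x / 24 + x * x * x * x * x / 120 +
  x * x * x * x * x * x / 720 + x * x * x * x * x * x * x / 5040 -> c <= b ^ n -> c <= exp (INR n * x).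
Proof.
  intros Hx Hb0 Hb Hc. assert (H := exp_lower x Hx). rewrite <- exp_pow.
  eapply Rle_trans; [exact Hc|]. apply pow_incr. lra.
Qed.

Lemma exp_num_2 : exp (692 / 1000) <= 2.
Proof.
  replace (692 / 1000) with (INR 2 * (346 / 1000)) by (simpl; field).
  apply exp_upper_pow with (b := 1.414); simpl; lra.
Qed.

Lemma half_pow_le (n : nat) : (/ 2) ^ n <= exp (- (692 / 1000)) ^ n.
Proof.
  apply pow_incr. split; [lra|]. rewrite exp_Ropp. apply Rinv_le_contravar; [apply exp_pos|apply exp_num_2].
Qed.

Lemma qpar_le_81 (z : C) : 7 / 10 <= Im z -> Cmod (qpar z) <= / 81.
Proof.
  intros Hz. assert (HPI := PI_bounds). rewrite Cmod_qpar, exp_Ropp.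
  apply Rinv_le_contravar; [lra|]. apply Rle_trans with (exp 4.397); [|apply exp_le; nra].
  replace 4.397 with (INR 4 * 1.09925) by (simpl; lra). apply exp_lower_pow with (b := 3.0018); simpl; lra.
Qed.

Lemma qpar_le_205 (z : C) : 17 / 20 <= Im z -> Cmod (qpar z) <= / 205.
Proof.
  intros Hz. assert (HPI := PI_bounds). rewrite Cmod_qpar, exp_Ropp.
  apply Rinv_le_contravar; [lra|]. apply Rle_trans with (exp 5.339); [|apply exp_le; nra].
  replace 5.339 with (INR 4 * 1.33475) by (simpl; lra). apply exp_lower_pow with (b := 3.798); simpl; lra.
Qed.

(** 0.304 bounds 24 r/(1 - r)^2 at r = 1/81, the bound for |q| at height 7/10. *)
Lemma Dmod_lower (z : C) : 7 / 10 <= Im z -> Cmod (qpar z) <= exp (304 / 1000) * Dmod z.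
Proof.
  intros Hz. destruct (Dmod_bounds z (/ 81) ltac:(lra) (qpar_le_81 z Hz) ltac:(lra)) as [H _].
  assert (H1 := Cmod_ge_0 (qpar z)).
  assert (H2 : exp (- (304 / 1000)) <= exp (- (24 * (/ 81 / ((1 - / 81) * (1 - / 81)))))) by (apply exp_le; lra).
  assert (H3 : exp (- (304 / 1000)) * Cmod (qpar z) <= Dmod z).
  { eapply Rle_trans; [|exact H]. apply Rmult_le_compat_r; auto. }
  apply Rle_trans with (exp (304 / 1000) * (exp (- (304 / 1000)) * Cmod (qpar z))).
  - right. rewrite <- Rmult_assoc, <- exp_plus, Rplus_opp_r, exp_0. ring.
  - apply Rmult_le_compat_l; auto. left. apply exp_pos.
Qed.

Lemma Dmod_upper (z : C) : 17 / 20 <= Im z -> Dmod z <= exp (119 / 1000) * Cmod (qpar z).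
Proof.
  intros Hz. destruct (Dmod_bounds z (/ 205) ltac:(lra) (qpar_le_205 z Hz) ltac:(lra)) as [_ H].
  eapply Rle_trans; [exact H|]. apply Rmult_le_compat_r; [apply Cmod_ge_0|]. apply exp_le. lra.
Qed.

(** Here t = |z|^2 on the line. The extreme value is the one at t = 0.49, that is at z = 7i/10, and
    v measures the distance from it. *)
Lemma line_weight (t : R) : 49 / 100 <= t <= 74 / 100 -> t ^ 6 * exp (2 * PI * (7 / 10 / t)) <= 113.
Proof.
  intros Ht. assert (HPI := PI_bounds). set (v := 1 - 49 / 100 / t).
  assert (Hit : / (74 / 100) <= / t <= / (49 / 100)) by (split; apply Rinv_le_contravar; lra).
  assert (Hv : 0 <= v <= 34 / 100) by (unfold v, Rdiv; lra).
  assert (Et : t * (1 - v) = 49 / 100) by (unfold v; field; lra).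
  assert (E : exp (2 * PI * (7 / 10 / t)) = exp (2 * PI * (10 / 7)) * / exp (2 * PI * (10 / 7) * v)).
  { rewrite <- exp_Ropp, <- exp_plus. f_equal. unfold v. field. lra. }
  assert (H1 : exp (2 * PI * (10 / 7)) <= 8000).
  { apply Rle_trans with (exp (INR 32 * 0.28055)).
    - apply exp_le. replace (INR 32) with 32 by (simpl; lra). lra.
    - apply exp_upper_pow with (b := 1.32412); [lra|lra|]. replace (1.32412 ^ 32) with ((((1.32412 ^ 2) ^ 2) ^ 2) ^ 4) by (rewrite <- !pow_mult; reflexivity).
      assert (P1 : 1.32412 ^ 2 <= 1.753294) by (simpl; lra). assert (P2 : (1.32412 ^ 2) ^ 2 <= 1.753294 ^ 2) by (apply pow_incr; split; [apply pow2_ge_0|auto]).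
      lra. }
  assert (H2 : t ^ 6 <= (49 / 100) ^ 6 * exp (2 * PI * (10 / 7) * v)).
  { apply Rle_trans with ((49 / 100 * exp (1.495 * v)) ^ 6).
    - apply pow_incr. split; [lra|]. assert (Hl := exp_lower (1.495 * v) ltac:(lra)).
      assert (Hl2 : 1 + 1.495 * v + (1.495 * v) * (1.495 * v) / 2 <= exp (1.495 * v)).
      { eapply Rle_trans; [|exact Hl]. set (x := 1.495 * v) in *. assert (Hx0 : 0 <= x) by (unfold x; lra). clearbody x.
        assert (0 <= x * x * x) by (repeat apply Rmult_le_pos; auto).
        assert (0 <= x * x * x * x) by (repeat apply Rmult_le_pos; auto).
        assert (0 <= x * x * x * x * x) by (repeat apply Rmult_le_pos; auto).
        assert (0 <= x * x * x * x * x * x) by (repeat apply Rmult_le_pos; auto).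
        assert (0 <= x * x * x * x * x * x * x) by (repeat apply Rmult_le_pos; auto). lra. }
      rewrite <- Et. rewrite Rmult_assoc. rewrite <- (Rmult_1_r t) at 1. apply Rmult_le_compat_l; [lra|].
      apply Rle_trans with ((1 - v) * (1 + 1.495 * v + (1.495 * v) * (1.495 * v) / 2));
        [|apply Rmult_le_compat_l; lra].
      assert (0 <= v * (0.495 - 0.37749 * v - 1.1175125 * (v * v))); [|nra].
      apply Rmult_le_pos; [lra|]. assert (v * v <= 34 / 100 * (34 / 100)) by (apply Rmult_le_compat; lra). lra.
    - rewrite Rpow_mult_distr. apply Rmult_le_compat_l; [apply pow_le; lra|]. rewrite exp_pow. apply exp_le.
      simpl. assert (8.97 * v <= 2 * PI * (10 / 7) * v) by (apply Rmult_le_compat_r; lra). lra. }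
  rewrite E. assert (He := exp_pos (2 * PI * (10 / 7) * v)). assert (He0 := exp_pos (2 * PI * (10 / 7))).
  apply Rle_trans with ((49 / 100) ^ 6 * exp (2 * PI * (10 / 7) * v) * (exp (2 * PI * (10 / 7)) * / exp (2 * PI * (10 / 7) * v))).
  - apply Rmult_le_compat_r; auto. apply Rmult_le_pos; [lra|]. left. apply Rinv_0_lt_compat; auto.
  - replace ((49 / 100) ^ 6 * exp (2 * PI * (10 / 7) * v) * (exp (2 * PI * (10 / 7)) * / exp (2 * PI * (10 / 7) * v)))
      with ((49 / 100) ^ 6 * exp (2 * PI * (10 / 7))) by (field; lra).
    simpl. lra.
Qed.

(* The size of q^m|S on the line Im z = 2, up to a constant. *)
Definition thr (K m : nat) : R := (/ 2) ^ (2 * K) * exp (- PI) ^ m.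

(** Chosen so that the bound for the head, divided by |Delta|^(l+1), is at most [head_scale]/|q|.
    The number 27.3 is 26 times 21/20, and exp(0.304) converts |q| into |Delta|. *)
Definition head_scale (K m l : nat) : R :=
  273 / 10 * thr K m * exp (4 * PI) ^ l * exp (304 / 1000) ^ S l.

Lemma thr_pos (K m : nat) : 0 < thr K m.
Proof. unfold thr. apply Rmult_lt_0_compat; apply pow_lt; [lra|apply exp_pos]. Qed.

Lemma head_scale_pos (K m l : nat) : 0 < head_scale K m l.
Proof.
  unfold head_scale. assert (H := thr_pos K m).
  assert (0 < exp (4 * PI) ^ l) by (apply pow_lt, exp_pos).
  assert (0 < exp (304 / 1000) ^ S l) by (apply pow_lt, exp_pos).
  apply Rmult_lt_0_compat; auto. apply Rmult_lt_0_compat; auto. lra.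
Qed.

Lemma head_bound_alt (K m l : nat) (y : R) :
  273 / 10 * thr K m * exp (2 * PI * (2 - y)) ^ l =
  273 / 10 * thr K m * exp (4 * PI) ^ l * exp (- (2 * PI * y)) ^ S l * exp (2 * PI * y).
Proof.
  rewrite !exp_pow, !(Rmult_assoc _ (exp _)), <- !exp_plus. do 2 f_equal. rewrite S_INR. ring.
Qed.

Lemma head_Dmod (K m l : nat) (z : C) : 7 / 10 <= Im z ->
  273 / 10 * thr K m * exp (2 * PI * (2 - Im z)) ^ l <=
  head_scale K m l * exp (2 * PI * Im z) * Dmod z ^ S l.
Proof.
  intros Hz. rewrite head_bound_alt. assert (H := Dmod_lower z Hz). rewrite Cmod_qpar in H.
  assert (HD := Dmod_pos z). assert (HT := thr_pos K m).
  assert (H1 : exp (- (2 * PI * Im z)) ^ S l <= (exp (304 / 1000) * Dmod z) ^ S l).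
  { apply pow_incr. split; [left; apply exp_pos|auto]. }
  rewrite Rpow_mult_distr in H1.
  set (A := 273 / 10 * thr K m * exp (4 * PI) ^ l).
  assert (HA : 0 <= A).
  { unfold A. apply Rmult_le_pos; [lra|]. apply pow_le. left. apply exp_pos. }
  replace (head_scale K m l * exp (2 * PI * Im z) * Dmod z ^ S l) with
    (A * (exp (304 / 1000) ^ S l * Dmod z ^ S l) * exp (2 * PI * Im z)) by (unfold head_scale, A; ring).
  apply Rmult_le_compat_r; [left; apply exp_pos|]. apply Rmult_le_compat_l; auto.
Qed.

(** The far translates are of order (2y)^(-k), while the head bound has the factor 2^(-k) and in
    addition exp(2 pi (2 - y) l), which wins because l is large against m. The factor 36 is 34 for
    the translates and 2 for the approximation of L by P. *)
Lemma far_small (K K' l m : nat) (y : R) : K = (6 * l + K')%nat -> (K' <= 7)%nat -> (1 <= m)%nat ->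
  (9 * m + 20 <= 2 * l)%nat -> (y = 7 / 10 \/ y = 1) ->
  36 * (/ (2 * y)) ^ (2 * K) <= 1 / 100 * (273 / 10 * thr K m * exp (2 * PI * (2 - y)) ^ l).
Proof.
  intros HK HK' Hm Hl Hy. assert (HPI := PI_bounds). unfold thr.
  assert (Hl' : 9 * INR m + 20 <= 2 * INR l).
  { apply le_INR in Hl. rewrite plus_INR, !mult_INR in Hl. simpl in Hl. lra. }
  assert (Hm' : 1 <= INR m) by (apply (le_INR 1); auto).
  assert (Hyp : 0 < y) by (destruct Hy; lra).
  rewrite Rinv_mult, Rpow_mult_distr.
  assert (Hp := pow_lt (/ 2) (2 * K) ltac:(lra)).
  assert (Hy2 : (/ y) ^ (2 * K) <= exp (36 / 100 * (1 - y) / (3 / 10)) ^ (2 * K)).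
  { apply pow_incr. split; [left; apply Rinv_0_lt_compat; auto|].
    destruct Hy as [-> | ->].
    - replace (36 / 100 * (1 - 7 / 10) / (3 / 10)) with 0.36 by lra.
      eapply Rle_trans; [|apply exp_lower; lra]. lra.
    - replace (36 / 100 * (1 - 1) / (3 / 10)) with 0 by lra. rewrite exp_0. lra. }
  assert (He : 131.9 <= exp 4.9).
  { replace 4.9 with (INR 4 * 1.225) by (simpl; lra). apply exp_lower_pow with (b := 3.4); simpl; lra. }
  assert (Hmain : exp 4.9 * exp (36 / 100 * (1 - y) / (3 / 10)) ^ (2 * K) <=
    exp (- PI) ^ m * exp (2 * PI * (2 - y)) ^ l).
  { rewrite !exp_pow, <- !exp_plus. apply exp_le.
    assert (HKr : INR (2 * K) <= 12 * INR l + 14).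
    { replace 14 with (INR 14) by (simpl; lra). replace 12 with (INR 12) by (simpl; lra).
      rewrite <- mult_INR, <- plus_INR. apply le_INR. lia. }
    assert (Hpm : INR m * PI <= INR m * 3.142) by (apply Rmult_le_compat_l; lra).
    assert (Hpl : INR l * 3.141 <= INR l * PI) by (apply Rmult_le_compat_l; lra).
    destruct Hy as [-> | ->].
    - replace (INR (2 * K) * (36 / 100 * (1 - 7 / 10) / (3 / 10))) with (INR (2 * K) * 0.36) by lra.
      replace (INR l * (2 * PI * (2 - 7 / 10))) with (2.6 * (INR l * PI)) by lra. lra.
    - replace (INR (2 * K) * (36 / 100 * (1 - 1) / (3 / 10))) with 0 by lra.
      replace (INR l * (2 * PI * (2 - 1))) with (2 * (INR l * PI)) by lra. lra. }
  set (X := exp (- PI) ^ m * exp (2 * PI * (2 - y)) ^ l) in *.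
  set (Y := exp (36 / 100 * (1 - y) / (3 / 10)) ^ (2 * K)) in *.
  assert (HY : 0 < Y) by (apply pow_lt, exp_pos).
  assert (131.9 * Y <= exp 4.9 * Y) by (apply Rmult_le_compat_r; lra).
  replace (1 / 100 * (273 / 10 * ((/ 2) ^ (2 * K) * exp (- PI) ^ m) * exp (2 * PI * (2 - y)) ^ l))
    with ((/ 2) ^ (2 * K) * (273 / 1000 * X)) by (unfold X; field).
  replace (36 * ((/ 2) ^ (2 * K) * (/ y) ^ (2 * K))) with ((/ 2) ^ (2 * K) * (36 * (/ y) ^ (2 * K))) by ring.
  apply Rmult_le_compat_l; lra.
Qed.

Lemma translate_bounds_line (z : C) (n : nat) : Im z = 7 / 10 -> Rabs (Re z) <= 1 / 2 -> (2 <= n)%nat ->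
  7 / 10 * INR n <= Cmod (z + RtoC (INR n)) /\ 7 / 10 * INR n <= Cmod (z - RtoC (INR n)) /\
  7 / 10 * INR n <= Cmod (1 + RtoC (INR n) * z) /\ 7 / 10 * INR n <= Cmod (1 - RtoC (INR n) * z).
Proof.
  intros Hz Hx Hn. apply Rabs_le_between in Hx. assert (Hn' : 2 <= INR n) by (apply (le_INR 2); auto).
  assert (E1 : Re (z + RtoC (INR n)) = Re z + INR n) by reflexivity.
  assert (E2 : Re (z - RtoC (INR n)) = Re z - INR n) by reflexivity.
  assert (E3 : Im (1 + RtoC (INR n) * z) = INR n * Im z) by (simpl; unfold Im; ring).
  assert (E4 : Im (1 - RtoC (INR n) * z) = - (INR n * Im z)) by (simpl; unfold Im; ring).
  repeat split.
  - eapply Rle_trans; [|apply Cmod_Re_le]. rewrite E1. eapply Rle_trans; [|apply Rle_abs]. lra.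
  - rewrite Cmod_sub_comm. eapply Rle_trans; [|apply Cmod_Re_le].
    replace (Re (RtoC (INR n) - z)) with (INR n - Re z) by reflexivity.
    eapply Rle_trans; [|apply Rle_abs]. lra.
  - eapply Rle_trans; [|apply Cmod_Im_le]. rewrite E3, Hz. eapply Rle_trans; [|apply Rle_abs]. lra.
  - eapply Rle_trans; [|apply Cmod_Im_le]. rewrite E4, Hz, Rabs_Ropp. eapply Rle_trans; [|apply Rle_abs]. lra.
Qed.

Lemma translate_bounds_Ci (n : nat) : (2 <= n)%nat ->
  1 * INR n <= Cmod (Ci + RtoC (INR n)) /\ 1 * INR n <= Cmod (Ci - RtoC (INR n)) /\
  1 * INR n <= Cmod (1 + RtoC (INR n) * Ci) /\ 1 * INR n <= Cmod (1 - RtoC (INR n) * Ci).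
Proof.
  intros Hn. assert (Hn' : 2 <= INR n) by (apply (le_INR 2); auto).
  assert (E1 : Re (Ci + RtoC (INR n)) = INR n) by (simpl; ring).
  assert (E2 : Re (RtoC (INR n) - Ci) = INR n) by (simpl; ring).
  assert (E3 : Im (1 + RtoC (INR n) * Ci) = INR n) by (simpl; ring).
  assert (E4 : Im (RtoC (INR n) * Ci - 1) = INR n) by (simpl; ring).
  rewrite (Cmod_sub_comm Ci), (Cmod_sub_comm 1), Rmult_1_l.
  repeat split; (eapply Rle_trans; [apply Rle_abs|]);
    [rewrite <- E1 at 1; apply Cmod_Re_le|rewrite <- E2 at 1; apply Cmod_Re_le|
     rewrite <- E3 at 1; apply Cmod_Im_le|rewrite <- E4 at 1; apply Cmod_Im_le].
Qed.

(** The weight cancels against |Delta(-1/z)| = |z|^12 |Delta(z)| up to |z|^(12 - k'), the multiplier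
    met in the contraction. *)
Lemma head_S_bound (K K' l m : nat) (z : C) : K = (6 * l + K')%nat -> 0 < Im z -> 7 / 10 <= Im (- / z) ->
  (/ Cmod z) ^ (2 * K) * (273 / 10 * thr K m * exp (2 * PI * (2 - Im (- / z))) ^ l) <=
  head_scale K m l * ((Cmod z * Cmod z) ^ 6 * exp (2 * PI * Im (- / z)) * (/ (Cmod z * Cmod z)) ^ K') * Dmod z ^ S l.
Proof.
  intros HK Hz Hz'. assert (HC : 0 < Cmod z) by (apply Cmod_pos, Im_pos_neq_0; auto).
  eapply Rle_trans; [apply Rmult_le_compat_l; [|apply head_Dmod; exact Hz']|].
  - apply pow_le. left. apply Rinv_0_lt_compat; auto.
  - right. rewrite Dmod_S by auto. rewrite Rpow_mult_distr.
    replace ((/ Cmod z) ^ (2 * K)) with ((/ (Cmod z * Cmod z)) ^ K' * (/ (Cmod z * Cmod z)) ^ (6 * l)).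
    + assert (E : ((Cmod z ^ 12) ^ S l) = (Cmod z * Cmod z) ^ 6 * (Cmod z * Cmod z) ^ (6 * l)).
      { rewrite <- pow_add. replace (Cmod z ^ 12) with ((Cmod z * Cmod z) ^ 6) by (simpl; ring).
        rewrite <- pow_mult. f_equal. lia. }
      rewrite E.
      assert (E2 : (/ (Cmod z * Cmod z)) ^ (6 * l) * (Cmod z * Cmod z) ^ (6 * l) = 1).
      { rewrite <- Rpow_mult_distr, Rinv_l, pow1; auto. apply Rgt_not_eq. nra. }
      set (u := (/ (Cmod z * Cmod z)) ^ (6 * l)) in *. set (v := (Cmod z * Cmod z) ^ (6 * l)) in *.
      match goal with |- ?L = ?R => replace R with ((u * v) * R) by (rewrite E2; ring) end. ring.
    + rewrite <- pow_add, HK, pow_mult. replace (6 * l + K')%nat with (K' + 6 * l)%nat by lia. f_equal.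
      simpl. field. lra.
Qed.

(** 82.6 collects exp(1.4 pi) <= 81.7 for the head at z and one percent of it for the far
    translates; 113 is the bound of [line_weight], for the head at -1/z. *)
Definition weight_factor (K' : nat) : R := 82.6 + 113 * (/ (49 / 100)) ^ K'.

(** The factor 4^K' is harmless because [thr] contains 2^(-2K). The tight case is K' = 0, with 244.5
    against 245. *)
Lemma weight_factor_le (K' : nat) : In K' (0 :: 2 :: 3 :: 4 :: 5 :: 7 :: nil)%nat ->
  Kc (2 * K') * weight_factor K' <= 245 * 4 ^ K'.
Proof.
  unfold weight_factor. simpl. intros [<-|[<-|[<-|[<-|[<-|[<-|[]]]]]]]; simpl; lra.
Qed.

Lemma exp_num_line : exp (2 * PI * (7 / 10)) <= 81.7.
Proof.
  assert (HPI := PI_bounds). apply Rle_trans with (exp (INR 16 * 0.275)).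
  - apply exp_le. replace (INR 16) with 16 by (simpl; lra). lra.
  - apply exp_upper_pow with (b := 1.31676); [lra|lra|].
    replace (1.31676 ^ 16) with (((1.31676 ^ 2) ^ 2) ^ 4) by (rewrite <- !pow_mult; reflexivity). lra.
Qed.

Lemma exp_num_i : exp (2 * PI) <= 600.
Proof.
  assert (HPI := PI_bounds). apply Rle_trans with (exp (INR 16 * 0.393)).
  - apply exp_le. replace (INR 16) with 16 by (simpl; lra). lra.
  - apply exp_upper_pow with (b := 1.4825); [lra|lra|].
    replace (1.4825 ^ 16) with (((1.4825 ^ 2) ^ 2) ^ 4) by (rewrite <- !pow_mult; reflexivity). lra.
Qed.

Lemma eps_far (K : nat) (m : nat) (y c : R) : 0 < y <= 1 -> y <= c ->
  (/ 3) ^ (2 * K) * exp (-4) ^ m * (1 + (/ c) ^ (2 * K)) <= 2 * (/ (2 * y)) ^ (2 * K).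
Proof.
  intros Hy Hc. assert (H1 : 0 < exp (-4) ^ m <= 1).
  { split; [apply pow_lt, exp_pos|apply pow_le_1]. split; [left; apply exp_pos|]. rewrite <- exp_0. apply exp_le. lra. }
  assert (H3 : 0 < (/ 3) ^ (2 * K)) by (apply pow_lt; lra).
  assert (H4 : 0 < / c) by (apply Rinv_0_lt_compat; lra).
  assert (H5 : 0 < (/ c) ^ (2 * K)) by (apply pow_lt; auto).
  assert (H6 : (/ 3) ^ (2 * K) <= (/ (2 * y)) ^ (2 * K)).
  { apply pow_incr. split; [lra|]. apply Rinv_le_contravar; lra. }
  assert (H7 : (/ 3) ^ (2 * K) * (/ c) ^ (2 * K) <= (/ (2 * y)) ^ (2 * K)).
  { rewrite <- Rpow_mult_distr, <- Rinv_mult. apply pow_incr. split; [left; apply Rinv_0_lt_compat; lra|].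
    apply Rinv_le_contravar; lra. }
  apply Rle_trans with ((/ 3) ^ (2 * K) * 1 * (1 + (/ c) ^ (2 * K))).
  - apply Rmult_le_compat_r; [lra|]. apply Rmult_le_compat_l; lra.
  - lra.
Qed.

(** * The relative error of the three-term approximation *)

(** [Hd] is the part of P up to q^l. Then f - q^m - (P - Hd) vanishes to order l + 1 at the cusp and
    fails to be modular only by a small source, so the contraction applies to it. *)
Lemma form_tail (K K' l m : nat) (f : C -> C) (a : nat -> C) :
  K = (6 * l + K')%nat -> In K' (0 :: 2 :: 3 :: 4 :: 5 :: 7 :: nil)%nat -> (1 <= m)%nat ->
  (9 * m + 20 <= 2 * l)%nat -> vanish_form (2 * K) l m f a ->
  exists P Hd N0,
    (forall N z, (N0 <= N)%nat -> 7 / 10 <= Im z -> Rabs (Re z) <= 1 ->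
       Cmod (LN (2 * K) m N z - P (qpar z)) <= (/ 3) ^ (2 * K) * exp (-4) ^ m) /\
    (forall z, Im z <= 3 / 2 -> Cmod (Hd z) <= 273 / 10 * thr K m * exp (2 * PI * (2 - Im z)) ^ l) /\
    (forall z, 7 / 10 < Im z ->
       Cmod (f z - qpar z ^ m - P (qpar z) + Hd z) <= 245 * 4 ^ K' * head_scale K m l * Dmod z ^ S l).
Proof.
  intros HK HK' Hm Hl Hf. assert (HPI := PI_bounds).
  assert (HK7 : (K' <= 7)%nat) by (simpl in HK'; lia).
  assert (HK2 : (2 * K' <= 10 \/ 2 * K' = 14)%nat) by (simpl in HK'; lia).
  (* Below [thr], so that P obeys the bound 25 + 1 = 26 times [thr] on Im z = 2, and no larger than
     the far translates. *)
  set (eps := (/ 3) ^ (2 * K) * exp (-4) ^ m).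
  assert (Heps : 0 < eps) by (unfold eps; apply Rmult_lt_0_compat; apply pow_lt; [lra|apply exp_pos]).
  assert (Hepsthr : eps <= thr K m).
  { unfold eps, thr. apply Rmult_le_compat; try (apply pow_le; try lra; left; apply exp_pos).
    - apply pow_incr. lra.
    - apply pow_incr. split; [left; apply exp_pos|apply exp_le; lra]. }
  destruct (LN_approx (7 / 10) (2 * K) m eps ltac:(lra) ltac:(lia) Heps) as [P [N0 [HP HL]]].
  assert (Hthr := thr_pos K m).
  destruct (poly_truncate P l (exp (- (2 * PI * 2))) (26 * thr K m) HP (exp_pos _)) as [H [Q [HQ [HPQ HH]]]].
  { intros t. destruct (circle_point 2 t) as [z [Hz [Hx Eq]]]. rewrite <- Eq.
    assert (B1 := LN_line2 K m N0 z Hz Hx ltac:(lia)). fold (thr K m) in B1.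
    assert (B2 := HL N0 z (le_n _) ltac:(lra) ltac:(lra)). rewrite Cmod_sub_comm in B2.
    replace (P (qpar z)) with ((P (qpar z) - LN (2 * K) m N0 z) + LN (2 * K) m N0 z)%C by ring.
    eapply Rle_trans; [apply Cmod_triangle|]. lra. }
  assert (HHd : forall z, Im z <= 3 / 2 -> Cmod (H (qpar z)) <= 273 / 10 * thr K m * exp (2 * PI * (2 - Im z)) ^ l).
  { intros z Hz.
    assert (E : Cmod (qpar z) / exp (- (2 * PI * 2)) = exp (2 * PI * (2 - Im z))).
    { rewrite Cmod_qpar. unfold Rdiv. rewrite <- exp_Ropp, <- exp_plus. f_equal. ring. }
    assert (E0 : 21 <= exp (2 * PI * (2 - Im z))).
    { apply Rle_trans with (exp (INR 2 * 1.57)).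
      - apply exp_lower_pow with (b := 4.7); [lra|lra|lra|simpl; lra].
      - apply exp_le. simpl. nra. }
    assert (B := HH (qpar z)). rewrite E in B.
    replace (273 / 10 * thr K m) with (21 / 20 * (26 * thr K m)) by field. apply B.
    rewrite <- E in E0. apply Rmult_le_reg_r with (/ exp (- (2 * PI * 2))).
    - apply Rinv_0_lt_compat, exp_pos.
    - unfold Rdiv in E0. rewrite Rmult_assoc, Rinv_r, Rmult_1_r; auto. apply Rgt_not_eq, exp_pos. }
  set (e := fun z => (f z - qpar z ^ m - qpar z ^ S l * Q (qpar z))%C).
  exists P, (fun z => H (qpar z)), N0. split; [auto|split; [auto|]].
  assert (Ee : forall z, (f z - qpar z ^ m - P (qpar z) + H (qpar z) = e z)%C).
  { intros z. unfold e. rewrite HPQ. ring. }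
  assert (Hv : qvanish l e).
  { unfold e. apply qvanish_minus with (h := fun z => (f z - qpar z ^ m)%C).
    - apply (vanish_form_qvanish (2 * K) l m f a Hf). lia.
    - exists (fun z => Q (qpar z)). split; [reflexivity|]. apply approx_poly; auto. }
  destruct Hv as [g [Eg Ag]].
  set (s := head_scale K m l * weight_factor K').
  assert (Hhs := head_scale_pos K m l).
  assert (Hw1 : 1 <= (/ (49 / 100)) ^ K').
  { apply pow_R1_Rle. lra. }
  assert (Hs0 : 0 <= s) by (unfold s, weight_factor; apply Rmult_le_pos; lra).
  assert (Hline : forall z, Im z = 7 / 10 -> Rabs (Re z) <= 1 / 2 ->
    Cmod (e z - (/ z) ^ (2 * K) * e (- / z)%C) <= s * Dmod z ^ S l).
  { intros z Hz Hx. destruct (line_facts z Hz Hx) as [Ht [Ew [Hw Hxw]]].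
    assert (HD : 0 < Dmod z ^ S l) by (apply pow_lt, Dmod_pos).
    assert (HC : 0 < Cmod z) by (apply Cmod_pos, Im_pos_neq_0; lra).
    assert (Hw15 : Im (- / z) <= 3 / 2).
    { rewrite Ew. apply Rmult_le_reg_r with (Cmod z * Cmod z); [lra|].
      unfold Rdiv at 1. rewrite Rmult_assoc, Rinv_l; lra. }
    assert (B := form_source K l m f a P H Q eps (7 / 10) N0 z ltac:(lia) Hf HPQ HL ltac:(lra) ltac:(lra)
      ltac:(lra) Hxw ltac:(lra) (fun n => translate_bounds_line z n Hz Hx)).
    cbv zeta in B. fold e in B.
    assert (Hyc : 7 / 10 <= Cmod z).
    { assert (HI := Cmod_Im_le z). rewrite Hz, Rabs_right in HI; lra. }
    assert (B1 := eps_far K m (7 / 10) (Cmod z) ltac:(lra) Hyc). fold eps in B1.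
    assert (B2 := far_small K K' l m (7 / 10) HK HK7 Hm Hl (or_introl eq_refl)).
    assert (B3 := HHd z ltac:(lra)). assert (B4 := head_Dmod K m l z ltac:(lra)). rewrite Hz in B3, B4.
    assert (B5 := HHd _ Hw15). assert (B6 := head_S_bound K K' l m z HK ltac:(lra) ltac:(lra)).
    assert (B7 : (/ Cmod z) ^ (2 * K) * Cmod (H (qpar (- / z))) <=
       (/ Cmod z) ^ (2 * K) * (273 / 10 * thr K m * exp (2 * PI * (2 - Im (- / z))) ^ l)).
    { apply Rmult_le_compat_l; auto. apply pow_le. left. apply Rinv_0_lt_compat; auto. }
    assert (B8 : (Cmod z * Cmod z) ^ 6 * exp (2 * PI * Im (- / z)) * (/ (Cmod z * Cmod z)) ^ K' <=
      113 * (/ (49 / 100)) ^ K').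
    { rewrite Ew. apply Rmult_le_compat.
      - apply Rmult_le_pos; [apply pow_le; lra|left; apply exp_pos].
      - apply pow_le. left. apply Rinv_0_lt_compat. lra.
      - apply line_weight; auto.
      - apply pow_incr. split; [left; apply Rinv_0_lt_compat; lra|]. apply Rinv_le_contravar; lra. }
    assert (B9 : head_scale K m l * ((Cmod z * Cmod z) ^ 6 * exp (2 * PI * Im (- / z)) *
      (/ (Cmod z * Cmod z)) ^ K') * Dmod z ^ S l <= head_scale K m l * (113 * (/ (49 / 100)) ^ K') * Dmod z ^ S l).
    { apply Rmult_le_compat_r; [lra|]. apply Rmult_le_compat_l; lra. }
    assert (B10 : head_scale K m l * exp (2 * PI * (7 / 10)) * Dmod z ^ S l <= head_scale K m l * 81.7 * Dmod z ^ S l).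
    { apply Rmult_le_compat_r; [lra|]. apply Rmult_le_compat_l; [lra|apply exp_num_line]. }
    unfold s, weight_factor.
    assert (HX : 0 < head_scale K m l * Dmod z ^ S l) by (apply Rmult_lt_0_compat; auto).
    replace (head_scale K m l * (82.6 + 113 * (/ (49 / 100)) ^ K') * Dmod z ^ S l) with
      (82.6 * (head_scale K m l * Dmod z ^ S l) + head_scale K m l * (113 * (/ (49 / 100)) ^ K') * Dmod z ^ S l) by ring.
    lra. }
  (* At the fixed point i the source is exactly 2 e(i), since i^(-k) = -1. *)
  assert (Hi : (2 * K' = 14)%nat -> 2 * Cmod (e Ci) <= s * Dmod Ci ^ S l).
  { intros HK'7. assert (HK'7' : K' = 7%nat) by lia.
    assert (HD : 0 < Dmod Ci ^ S l) by (apply pow_lt, Dmod_pos).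
    assert (HIm : Im Ci = 1) by reflexivity.
    assert (HRe : Rabs (Re Ci) <= 1) by (simpl; rewrite Rabs_R0; lra).
    assert (HC : Cmod Ci = 1) by apply Cmod_Ci.
    assert (B := form_source K l m f a P H Q eps 1 N0 Ci ltac:(lia) Hf HPQ HL ltac:(lra)
      ltac:(rewrite neg_inv_Ci; lra) HRe ltac:(rewrite neg_inv_Ci; exact HRe) ltac:(lra) translate_bounds_Ci).
    cbv zeta in B. fold e in B. rewrite neg_inv_Ci in B.
    replace (2 * K)%nat with (12 * l + 14)%nat in B at 1 by lia. rewrite Ci_pow_14, HC, Rinv_1, pow1 in B.
    replace (e Ci - - (1) * e Ci)%C with (RtoC 2 * e Ci)%C in B by ring.
    rewrite Cmod_mult, Cmod_R, Rabs_right in B by lra.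
    assert (B1 := eps_far K m 1 1 ltac:(lra) ltac:(lra)). fold eps in B1. rewrite Rinv_1, pow1 in B1.
    assert (B2 := far_small K K' l m 1 HK HK7 Hm Hl (or_intror eq_refl)).
    assert (B3 := HHd Ci ltac:(lra)). assert (B4 := head_Dmod K m l Ci ltac:(lra)). rewrite HIm in B3, B4.
    assert (HX : 0 < head_scale K m l * Dmod Ci ^ S l) by (apply Rmult_lt_0_compat; auto).
    assert (B10 : head_scale K m l * exp (2 * PI * 1) * Dmod Ci ^ S l <= 600 * (head_scale K m l * Dmod Ci ^ S l)).
    { replace (head_scale K m l * exp (2 * PI * 1) * Dmod Ci ^ S l) with
        (exp (2 * PI) * (head_scale K m l * Dmod Ci ^ S l)) by (rewrite Rmult_1_r; ring).
      apply Rmult_le_compat_r; [lra|apply exp_num_i]. }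
    unfold s. replace (head_scale K m l * weight_factor K' * Dmod Ci ^ S l) with
      (weight_factor K' * (head_scale K m l * Dmod Ci ^ S l)) by ring.
    assert (Hwf : 2000 <= weight_factor K') by (rewrite HK'7'; unfold weight_factor; simpl; lra).
    assert (2000 * (head_scale K m l * Dmod Ci ^ S l) <= weight_factor K' * (head_scale K m l * Dmod Ci ^ S l))
      by (apply Rmult_le_compat_r; lra).
    lra. }
  assert (HR := contraction (2 * K) (2 * K') l e g s ltac:(lia) HK2 Hs0 Eg Ag Hline Hi).
  intros z Hz. rewrite Ee. eapply Rle_trans; [apply HR; auto|].
  apply Rmult_le_compat_r; [apply pow_le; left; apply Dmod_pos|].
  unfold s. assert (HW := weight_factor_le K' HK').
  replace (Kc (2 * K') * (head_scale K m l * weight_factor K')) with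
    (Kc (2 * K') * weight_factor K' * head_scale K m l) by ring.
  apply Rmult_le_compat_r; lra.
Qed.

(** 4^K' cancels the part 2^(-2K') of 2^(-2K), leaving a bound free of k'. *)
Lemma thr_le (K K' l m : nat) : K = (6 * l + K')%nat ->
  4 ^ K' * thr K m <= exp (- (692 / 1000)) ^ (12 * l) * exp (- PI) ^ m.
Proof.
  intros HK. unfold thr.
  assert (E : 4 ^ K' * ((/ 2) ^ (2 * K) * exp (- PI) ^ m) = (/ 2) ^ (12 * l) * exp (- PI) ^ m).
  { rewrite <- Rmult_assoc. f_equal. replace (2 * K)%nat with (2 * K' + 12 * l)%nat by lia.
    rewrite pow_add, <- Rmult_assoc, (pow_mult _ 2 K'), <- Rpow_mult_distr.
    replace (4 * (/ 2) ^ 2) with 1 by (simpl; field). rewrite pow1. ring. }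
  rewrite E. apply Rmult_le_compat_r; [apply pow_le; left; apply exp_pos|apply half_pow_le].
Qed.

(** The rectangle reaches below the corner and beyond -1/2 <= Re z <= 0 on both sides, to leave room
    for Cauchy estimates on small discs around points of the left half of the fundamental domain. *)
Lemma error_bound (K K' l m : nat) (f : C -> C) (a : nat -> C) :
  K = (6 * l + K')%nat -> In K' (0 :: 2 :: 3 :: 4 :: 5 :: 7 :: nil)%nat -> (1 <= m)%nat ->
  (9 * m + 20 <= 2 * l)%nat -> vanish_form (2 * K) l m f a ->
  forall z, 17 / 20 <= Im z <= 3 / 2 -> - (11 / 20) <= Re z <= 1 / 20 ->
    Cmod (f z - qpar z ^ m - Sl (2 * K) m z - Sl (2 * K) m (z + 1)) <=
      2 / 5 * exp (- (3 / 20 * INR l)) * Cmod (qpar z) ^ m.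
Proof.
  intros HK HK' Hm Hl Hf z Hz Hx. assert (HPI := PI_bounds).
  destruct (form_tail K K' l m f a HK HK' Hm Hl Hf) as [P [Hd [N0 [HL [HH HE]]]]].
  assert (Hl' : 9 * INR m + 20 <= 2 * INR l).
  { assert (Hl2 := Hl). apply le_INR in Hl2. rewrite plus_INR, !mult_INR in Hl2. simpl in Hl2. lra. }
  assert (Hm' : 1 <= INR m) by (apply (le_INR 1); auto).
  assert (Hl15 : 15 <= INR l) by (replace 15 with (INR 15) by (simpl; lra); apply le_INR; lia).
  set (y := Im z) in *. assert (Hyz : Im z = y) by reflexivity.
  assert (Hthr := thr_le K K' l m HK). assert (Hthr0 := thr_pos K m).
  assert (Hth1 : thr K m <= exp (- (692 / 1000)) ^ (12 * l) * exp (- PI) ^ m).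
  { assert (1 <= 4 ^ K') by (apply pow_R1_Rle; lra).
    eapply Rle_trans; [|exact Hthr]. rewrite <- (Rmult_1_l (thr K m)) at 1. apply Rmult_le_compat_r; lra. }
  assert (I12 : INR (12 * l) = 12 * INR l) by (rewrite mult_INR; simpl; lra).
  assert (Hpl : INR l * PI <= INR l * 3.142) by (apply Rmult_le_compat_l; lra).
  assert (Hpm : INR m * PI <= INR m * 3.142) by (apply Rmult_le_compat_l; lra).
  assert (Hyl : 17 / 20 * (PI * (INR l - INR m)) <= y * (PI * (INR l - INR m))).
  { apply Rmult_le_compat_r; [|lra]. apply Rmult_le_pos; lra. }
  assert (Hy1 : 17 / 20 * PI <= y * PI) by (apply Rmult_le_compat_r; lra).
  assert (Hql : Cmod (qpar z) = exp (- (2 * PI * y))) by apply Cmod_qpar.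
  assert (Cn : exp (INR l * - (0.015)) <= 0.8).
  { apply Rle_trans with (exp (- (0.225))); [apply exp_le; lra|]. rewrite exp_Ropp.
    assert (B := exp_lower 0.225 ltac:(lra)). replace 0.8 with (/ 1.25) by lra. apply Rinv_le_contravar; lra. }
  set (F := exp (- (3 / 20 * INR l)) * Cmod (qpar z) ^ m).
  assert (HF : 0 < F) by (unfold F; rewrite Hql; apply Rmult_lt_0_compat; [apply exp_pos|apply pow_lt, exp_pos]).
  assert (EF : F = exp (- (3 / 20 * INR l) + INR m * - (2 * PI * y))).
  { unfold F. rewrite Hql, exp_pow, <- exp_plus. reflexivity. }
  assert (N1 : exp (- (95 / 100)) <= 0.3875).
  { rewrite exp_Ropp. assert (B := exp_lower (95 / 100) ltac:(lra)).
    apply Rle_trans with (/ 2.5848); [apply Rinv_le_contravar; lra|lra]. }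
  assert (N2 : exp (-8) <= 0.001).
  { replace (-8) with (Ropp (INR 4 * 2)) by (simpl; lra). rewrite exp_Ropp.
    assert (B : 2000 <= exp (INR 4 * 2)) by (apply exp_lower_pow with (b := 7); [lra|lra|lra|lra]).
    replace 0.001 with (/ 1000) by lra. apply Rinv_le_contravar; lra. }
  assert (B1 : Cmod (f z - qpar z ^ m - P (qpar z) + Hd z) <= 0.31 * F).
  { eapply Rle_trans; [apply HE; lra|].
    assert (HD := Dmod_upper z ltac:(lra)). assert (HD0 := Dmod_pos z).
    assert (HD2 : Dmod z ^ S l <= exp (119 / 1000) ^ S l * Cmod (qpar z) ^ S l).
    { rewrite <- Rpow_mult_distr. apply pow_incr. lra. }
    assert (C1 : 245 * (273 / 10) <= exp 8.85).
    { replace 8.85 with (INR 8 * 1.10625) by (simpl; lra). apply exp_lower_pow with (b := 3.0229); [lra|lra|lra|].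
      replace (3.0229 ^ 8) with (((3.0229 ^ 2) ^ 2) ^ 2) by (rewrite <- !pow_mult; reflexivity). lra. }
    set (X := exp (4 * PI) ^ l * exp (304 / 1000) ^ S l).
    assert (HX : 0 < X) by (apply Rmult_lt_0_compat; apply pow_lt, exp_pos).
    replace (245 * 4 ^ K' * head_scale K m l * Dmod z ^ S l) with
      (245 * (273 / 10) * (4 ^ K' * thr K m) * X * Dmod z ^ S l) by (unfold head_scale, X; field).
    apply Rle_trans with (exp 8.85 * (exp (- (692 / 1000)) ^ (12 * l) * exp (- PI) ^ m) * X *
       (exp (119 / 1000) ^ S l * Cmod (qpar z) ^ S l)).
    - assert (H4 : 0 < 4 ^ K') by (apply pow_lt; lra).
      assert (H5 : 0 < 4 ^ K' * thr K m) by (apply Rmult_lt_0_compat; auto).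
      assert (H6 : 0 < Dmod z ^ S l) by (apply pow_lt; auto).
      apply Rmult_le_compat; auto; [|lra|].
      + apply Rmult_le_pos; [|lra]. apply Rmult_le_pos; lra.
      + apply Rmult_le_compat_r; [lra|]. apply Rmult_le_compat; lra.
    - unfold X. rewrite Hql, !exp_pow, <- !exp_plus, EF.
      (* At the worst height, 0.85, the exponent is about -0.656 l + 2.2 m + 8.85 + 0.423 - 5.34.
         Inserting m <= (2 l - 20)/9 leaves -0.167 l - 0.95: here the hypothesis on l is used up. *)
      apply Rle_trans with (exp (- (95 / 100) + INR l * - (0.015)) * exp (- (3 / 20 * INR l) + INR m * - (2 * PI * y))).
      + rewrite <- exp_plus. apply exp_le. rewrite I12, S_INR. lra.
      + apply Rmult_le_compat_r; [left; apply exp_pos|]. rewrite exp_plus.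

        apply Rle_trans with (0.3875 * 0.8); [|lra]. apply Rmult_le_compat; auto; left; apply exp_pos. }
  assert (small : forall x, exp x * F <= 0.001 * F \/ -8 < x).
  { intros x. destruct (Rle_dec x (-8)) as [Hx8|]; [left|right; lra].
    apply Rmult_le_compat_r; [lra|]. eapply Rle_trans; [apply exp_le; exact Hx8|exact N2]. }
  assert (B2 : Cmod (Hd z) <= 0.001 * F).
  { eapply Rle_trans; [apply HH; lra|]. fold y.
    assert (C1 : (273 / 10) <= exp 3.31).
    { replace 3.31 with (INR 2 * 1.655) by (simpl; lra). apply exp_lower_pow with (b := 5.23); [lra|lra|lra|lra]. }
    apply Rle_trans with (exp (-8) * F); [|apply Rmult_le_compat_r; lra].
    apply Rle_trans with (exp 3.31 * (exp (- (692 / 1000)) ^ (12 * l) * exp (- PI) ^ m) * exp (2 * PI * (2 - y)) ^ l).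
    - apply Rmult_le_compat_r; [apply pow_le; left; apply exp_pos|]. apply Rmult_le_compat; lra.
    - rewrite !exp_pow, <- !exp_plus, EF, <- exp_plus. apply exp_le. rewrite I12. lra. }
  assert (B3 : (/ 3) ^ (2 * K) * exp (-4) ^ m <= 0.001 * F).
  { assert (C1 : (/ 3) ^ (2 * K) <= exp (- (692 / 1000)) ^ (12 * l)).
    { apply Rle_trans with ((/ 3) ^ (12 * l)).
      - replace (2 * K)%nat with (12 * l + 2 * K')%nat by lia. rewrite pow_add.
        assert (B := pow_le_1 (/ 3) (2 * K') ltac:(lra)). assert (0 < (/ 3) ^ (12 * l)) by (apply pow_lt; lra).
        rewrite <- (Rmult_1_r ((/ 3) ^ (12 * l))) at 2. apply Rmult_le_compat_l; lra.
      - eapply Rle_trans; [|apply half_pow_le]. apply pow_incr. lra. }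
    apply Rle_trans with (exp (- (692 / 1000)) ^ (12 * l) * exp (-4) ^ m).
    { apply Rmult_le_compat_r; auto. apply pow_le. left. apply exp_pos. }
    apply Rle_trans with (exp (-8) * F); [|apply Rmult_le_compat_r; lra].
    rewrite !exp_pow, <- !exp_plus, EF, <- exp_plus. apply exp_le. rewrite I12.
    assert (INR m * PI * y <= INR m * 3.142 * (3 / 2)); [|lra].
    apply Rmult_le_compat; try lra. apply Rmult_le_pos; lra. }
  (* 1.6 bounds |w|^2 from below for w = z - 1 and for the far translates; the estimate takes N0 = 1
     and d = 10 >= 3 pi. *)
  set (M := Cmod (qpar z) ^ m * (/ 1.6) ^ (K - 10 * m - 1)).
  assert (HM0 : 0 < M) by (unfold M; rewrite Hql; apply Rmult_lt_0_compat; apply pow_lt; [apply exp_pos|lra]).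
  assert (HM : 18 * M <= 0.001 * F).
  { assert (C1 : / 1.6 <= exp (- (0.46))).
    { rewrite exp_Ropp. apply Rinv_le_contravar; [apply exp_pos|].
      eapply Rle_trans; [apply exp_upper; lra|lra]. }
    assert (C2 : 18 <= exp 2.9).
    { replace 2.9 with (INR 2 * 1.45) by (simpl; lra). apply exp_lower_pow with (b := 4.26); [lra|lra|lra|lra]. }
    assert (C3 : (/ 1.6) ^ (K - 10 * m - 1) <= exp (- (0.46)) ^ (K - 10 * m - 1)) by (apply pow_incr; lra).
    apply Rle_trans with (exp (-8) * F); [|apply Rmult_le_compat_r; lra].
    apply Rle_trans with (exp 2.9 * (Cmod (qpar z) ^ m * exp (- (0.46)) ^ (K - 10 * m - 1))).
    - unfold M. assert (0 <= Cmod (qpar z) ^ m) by (apply pow_le, Cmod_ge_0).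
      assert (0 <= (/ 1.6) ^ (K - 10 * m - 1)) by (apply pow_le; lra).
      apply Rmult_le_compat; [lra|apply Rmult_le_pos; auto|lra|]. apply Rmult_le_compat_l; auto.
    - rewrite Hql, !exp_pow, <- !exp_plus, EF, <- exp_plus. apply exp_le.
      assert (HKr : 6 * INR l - 10 * INR m - 1 <= INR (K - 10 * m - 1)).
      { rewrite !minus_INR by lia. rewrite HK, plus_INR, !mult_INR. simpl. assert (H := pos_INR K'). lra. }
      lra. }
  assert (G : forall w c, Im w = y -> 1.6 <= Cmod w * Cmod w -> 0 < c -> c <= Cmod w * Cmod w ->
     Cmod (Sl (2 * K) m w) <= M * / c).
  { intros w c Hw HN Hc HcN. eapply Rle_trans; [apply (Sl_bound K m 10 w 1); try lra; try lia|].
    - rewrite Hw. replace (INR 10) with 10 by (simpl; lra).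
      assert (PI * y <= 3.142 * (3 / 2)) by (apply Rmult_le_compat; lra). lra.
    - rewrite Hw, Rinv_1, pow1, Rmult_1_l.
      replace (- (2 * PI * y / 1)) with (- (2 * PI * y)) by field. rewrite <- Hql.
      replace (K - 10 * m)%nat with (S (K - 10 * m - 1)) by lia.
      unfold M. rewrite Rmult_assoc. apply Rmult_le_compat_l; [apply pow_le, Cmod_ge_0|].
      simpl pow. rewrite Rmult_comm. unfold Rdiv. rewrite Rmult_1_l.
      assert (Hi : 0 < / (Cmod w * Cmod w)) by (apply Rinv_0_lt_compat; lra).
      apply Rmult_le_compat; [apply pow_le; lra|lra| |apply Rinv_le_contravar; lra].
      apply pow_incr. split; [lra|]. apply Rinv_le_contravar; lra. }
  assert (B4 : Cmod (Sl (2 * K) m (z - 1)) <= M).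
  { replace M with (M * / 1) by field. destruct (Im_shift z 1) as [_ [E _]].
    assert (HN : 1.6 <= Cmod (z - 1) * Cmod (z - 1)).
    { rewrite Cmod_sq, E, Re_minus, Re_RtoC. fold y. nra. }
    apply G; auto; lra. }
  assert (B5 : Cmod (far_translates (2 * K) m N0 z) <= 17 * M).
  { apply far_translates_bound; [|lra]. intros n Hn. assert (Hn' : 2 <= INR n) by (apply (le_INR 2); auto).
    destruct (Im_shift z (INR n)) as [E1 [E2 _]].
    assert (En : 4 / (INR n * INR n) = / (INR n * INR n / 4)) by (field; lra).
    rewrite En.
    assert (Q1 : INR n * INR n / 2 <= Cmod (z + RtoC (INR n)) * Cmod (z + RtoC (INR n))).
    { rewrite Cmod_sq_translate. fold y. nra. }
    assert (Q2 : INR n * INR n / 2 <= Cmod (z - RtoC (INR n)) * Cmod (z - RtoC (INR n))).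
    { rewrite Cmod_sq, E2, Re_minus, Re_RtoC. fold y. nra. }
    assert (Hn4 : 2 * 2 <= INR n * INR n) by (apply Rmult_le_compat; lra).
    split; apply G; auto; lra. }
  assert (B6 := HL (S (S N0)) z ltac:(lia) ltac:(fold y; lra) ltac:(apply Rabs_le; lra)).
  rewrite LN_split in B6. set (T := far_translates (2 * K) m N0 z) in *.
  set (D := (Sl (2 * K) m z + Sl (2 * K) m (z + 1) + Sl (2 * K) m (z - 1) + T - P (qpar z))%C) in *.
  replace (f z - qpar z ^ m - Sl (2 * K) m z - Sl (2 * K) m (z + 1))%C with
    ((f z - qpar z ^ m - P (qpar z) + Hd z) - Hd z - D + Sl (2 * K) m (z - 1) + T)%C by (unfold D; ring).
  replace (2 / 5 * exp (- (3 / 20 * INR l)) * Cmod (qpar z) ^ m) with (2 / 5 * F) by (unfold F; ring).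
  assert (L1 := Cmod_triangle ((f z - qpar z ^ m - P (qpar z) + Hd z) - Hd z - D + Sl (2 * K) m (z - 1)) T).
  assert (L2 := Cmod_triangle ((f z - qpar z ^ m - P (qpar z) + Hd z) - Hd z - D) (Sl (2 * K) m (z - 1))).
  assert (L3 := Cmod_sub_triangle ((f z - qpar z ^ m - P (qpar z) + Hd z) - Hd z) D).
  assert (L4 := Cmod_sub_triangle (f z - qpar z ^ m - P (qpar z) + Hd z) (Hd z)).
  lra.
Qed.

(* The weight k = 12 l + k' is 2 K with k' = 2 K', and l > 4.5 m + 9.5 reads 2 l >= 9 m + 20 over the integers. *)
Definition setting (K K' l m : nat) (f : C -> C) (a : nat -> C) : Prop :=
  K = (6 * l + K')%nat /\ In K' (0 :: 2 :: 3 :: 4 :: 5 :: 7 :: nil)%nat /\ (1 <= m)%nat /\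
  (9 * m + 20 <= 2 * l)%nat /\ vanish_form (2 * K) l m f a.

(** * Localisation of the zeros near the unit circle *)

Lemma setting_num (K K' l m : nat) (f : C -> C) (a : nat -> C) : setting K K' l m f a ->
  1 <= INR m /\ 15 <= INR l /\ 9 * INR m + 20 <= 2 * INR l /\ 6 * INR l <= INR K <= 6 * INR l + 7 /\
  (7 * m <= 10 * m)%nat /\ (10 * m + 77 <= K)%nat.
Proof.
  intros [HK [HK' [Hm [Hl _]]]]. assert (HK7 : (K' <= 7)%nat) by (simpl in HK'; lia).
  split; [apply (le_INR 1); auto|].
  split; [replace 15 with (INR 15) by (simpl; lra); apply le_INR; lia|].
  split; [apply le_INR in Hl; rewrite plus_INR, !mult_INR in Hl; simpl in Hl; lra|].
  split; [|split; lia]. rewrite HK, plus_INR, mult_INR. apply le_INR in HK7. assert (H := pos_INR K').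
  simpl in *. lra.
Qed.

Lemma setting_reflect (K K' l m : nat) (f : C -> C) (a : nat -> C) : setting K K' l m f a ->
  forall z, 7 / 10 < Im z -> f (- Cconj z)%C = Cconj (f z).
Proof.
  intros [HK [HK' [Hm [Hl Hf]]]]. apply (form_reflect (2 * K) (2 * K') l m f a); auto.
  - lia.
  - simpl in HK'. lia.
  - lia.
  - exists K. lia.
Qed.

(** The bound 15 is the least l allowed when m = 1; the exponent there is 2.25. *)
Lemma delta_small (l : R) : 15 <= l -> 2 / 5 * exp (- (3 / 20 * l)) <= 0.0425.
Proof.
  intros Hl. apply Rle_trans with (2 / 5 * exp (- (INR 2 * 1.125))).
  - apply Rmult_le_compat_l; [lra|]. apply exp_le. simpl. lra.
  - rewrite exp_Ropp. assert (H : 9.42 <= exp (INR 2 * 1.125)).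
    { apply exp_lower_pow with (b := 3.08); [lra|lra|lra|lra]. }
    assert (H1 : / exp (INR 2 * 1.125) <= / 9.42) by (apply Rinv_le_contravar; lra). lra.
Qed.

(** The case N0 = 1 of [Sl_bound], in which the exponential factor is |q| itself. *)
Lemma Sl_rel (K m d : nat) (z w : C) : 0 < Im z -> Im w = Im z -> 1 <= Cmod w * Cmod w ->
  2 * PI * Im z <= INR d -> (d * m <= K)%nat ->
  Cmod (Sl (2 * K) m w) <= Cmod (qpar z) ^ m * (/ (Cmod w * Cmod w)) ^ (K - d * m).
Proof.
  intros Hz Hw HN Hd HK. eapply Rle_trans; [apply (Sl_bound K m d w 1); try lra; auto|].
  - rewrite Hw. lra.
  - right. rewrite Hw, Rinv_1, pow1, Rmult_1_l, Cmod_qpar. f_equal.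
    + do 2 f_equal. field.
    + f_equal. unfold Rdiv. ring.
Qed.

Lemma translate_norm_ge (z : C) : - (1 / 2) <= Re z -> Cmod z * Cmod z <= Cmod (z + 1) * Cmod (z + 1).
Proof.
  intros Hx. rewrite (Cmod_sq_translate z 1), Cmod_sq. nra.
Qed.

(** At a zero q^m has to be balanced by q^m|S and q^m|ST up to the relative error; both are then
    measured against |q|^m. *)
Lemma zero_ineq (K K' l m d : nat) (f : C -> C) (a : nat -> C) (z : C) : setting K K' l m f a ->
  17 / 20 <= Im z <= 3 / 2 -> - (1 / 2) <= Re z <= 0 -> 1 <= Cmod z -> f z = 0%C ->
  2 * PI * Im z <= INR d -> (d <= 10)%nat ->
  1 - 0.0425 <= (/ (Cmod z * Cmod z)) ^ (K - d * m) + (/ (Cmod (z + 1) * Cmod (z + 1))) ^ (K - d * m).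
Proof.
  intros HS Hy Hx Hz Hf Hd Hd10. destruct (setting_num _ _ _ _ _ _ HS) as [Hm1 [Hl15 [Hlm [HKr [_ HKm]]]]].
  assert (HS' := HS). destruct HS' as [HK [HK' [Hm [Hl Hv]]]].
  assert (Herr := error_bound K K' l m f a HK HK' Hm Hl Hv z Hy ltac:(lra)).
  assert (Hdel := delta_small (INR l) Hl15).
  assert (Hn := translate_norm_ge z ltac:(lra)).
  assert (Hdm : (d * m <= K)%nat) by nia.
  assert (HN : 1 <= Cmod z * Cmod z) by nra.
  assert (B1 := Sl_rel K m d z z ltac:(lra) eq_refl HN Hd Hdm).
  destruct (Im_shift z 1) as [E1 _].
  assert (B2 := Sl_rel K m d z (z + 1) ltac:(lra) E1 ltac:(lra) Hd Hdm).
  rewrite Hf in Herr.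
  assert (Hq : 0 < Cmod (qpar z) ^ m) by (apply pow_lt, Cmod_pos, qpar_neq_0).
  set (Q := Cmod (qpar z) ^ m) in *.
  assert (Hdel2 : 2 / 5 * exp (- (3 / 20 * INR l)) * Q <= 0.0425 * Q) by (apply Rmult_le_compat_r; lra).
  assert (L : Q <= Cmod (Sl (2 * K) m z) + Cmod (Sl (2 * K) m (z + 1)) + 0.0425 * Q).
  { unfold Q at 1. rewrite <- Cmod_pow.
    replace (qpar z ^ m)%C with (- (0 - qpar z ^ m - Sl (2 * K) m z - Sl (2 * K) m (z + 1)) - Sl (2 * K) m z - Sl (2 * K) m (z + 1))%C by ring.
    eapply Rle_trans; [apply Cmod_sub_triangle|].
    assert (L1 := Cmod_sub_triangle (- (0 - qpar z ^ m - Sl (2 * K) m z - Sl (2 * K) m (z + 1))) (Sl (2 * K) m z)).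
    rewrite Cmod_opp in L1. lra. }
  apply Rmult_le_reg_l with Q; auto. lra.
Qed.

(** Since |z| <= |z + 1|, the balance gives |z|^(2(K - dm)) <= 2/0.9575 < 2.09. A pass with d = 10,
    valid for Im z <= 3/2, yields |z|^2 <= 1.01; then Im z is small enough for the sharper d = 7. *)
Lemma zero_near_circle (K K' l m : nat) (f : C -> C) (a : nat -> C) (z : C) : setting K K' l m f a ->
  17 / 20 <= Im z <= 3 / 2 -> - (1 / 2) <= Re z <= 0 -> 1 <= Cmod z -> f z = 0%C ->
  Cmod z * Cmod z <= 1.01 /\ INR (K - 7 * m) * (1 - / (Cmod z * Cmod z)) <= 0.74.
Proof.
  intros HS Hy Hx Hz Hf. assert (HPI := PI_bounds).
  destruct (setting_num _ _ _ _ _ _ HS) as [Hm1 [Hl15 [Hlm [HKr [_ HKm]]]]].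
  set (t := Cmod z * Cmod z). assert (Ht : 1 <= t) by (unfold t; nra).
  assert (G : forall d, (d <= 10)%nat -> 2 * PI * Im z <= INR d ->
     exp (INR (K - d * m) * (1 - / t)) <= 2.09).
  { intros d Hd10 Hd. assert (B := zero_ineq K K' l m d f a z HS Hy Hx Hz Hf Hd Hd10).
    assert (Hn := translate_norm_ge z ltac:(lra)). fold t in Hn, B.
    assert (B2 : (/ (Cmod (z + 1) * Cmod (z + 1))) ^ (K - d * m) <= (/ t) ^ (K - d * m)).
    { apply pow_incr. split; [left; apply Rinv_0_lt_compat; lra|]. apply Rinv_le_contravar; lra. }
    assert (Htn : 0 < t ^ (K - d * m)) by (apply pow_lt; lra). rewrite !pow_inv in *.
    assert (B3 : t ^ (K - d * m) <= 2.09).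
    { apply Rmult_le_reg_r with (/ t ^ (K - d * m)); [apply Rinv_0_lt_compat; auto|].
      rewrite Rinv_r; lra. }
    eapply Rle_trans; [|exact B3]. rewrite <- exp_pow. apply pow_incr. split; [left; apply exp_pos|].
    apply exp_1_minus_inv. lra. }
  assert (H1 : t <= 1.01).
  { assert (B := G 10%nat (le_n _)). replace (INR 10) with 10 in B by (simpl; lra).
    assert (PI * Im z <= 3.142 * (3 / 2)) by (apply Rmult_le_compat; lra). specialize (B ltac:(lra)).
    destruct (Rle_dec t 1.01) as [|Ht2]; auto. exfalso.
    assert (Hi : / t <= / 1.01) by (apply Rinv_le_contravar; lra).
    assert (H77 : 77 <= INR (K - 10 * m)) by (replace 77 with (INR 77) by (simpl; lra); apply le_INR; lia).
    assert (77 * (1 - / 1.01) <= INR (K - 10 * m) * (1 - / t)) by (apply Rmult_le_compat; lra).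
    assert (B2 : exp 0.75 <= 2.09) by (eapply Rle_trans; [apply exp_le|exact B]; lra).
    assert (B3 := exp_lower 0.75 ltac:(lra)). lra. }
  split; auto. assert (B := G 7%nat ltac:(lia)). replace (INR 7) with 7 in B by (simpl; lra).
  assert (Hy1 : Im z <= 1.01).
  { assert (E := Cmod_sq z). fold t in E. nra. }
  assert (PI * Im z <= 3.142 * 1.01) by (apply Rmult_le_compat; lra). specialize (B ltac:(lra)).
  destruct (Rle_dec (INR (K - 7 * m) * (1 - / t)) 0.74) as [|Hgt]; auto. exfalso.
  assert (B2 : exp 0.74 <= 2.09) by (eapply Rle_trans; [apply exp_le|exact B]; lra).
  assert (B3 := exp_lower 0.74 ltac:(lra)). lra.
Qed.

(** On Im z = 3/2 one has |f - q^m| <= |q|^m/2. The maximum principle for (f - q^m)/q^(l+1) carries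
    this upwards, where q^(l+1) decays faster than q^m. *)
Lemma no_zero_high (K K' l m : nat) (f : C -> C) (a : nat -> C) (z : C) : setting K K' l m f a ->
  3 / 2 < Im z -> f z <> 0%C.
Proof.
  intros HS Hz Hf. assert (HPI := PI_bounds).
  destruct (setting_num _ _ _ _ _ _ HS) as [Hm1 [Hl15 [Hlm [HKr [_ HKm]]]]].
  assert (HS' := HS). destruct HS' as [HK [HK' [Hm [Hl Hv]]]].
  destruct (vanish_form_qvanish (2 * K) l m f a Hv ltac:(lia)) as [g [Eg Ag]].
  assert (Hdel := delta_small (INR l) Hl15).
  set (q1 := exp (- (2 * PI * (3 / 2)))). assert (Hq1 : 0 < q1) by apply exp_pos.
  assert (Hl0 : forall w, Im w = 3 / 2 -> - (1 / 2) <= Re w <= 0 -> Cmod (f w - qpar w ^ m) <= / 2 * q1 ^ m).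
  { intros w Hw Hx. assert (Herr := error_bound K K' l m f a HK HK' Hm Hl Hv w ltac:(lra) ltac:(lra)).
    assert (Eq : Cmod (qpar w) = q1) by (rewrite Cmod_qpar, Hw; reflexivity).
    assert (Hn := translate_norm_ge w ltac:(lra)).
    assert (HN : 2.25 <= Cmod w * Cmod w) by (rewrite Cmod_sq, Hw; nra).
    assert (Hd : 2 * PI * Im w <= INR 10) by (rewrite Hw; simpl; lra).
    destruct (Im_shift w 1) as [E1 _].
    assert (B1 := Sl_rel K m 10 w w ltac:(lra) eq_refl ltac:(lra) Hd ltac:(lia)).
    assert (B2 := Sl_rel K m 10 w (w + 1) ltac:(lra) E1 ltac:(lra) Hd ltac:(lia)).
    assert (G : forall N, 2.25 <= N -> (/ N) ^ (K - 10 * m) <= 0.2).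
    { intros N HN2. replace (K - 10 * m)%nat with (2 + (K - 10 * m - 2))%nat by lia. rewrite pow_add.
      assert (Hi : 0 < / N <= / 2.25) by (split; [apply Rinv_0_lt_compat; lra|apply Rinv_le_contravar; lra]).
      assert (P1 : (/ N) ^ 2 <= (/ 2.25) ^ 2) by (apply pow_incr; lra).
      assert (P2 := pow_le_1 (/ N) (K - 10 * m - 2) ltac:(lra)).
      apply Rle_trans with ((/ 2.25) ^ 2 * 1); [|simpl; lra].
      apply Rmult_le_compat; auto; apply pow_le; lra. }
    assert (Hqm : 0 < q1 ^ m) by (apply pow_lt; auto). rewrite Eq in *.
    assert (C1 := G _ HN). assert (C2 := G (Cmod (w + 1) * Cmod (w + 1)) ltac:(lra)).
    apply (Rmult_le_compat_l (q1 ^ m)) in C1; [|lra]. apply (Rmult_le_compat_l (q1 ^ m)) in C2; [|lra].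
    replace (f w - qpar w ^ m)%C with ((f w - qpar w ^ m - Sl (2 * K) m w - Sl (2 * K) m (w + 1)) + Sl (2 * K) m w + Sl (2 * K) m (w + 1))%C by ring.
    assert (L1 := Cmod_triangle ((f w - qpar w ^ m - Sl (2 * K) m w - Sl (2 * K) m (w + 1)) + Sl (2 * K) m w) (Sl (2 * K) m (w + 1))).
    assert (L2 := Cmod_triangle (f w - qpar w ^ m - Sl (2 * K) m w - Sl (2 * K) m (w + 1)) (Sl (2 * K) m w)).
    assert (2 / 5 * exp (- (3 / 20 * INR l)) * q1 ^ m <= 0.0425 * q1 ^ m) by (apply Rmult_le_compat_r; lra).
    lra. }
  assert (Hline : forall w, Im w = 3 / 2 -> Rabs (Re w) <= 1 / 2 -> Cmod (f w - qpar w ^ m) <= / 2 * q1 ^ m).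
  { intros w Hw Hx. apply Rabs_le_between in Hx. destruct (Rle_dec (Re w) 0) as [H0|H0]; [apply Hl0; auto; lra|].
    assert (R1 := setting_reflect _ _ _ _ _ _ HS w ltac:(lra)).
    assert (Im' : Im (- Cconj w) = Im w) by (simpl; unfold Im; ring).
    assert (Re' : Re (- Cconj w) = - Re w) by (simpl; unfold Re; ring).
    assert (B := Hl0 (- Cconj w)%C ltac:(lra) ltac:(lra)).
    rewrite R1, qpar_reflect, <- Cpow_conj, <- Cminus_conj, Cmod_conj in B. exact B. }
  assert (Hgl : forall w, Im w = 3 / 2 -> Rabs (Re w) <= 1 / 2 -> Cmod (g w) <= / 2 * q1 ^ m * / q1 ^ S l).
  { intros w Hw Hx. assert (B := Hline w Hw Hx). rewrite Eg in B by lra.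
    rewrite Cmod_mult, Cmod_pow, Cmod_qpar, Hw in B. fold q1 in B.
    assert (0 < q1 ^ S l) by (apply pow_lt; auto).
    apply Rmult_le_reg_l with (q1 ^ S l); auto.
    replace (q1 ^ S l * (/ 2 * q1 ^ m * / q1 ^ S l)) with (/ 2 * q1 ^ m) by (field; lra). auto. }
  assert (B := hp_maxmod (3 / 2) _ g (approx_sub (hp (7 / 10)) (hp (3 / 2)) qpar g ltac:(unfold hp; intros; lra) Ag) Hgl z Hz).
  assert (Ez := Eg z ltac:(lra)). rewrite Hf in Ez.
  assert (Eq : Cmod (qpar z) ^ m = Cmod (qpar z) ^ S l * Cmod (g z)).
  { rewrite <- !Cmod_pow, <- Cmod_mult, <- Ez. rewrite <- (Cmod_opp (qpar z ^ m)). f_equal. ring. }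
  set (q := Cmod (qpar z)) in *.
  assert (Hq : 0 < q) by (apply Cmod_pos, qpar_neq_0).
  assert (Hqq : q <= q1) by (apply Cmod_qpar_le; lra).
  assert (El : S l = (m + (S l - m))%nat) by lia. rewrite El in Eq, B.
  set (j := (S l - m)%nat) in *. rewrite !pow_add in *.
  assert (P1 : 0 < q ^ m) by (apply pow_lt; auto). assert (P2 : 0 < q ^ j) by (apply pow_lt; auto).
  assert (P3 : 0 < q1 ^ m) by (apply pow_lt; auto). assert (P4 : 0 < q1 ^ j) by (apply pow_lt; auto).
  assert (P5 : q ^ j <= q1 ^ j) by (apply pow_incr; lra).
  replace (/ 2 * q1 ^ m * / (q1 ^ m * q1 ^ j)) with (/ 2 * / q1 ^ j) in B by (field; lra).
  assert (1 <= q1 ^ j * (/ 2 * / q1 ^ j)).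
  { apply Rmult_le_reg_l with (q ^ m); auto. rewrite Rmult_1_r. rewrite Eq at 1. rewrite Rmult_assoc.
    apply Rmult_le_compat_l; [lra|]. apply Rmult_le_compat; auto; [lra|apply Cmod_ge_0]. }
  replace (q1 ^ j * (/ 2 * / q1 ^ j)) with (/ 2) in H by (field; lra). lra.
Qed.

(** * Taylor remainders of the complex exponential *)

(** The remainder is a polynomial in v with nonnegative coefficients, hence dominated by its value
    at |v|. *)
Lemma binomial_remainder (v : C) (M : nat) :
  Cmod ((1 + v) ^ M - 1 - RtoC (INR M) * v - RtoC (INR M * (INR M - 1) / 2) * (v * v)) <=
  (1 + Cmod v) ^ M - 1 - INR M * Cmod v - INR M * (INR M - 1) / 2 * (Cmod v * Cmod v).
Proof.
  assert (Hv := Cmod_ge_0 v). induction M as [|M IH].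
  - simpl. replace (1 - 1 - 0 * v - RtoC (0 * (0 - 1) / 2) * (v * v))%C with (RtoC 0).
    + rewrite Cmod_0. lra.
    + replace (0 * (0 - 1) / 2) with 0 by field. ring.
  - set (e := ((1 + v) ^ M - 1 - RtoC (INR M) * v - RtoC (INR M * (INR M - 1) / 2) * (v * v))%C) in *.
    assert (E : ((1 + v) ^ S M - 1 - RtoC (INR (S M)) * v - RtoC (INR (S M) * (INR (S M) - 1) / 2) * (v * v) =
      e * (1 + v) + RtoC (INR M * (INR M - 1) / 2) * (v * v * v))%C).
    { unfold e. rewrite S_INR. replace ((INR M + 1) * (INR M + 1 - 1) / 2) with (INR M * (INR M - 1) / 2 + INR M) by field.
      rewrite !RtoC_plus, Cpow_S. ring. }
    rewrite E. set (x := Cmod v) in *.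
    assert (Hc : 0 <= INR M * (INR M - 1) / 2).
    { destruct M as [|M]; [simpl; lra|]. rewrite S_INR. assert (H := pos_INR M). nra. }
    assert (H1 : Cmod (1 + v) <= 1 + x) by (eapply Rle_trans; [apply Cmod_triangle|rewrite Cmod_1; unfold x; lra]).
    eapply Rle_trans; [apply Cmod_triangle|]. rewrite !Cmod_mult, Cmod_R, Rabs_right by lra. fold x.
    assert (H2 : Cmod e * Cmod (1 + v) <=
      ((1 + x) ^ M - 1 - INR M * x - INR M * (INR M - 1) / 2 * (x * x)) * (1 + x)).
    { apply Rmult_le_compat; auto using Cmod_ge_0. }
    rewrite S_INR. simpl pow.
    replace ((1 + x) * (1 + x) ^ M - 1 - (INR M + 1) * x - (INR M + 1) * (INR M + 1 - 1) / 2 * (x * x)) with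
      (((1 + x) ^ M - 1 - INR M * x - INR M * (INR M - 1) / 2 * (x * x)) * (1 + x) +
       INR M * (INR M - 1) / 2 * (x * x * x)) by field. lra.
Qed.

(** The binomial estimate at v = w/N passes to the limit, so the majorant is exactly the remainder
    of the real exponential at |w|, without loss of a constant. *)
Lemma Cexp_taylor3 (w : C) :
  Cmod (Cexp w - 1 - w - w * w / 2) <= exp (Cmod w) - 1 - Cmod w - Cmod w * Cmod w / 2.
Proof.
  set (x := Cmod w). assert (Hx : 0 <= x) by apply Cmod_ge_0.
  set (C0 := exp x * (4 * (x * x))). assert (HC0 : 0 <= C0) by (unfold C0; assert (H := exp_pos x); nra).
  apply le_of_forall_eps with (K := 1); [lra|]. intros eps He.
  destruct (inv_INR_small (2 * C0 + x * x) eps He) as [N1 HN1]. destruct (INR_unbounded (2 * x)) as [N2 HN2].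
  set (N := S (Nat.max N1 N2)). assert (HNp : 1 <= INR N) by apply nS_pos. assert (HN : 0 < INR N) by lra.
  assert (HN2' : INR N2 <= INR N) by (apply le_INR; unfold N; lia).
  specialize (HN1 (Nat.max N1 N2) ltac:(lia)). fold N in HN1.
  assert (A1 := exp_limit_bound w x N (Rle_refl _) ltac:(lra) ltac:(unfold N; lia)).
  assert (Cx : Cmod (RtoC x) <= x) by (rewrite Cmod_R, Rabs_right; lra).
  assert (A2 := exp_limit_bound (RtoC x) x N Cx ltac:(lra) ltac:(unfold N; lia)). fold C0 in A1, A2.
  assert (E2 : (Cexp (RtoC x) - (1 + RtoC x * RtoC (/ INR N)) ^ N)%C = RtoC (exp x - (1 + x * / INR N) ^ N)).
  { rewrite Cexp_RtoC, <- RtoC_mult, <- RtoC_plus, <- RtoC_pow, <- RtoC_minus. reflexivity. }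
  rewrite E2, Cmod_R in A2. apply Rabs_le_between in A2.
  set (v := (w * RtoC (/ INR N))%C) in *.
  assert (Hvx : Cmod v = x * / INR N).
  { unfold v. rewrite Cmod_mult, Cmod_R, Rabs_right; auto. left. apply Rinv_0_lt_compat; auto. }
  assert (A3 := binomial_remainder v N). rewrite Hvx in A3.
  assert (HNC : RtoC (INR N) <> 0%C) by (intros H; apply (f_equal Re) in H; rewrite !Re_RtoC in H; lra).
  assert (E3 : (Cexp w - 1 - w - w * w / 2 = (Cexp w - (1 + v) ^ N) +
    ((1 + v) ^ N - 1 - RtoC (INR N) * v - RtoC (INR N * (INR N - 1) / 2) * (v * v)) -
    RtoC (/ (2 * INR N)) * (w * w))%C).
  { assert (E4 : (RtoC (INR N) * v = w)%C).
    { unfold v. rewrite RtoC_inv by lra. field. auto. }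
    assert (E5 : (RtoC (INR N * (INR N - 1) / 2) * (v * v) = w * w / 2 - RtoC (/ (2 * INR N)) * (w * w))%C).
    { unfold v.
      replace (RtoC (INR N * (INR N - 1) / 2) * (w * RtoC (/ INR N) * (w * RtoC (/ INR N))))%C with
        (RtoC (INR N * (INR N - 1) / 2 * (/ INR N * / INR N)) * (w * w))%C by (rewrite !RtoC_mult; ring).
      replace (INR N * (INR N - 1) / 2 * (/ INR N * / INR N)) with (/ 2 - / (2 * INR N)) by (field; lra).
      rewrite RtoC_minus, (RtoC_inv 2) by lra. unfold Cdiv. ring. }
    rewrite E4, E5. ring. }
  rewrite E3. eapply Rle_trans; [apply Cmod_sub_triangle|].
  assert (L := Cmod_triangle (Cexp w - (1 + v) ^ N) ((1 + v) ^ N - 1 - RtoC (INR N) * v - RtoC (INR N * (INR N - 1) / 2) * (v * v))).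
  assert (E6 : Cmod (RtoC (/ (2 * INR N)) * (w * w)) = x * x / (2 * INR N)).
  { rewrite !Cmod_mult, Cmod_R, Rabs_right; [unfold x, Rdiv; ring|]. left. apply Rinv_0_lt_compat; lra. }
  assert (E7 : INR N * (x * / INR N) = x) by (field; lra).
  assert (E8 : INR N * (INR N - 1) / 2 * (x * / INR N * (x * / INR N)) = x * x / 2 - x * x / (2 * INR N)) by (field; lra).
  rewrite E7, E8 in A3. rewrite E6.
  replace ((2 * C0 + x * x) / INR N) with (C0 / INR N + C0 / INR N + 2 * (x * x / (2 * INR N))) in HN1 by (field; lra).
  lra.
Qed.

Lemma Cexp_taylor2 (w : C) : Cmod (Cexp w - 1 - w) <= exp (Cmod w) - 1 - Cmod w.
Proof.
  assert (H := Cexp_taylor3 w).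
  replace (Cexp w - 1 - w)%C with ((Cexp w - 1 - w - w * w / 2) + w * w / 2)%C by ring.
  eapply Rle_trans; [apply Cmod_triangle|].
  unfold Cdiv at 2. rewrite !Cmod_mult. rewrite Cmod_inv, Cmod_R, Rabs_right by (try apply C2_neq_0; lra). lra.
Qed.

Lemma Cexp_taylor1 (w : C) : Cmod (Cexp w - 1) <= exp (Cmod w) - 1.
Proof.
  assert (H := Cexp_taylor2 w). replace (Cexp w - 1)%C with ((Cexp w - 1 - w) + w)%C by ring.
  eapply Rle_trans; [apply Cmod_triangle|]. lra.
Qed.

(** Each factor differs from 1 by at most a real exponential minus 1, and bounds of this shape are
    stable under products. *)
Lemma pow_exp_perturb (h1 h2 : C) (n : nat) :
  Cmod ((1 + h1) ^ n * Cexp h2 - 1) <= exp (INR n * Cmod h1 + Cmod h2) - 1.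
Proof.
  assert (H1 := Cmod_ge_0 h1).
  assert (A : forall n, Cmod ((1 + h1) ^ n - 1) <= exp (INR n * Cmod h1) - 1).
  { clear n. intros n. rewrite <- exp_pow. set (E := exp (Cmod h1)).
    assert (HE : 1 + Cmod h1 <= E) by apply exp_ineq1_le.
    induction n as [|n IH]; [simpl; replace (1 - 1)%C with (RtoC 0) by ring; rewrite Cmod_0; lra|].
    rewrite Cpow_S. simpl pow.
    replace ((1 + h1) * (1 + h1) ^ n - 1)%C with ((1 + h1) * ((1 + h1) ^ n - 1) + h1)%C by ring.
    eapply Rle_trans; [apply Cmod_triangle|]. rewrite Cmod_mult.
    assert (L : Cmod (1 + h1) <= E) by (eapply Rle_trans; [apply Cmod_triangle|rewrite Cmod_1; lra]).
    assert (Cmod (1 + h1) * Cmod ((1 + h1) ^ n - 1) <= E * (E ^ n - 1)) by (apply Rmult_le_compat; auto using Cmod_ge_0).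
    lra. }
  specialize (A n). assert (B := Cexp_taylor1 h2). rewrite exp_plus.
  set (P := ((1 + h1) ^ n)%C) in *. set (Q := Cexp h2) in *.
  replace (P * Q - 1)%C with ((P - 1) * (Q - 1) + (P - 1) + (Q - 1))%C by ring.
  eapply Rle_trans; [apply Cmod_triangle|].
  assert (L := Cmod_triangle ((P - 1) * (Q - 1)) (P - 1)). rewrite Cmod_mult in L.
  assert (Cmod (P - 1) * Cmod (Q - 1) <= (exp (INR n * Cmod h1) - 1) * (exp (Cmod h2) - 1))
    by (apply Rmult_le_compat; auto using Cmod_ge_0).
  lra.
Qed.

(** * Zeros off the arc, away from the corner *)

Definition err (K m : nat) (f : C -> C) (z : C) : C :=
  (f z - qpar z ^ m - Sl (2 * K) m z - Sl (2 * K) m (z + 1))%C.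

(** The coordinate [zeta] is left free because the error is studied in two charts: translated discs
    along the arc, and [zmap] near rho. *)
Lemma approx_err (K l m : nat) (f : C -> C) (D : C -> Prop) (phi zeta : C -> C) : bounded_on D phi ->
  approx D phi zeta -> approx D phi (fun u => / zeta u)%C -> approx D phi (fun u => / (zeta u + 1))%C ->
  (forall u, D u -> 7 / 10 <= Im (zeta u)) -> qvanish l (fun z => f z - qpar z ^ m)%C ->
  approx D phi (fun u => err K m f (zeta u)).
Proof.
  intros Hb A0 A1 A2 HD [g [Eg Ag]].
  assert (Q : forall h, approx D phi h -> approx D phi (fun u => qpar (h u))).
  { intros h Hh. apply approx_exp; auto. apply approx_scal; auto. apply approx_scal; auto. }
  assert (N : forall h, approx D phi h -> approx D phi (fun u => - h u)%C).
  { intros h Hh. apply approx_ext with (fun u => (- (1)) * h u)%C; [intros; ring|]. apply approx_scal; auto. }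
  unfold err, Sl. apply approx_minus; auto; [apply approx_minus; auto|].
  - apply approx_ext with (fun u => qpar (zeta u) ^ S l * g (zeta u))%C.
    { intros u Hu. rewrite Eg; auto. }
    apply approx_mult; auto; [apply approx_pow; auto|].
    apply approx_comp with (D' := hp (7 / 10)) (phi' := qpar); auto.
  - apply approx_mult; auto; [apply approx_pow; auto|]. apply approx_pow; auto.
  - apply approx_mult; auto; [apply approx_pow; auto|]. apply approx_pow; auto.
Qed.

(* Fac normalises f: it sends q^m to Earc, q^m|S to 1/Earc and q^m|ST to Tarc. *)
Definition Fac (K m : nat) (z : C) : C := (z ^ K * Cexp (- (Ci * RtoC (PI * INR m) * (z - / z))))%C.

Definition Earc (K m : nat) (z : C) : C := (z ^ K * Cexp (Ci * RtoC (PI * INR m) * (z + / z)))%C.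

Definition Tarc (K m : nat) (z : C) : C :=
  ((z * (/ (z + 1) * / (z + 1))) ^ K * Cexp (- (Ci * RtoC (PI * INR m) * (z - / z + 2 * / (z + 1)))))%C.

Lemma qpar_pow (w : C) (m : nat) : (qpar w ^ m = Cexp (2 * (Ci * RtoC (PI * INR m) * w)))%C.
Proof.
  unfold qpar. rewrite <- Cexp_nat. f_equal. rewrite !RtoC_mult. ring.
Qed.

Lemma Cinv_mult (a b : C) : a <> 0%C -> b <> 0%C -> (/ (a * b) = / a * / b)%C.
Proof. intros Ha Hb. field. auto. Qed.

Lemma Earc_neq_0 (K m : nat) (z : C) : z <> 0%C -> Earc K m z <> 0%C.
Proof. intros Hz. apply Cmult_neq_0; [apply Cpow_nz; auto|apply Cexp_neq_0]. Qed.

Lemma Fac_terms (K m : nat) (z : C) : z <> 0%C -> (z + 1 <> 0)%C ->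
  (Fac K m z * qpar z ^ m = Earc K m z)%C /\ (Fac K m z * Sl (2 * K) m z = / Earc K m z)%C /\
  (Fac K m z * Sl (2 * K) m (z + 1) = Tarc K m z)%C.
Proof.
  intros Hz Hz1. unfold Fac, Sl, Earc, Tarc. rewrite !qpar_pow. set (c := (Ci * RtoC (PI * INR m))%C).
  assert (Hzk := Cpow_nz z K Hz).
  split; [|split].
  - rewrite <- Cmult_assoc, <- Cexp_plus. do 2 f_equal. ring.
  - rewrite Cinv_mult by (auto; apply Cexp_neq_0). rewrite <- Cexp_opp.
    replace (z ^ K * Cexp (- (c * (z - / z))) * ((/ z) ^ (2 * K) * Cexp (2 * (c * - / z))))%C with
      (z ^ K * (/ z) ^ (2 * K) * (Cexp (- (c * (z - / z))) * Cexp (2 * (c * - / z))))%C by ring.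
    rewrite <- Cexp_plus. f_equal; [|f_equal; ring].
    rewrite Cpow_mult_r, <- Cpow_mult_l, <- Cpow_inv by auto. f_equal. simpl. field. auto.
  - replace (z ^ K * Cexp (- (c * (z - / z))) * ((/ (z + 1)) ^ (2 * K) * Cexp (2 * (c * - / (z + 1)))))%C with
      (z ^ K * (/ (z + 1)) ^ (2 * K) * (Cexp (- (c * (z - / z))) * Cexp (2 * (c * - / (z + 1)))))%C by ring.
    rewrite <- Cexp_plus. f_equal; [|f_equal; ring].
    rewrite Cpow_mult_r, <- Cpow_mult_l. f_equal. simpl. ring.
Qed.

Lemma Fac_form (K m : nat) (f : C -> C) (z : C) : z <> 0%C -> (z + 1 <> 0)%C ->
  (Fac K m z * f z = Earc K m z + / Earc K m z + (Tarc K m z + Fac K m z * err K m f z))%C.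
Proof.
  intros Hz Hz1. destruct (Fac_terms K m z Hz Hz1) as [H1 [H2 H3]]. rewrite <- H2, <- H1, <- H3.
  unfold err. ring.
Qed.

Lemma Cmod_Earc (K m : nat) (z : C) : z <> 0%C ->
  Cmod (Earc K m z) = Cmod z ^ K * exp (- (PI * INR m * (Im z * (1 - / (Cmod z * Cmod z))))).
Proof.
  intros Hz. unfold Earc. rewrite Cmod_mult, Cmod_pow, Cmod_Cexp. do 2 f_equal.
  rewrite (Cinv_alt z Hz). simpl. unfold Rdiv, Re, Im. ring.
Qed.

Lemma Cmod_Fac (K m : nat) (z : C) : z <> 0%C -> (z + 1 <> 0)%C ->
  Cmod (Fac K m z) * Cmod (qpar z) ^ m = Cmod (Earc K m z).
Proof.
  intros Hz Hz1. destruct (Fac_terms K m z Hz Hz1) as [H1 _]. rewrite <- H1, Cmod_mult, Cmod_pow. reflexivity.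
Qed.

Lemma Im_conj_0 (z : C) : Cconj z = z -> Im z = 0.
Proof. intros H. apply (f_equal Im) in H. simpl in H. unfold Im in *. lra. Qed.

Lemma unit_inv (z : C) : Cmod z = 1 -> (/ z = Cconj z)%C.
Proof.
  intros H. assert (Hz : z <> 0%C) by (apply Cmod_neq_0; lra). rewrite Cinv_alt, H by auto.
  apply injective_projections; simpl; unfold Re, Im; field.
Qed.

(* On the unit circle all the quantities f, E + 1/E are real after normalisation, because f(-1/z) = f(-conj z). *)
Lemma W_real (K K' l m : nat) (f : C -> C) (a : nat -> C) (z : C) : setting K K' l m f a ->
  Cmod z = 1 -> 7 / 10 < Im z -> Im (Fac K m z * f z - Earc K m z - / Earc K m z) = 0.
Proof.
  intros HS Hz Hy. assert (Hz0 : z <> 0%C) by (apply Im_pos_neq_0; lra).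
  assert (Hi := unit_inv z Hz).
  set (c := RtoC (PI * INR m)). assert (Hc : Cconj c = c) by (apply injective_projections; simpl; ring).
  assert (HCi : (Cconj Ci = - Ci)%C) by (apply injective_projections; simpl; ring).
  assert (Hinv : (Cconj z * z = 1)%C) by (rewrite <- Hi; field; auto).
  apply Im_conj_0. rewrite !Cminus_conj, Cmult_conj, Cinv_conj by (apply Earc_neq_0; auto).
  assert (Hf : Cconj (f z) = (z ^ (2 * K) * f z)%C).
  { destruct HS as [HK [HK' [Hm [Hl Hv]]]]. rewrite <- (proj1 Hv z ltac:(lra)).
    rewrite <- (setting_reflect K K' l m f a) by (try (repeat split; auto); apply Hv || auto).
    rewrite Hi. reflexivity. }
  assert (HE : Cconj (Earc K m z) = (/ Earc K m z)%C).
  { unfold Earc. fold c. rewrite Cmult_conj, Cpow_conj, Cexp_conj, Cinv_mult by (try apply Cexp_neq_0; apply Cpow_nz; auto).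
    rewrite <- Cexp_opp, <- Cpow_inv, <- Hi by auto. f_equal. f_equal.
    rewrite !Cmult_conj, Cplus_conj, Hc, HCi, Hi, Cconj_conj. ring. }
  assert (HF : (Cconj (Fac K m z) * z ^ (2 * K) = Fac K m z)%C).
  { unfold Fac. fold c. rewrite Cmult_conj, Cpow_conj, Cexp_conj.
    rewrite !Copp_conj, !Cmult_conj, Cminus_conj, Hc, HCi, Hi, Cconj_conj.
    replace (- (- Ci * c * (Cconj z - z)))%C with (- (Ci * c * (z - Cconj z)))%C by ring.
    rewrite (Cpow_mult_r z 2 K). simpl (z ^ 2)%C.
    replace (Cconj z ^ K * Cexp (- (Ci * c * (z - Cconj z))) * (z * (z * 1)) ^ K)%C with
      (Cconj z ^ K * (z * (z * 1)) ^ K * Cexp (- (Ci * c * (z - Cconj z))))%C by ring.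
    rewrite <- Cpow_mult_l. f_equal. f_equal. replace (Cconj z * (z * (z * 1)))%C with (Cconj z * z * z)%C by ring.
    rewrite Hinv. ring. }
  assert (HE0 := Earc_neq_0 K m z Hz0). rewrite Hf, HE, Cmult_assoc, HF. field. auto.
Qed.

Lemma approx_inv_disc (c : C) (r : R) : 0 <= r < 1 -> 1 <= Cmod c ->
  approx (fun u => Cmod u <= r) (fun u => u) (fun u => / (c + u))%C.
Proof.
  intros Hr Hc. assert (Hc0 : c <> 0%C) by (apply Cmod_neq_0; lra).
  assert (HB := disc_bounded r ltac:(lra)).
  assert (Hi : 0 < / Cmod c <= 1).
  { split; [apply Rinv_0_lt_compat; lra|]. rewrite <- Rinv_1. apply Rinv_le_contravar; lra. }
  assert (G : forall u, Cmod u <= r -> Cmod (- / c * u) <= r).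
  { intros u Hu. rewrite Cmod_mult, Cmod_opp, Cmod_inv by auto. assert (H := Cmod_ge_0 u). nra. }
  apply approx_ext with (fun u => / c * / (1 - - / c * u))%C.
  - intros u Hu. assert (H := one_minus_neq_0 (- / c * u) ltac:(specialize (G u Hu); lra)).
    assert (H2 : (c + u <> 0)%C).
    { intros E. apply H. replace (1 - - / c * u)%C with ((c + u) / c)%C by (field; auto). rewrite E. field. auto. }
    assert (H3 : (1 - - / c * u)%C = ((c + u) * / c)%C) by (field; auto).
    rewrite H3, Cinv_mult by (auto; apply Cmod_neq_0; rewrite Cmod_inv by auto; lra). field. auto.
  - apply approx_scal; auto. apply approx_geom with r; auto.
    apply approx_scal; auto. apply approx_gen.
Qed.

(* If |E| > 1 while E + 1/E is small, then E is close to the imaginary axis and the imaginary part of E + 1/E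
   is about 2 ln |E|. *)
Lemma joukowski_Im (E W : C) (lam : R) : E <> 0%C -> Cmod E = exp lam -> 0 <= lam <= 0.22 ->
  (W = - (E + / E))%C -> Cmod W <= 1 / 2 -> 1.8 * lam <= Rabs (Im W).
Proof.
  intros HE HG Hl HW HWs.
  set (p := exp (- (2 * lam))). assert (Hp : 0 < p <= 1).
  { split; [apply exp_pos|]. rewrite <- exp_0. apply exp_le. lra. }
  assert (HG2 : Cmod E * Cmod E = / p).
  { rewrite HG, <- exp_plus. unfold p. rewrite <- exp_Ropp. f_equal. ring. }
  assert (Hinv := Cinv_alt E HE). rewrite HG2 in Hinv.
  assert (HRe : Re W = - (Re E * (1 + p))).
  { rewrite HW, Hinv. simpl. unfold Re, Im. field. lra. }
  assert (HIm : Im W = - (Im E * (1 - p))).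
  { rewrite HW, Hinv. simpl. unfold Re, Im. field. lra. }
  assert (HR := Cmod_Re_le W). assert (HR2 : Re W * Re W <= 1 / 4).
  { replace (Re W * Re W) with (Rabs (Re W) * Rabs (Re W)) by (rewrite <- Rabs_mult; apply Rabs_right; apply Rle_ge, Rle_0_sqr).
    assert (H := Rabs_pos (Re W)). assert (Rabs (Re W) * Rabs (Re W) <= 1 / 2 * (1 / 2)) by (apply Rmult_le_compat; lra). lra. }
  assert (Ha : Re E * Re E * (4 * p) <= 1 / 4).
  { replace (Re W * Re W) with (Re E * Re E * ((1 + p) * (1 + p))) in HR2 by (rewrite HRe; ring).
    eapply Rle_trans; [|exact HR2]. apply Rmult_le_compat_l; [apply Rle_0_sqr|].
    assert (H := Rle_0_sqr (1 - p)). unfold Rsqr in H. lra. }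
  assert (Hs := Cmod_sq E). rewrite HG2 in Hs.
  assert (Hb : 15 / 16 <= Im E * Im E * p).
  { assert (Hs' : / p * p = (Re E * Re E + Im E * Im E) * p) by (rewrite Hs; reflexivity).
    rewrite Rinv_l in Hs' by lra. lra. }
  set (e := exp (- lam)). assert (He : 0 < e) by apply exp_pos.
  assert (Hpe : p = e * e) by (unfold p, e; rewrite <- exp_plus; f_equal; ring).
  assert (He1 : e * (1 + lam + lam * lam / 2) <= 1).
  { assert (Hx := exp_lower lam ltac:(lra)).
    assert (Hx2 : 1 + lam + lam * lam / 2 <= exp lam).
    { eapply Rle_trans; [|exact Hx].
      assert (0 <= lam * lam * lam) by (repeat apply Rmult_le_pos; lra).
      assert (0 <= lam * lam * lam * lam) by (repeat apply Rmult_le_pos; lra).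
      assert (0 <= lam * lam * lam * lam * lam) by (repeat apply Rmult_le_pos; lra).
      assert (0 <= lam * lam * lam * lam * lam * lam) by (repeat apply Rmult_le_pos; lra).
      assert (0 <= lam * lam * lam * lam * lam * lam * lam) by (repeat apply Rmult_le_pos; lra). lra. }
    apply Rle_trans with (e * exp lam); [apply Rmult_le_compat_l; lra|].
    unfold e. rewrite <- exp_plus, Rplus_opp_l, exp_0. lra. }
  assert (He2 : e <= 1 - lam + lam * lam / 2).
  { apply Rmult_le_reg_r with (1 + lam + lam * lam / 2); [nra|].
    eapply Rle_trans; [exact He1|]. assert (0 <= lam * lam * (lam * lam) / 4) by nra. lra. }
  assert (Hsig : 1.88 * lam * e <= 1 - p).
  { rewrite Hpe. assert (He3 : e <= 1) by nra.
    assert (H1 : 1 - lam <= e). { unfold e. replace (1 - lam) with (1 + - lam) by ring. apply exp_ineq1_le. }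
    apply Rle_trans with (1.88 * lam * (1 - lam + lam * lam / 2)).
    - apply Rmult_le_compat_l; lra.
    - assert (e * e <= (1 - lam + lam * lam / 2) * (1 - lam + lam * lam / 2)) by (apply Rmult_le_compat; lra).
      assert (0 <= lam * (0.12 - 0.12 * lam)) by (apply Rmult_le_pos; lra).
      assert (0 <= lam * lam * lam * (0.06 - lam / 4)).
      { apply Rmult_le_pos; [|lra]. repeat apply Rmult_le_pos; lra. }
      lra. }
  apply Rsqr_incr_0_var; [|apply Rabs_pos]. rewrite <- Rsqr_abs. unfold Rsqr.
  replace (Im W * Im W) with (Im E * Im E * ((1 - p) * (1 - p))) by (rewrite HIm; ring).
  assert (H0 : 0 <= 1.88 * lam * e) by (apply Rmult_le_pos; lra).
  assert (H1 : (1.88 * lam * e) * (1.88 * lam * e) <= (1 - p) * (1 - p)) by (apply Rmult_le_compat; lra).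
  apply Rle_trans with (Im E * Im E * ((1.88 * lam * e) * (1.88 * lam * e))).
  - replace (Im E * Im E * (1.88 * lam * e * (1.88 * lam * e))) with ((Im E * Im E * p) * (1.88 * lam * (1.88 * lam))) by (rewrite Hpe; ring).
    assert (0 <= lam * lam) by (apply Rmult_le_pos; lra).
    assert (15 / 16 * (1.88 * lam * (1.88 * lam)) <= Im E * Im E * p * (1.88 * lam * (1.88 * lam))).
    { apply Rmult_le_compat_r; [|lra]. apply Rmult_le_pos; lra. }
    lra.
  - apply Rmult_le_compat_l; auto. apply Rle_0_sqr.
Qed.

Lemma inv_le_1 (x : R) : 1 <= x -> 0 <= / x <= 1.
Proof.
  intros Hx. split; [left; apply Rinv_0_lt_compat; lra|]. rewrite <- Rinv_1. apply Rinv_le_contravar; lra.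
Qed.

(** K >= 6 l >= 3 (9 m + 20) gives K >= 27 m + 60, the form in which the hypothesis makes m small
    against K. *)
Lemma setting_num2 (K K' l m : nat) (f : C -> C) (a : nat -> C) : setting K K' l m f a ->
  INR m <= (INR K - 60) / 27 /\ 90 <= INR K /\ INR (K - 7 * m) = INR K - 7 * INR m /\ 80 <= INR (K - 7 * m).
Proof.
  intros HS. destruct (setting_num _ _ _ _ _ _ HS) as [Hm1 [Hl15 [Hlm [HKr [_ HKm]]]]].
  assert (E : INR (K - 7 * m) = INR K - 7 * INR m).
  { rewrite minus_INR by lia. rewrite mult_INR. simpl. lra. }
  repeat split; try lra.
Qed.

(** On the unit circle |z + 1|^2 = 2 + 2 Re z. The last hypothesis keeps z away from the corner, so
    that |z + 1|^(-2n) with n = K - 7m drops to exp(-1.47). *)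
Lemma Tarc_unit_bound (K K' l m : nat) (f : C -> C) (a : nat -> C) (z : C) : setting K K' l m f a ->
  Cmod z = 1 -> 0 < Im z <= 1 -> - (1 / 2) <= Re z -> 3 / 2 <= INR (K - 7 * m) * (1 + 2 * Re z) ->
  Cmod (Tarc K m z) <= (/ (Cmod (z + 1) * Cmod (z + 1))) ^ (K - 7 * m) /\
  (/ (Cmod (z + 1) * Cmod (z + 1))) ^ (K - 7 * m) <= 0.2303.
Proof.
  intros HS Hz Hy Hx Hn. assert (HPI := PI_bounds).
  destruct (setting_num _ _ _ _ _ _ HS) as [_ [_ [_ [_ [_ HKm]]]]].
  destruct (setting_num2 _ _ _ _ _ _ HS) as [_ [_ [_ Hn80]]].
  assert (Hz0 : z <> 0%C) by (apply Im_pos_neq_0; lra).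
  destruct (Im_neq_0_shift z 1 ltac:(lra)) as [Hz1 _].
  assert (HN : Cmod (z + 1) * Cmod (z + 1) = 2 + 2 * Re z).
  { rewrite (Cmod_sq_translate z 1). assert (E := Cmod_sq z). rewrite Hz in E. lra. }
  destruct (Im_shift z 1) as [E1 _].
  split.
  - destruct (Fac_terms K m z Hz0 Hz1) as [_ [_ H3]]. rewrite <- H3, Cmod_mult.
    assert (HF := Cmod_Fac K m z Hz0 Hz1). rewrite (Cmod_Earc K m z Hz0), Hz, pow1 in HF.
    replace (- (PI * INR m * (Im z * (1 - / (1 * 1))))) with 0 in HF by field. rewrite exp_0 in HF.
    assert (Hd : 2 * PI * Im z <= INR 7).
    { replace (INR 7) with 7 by (simpl; lra). assert (PI * Im z <= 3.142 * 1) by (apply Rmult_le_compat; lra). lra. }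
    assert (B := Sl_rel K m 7 z (z + 1) ltac:(lra) E1 ltac:(lra) Hd ltac:(lia)).
    set (X := (/ (Cmod (z + 1) * Cmod (z + 1))) ^ (K - 7 * m)) in *.
    apply Rle_trans with (Cmod (Fac K m z) * (Cmod (qpar z) ^ m * X)).
    + apply Rmult_le_compat_l; auto using Cmod_ge_0.
    + rewrite <- Rmult_assoc, HF. lra.
  - rewrite HN, pow_inv. set (n := (K - 7 * m)%nat) in *.
    assert (H : 1.47 <= INR n * (1 - / (2 + 2 * Re z))).
    { set (u := 2 + 2 * Re z). assert (Hu : 1 <= u) by (unfold u; lra).
      (* For u near 1 the hypothesis gives n (u - 1)/u >= 1.5/1.02; for larger u it is enough that n
         >= 80. *)
      destruct (Rle_dec u 1.02) as [Hs|Hs].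
      - replace (INR n * (1 - / u)) with (INR n * (1 + 2 * Re z) * / u) by (unfold u; field; unfold u in Hu; lra).
        assert (Hi : / 1.02 <= / u) by (apply Rinv_le_contravar; lra).
        apply Rle_trans with (3 / 2 * / 1.02); [lra|]. apply Rmult_le_compat; lra.
      - assert (Hi : / u <= / 1.02) by (apply Rinv_le_contravar; lra).
        apply Rle_trans with (80 * (1 - / 1.02)); [lra|]. apply Rmult_le_compat; lra. }
    assert (B : 4.3485 <= (2 + 2 * Re z) ^ n).
    { apply Rle_trans with (exp (1 - / (2 + 2 * Re z)) ^ n).
      - rewrite exp_pow. apply Rle_trans with (exp 1.47); [|apply exp_le; lra].
        assert (B := exp_lower 1.47 ltac:(lra)). lra.
      - apply pow_incr. split; [left; apply exp_pos|]. apply exp_1_minus_inv. lra. }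
    apply Rle_trans with (/ 4.3485); [apply Rinv_le_contravar; lra|lra].
Qed.

(** Along a ray [Tarc] is multiplied by (1 + h1)^K exp(h2) with h1 of order g and h2 of order m g,
    so its variation is relative to its value on the circle. *)
Lemma Tarc_radial (K m : nat) (z0 : C) (g : R) : z0 <> 0%C -> (z0 + 1 <> 0)%C -> 0 <= g ->
  let z := (RtoC (1 + g) * z0)%C in z <> 0%C -> (z + 1 <> 0)%C -> Cmod z0 = 1 ->
  1 <= Cmod (z0 + 1) -> 1 <= Cmod (z + 1) ->
  Cmod (Tarc K m z - Tarc K m z0) <=
    Cmod (Tarc K m z0) * (exp (INR K * (g * (2 + g)) + PI * INR m * (4 * g)) - 1).
Proof.
  intros Hz0 Hz01 Hg z Hz Hz1 Hu Hb0 Hb. assert (HPI := PI_bounds).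
  set (c := (Ci * RtoC (PI * INR m))%C).
  set (h1 := (RtoC g * (1 - z * z0) * (/ (z + 1) * / (z + 1)))%C).
  set (h2 := (- (c * (RtoC g * z0 + RtoC g * / z - 2 * (RtoC g * z0) * (/ (z + 1) * / (z0 + 1)))))%C).
  assert (Hs : RtoC (1 + g) <> 0%C) by (intros H; apply (f_equal Re) in H; rewrite !Re_RtoC in H; lra).
  assert (E : (Tarc K m z = Tarc K m z0 * ((1 + h1) ^ K * Cexp h2))%C).
  { unfold Tarc. fold c.
    replace ((z0 * (/ (z0 + 1) * / (z0 + 1))) ^ K * Cexp (- (c * (z0 - / z0 + 2 * / (z0 + 1)))) * ((1 + h1) ^ K * Cexp h2))%C
      with (((z0 * (/ (z0 + 1) * / (z0 + 1))) ^ K * (1 + h1) ^ K) * (Cexp (- (c * (z0 - / z0 + 2 * / (z0 + 1)))) * Cexp h2))%C by ring.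
    rewrite <- Cexp_plus, <- Cpow_mult_l. f_equal.
    - f_equal. unfold h1, z in *. rewrite RtoC_plus in *. field. auto.
    - f_equal. unfold h2, z in *. rewrite RtoC_plus in *. field. auto. }
  rewrite E. replace (Tarc K m z0 * ((1 + h1) ^ K * Cexp h2) - Tarc K m z0)%C with
    (Tarc K m z0 * ((1 + h1) ^ K * Cexp h2 - 1))%C by ring.
  rewrite Cmod_mult. apply Rmult_le_compat_l; [apply Cmod_ge_0|].
  eapply Rle_trans; [apply pow_exp_perturb|]. apply Rplus_le_compat_r. apply exp_le.
  assert (Hm := pos_INR m). assert (HK := pos_INR K).
  assert (Hzm : Cmod z = 1 + g) by (unfold z; rewrite Cmod_mult, Cmod_R, Rabs_right, Hu; lra).
  assert (Hi0 : 0 <= Cmod (/ (z0 + 1)) <= 1).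
  { rewrite Cmod_inv by auto. apply inv_le_1; lra. }
  assert (Hi1 : 0 <= Cmod (/ (z + 1)) <= 1).
  { rewrite Cmod_inv by auto. apply inv_le_1; lra. }
  assert (Hiz : 0 <= Cmod (/ z) <= 1).
  { rewrite Cmod_inv, Hzm by auto. apply inv_le_1; lra. }
  assert (Hg1 : Cmod (RtoC g) = g) by (rewrite Cmod_R, Rabs_right; lra).
  assert (B1 : Cmod h1 <= g * (2 + g)).
  { unfold h1. rewrite !Cmod_mult, Hg1.
    assert (L : Cmod (1 - z * z0) <= 2 + g).
    { eapply Rle_trans; [apply Cmod_sub_triangle|]. rewrite Cmod_1, Cmod_mult, Hzm, Hu. lra. }
    assert (L2 : Cmod (/ (z + 1)) * Cmod (/ (z + 1)) <= 1 * 1) by (apply Rmult_le_compat; lra).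
    assert (L3 : g * Cmod (1 - z * z0) <= g * (2 + g)) by (apply Rmult_le_compat_l; auto).
    rewrite <- (Rmult_1_r (g * (2 + g))). apply Rmult_le_compat; auto; try lra.
    - apply Rmult_le_pos; auto using Cmod_ge_0.
    - apply Rmult_le_pos; lra. }
  assert (B2 : Cmod h2 <= PI * INR m * (4 * g)).
  { unfold h2, c. rewrite Cmod_opp, !Cmod_mult, Cmod_Ci, Cmod_R, Rabs_right by (apply Rle_ge, Rmult_le_pos; lra).
    rewrite Rmult_1_l. apply Rmult_le_compat_l; [apply Rmult_le_pos; lra|].
    eapply Rle_trans; [apply Cmod_sub_triangle|].
    assert (L1 := Cmod_triangle (RtoC g * z0) (RtoC g * / z)). rewrite !Cmod_mult, Hg1, Hu in *.
    rewrite Cmod_R, Rabs_right by lra.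
    assert (L2 : Cmod (/ (z + 1)) * Cmod (/ (z0 + 1)) <= 1 * 1) by (apply Rmult_le_compat; lra).
    assert (L3 : g * Cmod (/ z) <= g * 1) by (apply Rmult_le_compat_l; lra).
    assert (L4 : 2 * (g * 1) * (Cmod (/ (z + 1)) * Cmod (/ (z0 + 1))) <= 2 * (g * 1) * (1 * 1)) by (apply Rmult_le_compat_l; lra).
    lra. }
  apply Rplus_le_compat; auto. apply Rmult_le_compat_l; auto.
Qed.

(* Cauchy estimate (in the form of the Schwarz lemma) for the error term on a disc of radius 1/100. *)
Lemma err_radial (K K' l m : nat) (f : C -> C) (a : nat -> C) (z0 u : C) : setting K K' l m f a ->
  Cmod z0 = 1 -> - (1 / 2) <= Re z0 <= 0 -> 866 / 1000 <= Im z0 <= 1 -> Cmod u < / 100 ->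
  Cmod (Fac K m (z0 + u) * err K m f (z0 + u) - Fac K m z0 * err K m f z0) <= 0.25 * INR K * Cmod u.
Proof.
  intros HS Hu0 Hx Hy Hu. assert (HPI := PI_bounds).
  destruct (setting_num _ _ _ _ _ _ HS) as [Hm1 [Hl15 [Hlm [HKr [_ HKm]]]]].
  destruct (setting_num2 _ _ _ _ _ _ HS) as [HmK [HK90 _]].
  assert (HS' := HS). destruct HS' as [HK [HK' [Hm [Hl Hv]]]].
  assert (HB := disc_bounded (/ 100) ltac:(lra)).
  assert (Hz01 : 1 <= Cmod (z0 + 1)).
  { assert (E := Cmod_sq_translate z0 1). assert (E2 := Cmod_sq z0). rewrite Hu0 in E2.
    assert (H := Cmod_ge_0 (z0 + 1)). apply Rsqr_incr_0_var; [|auto]. unfold Rsqr. lra. }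
  set (D := fun u => Cmod u <= / 100).
  assert (A0 : approx D (fun u => u) (fun u => z0 + u)%C).
  { apply approx_plus; [apply approx_const|apply approx_gen]. }
  assert (A1 : approx D (fun u => u) (fun u => / (z0 + u))%C) by (apply approx_inv_disc; lra).
  assert (A2 : approx D (fun u => u) (fun u => / (z0 + u + 1))%C).
  { apply approx_ext with (fun u => / ((z0 + 1) + u))%C; [intros; f_equal; ring|]. apply approx_inv_disc; lra. }
  assert (Hgeo : forall u, D u -> - (11 / 20) <= Re (z0 + u) <= 1 / 20 /\ 17 / 20 <= Im (z0 + u) <= 3 / 2 /\
     0.99 <= Cmod (z0 + u) <= 1.01).
  { intros v Hv'. unfold D in Hv'. assert (R1 := Cmod_Re_le v). assert (R2 := Cmod_Im_le v).
    assert (R3 := Rle_trans _ _ _ R1 Hv'). assert (R4 := Rle_trans _ _ _ R2 Hv').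
    apply Rabs_le_between in R3. apply Rabs_le_between in R4.
    rewrite Re_plus, Im_plus. assert (L1 := Cmod_triangle z0 v). assert (L2 := Cmod_plus_ge z0 v). lra. }
  assert (AF : approx D (fun u => u) (fun u => Fac K m (z0 + u) * err K m f (z0 + u))%C).
  { apply approx_mult; auto.
    - unfold Fac. apply approx_mult; auto; [apply approx_pow; auto|]. apply approx_exp; auto.
      apply approx_ext with (fun u => - (Ci * RtoC (PI * INR m)) * (z0 + u - / (z0 + u)))%C; [intros; ring|].
      apply approx_scal; auto. apply approx_minus; auto.
    - apply (approx_err K l m f D (fun u => u) (fun u => z0 + u)%C); auto.
      + intros v Hv'. destruct (Hgeo v Hv') as [_ [H1 _]]. lra.
      + apply (vanish_form_qvanish (2 * K) l m f a Hv). lia. }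
  (* On the disc |E| is at most exp(0.01 K); with K <= 6 l + 7 a net decay of 0.09 l remains in the
     exponent. *)
  set (M := 2 / 5 * exp (- (3 / 20 * INR l)) * exp (0.01 * INR K)).
  assert (HM : forall u, D u -> Cmod (Fac K m (z0 + u) * err K m f (z0 + u)) <= M).
  { intros v Hv'. destruct (Hgeo v Hv') as [H1 [H2 H3]]. set (w := (z0 + v)%C) in *.
    assert (Hw0 : w <> 0%C) by (apply Im_pos_neq_0; lra).
    destruct (Im_neq_0_shift w 1 ltac:(lra)) as [Hw1 _].
    assert (Herr := error_bound K K' l m f a HK HK' Hm Hl Hv w H2 H1). fold (err K m f w) in Herr.
    rewrite Cmod_mult. set (dl := 2 / 5 * exp (- (3 / 20 * INR l))) in *.
    assert (Hdl : 0 < dl) by (unfold dl; assert (H := exp_pos (- (3 / 20 * INR l))); lra).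
    apply Rle_trans with (Cmod (Fac K m w) * (dl * Cmod (qpar w) ^ m)).
    { apply Rmult_le_compat_l; auto using Cmod_ge_0. }
    replace (Cmod (Fac K m w) * (dl * Cmod (qpar w) ^ m)) with (dl * (Cmod (Fac K m w) * Cmod (qpar w) ^ m)) by ring.
    rewrite Cmod_Fac by auto. unfold M. fold dl. apply Rmult_le_compat_l; [lra|].
    rewrite Cmod_Earc by auto. set (s := Cmod w) in *.
    assert (Hs1 : s ^ K <= exp (INR K * (s - 1))).
    { rewrite <- exp_pow. apply pow_incr. split; [lra|]. replace s with (1 + (s - 1)) at 1 by ring. apply exp_ineq1_le. }
    apply Rle_trans with (exp (INR K * (s - 1)) * exp (- (PI * INR m * (Im w * (1 - / (s * s)))))).
    { apply Rmult_le_compat_r; auto. left. apply exp_pos. }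
    rewrite <- exp_plus. apply exp_le.
    assert (Hyw : Im w <= s). { eapply Rle_trans; [apply Rle_abs|apply Cmod_Im_le]. }
    assert (Hpm : 0 <= PI * INR m) by (apply Rmult_le_pos; lra).
    destruct (Rle_dec 1 s) as [Hs|Hs].
    - assert (Hi : / (s * s) <= 1) by (rewrite <- Rinv_1; apply Rinv_le_contravar; nra).
      assert (0 <= PI * INR m * (Im w * (1 - / (s * s)))) by (apply Rmult_le_pos; auto; apply Rmult_le_pos; lra).
      assert (INR K * (s - 1) <= INR K * 0.01) by (apply Rmult_le_compat_l; lra). lra.
    - assert (Hi : / (s * s) <= / (0.99 * 0.99)) by (apply Rinv_le_contravar; [lra|apply Rmult_le_compat; lra]).
      assert (Hd : / (s * s) - 1 = (1 - s) * ((1 + s) * / (s * s))) by (field; lra).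
      assert (Hc : (1 + s) * / (s * s) <= 2.05).
      { apply Rle_trans with (2 * / (0.99 * 0.99)); [|lra].
        apply Rmult_le_compat; try lra. left. apply Rinv_0_lt_compat. nra. }
      assert (H5 : Im w * (/ (s * s) - 1) <= 1 * ((1 - s) * 2.05)).
      { rewrite Hd. apply Rmult_le_compat; try lra.
        - apply Rmult_le_pos; [lra|]. apply Rmult_le_pos; [lra|]. left. apply Rinv_0_lt_compat. nra.
        - apply Rmult_le_compat_l; lra. }
      assert (H6 : PI * INR m * (Im w * (/ (s * s) - 1)) <= PI * INR m * ((1 - s) * 2.05)).
      { apply Rmult_le_compat_l; lra. }
      assert (H7 : PI * INR m <= 3.142 * INR m) by (apply Rmult_le_compat_r; lra).
      assert (H8 : PI * INR m * ((1 - s) * 2.05) <= INR K * (1 - s)).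
      { replace (PI * INR m * ((1 - s) * 2.05)) with (PI * INR m * 2.05 * (1 - s)) by ring.
        apply Rmult_le_compat_r; lra. }
      replace (- (PI * INR m * (Im w * (1 - / (s * s))))) with (PI * INR m * (Im w * (/ (s * s) - 1))) by ring. lra. }
  assert (B := disc_schwarz _ (/ 100) M u ltac:(lra) AF HM Hu).
  assert (Ez : (z0 + 0 = z0)%C) by ring. cbv beta in B. rewrite Ez in B.
  eapply Rle_trans; [exact B|].
  assert (HMb : M <= 0.1125).
  { unfold M. rewrite Rmult_assoc, <- exp_plus.
    apply Rle_trans with (2 / 5 * exp (- (1.28))).
    - apply Rmult_le_compat_l; [lra|]. apply exp_le. lra.
    - rewrite exp_Ropp. assert (Hx' := exp_lower 1.28 ltac:(lra)).
      assert (/ exp 1.28 <= / 3.5955) by (apply Rinv_le_contravar; lra). lra. }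
  assert (H0 := Cmod_ge_0 u). unfold Rdiv. rewrite Rinv_inv.
  replace (2 * M * (Cmod u * 100)) with (200 * M * Cmod u) by ring. apply Rmult_le_compat_r; auto. lra.
Qed.

Lemma le_of_sq_le (x y : R) : 0 <= y -> x * x <= y * y -> x <= y.
Proof. intros Hy H. apply Rsqr_incr_0_var; auto. Qed.

(** Let z0 = z/|z| and g = |z| - 1. At a zero W = -(E + 1/E), so |Im W| >= 1.8 log |E| >= 1.37 K g.
    But W is real at z0 and varies by at most 1.01 K g along the radius: 0.76 for the third main
    term and 0.25 for the error. *)
Lemma no_zero_arc (K K' l m : nat) (f : C -> C) (a : nat -> C) (z : C) : setting K K' l m f a ->
  - (1 / 2) <= Re z <= 0 -> 0 < Im z <= 3 / 2 -> 1 < Cmod z ->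
  3 / 2 <= INR (K - 7 * m) * (1 + 2 * (Re z / Cmod z)) -> f z <> 0%C.
Proof.
  intros HS Hx Hy Hs Hn Hf. assert (HPI := PI_bounds).
  destruct (setting_num _ _ _ _ _ _ HS) as [Hm1 [Hl15 [Hlm [HKr [_ HKm]]]]].
  destruct (setting_num2 _ _ _ _ _ _ HS) as [HmK [HK90 [En Hn80]]].
  assert (HS' := HS). destruct HS' as [HK [HK' [Hm [Hl Hv]]]].
  set (s := Cmod z) in *. set (g := s - 1).
  assert (Es := Cmod_sq z). fold s in Es.
  assert (Hy0 : 866 / 1000 <= Im z).
  { apply le_of_sq_le; [lra|]. assert (1 * 1 <= s * s) by (apply Rmult_le_compat; lra).
    assert (- Re z * - Re z <= 1 / 2 * (1 / 2)) by (apply Rmult_le_compat; lra). lra. }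
  destruct (zero_near_circle K K' l m f a z HS ltac:(lra) Hx ltac:(fold s; lra) Hf) as [Ht _]. fold s in Ht.
  assert (Hss : 1 <= s * s) by (assert (1 * 1 <= s * s) by (apply Rmult_le_compat; lra); lra).
  assert (Hg : 0 < g <= 0.005).
  { unfold g. split; [lra|]. assert (s <= 1.005) by (apply le_of_sq_le; lra). lra. }
  set (z0 := (RtoC (/ s) * z)%C).
  assert (His : 0 < / s <= 1) by (split; [apply Rinv_0_lt_compat; lra|apply inv_le_1; lra]).
  assert (Hx0 : Re z0 = Re z / s) by (unfold z0; rewrite Re_scal; unfold Rdiv; ring).
  assert (Hy0' : Im z0 = Im z * / s) by (unfold z0; rewrite Im_scal; ring).
  assert (Hu0 : Cmod z0 = 1).
  { unfold z0. rewrite Cmod_mult, Cmod_R, Rabs_right by lra. fold s. apply Rinv_l. lra. }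
  assert (Hxr : - (1 / 2) <= Re z0 <= 0).
  { rewrite Hx0. unfold Rdiv. assert (- Re z * / s <= 1 / 2 * 1) by (apply Rmult_le_compat; lra).
    assert (0 <= - Re z * / s) by (apply Rmult_le_pos; lra). lra. }
  assert (E0 := Cmod_sq z0). rewrite Hu0 in E0.
  assert (Hyp : 0 < Im z0) by (rewrite Hy0'; apply Rmult_lt_0_compat; lra).
  assert (Hyr : 866 / 1000 <= Im z0 <= 1).
  { assert (- Re z0 * - Re z0 <= 1 / 2 * (1 / 2)) by (apply Rmult_le_compat; lra).
    assert (0 <= - Re z0 * - Re z0) by (apply Rmult_le_pos; lra).
    split; apply le_of_sq_le; lra. }
  assert (Ez : z = (RtoC (1 + g) * z0)%C).
  { unfold z0. rewrite Cmult_assoc, <- RtoC_mult. replace ((1 + g) * / s) with 1 by (unfold g; field; lra). ring. }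
  assert (Hz0 : z0 <> 0%C) by (apply Im_pos_neq_0; lra).
  assert (Hzn : z <> 0%C) by (apply Im_pos_neq_0; lra).
  destruct (Im_neq_0_shift z0 1 Hyp) as [Hz01 _]. destruct (Im_neq_0_shift z 1 ltac:(lra)) as [Hz1 _].
  assert (HN0 : 1 <= Cmod (z0 + 1) * Cmod (z0 + 1)).
  { assert (E := Cmod_sq_translate z0 1). lra. }
  assert (HNz : Cmod (z0 + 1) * Cmod (z0 + 1) <= Cmod (z + 1) * Cmod (z + 1)).
  { assert (E := Cmod_sq_translate z0 1). assert (E1 := Cmod_sq_translate z 1).
    assert (Exs : Re z = Re z0 * (1 + g)) by (rewrite Ez, Re_scal; ring).
    assert (s * s = 1 + 2 * g + g * g) by (unfold g; ring).
    assert (- (1 / 2) * g <= Re z0 * g) by (apply Rmult_le_compat_r; lra).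
    assert (0 <= g * g) by (apply Rmult_le_pos; lra). lra. }
  assert (HN0' : 1 <= Cmod (z0 + 1)). { apply le_of_sq_le; [apply Cmod_ge_0|lra]. }
  assert (HNz' : 1 <= Cmod (z + 1)). { apply le_of_sq_le; [apply Cmod_ge_0|lra]. }
  destruct (Tarc_unit_bound K K' l m f a z0 HS Hu0 ltac:(lra) ltac:(lra) ltac:(rewrite Hx0; exact Hn)) as [HT0 HT1].
  set (n := (K - 7 * m)%nat) in *.
  (* Away from the corner the third main term supplies at most 0.2303 of the balance, so |z|^(-2n)
     >= 1 - 0.0425 - 0.2303 = 0.7272. *)
  assert (Hng : INR n * g <= 0.162).
  { assert (Hd : 2 * PI * Im z <= INR 7).
    { replace (INR 7) with 7 by (simpl; lra). assert (0 <= Re z * Re z) by apply Rle_0_sqr.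
      assert (Im z <= 1.01) by (apply le_of_sq_le; lra).
      assert (PI * Im z <= 3.142 * 1.01) by (apply Rmult_le_compat; lra). lra. }
    assert (B := zero_ineq K K' l m 7 f a z HS ltac:(lra) Hx ltac:(fold s; lra) Hf Hd ltac:(lia)). fold s n in B.
    assert (B2 : (/ (Cmod (z + 1) * Cmod (z + 1))) ^ n <= (/ (Cmod (z0 + 1) * Cmod (z0 + 1))) ^ n).
    { apply pow_incr. split; [left; apply Rinv_0_lt_compat; lra|]. apply Rinv_le_contravar; lra. }
    assert (B3 : 0.7272 <= (/ (s * s)) ^ n) by lra.
    assert (B4 : (s * s) ^ n <= / 0.7272).
    { rewrite pow_inv in B3. rewrite <- (Rinv_inv ((s * s) ^ n)). apply Rinv_le_contravar; lra. }
    assert (B5 : exp (INR n * (1 - / (s * s))) <= / 0.7272).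
    { eapply Rle_trans; [|exact B4]. rewrite <- exp_pow. apply pow_incr. split; [left; apply exp_pos|].
      apply exp_1_minus_inv. lra. }
    assert (B6 : INR n * (1 - / (s * s)) <= 0.32).
    { destruct (Rle_dec (INR n * (1 - / (s * s))) 0.32) as [|H]; auto. exfalso.
      assert (B7 : exp 0.32 <= / 0.7272) by (eapply Rle_trans; [apply exp_le|exact B5]; lra).
      assert (B8 := exp_lower 0.32 ltac:(lra)). lra. }
    assert (B7 : 1.98 * g <= 1 - / (s * s)).
    { apply Rmult_le_reg_r with (s * s); [lra|]. rewrite Rmult_minus_distr_r, Rinv_l, Rmult_1_l by lra.
      replace (s * s) with (1 + 2 * g + g * g) by (unfold g; ring).
      assert (g * g <= 0.005 * 0.005) by (apply Rmult_le_compat; lra).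
      assert (0 <= g * (0.02 - 2.96 * g - 1.98 * (g * g))) by (apply Rmult_le_pos; lra). lra. }
    assert (B8 : INR n * (1.98 * g) <= INR n * (1 - / (s * s))) by (apply Rmult_le_compat_l; lra).
    lra. }
  set (Kg := INR K * g).
  assert (Hmg : INR m * g <= 0.03704 * Kg).
  { unfold Kg. rewrite <- Rmult_assoc. apply Rmult_le_compat_r; lra. }
  assert (Hmg0 : 0 <= INR m * g) by (apply Rmult_le_pos; lra).
  assert (HKg : 0 < Kg <= 0.2188).
  { split; [unfold Kg; apply Rmult_lt_0_compat; lra|].
    assert (INR n * g = Kg - 7 * (INR m * g)) by (rewrite En; unfold Kg; ring). lra. }
  assert (Hpm : 0 <= PI * INR m) by (apply Rmult_le_pos; lra).
  assert (Hpmg : PI * (INR m * g) <= 3.142 * (INR m * g)) by (apply Rmult_le_compat_r; lra).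
  (* This is log |E|. The part from q^m costs at most 2 pi m g <= 0.233 K g, which leaves 0.762 K
     g. *)
  set (lam := INR K * ln s - PI * INR m * (Im z * (1 - / (s * s)))).
  assert (HG : Cmod (Earc K m z) = exp lam).
  { rewrite Cmod_Earc by auto. fold s. unfold lam, Rminus. rewrite exp_plus. f_equal.
    rewrite <- exp_pow, exp_ln; lra. }
  assert (Hln1 : 0.995 * g <= ln s).
  { apply Rle_trans with (1 - / s).
    - apply Rmult_le_reg_r with s; [lra|]. rewrite Rmult_minus_distr_r, Rinv_l by lra. unfold g in *. nra.
    - rewrite <- (ln_exp (1 - / s)). apply ln_le; [apply exp_pos|]. apply exp_1_minus_inv. lra. }
  assert (Hln2 : ln s <= g).
  { rewrite <- (ln_exp g). apply ln_le; [lra|]. replace s with (1 + g) by (unfold g; ring). apply exp_ineq1_le. }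
  assert (Hiss : 0 <= 1 - / (s * s)).
  { assert (H := inv_le_1 (s * s) Hss). lra. }
  assert (Hyt : 0 <= Im z * (1 - / (s * s)) <= 2 * g).
  { split; [apply Rmult_le_pos; lra|].
    assert (Hys : Im z <= s). { eapply Rle_trans; [apply Rle_abs|apply Cmod_Im_le]. }
    apply Rle_trans with (s * (1 - / (s * s))); [apply Rmult_le_compat_r; lra|].
    replace (s * (1 - / (s * s))) with (g * (1 + / s)) by (unfold g; field; lra). nra. }
  assert (Hl1 : 0.762 * Kg <= lam).
  { unfold lam. assert (INR K * (0.995 * g) <= INR K * ln s) by (apply Rmult_le_compat_l; lra).
    assert (PI * INR m * (Im z * (1 - / (s * s))) <= PI * INR m * (2 * g)) by (apply Rmult_le_compat_l; lra).
    unfold Kg in *. lra. }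
  assert (Hl2 : lam <= Kg).
  { unfold lam, Kg. assert (INR K * ln s <= INR K * g) by (apply Rmult_le_compat_l; lra).
    assert (0 <= PI * INR m * (Im z * (1 - / (s * s)))) by (apply Rmult_le_pos; lra). lra. }
  set (W := (Tarc K m z + Fac K m z * err K m f z)%C).
  set (W0 := (Tarc K m z0 + Fac K m z0 * err K m f z0)%C).
  assert (HW : W = (- (Earc K m z + / Earc K m z))%C).
  { assert (E := Fac_form K m f z Hzn Hz1). fold W in E. rewrite Hf, Cmult_0_r in E.
    replace W with (Earc K m z + / Earc K m z + W - (Earc K m z + / Earc K m z))%C by ring. rewrite <- E. ring. }
  assert (HW0 : Im W0 = 0).
  { rewrite <- (W_real K K' l m f a z0 HS Hu0 ltac:(lra)). f_equal.
    rewrite (Fac_form K m f z0 Hz0 Hz01). fold W0. ring. }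
  set (X := INR K * (g * (2 + g)) + PI * INR m * (4 * g)).
  assert (HX : X <= 2.471 * Kg).
  { unfold X. assert (INR K * (g * (2 + g)) <= Kg * 2.005).
    { replace (INR K * (g * (2 + g))) with (Kg * (2 + g)) by (unfold Kg; ring). apply Rmult_le_compat_l; lra. }
    lra. }
  assert (HX0 : 0 <= X).
  { unfold X. apply Rplus_le_le_0_compat; apply Rmult_le_pos; try lra. nra. }
  assert (HTd : Cmod (Tarc K m z - Tarc K m z0) <= Cmod (Tarc K m z0) * (exp X - 1)).
  { rewrite Ez. rewrite Ez in Hzn, Hz1, HNz'. apply Tarc_radial; auto. lra. }
  assert (HeX : exp X - 1 <= 1.334 * X).
  { assert (B := exp_upper X ltac:(lra)).
    assert (X * (X / 2 + X * X / 6 + X * X * X / 12) <= X * 0.334); [|lra].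
    apply Rmult_le_compat_l; auto. assert (X * X <= 0.541 * 0.541) by (apply Rmult_le_compat; lra).
    assert (X * X * X <= 0.541 * 0.541 * 0.541) by (apply Rmult_le_compat; try lra; nra). lra. }
  assert (HTd2 : Cmod (Tarc K m z - Tarc K m z0) <= 0.76 * Kg).
  { eapply Rle_trans; [exact HTd|]. apply Rle_trans with (0.2303 * (1.334 * (2.471 * Kg))); [|lra].
    apply Rmult_le_compat; try lra; [apply Cmod_ge_0|]. assert (H := exp_ineq1_le X). lra. }
  assert (Hed : Cmod (Fac K m z * err K m f z - Fac K m z0 * err K m f z0) <= 0.25 * Kg).
  { assert (Ezu : z = (z0 + RtoC g * z0)%C) by (rewrite Ez, RtoC_plus; ring).
    assert (Hug : Cmod (RtoC g * z0) = g) by (rewrite Cmod_mult, Cmod_R, Rabs_right, Hu0; lra).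
    assert (B := err_radial K K' l m f a z0 (RtoC g * z0) HS Hu0 Hxr Hyr ltac:(lra)).
    rewrite <- Ezu, Hug in B. unfold Kg. lra. }
  assert (Hez : Cmod (Fac K m z * err K m f z) <= 0.054).
  { assert (Herr := error_bound K K' l m f a HK HK' Hm Hl Hv z ltac:(lra) ltac:(lra)). fold (err K m f z) in Herr.
    assert (Hdel := delta_small (INR l) Hl15).
    assert (HF := Cmod_Fac K m z Hzn Hz1). rewrite HG in HF. rewrite Cmod_mult.
    set (dl := 2 / 5 * exp (- (3 / 20 * INR l))) in *.
    apply Rle_trans with (Cmod (Fac K m z) * (dl * Cmod (qpar z) ^ m)).
    { apply Rmult_le_compat_l; auto using Cmod_ge_0. }
    replace (Cmod (Fac K m z) * (dl * Cmod (qpar z) ^ m)) with (dl * (Cmod (Fac K m z) * Cmod (qpar z) ^ m)) by ring.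
    rewrite HF. assert (B := exp_upper 0.22 ltac:(lra)).
    assert (exp lam <= exp 0.22) by (apply exp_le; lra). assert (Hdl : 0 <= dl) by (unfold dl; assert (H0 := exp_pos (- (3 / 20 * INR l))); lra).
    apply Rle_trans with (0.0425 * 1.25); [|lra]. apply Rmult_le_compat; try lra. left. apply exp_pos. }
  assert (HWs : Cmod W <= 1 / 2).
  { unfold W. eapply Rle_trans; [apply Cmod_triangle|].
    replace (Tarc K m z) with ((Tarc K m z - Tarc K m z0) + Tarc K m z0)%C by ring.
    assert (L := Cmod_triangle (Tarc K m z - Tarc K m z0) (Tarc K m z0)). lra. }
  assert (HJ := joukowski_Im (Earc K m z) W lam (Earc_neq_0 K m z Hzn) HG ltac:(lra) HW HWs).
  assert (HWd : Rabs (Im W) <= 1.01 * Kg).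
  { replace (Im W) with (Im (W - W0)) by (rewrite Im_minus, HW0; ring).
    eapply Rle_trans; [apply Cmod_Im_le|].
    replace (W - W0)%C with ((Tarc K m z - Tarc K m z0) + (Fac K m z * err K m f z - Fac K m z0 * err K m f z0))%C by (unfold W, W0; ring).
    eapply Rle_trans; [apply Cmod_triangle|]. lra. }
  lra.
Qed.

(** * The neighbourhood of the corner *)

Definition rho : C := (- (1 / 2), sqrt 3 / 2).

Lemma sqrt3_bounds : sqrt 3 * sqrt 3 = 3 /\ 1.732 <= sqrt 3 <= 1.73206.
Proof.
  assert (H := sqrt_sqrt 3 ltac:(lra)). assert (H0 := sqrt_pos 3). split; auto. split.
  - destruct (Rle_dec 1.732 (sqrt 3)); auto. exfalso. nra.
  - destruct (Rle_dec (sqrt 3) 1.73206); auto. exfalso. nra.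
Qed.

Lemma rho_sq : (rho * rho = - (1) - rho)%C.
Proof.
  destruct sqrt3_bounds as [H _]. apply injective_projections; simpl; [|field].
  replace (- (1 / 2) * - (1 / 2) - sqrt 3 / 2 * (sqrt 3 / 2)) with (1 / 4 - sqrt 3 * sqrt 3 / 4) by field.
  rewrite H. field.
Qed.

Lemma rho_cube : (rho * rho * rho = 1)%C.
Proof. rewrite rho_sq. replace ((- (1) - rho) * rho)%C with (- rho - rho * rho)%C by ring. rewrite rho_sq. ring. Qed.

Lemma Cmod_rho : Cmod rho = 1.
Proof.
  destruct sqrt3_bounds as [H _]. assert (E := Cmod_sq rho). simpl in E. unfold Re, Im in E. simpl in E.
  assert (E2 : Cmod rho * Cmod rho = 1) by (rewrite E; replace (sqrt 3 / 2 * (sqrt 3 / 2)) with (sqrt 3 * sqrt 3 / 4) by field; rewrite H; field).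
  assert (H0 := Cmod_ge_0 rho). nra.
Qed.

Lemma rho_neq_0 : rho <> 0%C.
Proof. apply Cmod_neq_0. rewrite Cmod_rho. lra. Qed.

Lemma Cinv_rho : (/ rho = rho * rho)%C.
Proof.
  assert (H := rho_neq_0). replace (rho * rho)%C with (rho * rho * rho * / rho)%C by (field; auto).
  rewrite rho_cube. ring.
Qed.

(* The inverse of w = (z - rho)/(z - conj rho): the stabiliser of rho acts on w by the rotation w -> rho w. *)
Definition zmap (w : C) : C := (rho * (1 - rho * w) / (1 - w))%C.

Lemma small_neq (w : C) : Cmod w < 1 -> (1 - w <> 0 /\ 1 - rho * w <> 0 /\ 1 - rho * (rho * w) <> 0)%C.
Proof.
  intros H. repeat split; apply one_minus_neq_0; rewrite ?Cmod_mult, ?Cmod_rho; lra.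
Qed.

Lemma zmap_shift (w : C) : Cmod w < 1 ->
  (zmap w + 1 = - (rho * rho) * (1 - rho * (rho * w)) / (1 - w))%C.
Proof.
  intros H. destruct (small_neq w H) as [H1 _]. unfold zmap.
  assert (E : (rho * (1 - rho * w) + (1 - w) = - (rho * rho) * (1 - rho * (rho * w)))%C).
  { replace (- (rho * rho) * (1 - rho * (rho * w)))%C with (- (rho * rho) + rho * rho * rho * rho * w)%C by ring.
    rewrite rho_cube. replace (rho * (1 - rho * w))%C with (rho - rho * rho * w)%C by ring. rewrite rho_sq. ring. }
  rewrite <- E. field. auto.
Qed.

(** Up to a translation by 1, S and ST act on w as rotations of order 3; hence q^m, q^m|S and q^m|ST
    are one function of w, rotated. *)
Lemma zmap_rot (w : C) : Cmod w < 1 ->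
  (- / zmap w = zmap (rho * w) + 1)%C /\ (- / (zmap w + 1) = zmap (rho * (rho * w)))%C.
Proof.
  intros H. destruct (small_neq w H) as [H1 [H2 H3]]. assert (Hr := rho_neq_0).
  assert (Hw1 : Cmod (rho * w) < 1) by (rewrite Cmod_mult, Cmod_rho; lra).
  assert (E3 : (rho * (rho * (rho * w)) = w)%C).
  { replace (rho * (rho * (rho * w)))%C with (rho * rho * rho * w)%C by ring. rewrite rho_cube. ring. }
  split.
  - rewrite zmap_shift by auto. rewrite E3. rewrite <- Cinv_rho. unfold zmap. field. auto.
  - rewrite zmap_shift by auto. unfold zmap. rewrite E3, <- Cinv_rho. field. auto.
Qed.

Lemma rho_diff : (rho - rho * rho = Ci * RtoC (sqrt 3))%C.
Proof. rewrite rho_sq. apply injective_projections; simpl; field. Qed.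

Lemma zmap_minus_rho (w : C) : Cmod w < 1 -> (zmap w = rho + Ci * RtoC (sqrt 3) * (w / (1 - w)))%C.
Proof.
  intros H. destruct (small_neq w H) as [H1 _]. rewrite <- rho_diff. unfold zmap. field. auto.
Qed.

(** Because z - rho = i sqrt 3 w/(1 - w), the power q^m is its value at rho times exp(-c w/(1 - w))
    with this constant c. *)
Definition cusp_c (m : nat) : R := 2 * (PI * INR m) * sqrt 3.

(** q^m in the coordinate w, with its automorphy factor (1 - w)^(-2K) and normalised to 1 at w =
    0. *)
Definition arho (K m : nat) (w : C) : C :=
  ((/ (1 - w)) ^ (2 * K) * Cexp (- (RtoC (cusp_c m) * (w / (1 - w)))))%C.

Lemma arho_q (K m : nat) (w : C) : Cmod w < 1 ->
  ((/ (1 - w)) ^ (2 * K) * qpar (zmap w) ^ m = qpar rho ^ m * arho K m w)%C.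
Proof.
  intros H. rewrite zmap_minus_rho, qpar_plus, Cpow_mult_l by auto.
  rewrite (qpar_pow (Ci * RtoC (sqrt 3) * (w / (1 - w)))). unfold arho.
  replace (2 * (Ci * RtoC (PI * INR m) * (Ci * RtoC (sqrt 3) * (w / (1 - w)))))%C with
    (- (RtoC (cusp_c m) * (w / (1 - w))))%C; [ring|].
  unfold cusp_c. rewrite !(RtoC_mult (2 * _)), (RtoC_mult 2).
  replace (2 * (Ci * RtoC (PI * INR m) * (Ci * RtoC (sqrt 3) * (w / (1 - w)))))%C with
    ((Ci * Ci) * (2 * RtoC (PI * INR m) * RtoC (sqrt 3) * (w / (1 - w))))%C by ring.
  rewrite Ci2. ring.
Qed.

Lemma rho_pow3 (K : nat) : (rho ^ (3 * K) = 1)%C.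
Proof. rewrite Cpow_mult_r. replace (rho ^ 3)%C with (rho * rho * rho)%C by (simpl; ring). rewrite rho_cube. apply Cpow_1_l. Qed.

Lemma arho_Sl (K m : nat) (w : C) : Cmod w < 1 ->
  ((/ (1 - w)) ^ (2 * K) * Sl (2 * K) m (zmap w) = qpar rho ^ m * (rho ^ K * arho K m (rho * w)))%C /\
  ((/ (1 - w)) ^ (2 * K) * Sl (2 * K) m (zmap w + 1) = qpar rho ^ m * (rho ^ (2 * K) * arho K m (rho * (rho * w))))%C.
Proof.
  intros H. destruct (small_neq w H) as [H1 [H2 H3]]. assert (Hr := rho_neq_0).
  assert (Hw1 : Cmod (rho * w) < 1) by (rewrite Cmod_mult, Cmod_rho; lra).
  assert (Hw2 : Cmod (rho * (rho * w)) < 1) by (rewrite Cmod_mult, Cmod_rho; lra).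
  destruct (zmap_rot w H) as [R1 R2]. unfold Sl. split.
  - rewrite R1. destruct (qpar_shift (zmap (rho * w))) as [-> _].
    rewrite Cmult_assoc, <- Cpow_mult_l.
    replace (/ (1 - w) * / zmap w)%C with (/ rho * / (1 - rho * w))%C by (unfold zmap; field; auto).
    rewrite Cpow_mult_l, <- Cmult_assoc, arho_q by auto.
    replace ((/ rho) ^ (2 * K))%C with (rho ^ K)%C; [ring|].
    rewrite Cinv_rho, Cpow_mult_r. rewrite <- (Cmult_1_r (rho ^ K)), <- (rho_pow3 K).
    rewrite <- Cpow_add_r. replace (K + 3 * K)%nat with (4 * K)%nat by lia. rewrite Cpow_mult_r. f_equal. simpl. ring.
  - rewrite R2. rewrite Cmult_assoc, <- Cpow_mult_l.
    assert (E : (/ (1 - w) * / (zmap w + 1) = - (rho * / (1 - rho * (rho * w))))%C).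
    { rewrite zmap_shift, <- Cinv_rho by auto. field. auto. }
    rewrite E, Cpow_even_opp, Cpow_mult_l, <- Cmult_assoc, arho_q by auto. ring.
Qed.

(* In the coordinate w the form f becomes the average of a over the rotations of order 3, plus an error term. *)
Lemma form_at_rho (K m : nat) (f : C -> C) (w : C) : Cmod w < 1 ->
  ((/ (1 - w)) ^ (2 * K) * f (zmap w) =
   qpar rho ^ m * (arho K m w + rho ^ K * arho K m (rho * w) + rho ^ (2 * K) * arho K m (rho * (rho * w))) +
   (/ (1 - w)) ^ (2 * K) * err K m f (zmap w))%C.
Proof.
  intros H. destruct (arho_Sl K m w H) as [H1 H2]. assert (H0 := arho_q K m w H).
  rewrite !Cmult_plus_distr_l, <- H1, <- H2, <- H0. unfold err. ring.
Qed.

Lemma form_periodic (k l m : nat) (f : C -> C) (a : nat -> C) (z : C) : vanish_form k l m f a -> 0 < Im z ->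
  f (z + 1)%C = f z.
Proof.
  intros [_ [H _]] Hz. destruct (Im_shift z 1) as [E _].
  apply clim_unique with (u := csum (fun n => a n * qpar z ^ n)%C); [|apply H; auto].
  assert (L := H (z + 1)%C ltac:(rewrite E; auto)). destruct (qpar_shift z) as [Eq _]. rewrite Eq in L. exact L.
Qed.

Lemma err_rot (K l m : nat) (f : C -> C) (a : nat -> C) (w : C) : vanish_form (2 * K) l m f a ->
  Cmod w < 1 -> 0 < Im (zmap w) -> 0 < Im (zmap (rho * w)) ->
  ((/ (1 - rho * w)) ^ (2 * K) * err K m f (zmap (rho * w)) =
   rho ^ (2 * K) * ((/ (1 - w)) ^ (2 * K) * err K m f (zmap w)))%C.
Proof.
  intros Hv H Hz Hz'. destruct (small_neq w H) as [H1 [H2 H3]]. assert (Hr := rho_neq_0).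
  assert (Hw1 : Cmod (rho * w) < 1) by (rewrite Cmod_mult, Cmod_rho; lra).
  assert (Hzn := Im_pos_neq_0 _ Hz).
  assert (E1 := form_at_rho K m f w H). assert (E2 := form_at_rho K m f _ Hw1).
  assert (E3 : (rho * (rho * (rho * w)) = w)%C).
  { replace (rho * (rho * (rho * w)))%C with (rho * rho * rho * w)%C by ring. rewrite rho_cube. ring. }
  rewrite E3 in E2.
  assert (Ef : ((/ (1 - rho * w)) ^ (2 * K) * f (zmap (rho * w)) = rho ^ (2 * K) * ((/ (1 - w)) ^ (2 * K) * f (zmap w)))%C).
  { rewrite <- (form_periodic (2 * K) l m f a (zmap (rho * w)) Hv Hz').
    destruct (zmap_rot w H) as [R1 _]. rewrite <- R1, (proj1 Hv _ Hz).
    rewrite !Cmult_assoc, <- !Cpow_mult_l. f_equal. f_equal. unfold zmap. field. auto. }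
  rewrite E1, E2 in Ef.
  assert (Hk3 : (rho ^ (2 * K) * rho ^ K = 1)%C).
  { rewrite <- Cpow_add_r. replace (2 * K + K)%nat with (3 * K)%nat by lia. apply rho_pow3. }
  assert (Hk4 : (rho ^ (2 * K) * rho ^ (2 * K) = rho ^ K)%C).
  { rewrite <- Cpow_add_r. replace (2 * K + 2 * K)%nat with (3 * K + K)%nat by lia. rewrite Cpow_add_r, rho_pow3. ring. }
  set (A := arho K m w) in *. set (B := arho K m (rho * w)) in *. set (D := arho K m (rho * (rho * w))) in *.
  set (q := (qpar rho ^ m)%C) in *. set (t := (rho ^ K)%C) in *. set (t2 := (rho ^ (2 * K))%C) in *.
  set (e1 := ((/ (1 - w)) ^ (2 * K) * err K m f (zmap w))%C) in *.
  set (e2 := ((/ (1 - rho * w)) ^ (2 * K) * err K m f (zmap (rho * w)))%C) in *.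
  replace e2 with (q * (B + t * D + t2 * A) + e2 - q * (B + t * D + t2 * A))%C by ring. rewrite Ef.
  replace (t2 * (q * (A + t * B + t2 * D) + e1))%C with (q * (t2 * A + (t2 * t) * B + (t2 * t2) * D) + t2 * e1)%C by ring.
  rewrite Hk3, Hk4. ring.
Qed.

Lemma ispoly_rot (c : C) (Q : C -> C) (t : C) : ispoly Q ->
  ispoly (fun u => / 3 * (Q u + t * Q (rho * u) + c * Q (rho * (rho * u))))%C.
Proof.
  intros HQ. apply ispoly_scal. apply ispoly_plus; [apply ispoly_plus; auto|].
  - apply ispoly_scal. apply ispoly_dilate; auto.
  - apply ispoly_scal. apply (ispoly_dilate rho (fun u => Q (rho * u)%C)). apply ispoly_dilate; auto.
Qed.

Lemma rho_sum : (1 + rho + rho * rho = 0)%C.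
Proof. rewrite rho_sq. ring. Qed.

Lemma C3_neq_0 : RtoC 3 <> 0%C.
Proof. intros H. apply (f_equal Re) in H. rewrite !Re_RtoC in H. lra. Qed.

(* An equivariant function G(rho w) = rho^j G(w) vanishes to order j at 0: averaging an approximating polynomial
   over the rotations kills its lower coefficients. *)
Lemma equivariant_schwarz (G : C -> C) (r M : R) (j : nat) (w : C) : (j <= 2)%nat -> 0 < r ->
  approx (fun w => Cmod w <= r) (fun w => w) G ->
  (forall w, Cmod w <= r -> Cmod (G w) <= M) ->
  (forall w, Cmod w <= r -> G (rho * w) = rho ^ j * G w)%C ->
  Cmod w < r -> Cmod (G w) <= M * (Cmod w / r) ^ j.
Proof.
  intros Hj Hr HA HM HG Hw. assert (H3 := C3_neq_0).
  assert (Hrot : forall u, Cmod (rho * u) = Cmod u) by (intros u; rewrite Cmod_mult, Cmod_rho; ring).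
  apply le_of_forall_eps with (K := 2); [lra|]. intros eps He.
  destruct (HA eps He) as [P [HP HPe]].
  set (t := (rho ^ (2 * j))%C). set (t2 := (rho ^ j)%C).
  assert (Ht : Cmod t = 1) by (unfold t; rewrite Cmod_pow, Cmod_rho, pow1; auto).
  assert (Ht2 : Cmod t2 = 1) by (unfold t2; rewrite Cmod_pow, Cmod_rho, pow1; auto).
  set (Pt := fun u => (/ 3 * (P u + t * P (rho * u) + t2 * P (rho * (rho * u))))%C).
  assert (HPt : forall u, Cmod u <= r -> Cmod (G u - Pt u) <= eps).
  { intros u Hu.
    assert (Hu1 : Cmod (rho * u) <= r) by (rewrite Hrot; auto).
    assert (Hu2 : Cmod (rho * (rho * u)) <= r) by (rewrite !Hrot; auto).
    assert (E1 : (t * G (rho * u) = G u)%C).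
    { rewrite HG by auto. unfold t. rewrite Cmult_assoc, <- Cpow_add_r.
      replace (2 * j + j)%nat with (3 * j)%nat by lia. rewrite rho_pow3. ring. }
    assert (E2 : (t2 * G (rho * (rho * u)) = G u)%C).
    { rewrite HG, HG by auto. unfold t2. rewrite !Cmult_assoc, <- !Cpow_add_r.
      replace (j + j + j)%nat with (3 * j)%nat by lia. rewrite rho_pow3. ring. }
    replace (G u - Pt u)%C with (/ 3 * ((G u - P u) + t * (G (rho * u) - P (rho * u)) + t2 * (G (rho * (rho * u)) - P (rho * (rho * u)))))%C.
    - rewrite Cmod_mult, Cmod_inv, Cmod_R, Rabs_right by (auto; lra).
      assert (L1 := Cmod_triangle ((G u - P u) + t * (G (rho * u) - P (rho * u)))%C (t2 * (G (rho * (rho * u)) - P (rho * (rho * u))))%C).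
      assert (L2 := Cmod_triangle (G u - P u)%C (t * (G (rho * u) - P (rho * u)))%C).
      rewrite (Cmod_mult t2), Ht2 in L1. rewrite (Cmod_mult t), Ht in L2.
      assert (B0 := HPe u Hu). assert (B1 := HPe _ Hu1). assert (B2 := HPe _ Hu2). cbv beta in *. lra.
    - unfold Pt. transitivity (/ 3 * (G u + t * G (rho * u) + t2 * G (rho * (rho * u))) - / 3 * (P u + t * P (rho * u) + t2 * P (rho * (rho * u))))%C; [ring|].
      rewrite E1, E2. field. }
  assert (HhP : exists h, ispoly h /\ forall u, Pt u = (u ^ j * h u)%C).
  { destruct (ispoly_split P HP) as [c0 [Q1 [HQ1 E1]]]. destruct (ispoly_split Q1 HQ1) as [c1 [Q2 [HQ2 E2]]].
    assert (R3 := rho_cube). assert (RS := rho_sum).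
    destruct j as [|[|[|j]]]; [| | |lia].
    - exists Pt. split; [apply ispoly_rot; auto|]. intros u. simpl. ring.
    - exists (fun u => / 3 * (Q1 u + 1 * Q1 (rho * u) + 1 * Q1 (rho * (rho * u))))%C. split; [apply ispoly_rot; auto|].
      intros u. unfold Pt, t, t2. rewrite !E1. simpl.
      transitivity (/ 3 * (c0 * (1 + rho + rho * rho) + (u * Q1 u + (rho * rho * rho) * (u * Q1 (rho * u)) + (rho * rho * rho) * (u * Q1 (rho * (rho * u))))))%C; [ring|].
      rewrite RS, R3. ring.
    - exists (fun u => / 3 * (Q2 u + 1 * Q2 (rho * u) + 1 * Q2 (rho * (rho * u))))%C. split; [apply ispoly_rot; auto|].
      intros u. unfold Pt, t, t2. rewrite !E1, !E2. simpl.
      transitivity (/ 3 * (c0 * (1 + (rho * rho * rho) * rho + rho * rho) +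
         u * c1 * (1 + (rho * rho * rho) * (rho * rho) + (rho * rho * rho) * rho) +
         (u * u * Q2 u + (rho * rho * rho) * (rho * rho * rho) * (u * u * Q2 (rho * u)) +
          (rho * rho * rho) * (rho * rho * rho) * (u * u * Q2 (rho * (rho * u))))))%C; [ring|].
      rewrite R3, !Cmult_1_l, RS. replace (1 + rho * rho + rho)%C with (1 + rho + rho * rho)%C by ring. rewrite RS. ring. }
  destruct HhP as [h [Hh Eh]].
  assert (HW : Cmod (Pt w) <= (M + eps) * (Cmod w / r) ^ j).
  { apply poly_schwarz with h; auto. intros s.
    assert (Hc : Cmod (RtoC r * Cexp (Ci * RtoC s)) <= r).
    { rewrite Cmod_mult, Cmod_R, Cmod_Cexp_i, Rabs_right; lra. }
    set (u := (RtoC r * Cexp (Ci * RtoC s))%C) in *.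
    replace (Pt u) with (G u - (G u - Pt u))%C by ring.
    eapply Rle_trans; [apply Cmod_sub_triangle|]. specialize (HM u Hc). specialize (HPt u Hc). lra. }
  assert (Hq : 0 <= (Cmod w / r) ^ j <= 1).
  { assert (H0 : 0 <= Cmod w / r <= 1).
    { assert (H := Cmod_ge_0 w). split; [apply Rmult_le_pos; auto; left; apply Rinv_0_lt_compat; auto|].
      apply Rmult_le_reg_r with r; auto. unfold Rdiv. rewrite Rmult_assoc, Rinv_l; lra. }
    split; [apply pow_le; lra|apply pow_le_1; auto]. }
  assert (HB := HPt w ltac:(lra)).
  replace (G w) with ((G w - Pt w) + Pt w)%C by ring.
  eapply Rle_trans; [apply Cmod_triangle|].
  assert (eps * (Cmod w / r) ^ j <= eps * 1) by (apply Rmult_le_compat_l; lra). lra.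
Qed.

Lemma cusp_c_bounds (m : nat) : 10.88 * INR m <= cusp_c m <= 10.885 * INR m.
Proof.
  assert (HPI := PI_bounds). destruct sqrt3_bounds as [_ Hs]. assert (Hm := pos_INR m). unfold cusp_c.
  replace (2 * (PI * INR m) * sqrt 3) with (2 * (PI * sqrt 3) * INR m) by ring.
  assert (PI * sqrt 3 <= 3.142 * 1.73206) by (apply Rmult_le_compat; lra).
  assert (3.141 * 1.732 <= PI * sqrt 3) by (apply Rmult_le_compat; lra).
  split; apply Rmult_le_compat_r; lra.
Qed.

(** The logarithmic derivative of [arho] at w = 0. *)
Definition kap (K m : nat) : R := 2 * INR K - cusp_c m.

(** exp(-w)/(1 - w) is 1 + O(w^2), so [arho] is exp(kap w) times a factor whose logarithm is O(K
    |w|^2), of order 1/K on the disc where kap |w| is bounded. *)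
Lemma arho_exp (K m : nat) (w : C) : Cmod w <= 0.01 ->
  Cmod (arho K m w - Cexp (RtoC (kap K m) * w)) <=
  exp (Re (RtoC (kap K m) * w)) * (exp ((1.04 * INR K + 1.011 * cusp_c m) * (Cmod w * Cmod w)) - 1).
Proof.
  intros Hw. assert (Hc := cusp_c_bounds m). assert (Hm := pos_INR m). assert (HK := pos_INR K).
  assert (H0 := Cmod_ge_0 w). destruct (small_neq w ltac:(lra)) as [H1 _].
  set (c := RtoC (cusp_c m)). set (x := Cmod w) in *.
  set (h1 := (/ (1 - w) * (Cexp (- w) - 1 - - w))%C).
  set (h2 := (- (c * (w * w * / (1 - w))))%C).
  assert (E : (arho K m w = Cexp (RtoC (kap K m) * w) * ((1 + h1) ^ (2 * K) * Cexp h2))%C).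
  { assert (Eh : (1 + h1 = / (1 - w) * Cexp (- w))%C) by (unfold h1; field; auto).
    rewrite Eh, Cpow_mult_l, <- Cexp_nat. unfold arho. fold c.
    replace (Cexp (RtoC (kap K m) * w) * ((/ (1 - w)) ^ (2 * K) * Cexp (RtoC (INR (2 * K)) * - w) * Cexp h2))%C with
      ((/ (1 - w)) ^ (2 * K) * (Cexp (RtoC (kap K m) * w) * Cexp (RtoC (INR (2 * K)) * - w) * Cexp h2))%C by ring.
    rewrite <- !Cexp_plus. do 2 f_equal. unfold kap, h2. rewrite RtoC_minus, mult_INR. fold c.
    replace (INR 2) with 2 by (simpl; lra). field. auto. }
  rewrite E. replace (Cexp (RtoC (kap K m) * w) * ((1 + h1) ^ (2 * K) * Cexp h2) - Cexp (RtoC (kap K m) * w))%C with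
    (Cexp (RtoC (kap K m) * w) * ((1 + h1) ^ (2 * K) * Cexp h2 - 1))%C by ring.
  rewrite Cmod_mult, Cmod_Cexp. apply Rmult_le_compat_l; [left; apply exp_pos|].
  eapply Rle_trans; [apply pow_exp_perturb|]. apply Rplus_le_compat_r. apply exp_le.
  assert (Hi : Cmod (/ (1 - w)) <= 1.0102).
  { eapply Rle_trans; [apply (Cmod_inv_one_minus w 0.01); auto; lra|]. lra. }
  assert (B1 : Cmod h1 <= 0.52 * (x * x)).
  { unfold h1. rewrite Cmod_mult. assert (T := Cexp_taylor2 (- w)). rewrite Cmod_opp in T. fold x in T.
    assert (U := exp_upper x ltac:(lra)).
    assert (U2 : x * x * x / 6 + x * x * x * x / 12 <= x * x * 0.002).
    { replace (x * x * x / 6 + x * x * x * x / 12) with (x * x * (x / 6 + x * x / 12)) by field.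
      apply Rmult_le_compat_l; nra. }
    assert (U3 : Cmod (Cexp (- w) - 1 - - w) <= 0.502 * (x * x)) by lra.
    apply Rle_trans with (1.0102 * (0.502 * (x * x))); [|nra].
    apply Rmult_le_compat; auto using Cmod_ge_0. }
  assert (B2 : Cmod h2 <= 1.011 * cusp_c m * (x * x)).
  { unfold h2, c. rewrite Cmod_opp, !Cmod_mult, Cmod_R, Rabs_right by lra. fold x.
    assert (x * x * Cmod (/ (1 - w)) <= x * x * 1.0102) by (apply Rmult_le_compat_l; nra).
    assert (0 <= x * x) by nra.
    assert (cusp_c m * (x * x * Cmod (/ (1 - w))) <= cusp_c m * (x * x * 1.0102)) by (apply Rmult_le_compat_l; lra).
    assert (0 <= cusp_c m * (x * x)) by (apply Rmult_le_pos; lra). lra. }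
  rewrite mult_INR. replace (INR 2) with 2 by (simpl; lra).
  assert (2 * INR K * Cmod h1 <= 2 * INR K * (0.52 * (x * x))) by (apply Rmult_le_compat_l; lra).
  lra.
Qed.

(** j is the residue of 2K mod 3, the order of vanishing at rho that the weight 2K imposes. *)
Lemma rho_pow_class (K : nat) : exists j, (j <= 2)%nat /\ (rho ^ (2 * K) = rho ^ j)%C /\ (rho ^ K = rho ^ (2 * j))%C.
Proof.
  assert (H := Nat.div_mod_eq K 3). assert (Hlt := Nat.mod_upper_bound K 3 ltac:(lia)).
  set (q := (K / 3)%nat) in *. set (r := (K mod 3)%nat) in *.
  destruct r as [|[|[|r]]]; [exists 0%nat|exists 2%nat|exists 1%nat|lia]; (split; [lia|]).
  - replace (2 * K)%nat with (3 * (2 * q) + 0)%nat by lia. replace K with (3 * q + 0)%nat at 1 by lia.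
    rewrite !Cpow_add_r, !rho_pow3, !Cmult_1_l. auto.
  - replace (2 * K)%nat with (3 * (2 * q) + 2)%nat by lia. replace K with (3 * q + 1)%nat at 1 by lia.
    change (2 * 2)%nat with (3 * 1 + 1)%nat. rewrite !Cpow_add_r, !rho_pow3, !Cmult_1_l. auto.
  - replace (2 * K)%nat with (3 * (2 * q + 1) + 1)%nat by lia. replace K with (3 * q + 2)%nat at 1 by lia.
    change (2 * 1)%nat with 2%nat. rewrite !Cpow_add_r, !rho_pow3, !Cmult_1_l. auto.
Qed.

(* Lower bounds for 3 |X|^j / j! minus the tail of the exponential series, valid for |X| <= 1.2. *)
Definition corner_low (j : nat) (x : R) : R :=
  match j with O => 1.6 | S O => 1.8 * x | _ => 0.54 * (x * x) end.

(* The sum is 3 times the part of the exponential series with exponents congruent to j mod 3. *)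
Lemma exp_rotation_sum (X : C) (j : nat) : (j <= 2)%nat -> Cmod X <= 1.2 ->
  corner_low j (Cmod X) <= Cmod (Cexp X + rho ^ (2 * j) * Cexp (rho * X) + rho ^ j * Cexp (rho * (rho * X))).
Proof.
  intros Hj HX. set (x := Cmod X) in *. assert (Hx : 0 <= x) by apply Cmod_ge_0.
  set (Rm := fun Y => (Cexp Y - 1 - Y - Y * Y / 2)%C).
  assert (HR : forall Y, Cmod Y = x -> Cmod (Rm Y) <= x * x * x / 6 + x * x * x * x / 12).
  { intros Y HY. assert (T := Cexp_taylor3 Y). rewrite HY in T. assert (U := exp_upper x ltac:(lra)). unfold Rm. lra. }
  assert (Hrot : forall u, Cmod (rho * u) = Cmod u) by (intros u; rewrite Cmod_mult, Cmod_rho; ring).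
  assert (R0 := HR X eq_refl). assert (R1 := HR (rho * X)%C (Hrot X)).
  assert (R2 := HR (rho * (rho * X))%C ltac:(rewrite !Hrot; reflexivity)).
  set (b := x * x * x / 6 + x * x * x * x / 12) in *.
  set (t := (rho ^ (2 * j))%C). set (t2 := (rho ^ j)%C).
  assert (Ht : Cmod t = 1) by (unfold t; rewrite Cmod_pow, Cmod_rho, pow1; auto).
  assert (Ht2 : Cmod t2 = 1) by (unfold t2; rewrite Cmod_pow, Cmod_rho, pow1; auto).
  set (mn := (1 + X + X * X / 2 + t * (1 + rho * X + rho * X * (rho * X) / 2) +
    t2 * (1 + rho * (rho * X) + rho * (rho * X) * (rho * (rho * X)) / 2))%C).
  assert (E : (Cexp X + t * Cexp (rho * X) + t2 * Cexp (rho * (rho * X)) =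
    mn - - (Rm X + t * Rm (rho * X) + t2 * Rm (rho * (rho * X))))%C).
  { unfold mn, Rm. ring. }
  rewrite E.
  assert (HS : Cmod (- (Rm X + t * Rm (rho * X) + t2 * Rm (rho * (rho * X))))%C <= 3 * b).
  { rewrite Cmod_opp. eapply Rle_trans; [apply Cmod_triangle|].
    assert (L := Cmod_triangle (Rm X) (t * Rm (rho * X)%C)%C).
    rewrite (Cmod_mult t), Ht in L. rewrite (Cmod_mult t2), Ht2. lra. }
  assert (L := Cmod_sub_ge mn (- (Rm X + t * Rm (rho * X) + t2 * Rm (rho * (rho * X))))%C).
  assert (Hmn : corner_low j x + 3 * b <= Cmod mn); [|lra].
  assert (R3 := rho_cube). assert (RS := rho_sum).
  assert (RS2 : (1 + rho * rho + rho = 0)%C) by (rewrite <- RS; ring).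
  destruct j as [|[|[|j]]]; [| | |lia]; unfold corner_low.
  - assert (Em : mn = RtoC 3).
    { unfold mn, t, t2. simpl. transitivity (3 + X * (1 + rho + rho * rho) + X * X / 2 * (1 + rho * rho + (rho * rho * rho) * rho))%C; [field|].
      rewrite R3, Cmult_1_l, RS, RS2. ring. }
    rewrite Em, Cmod_R, Rabs_right by lra. unfold b.
    assert (x * x <= 1.2 * 1.2) by (apply Rmult_le_compat; lra).
    assert (x * x * x <= 1.2 * 1.2 * 1.2) by (apply Rmult_le_compat; try lra; nra).
    assert (x * x * x * x <= 1.2 * 1.2 * 1.2 * 1.2) by (apply Rmult_le_compat; try lra; repeat apply Rmult_le_pos; lra).
    lra.
  - assert (Em : mn = (RtoC 3 * X)%C).
    { unfold mn, t, t2. simpl.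
      transitivity ((1 + rho * rho + rho) + X * (1 + (rho * rho * rho) + (rho * rho * rho)) + X * X / 2 * (1 + (rho * rho * rho) * rho + (rho * rho * rho) * (rho * rho)))%C; [field|].
      rewrite R3, !Cmult_1_l, RS, RS2. ring. }
    rewrite Em, Cmod_mult, Cmod_R, Rabs_right by lra. fold x. unfold b.
    assert (x * (x * x) <= x * (1.2 * 1.2)) by (apply Rmult_le_compat_l; auto; apply Rmult_le_compat; lra).
    assert (x * (x * x * x) <= x * (1.2 * 1.2 * 1.2)).
    { apply Rmult_le_compat_l; auto. apply Rmult_le_compat; try lra; try nra. }
    lra.
  - assert (Em : mn = (RtoC 3 * (X * X / 2))%C).
    { unfold mn, t, t2. simpl.
      transitivity ((1 + (rho * rho * rho) * rho + rho * rho) + X * (1 + (rho * rho * rho) * (rho * rho) + (rho * rho * rho) * rho) + X * X / 2 * (1 + (rho * rho * rho) * (rho * rho * rho) + (rho * rho * rho) * (rho * rho * rho)))%C; [field|].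
      rewrite R3, !Cmult_1_l, RS, RS2. ring. }
    rewrite Em. unfold Cdiv. rewrite !Cmod_mult, Cmod_inv, !Cmod_R, !Rabs_right by (try apply C2_neq_0; lra). fold x. unfold b.
    assert (x * x * x <= x * x * 1.2) by (apply Rmult_le_compat_l; nra).
    assert (x * x * (x * x) <= x * x * (1.2 * 1.2)) by (apply Rmult_le_compat_l; [nra|apply Rmult_le_compat; lra]).
    lra.
Qed.

Lemma corner_range (w : C) : Cmod w <= 0.009 ->
  - (11 / 20) <= Re (zmap w) <= 1 / 20 /\ 17 / 20 <= Im (zmap w) <= 3 / 2.
Proof.
  intros Hw. destruct sqrt3_bounds as [H3 Hs]. rewrite zmap_minus_rho by lra.
  set (d := (Ci * RtoC (sqrt 3) * (w / (1 - w)))%C).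
  assert (Hd : Cmod d <= 0.0158).
  { unfold d, Cdiv. rewrite !Cmod_mult, Cmod_Ci, Cmod_R, Rabs_right by lra.
    assert (Hi : Cmod (/ (1 - w)) <= / (1 - 0.009)) by (apply Cmod_inv_one_minus; lra).
    assert (H0 := Cmod_ge_0 w). assert (H1 := Cmod_ge_0 (/ (1 - w))).
    rewrite Rmult_1_l. apply Rle_trans with (1.73206 * (0.009 * / (1 - 0.009))); [|lra].
    apply Rmult_le_compat; try lra; [apply Rmult_le_pos; auto|]. apply Rmult_le_compat; auto. }
  assert (R1 := Rle_trans _ _ _ (Cmod_Re_le d) Hd). assert (R2 := Rle_trans _ _ _ (Cmod_Im_le d) Hd).
  apply Rabs_le_between in R1. apply Rabs_le_between in R2. rewrite Re_plus, Im_plus.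
  change (Re rho) with (- (1 / 2)). change (Im rho) with (sqrt 3 / 2). lra.
Qed.

Definition corner_err (K m : nat) (f : C -> C) (w : C) : C :=
  (/ qpar rho ^ m * ((/ (1 - w)) ^ (2 * K) * err K m f (zmap w)))%C.

Lemma kap_bounds (K K' l m : nat) (f : C -> C) (a : nat -> C) : setting K K' l m f a ->
  167 <= kap K m <= 2 * INR K /\ INR K <= 0.6263 * kap K m /\ 0 <= cusp_c m <= 0.2526 * kap K m /\
  cusp_c m <= 0.4033 * INR K /\ kap K m <= 2.16 * INR (K - 7 * m).
Proof.
  intros HS. destruct (setting_num2 _ _ _ _ _ _ HS) as [HmK [HK90 [En Hn80]]].
  assert (Hc := cusp_c_bounds m). assert (Hm := pos_INR m). unfold kap. lra.
Qed.

Lemma arho_exp_sq (K K' l m : nat) (f : C -> C) (a : nat -> C) (w : C) : setting K K' l m f a ->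
  Cmod w <= 0.009 ->
  exp ((1.04 * INR K + 1.011 * cusp_c m) * (Cmod w * Cmod w)) <= exp (0.000118 * INR K).
Proof.
  intros HS Hw. destruct (kap_bounds _ _ _ _ _ _ HS) as [B1 [B2 [B3 [B4 B5]]]]. apply exp_le.
  assert (H0 := Cmod_ge_0 w). assert (HK := pos_INR K).
  assert (Cmod w * Cmod w <= 0.009 * 0.009) by (apply Rmult_le_compat; lra).
  apply Rle_trans with (1.448 * INR K * (0.009 * 0.009)); [|lra].
  apply Rmult_le_compat; try lra. nra.
Qed.

(** On the disc of radius 0.009 the main term grows to at most exp(0.0182 K), and with K <= 6 l + 7
    the decay exp(-0.15 l) of the relative error prevails. *)
Lemma corner_err_bound (K K' l m : nat) (f : C -> C) (a : nat -> C) (w : C) : setting K K' l m f a ->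
  Cmod w <= 0.009 -> Cmod (corner_err K m f w) <= 0.246.
Proof.
  intros HS Hw. destruct (setting_num _ _ _ _ _ _ HS) as [Hm1 [Hl15 [Hlm [HKr [_ HKm]]]]].
  destruct (kap_bounds _ _ _ _ _ _ HS) as [B1 [B2 [B3 [B4 B5]]]].
  assert (HS' := HS). destruct HS' as [HK [HK' [Hm [Hl Hv]]]].
  destruct (corner_range w Hw) as [Rx Ry].
  assert (Herr := error_bound K K' l m f a HK HK' Hm Hl Hv _ Ry Rx). fold (err K m f (zmap w)) in Herr.
  set (dl := 2 / 5 * exp (- (3 / 20 * INR l))) in *.
  assert (Hdl : 0 < dl) by (unfold dl; assert (H := exp_pos (- (3 / 20 * INR l))); lra).
  assert (Eq := arho_q K m w ltac:(lra)). apply (f_equal Cmod) in Eq. rewrite !Cmod_mult, !Cmod_pow in Eq.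
  unfold corner_err. rewrite !Cmod_mult, Cmod_inv, !Cmod_pow by (apply Cpow_nz, qpar_neq_0).
  set (q := Cmod (qpar rho) ^ m) in *.
  assert (Hq : 0 < q) by (apply pow_lt, Cmod_pos, qpar_neq_0).
  set (p := Cmod (/ (1 - w)) ^ (2 * K)) in *. assert (Hp : 0 <= p) by (apply pow_le, Cmod_ge_0).
  assert (Hle : / q * (p * Cmod (err K m f (zmap w))) <= dl * Cmod (arho K m w)).
  { apply Rle_trans with (/ q * (p * (dl * Cmod (qpar (zmap w)) ^ m))).
    - apply Rmult_le_compat_l; [left; apply Rinv_0_lt_compat; auto|]. apply Rmult_le_compat_l; auto.
    - right. transitivity (/ q * dl * (p * Cmod (qpar (zmap w)) ^ m)); [ring|]. rewrite Eq. field. lra. }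
  eapply Rle_trans; [exact Hle|].
  assert (Ha := arho_exp K m w ltac:(lra)).
  assert (Hsq := arho_exp_sq K K' l m f a w HS Hw).
  set (e1 := exp ((1.04 * INR K + 1.011 * cusp_c m) * (Cmod w * Cmod w))) in *.
  set (e0 := exp (Re (RtoC (kap K m) * w))) in *.
  assert (He0 : 0 < e0 <= exp (0.018 * INR K)).
  { split; [apply exp_pos|]. apply exp_le. rewrite Re_scal.
    assert (R1 := Rle_trans _ _ _ (Cmod_Re_le w) Hw). apply Rabs_le_between in R1.
    assert (kap K m * Re w <= kap K m * 0.009) by (apply Rmult_le_compat_l; lra). lra. }
  assert (Har : Cmod (arho K m w) <= e0 * e1).
  { replace (arho K m w) with ((arho K m w - Cexp (RtoC (kap K m) * w)) + Cexp (RtoC (kap K m) * w))%C by ring.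
    eapply Rle_trans; [apply Cmod_triangle|]. rewrite Cmod_Cexp. fold e0. lra. }
  assert (Har2 : Cmod (arho K m w) <= exp (0.018118 * INR K)).
  { eapply Rle_trans; [exact Har|]. replace (0.018118 * INR K) with (0.018 * INR K + 0.000118 * INR K) by lra.
    rewrite exp_plus. apply Rmult_le_compat; try lra. left. apply exp_pos. }
  apply Rle_trans with (dl * exp (0.018118 * INR K)); [apply Rmult_le_compat_l; lra|].
  unfold dl. rewrite Rmult_assoc, <- exp_plus.
  apply Rle_trans with (2 / 5 * exp (- (0.49))).
  - apply Rmult_le_compat_l; [lra|]. apply exp_le. lra.
  - rewrite exp_Ropp. assert (Hx' := exp_lower 0.49 ltac:(lra)).
    assert (/ exp 0.49 <= / 1.632) by (apply Rinv_le_contravar; lra). lra.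
Qed.

(** Equivariance makes the error vanish at rho to the order j imposed on the main term, so the
    comparison of the two survives as w tends to 0. *)
Lemma corner_err_schwarz (K K' l m j : nat) (f : C -> C) (a : nat -> C) (w : C) : setting K K' l m f a ->
  (j <= 2)%nat -> (rho ^ (2 * K) = rho ^ j)%C -> Cmod w < 0.009 ->
  Cmod (corner_err K m f w) <= 0.246 * (Cmod w / 0.009) ^ j.
Proof.
  intros HS Hj Hr Hw. assert (HS' := HS). destruct HS' as [HK [HK' [Hm [Hl Hv]]]].
  apply equivariant_schwarz; auto; [lra| | |].
  - assert (HB := disc_bounded 0.009 ltac:(lra)). unfold corner_err.
    assert (A1 : approx (fun w => Cmod w <= 0.009) (fun w => w) (fun w => / (1 - w))%C).
    { apply approx_geom with 0.009; auto; [lra|apply approx_gen]. }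
    assert (A0 : approx (fun w => Cmod w <= 0.009) (fun w => w) zmap).
    { unfold zmap, Cdiv. apply approx_mult; auto. apply approx_scal; auto. apply approx_minus; auto; [apply approx_const|].
      apply approx_scal; auto. apply approx_gen. }
    apply approx_scal; auto. apply approx_mult; auto; [apply approx_pow; auto|].
    apply (approx_err K l m f _ (fun w => w) zmap); auto.
    + apply approx_ext with (fun w => / rho * ((1 - w) * / (1 - rho * w)))%C.
      * intros u Hu. destruct (small_neq u ltac:(lra)) as [H1 [H2 _]]. assert (Hr0 := rho_neq_0).
        unfold zmap. field. auto.
      * apply approx_scal; auto. apply approx_mult; auto; [apply approx_minus; auto; [apply approx_const|apply approx_gen]|].
        apply approx_geom with 0.009; auto; [lra|apply approx_scal; auto; apply approx_gen|].
        intros u Hu. rewrite Cmod_mult, Cmod_rho. lra.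
    + apply approx_ext with (fun w => - rho * ((1 - w) * / (1 - rho * (rho * w))))%C.
      * intros u Hu. destruct (small_neq u ltac:(lra)) as [H1 [_ H2]]. assert (Hr0 := rho_neq_0).
        rewrite zmap_shift, <- Cinv_rho by lra. field. auto.
      * apply approx_scal; auto. apply approx_mult; auto; [apply approx_minus; auto; [apply approx_const|apply approx_gen]|].
        apply approx_geom with 0.009; auto; [lra|apply approx_scal; auto; apply approx_scal; auto; apply approx_gen|].
        intros u Hu. rewrite !Cmod_mult, Cmod_rho. lra.
    + intros u Hu. destruct (corner_range u Hu) as [_ H]. lra.
    + apply (vanish_form_qvanish (2 * K) l m f a Hv). lia.
  - intros u Hu. apply (corner_err_bound K K' l m f a); auto.
  - intros u Hu. rewrite <- Hr. unfold corner_err.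
    assert (Hu1 : Cmod (rho * u) <= 0.009) by (rewrite Cmod_mult, Cmod_rho; lra).
    destruct (corner_range u Hu) as [_ H1]. destruct (corner_range _ Hu1) as [_ H2].
    rewrite (err_rot K l m f a u Hv) by lra. ring.
Qed.

(** With X = kap w the main term is at least [corner_low], of exact order |X|^j. Replacing [arho] by
    exponentials costs O(|X|^2) and the error is O(|X|^j); in each of the three cases the constants
    leave a margin. *)
Lemma corner_no_zero (K K' l m : nat) (f : C -> C) (a : nat -> C) (w : C) : setting K K' l m f a ->
  w <> 0%C -> kap K m * Cmod w <= 1.2 -> f (zmap w) <> 0%C.
Proof.
  intros HS Hw0 HX Hf. destruct (kap_bounds _ _ _ _ _ _ HS) as [B1 [B2 [B3 [B4 B5]]]].
  assert (Hwp := Cmod_pos w Hw0). set (kp := kap K m) in *.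
  assert (Hw : Cmod w <= 0.0072).
  { destruct (Rle_dec (Cmod w) 0.0072); auto. exfalso.
    assert (167 * 0.0072 <= kp * Cmod w) by (apply Rmult_le_compat; lra). lra. }
  destruct (rho_pow_class K) as [j [Hj [Hr1 Hr2]]].
  assert (HG := corner_err_schwarz K K' l m j f a w HS Hj Hr1 ltac:(lra)).
  set (X := (RtoC kp * w)%C). set (x := kp * Cmod w) in *.
  assert (Hx : Cmod X = x) by (unfold X, x; rewrite Cmod_mult, Cmod_R, Rabs_right; lra).
  assert (Hx0 : 0 < x) by (unfold x; apply Rmult_lt_0_compat; lra).
  assert (HE := exp_rotation_sum X j Hj ltac:(lra)). rewrite Hx in HE.
  assert (Hrot : forall u, Cmod (rho * u) = Cmod u) by (intros u; rewrite Cmod_mult, Cmod_rho; ring).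
  set (th := (1.04 * INR K + 1.011 * cusp_c m) * (Cmod w * Cmod w)).
  assert (Hth : 0 <= th <= 0.0055 * (x * x)).
  { assert (HK := pos_INR K). assert (Hww : 0 <= Cmod w * Cmod w) by nra. split.
    - unfold th. apply Rmult_le_pos; lra.
    - apply Rle_trans with (0.9068 * kp * (Cmod w * Cmod w)); [unfold th; apply Rmult_le_compat_r; lra|].
      replace (0.0055 * (x * x)) with (0.0055 * (kp * kp) * (Cmod w * Cmod w)) by (unfold x; ring).
      apply Rmult_le_compat_r; auto. assert (167 * kp <= kp * kp) by (apply Rmult_le_compat_r; lra). lra. }
  assert (Hxx : x * x <= 1.2 * 1.2) by (apply Rmult_le_compat; lra).
  assert (Het : exp th - 1 <= 0.0056 * (x * x)).
  { assert (U := exp_upper th ltac:(lra)).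
    assert (th * (th / 2 + th * th / 6 + th * th * th / 12) <= th * 0.01); [|lra].
    apply Rmult_le_compat_l; [lra|]. assert (th <= 0.008) by lra.
    assert (th * th <= 0.008 * 0.008) by (apply Rmult_le_compat; lra).
    assert (th * th * th <= 0.008 * 0.008 * 0.008) by (apply Rmult_le_compat; try lra; nra). lra. }
  assert (He12 : exp 1.2 <= 3.39).
  { eapply Rle_trans; [apply exp_upper; lra|lra]. }
  assert (HA : forall u, Cmod u = Cmod w -> Cmod (arho K m u - Cexp (RtoC kp * u)) <= 0.019 * (x * x)).
  { intros u Hu. eapply Rle_trans; [apply arho_exp; lra|]. fold kp. rewrite Hu. fold th.
    assert (He : exp (Re (RtoC kp * u)) <= 3.39).
    { eapply Rle_trans; [|exact He12]. apply exp_le. eapply Rle_trans; [apply Rle_abs|].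
      eapply Rle_trans; [apply Cmod_Re_le|]. rewrite Cmod_mult, Cmod_R, Rabs_right, Hu by lra. exact HX. }
    apply Rle_trans with (3.39 * (0.0056 * (x * x))); [|nra].
    apply Rmult_le_compat; auto; [left; apply exp_pos|]. assert (H := exp_ineq1_le th). lra. }
  assert (A0 := HA w eq_refl). assert (A1 := HA (rho * w)%C (Hrot w)).
  assert (A2 := HA (rho * (rho * w))%C ltac:(rewrite !Hrot; reflexivity)).
  assert (E := form_at_rho K m f w ltac:(lra)). rewrite Hf, Cmult_0_r, Hr1, Hr2 in E.
  assert (Hq := Cpow_nz _ m (qpar_neq_0 rho)).
  assert (E2 : (arho K m w + rho ^ (2 * j) * arho K m (rho * w) + rho ^ j * arho K m (rho * (rho * w)) = - corner_err K m f w)%C).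
  { unfold corner_err.
    set (S := (arho K m w + rho ^ (2 * j) * arho K m (rho * w) + rho ^ j * arho K m (rho * (rho * w)))%C) in *.
    set (e := ((/ (1 - w)) ^ (2 * K) * err K m f (zmap w))%C) in *.
    replace S with (/ qpar rho ^ m * (qpar rho ^ m * S + e) - / qpar rho ^ m * e)%C by (field; auto).
    rewrite <- E. ring. }
  set (t := (rho ^ (2 * j))%C) in *. set (t2 := (rho ^ j)%C) in *.
  assert (Ht : Cmod t = 1) by (unfold t; rewrite Cmod_pow, Cmod_rho, pow1; auto).
  assert (Ht2 : Cmod t2 = 1) by (unfold t2; rewrite Cmod_pow, Cmod_rho, pow1; auto).
  assert (EX1 : (rho * X = RtoC kp * (rho * w))%C) by (unfold X; ring).
  assert (EX2 : (rho * (RtoC kp * (rho * w)) = RtoC kp * (rho * (rho * w)))%C) by ring.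
  rewrite EX1, EX2 in HE. unfold X in HE.
  set (d0 := (arho K m w - Cexp (RtoC kp * w))%C) in *.
  set (d1 := (arho K m (rho * w) - Cexp (RtoC kp * (rho * w)))%C) in *.
  set (d2 := (arho K m (rho * (rho * w)) - Cexp (RtoC kp * (rho * (rho * w))))%C) in *.
  replace (Cexp (RtoC kp * w) + t * Cexp (RtoC kp * (rho * w)) + t2 * Cexp (RtoC kp * (rho * (rho * w))))%C
    with (- corner_err K m f w - (d0 + t * d1 + t2 * d2))%C in HE by (rewrite <- E2; unfold d0, d1, d2; ring).
  assert (L1 := Cmod_sub_triangle (- corner_err K m f w) (d0 + t * d1 + t2 * d2)). rewrite Cmod_opp in L1.
  assert (L2 := Cmod_triangle (d0 + t * d1) (t2 * d2)). rewrite (Cmod_mult t2), Ht2 in L2.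
  assert (L3 := Cmod_triangle d0 (t * d1)). rewrite (Cmod_mult t), Ht in L3.
  (* kap >= 167 and 1/(167 * 0.009) < 0.666. *)
  assert (Hwx : 0 <= Cmod w / 0.009 <= 0.666 * x).
  { split; [lra|]. assert (167 * Cmod w <= x) by (unfold x; apply Rmult_le_compat_r; lra). lra. }
  destruct j as [|[|[|j]]]; [| | |lia]; simpl pow in HG; unfold corner_low in HE.
  - lra.
  - assert (x * x <= x * 1.2) by (apply Rmult_le_compat_l; lra). lra.
  - assert (Cmod w / 0.009 * (Cmod w / 0.009) <= 0.666 * x * (0.666 * x)) by (apply Rmult_le_compat; lra).
    assert (0 < x * x) by (apply Rmult_lt_0_compat; auto). lra.
Qed.

(** The displacement from rho is O(1/n) in both directions: radially because a zero is near the
    circle, tangentially by the last hypothesis. This puts kap |w| below 1.2. *)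
Lemma no_zero_corner (K K' l m : nat) (f : C -> C) (a : nat -> C) (z : C) : setting K K' l m f a ->
  - (1 / 2) <= Re z <= 0 -> 0 < Im z <= 3 / 2 -> 1 < Cmod z ->
  INR (K - 7 * m) * (1 + 2 * (Re z / Cmod z)) < 3 / 2 -> f z <> 0%C.
Proof.
  intros HS Hx Hy Hs Hn Hf.
  destruct (setting_num2 _ _ _ _ _ _ HS) as [_ [_ [_ Hn80]]].
  destruct (kap_bounds _ _ _ _ _ _ HS) as [B1 [_ [_ [_ B5]]]].
  destruct sqrt3_bounds as [Hq3 Hq].
  set (s := Cmod z) in *. set (n := INR (K - 7 * m)) in *. set (g := s - 1). set (c := sqrt 3) in *.
  assert (Es := Cmod_sq z). fold s in Es.
  assert (Hyc : c / 2 <= Im z).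
  { apply Rsqr_incr_0_var; [|lra]. unfold Rsqr. replace (c / 2 * (c / 2)) with (3 / 4) by (rewrite <- Hq3; field). nra. }
  destruct (zero_near_circle K K' l m f a z HS ltac:(lra) Hx ltac:(fold s; lra) Hf) as [Ht Hng]. fold s n in Ht, Hng.
  assert (Hg : 0 < g <= 0.005) by (unfold g; split; [lra|nra]).
  assert (Hg2 : n * g <= 0.3738).
  { assert (B7 : 1.98 * g <= 1 - / (s * s)).
    { apply Rmult_le_reg_r with (s * s); [nra|]. rewrite Rmult_minus_distr_r, Rinv_l, Rmult_1_l by nra.
      replace (s * s) with (1 + 2 * g + g * g) by (unfold g; ring). nra. }
    assert (n * (1.98 * g) <= n * (1 - / (s * s))) by (apply Rmult_le_compat_l; lra). lra. }
  set (x0 := Re z / s). set (y0 := Im z / s).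
  assert (His : 0 < / s <= 1) by (split; [apply Rinv_0_lt_compat; lra|apply inv_le_1; lra]).
  assert (Hx0 : - (1 / 2) <= x0 <= 0) by (unfold x0, Rdiv; nra).
  assert (Exs : Re z = x0 * s) by (unfold x0; field; lra).
  assert (Eys : Im z = y0 * s) by (unfold y0; field; lra).
  assert (E1 : x0 * x0 + y0 * y0 = 1).
  { rewrite Exs, Eys in Es. apply Rmult_eq_reg_r with (s * s); nra. }
  assert (Hy0p : 0 < y0) by (unfold y0; apply Rdiv_lt_0_compat; lra).
  assert (Hy0 : c / 2 <= y0).
  { apply Rsqr_incr_0_var; [|lra]. unfold Rsqr. replace (c / 2 * (c / 2)) with (3 / 4) by (rewrite <- Hq3; field). nra. }
  set (a0 := x0 + 1 / 2). assert (Ha0 : 0 <= a0) by (unfold a0; lra).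
  assert (Hna : n * a0 <= 3 / 4) by (unfold a0; fold x0 in Hn; lra).
  set (b0 := y0 - c / 2).
  (* The arc lies below its tangent at rho, whose slope is 1/sqrt 3. *)
  assert (Hb : b0 * c <= a0).
  { assert (E2 : b0 * (y0 + c / 2) = a0 * (1 - a0)).
    { unfold b0, a0. replace ((y0 - c / 2) * (y0 + c / 2)) with (y0 * y0 - c * c / 4) by field. rewrite Hq3. lra. }
    assert (b0 * c <= b0 * (y0 + c / 2)) by (apply Rmult_le_compat_l; unfold b0; lra). nra. }
  assert (Hb2 : b0 * b0 * 3 <= a0 * a0).
  { rewrite <- Hq3. replace (b0 * b0 * (c * c)) with ((b0 * c) * (b0 * c)) by ring.
    apply Rmult_le_compat; auto; apply Rmult_le_pos; unfold b0; lra. }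
  assert (Hd : Cmod (z - rho) * Cmod (z - rho) = g * g + s * (a0 * a0 + b0 * b0)).
  { rewrite Cmod_sq, Re_minus, Im_minus. change (Re rho) with (- (1 / 2)). change (Im rho) with (c / 2).
    rewrite Exs, Eys. unfold g, a0, b0.
    transitivity (s * s * (x0 * x0 + y0 * y0) + s * x0 - s * y0 * c + 1 / 4 + c * c / 4); [field|].
    transitivity ((s - 1) * (s - 1) + s * ((x0 * x0 + y0 * y0) + x0 - y0 * c + 1 / 4 + c * c / 4)); [|field].
    rewrite E1, Hq3. field. }
  assert (Hden : c <= Cmod (z - rho * rho)).
  { eapply Rle_trans; [|eapply Rle_trans; [apply Rle_abs|apply Cmod_Im_le]]. rewrite rho_sq, Im_minus.
    replace (Im (- (1) - rho)) with (- (c / 2)) by (simpl; unfold c; ring). lra. }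
  assert (Hden0 : (z - rho * rho <> 0)%C) by (apply Cmod_neq_0; lra).
  set (w := ((z - rho) / (z - rho * rho))%C).
  assert (Hr0 := rho_neq_0).
  assert (Hr1 : (1 - rho <> 0)%C).
  { intros E. assert (E2 : Re (1 - rho) = 0) by (rewrite E; reflexivity). rewrite Re_minus, Re_RtoC in E2.
    change (Re rho) with (- (1 / 2)) in E2. lra. }
  assert (Hz0 : z <> 0%C) by (apply Im_pos_neq_0; lra).
  assert (Ez : z = zmap w).
  { unfold zmap, w.
    assert (D1 : (1 - (z - rho) / (z - rho * rho) = rho * (1 - rho) / (z - rho * rho))%C) by (field; auto).
    assert (D2 : (1 - rho * ((z - rho) / (z - rho * rho)) = z * (1 - rho) / (z - rho * rho))%C) by (field; auto).
    rewrite D1, D2. field. auto. }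
  assert (Hzr : (z - rho <> 0)%C).
  { intros E. assert (E2 : s = 1); [|lra]. unfold s. replace z with (z - rho + rho)%C by ring. rewrite E, Cplus_0_l. apply Cmod_rho. }
  assert (Hw0 : w <> 0%C).
  { intros E. apply Hzr. replace (z - rho)%C with (w * (z - rho * rho))%C by (unfold w; field; auto). rewrite E. ring. }
  apply (corner_no_zero K K' l m f a w HS Hw0); [|rewrite <- Ez; exact Hf].
  assert (Hcw : c * Cmod w <= Cmod (z - rho)).
  { replace (z - rho)%C with (w * (z - rho * rho))%C at 1 by (unfold w; field; auto).
    rewrite Cmod_mult, Rmult_comm. apply Rmult_le_compat_l; auto using Cmod_ge_0. }
  assert (Hcw2 : 3 * (Cmod w * Cmod w) <= Cmod (z - rho) * Cmod (z - rho)).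
  { rewrite <- Hq3. replace (c * c * (Cmod w * Cmod w)) with ((c * Cmod w) * (c * Cmod w)) by ring.
    assert (H0 := Cmod_ge_0 w). apply Rmult_le_compat; auto; apply Rmult_le_pos; lra. }
  set (kp := kap K m) in *. set (v := Cmod w) in *. assert (Hv0 : 0 <= v) by apply Cmod_ge_0.
  (* 0.3738^2 + 1.005 (4/3) (3/4)^2 < 0.8945, and with kap <= 2.16 n one gets 2.16^2 times 0.8945/3,
     which is below 1.2^2. *)
  assert (Hnw : 3 * ((n * v) * (n * v)) <= 0.8945).
  { rewrite Hd in Hcw2.
    assert (N1 : (n * g) * (n * g) <= 0.3738 * 0.3738) by (apply Rmult_le_compat; try lra; apply Rmult_le_pos; lra).
    assert (N2 : (n * a0) * (n * a0) <= 3 / 4 * (3 / 4)) by (apply Rmult_le_compat; try lra; apply Rmult_le_pos; lra).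
    assert (N3 : s * (a0 * a0 + b0 * b0) <= 1.005 * (4 / 3 * (a0 * a0))).
    { apply Rmult_le_compat; try lra; [|unfold g in Hg; lra]. nra. }
    assert (Hnn : 0 <= n * n) by nra.
    apply Rle_trans with (n * n * (g * g + 1.005 * (4 / 3 * (a0 * a0)))); [|nra].
    replace (3 * (n * v * (n * v))) with (n * n * (3 * (v * v))) by ring. apply Rmult_le_compat_l; lra. }
  apply Rsqr_incr_0_var; [|lra]. unfold Rsqr.
  assert (Hkn : kp * v <= 2.16 * n * v) by (apply Rmult_le_compat_r; auto).
  apply Rle_trans with ((2.16 * n * v) * (2.16 * n * v)); [|nra].
  apply Rmult_le_compat; auto; apply Rmult_le_pos; lra.
Qed.

(** * The left half of the fundamental domain and its reflection *)

Lemma no_zero_left (K K' l m : nat) (f : C -> C) (a : nat -> C) (z : C) : setting K K' l m f a ->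
  - (1 / 2) <= Re z <= 0 -> 0 < Im z -> 1 < Cmod z -> f z <> 0%C.
Proof.
  intros HS Hx Hy Hz. destruct (Rle_dec (Im z) (3 / 2)) as [H|H].
  - destruct (Rle_dec (3 / 2) (INR (K - 7 * m) * (1 + 2 * (Re z / Cmod z)))) as [H1|H1].
    + apply (no_zero_arc K K' l m f a); auto.
    + apply (no_zero_corner K K' l m f a); auto. lra.
  - apply (no_zero_high K K' l m f a); auto. lra.
Qed.

Lemma on_arc_of_unit (z : C) : Cmod z = 1 -> 0 < Im z -> - (1 / 2) <= Re z <= 0 -> on_arc z.
Proof.
  intros H1 Hy Hx. exists (acos (Re z)).
  assert (Hb : -1 <= Re z <= 1) by lra.
  assert (Hc := cos_acos (Re z) Hb). assert (Hr := acos_bound (Re z)). assert (HPI := PI_RGT_0).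
  split.
  - split.
    + apply cos_decr_0; try lra. rewrite Hc, cos_PI2. lra.
    + apply cos_decr_0; try lra. rewrite Hc.
      replace (2 * PI / 3) with (2 * (PI / 3)) by field. replace (2 * (PI / 3)) with (2 * (PI / 3)) by ring.
      rewrite cos_2a_cos, cos_PI3. lra.
  - assert (Hs := sin_acos (Re z) Hb). assert (E := Cmod_sq z). rewrite H1 in E.
    assert (Es : sqrt (1 - (Re z)²) = Im z).
    { replace (1 - (Re z)²) with (Im z * Im z) by (unfold Rsqr; lra). apply sqrt_square. lra. }
    rewrite Hc, Hs, Es. destruct z; reflexivity.
Qed.

Theorem theorem4p1 :
  forall m : nat, (1 <= m)%nat ->
  forall (l k' k : nat),
    In k' (0 :: 4 :: 6 :: 8 :: 10 :: 14 :: nil)%nat ->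
    k = (12 * l + k')%nat ->
    (m <= l)%nat ->
    INR l > 9 / 2 * INR m + 19 / 2 ->
    forall f : C -> C, is_g k l m f ->
    forall z : C, in_F z -> f z = RtoC 0 -> on_arc z.
Proof.
  intros m Hm l k' k Hk' Hk Hml Hl f Hf z [Hy Hz] Hf0.
  destruct (is_g_vanish_form k l m f Hf) as [a Hv].
  assert (Hl2 : (9 * m + 20 <= 2 * l)%nat).
  (* Doubled, the hypothesis is a strict inequality between integers, which gains one unit. *)
  { assert (H : (9 * m + 19 < 2 * l)%nat); [|lia]. apply INR_lt. rewrite plus_INR, !mult_INR. simpl. lra. }
  assert (HK' : exists K', k' = (2 * K')%nat /\ In K' (0 :: 2 :: 3 :: 4 :: 5 :: 7 :: nil)%nat).
  { simpl in Hk'. destruct Hk' as [<-|[<-|[<-|[<-|[<-|[<-|[]]]]]]];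
      [exists 0%nat|exists 2%nat|exists 3%nat|exists 4%nat|exists 5%nat|exists 7%nat]; simpl; tauto. }
  destruct HK' as [K' [EK' HK']].
  assert (HS : setting (6 * l + K') K' l m f a).
  { unfold setting. replace (2 * (6 * l + K'))%nat with k by lia. tauto. }
  destruct Hz as [[Hz1 Hz2]|[Hz1 Hz2]].
  - destruct (Req_dec (Cmod z) 1) as [E|E]; [apply on_arc_of_unit; auto; lra|].
    exfalso. apply (no_zero_left _ _ _ _ _ _ z HS); auto; lra.
  (* In the right half |z| > 1, and -conj z would be a zero of f in the left half off the unit
     circle. *)
  - exfalso. assert (Hz0 : 7 / 10 < Im z).
    { assert (E := Cmod_sq z). nra. }
    assert (ER : Re (- Cconj z) = - Re z) by (simpl; unfold Re; ring).
    assert (EI : Im (- Cconj z) = Im z) by (simpl; unfold Im; ring).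
    apply (no_zero_left _ _ _ _ _ _ (- Cconj z)%C HS); rewrite ?ER, ?EI, ?Cmod_opp, ?Cmod_conj; try lra.
    rewrite (setting_reflect _ _ _ _ _ _ HS z Hz0), Hf0. apply injective_projections; simpl; ring.
Qed.
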